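(* Let $\rho>0$, let $m\ge1$ be an integer and let $(b_1,\dots,b_m)\in\mathbb{R}^m$. Let $\mathbf{P}_{(b_1,\dots,b_m)}$ be the distribution on $C([0,\infty),\mathbb{R}^m)$ of the $m$-system of coalescing Brownian motions with speed $\rho$ and initial state $(b_1,\dots,b_m)$. Then $\mathbf{P}_{(b_1,\dots,b_m)}$ is the unique probability measure on $C([0,\infty),\mathbb{R}^m)$ such that $\mathbf{P}_{(b_1,\dots,b_m)}\{(w_1(0),\dots,w_m(0))=(b_1,\dots,b_m)\}=1$ and the coordinate process $\{(w_1(t),\dots,w_m(t)):t\ge0\}$ under $\mathbf{P}_{(b_1,\dots,b_m)}$ solves the $(G_0^{(m)},\mathcal{D}^{(m)})$-martingale problem.
   Context: Conventions: $C(E)$ denotes the bounded continuous real functions on $E$ when used as a class of test functions; $C^2(\mathbb{R})$ denotes the functions in $C(\mathbb{R})$ with bounded continuous derivatives up to order two. $C([0,\infty),\mathbb{R}^m)$ is the space of continuous paths with the topology of locally uniform convergence and $(w_1(t),\dots,w_m(t))$ is its coordinate process. A Brownian motion with speed $\rho$ is a real Brownian motion with quadratic variation $\rho t$. An $m$-dimensional continuous process $\{(y_1(t),\dots,y_m(t)):t\ge0\}$ is an $m$-system of coalescing Brownian motions ($m$-SCBM) with speed $\rho>0$ if each $\{y_i(t)\}$ is a Brownian motion with speed $\rho$ and, for $i\ne j$, $\{|y_i(t)-y_j(t)|\}$ is a Brownian motion with speed $2\rho$ stopped at the origin (all relative to the common filtration of the system). Equivalently, the $y_i$ are continuous local martingales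 with $\langle y_i,y_j\rangle(t)=\rho\,(t-t\wedge\tau_{ij})$ for $1\le i,j\le m$, where $\tau_{ij}=\inf\{t\ge0:y_i(t)=y_j(t)\}$ (so $\tau_{ii}=0$). For a permutation $(i_1,\dots,i_m)$ of $(1,\dots,m)$ let $\mathbb{R}^m_{i_1\cdots i_m}=\{x\in\mathbb{R}^m:x_{i_1}<x_{i_2}<\cdots<x_{i_m}\}$. Let $\mathcal{D}_0^{(1)}=C^2(\mathbb{R})$. For $m\ge2$ let $\mathcal{D}_0^{(m)}$ be the set of $f\in C(\mathbb{R}^m)$ such that (A) $f$ is twice continuously differentiable in each $\mathbb{R}^m_{i_1\cdots i_m}$ with bounded partial derivatives up to order two; (B) all partial derivatives up to order two extend to uniformly continuous functions on the closure of each $\mathbb{R}^m_{i_1\cdots i_m}$, and the extensions satisfy $\frac{\partial^2f}{\partial x_i\partial x_j}=\frac{\partial^2f}{\partial x_j\partial x_i}=0$ at points with $x_i=x_j$, for $1\le i<j\le m$. For $1\le i<j\le m$ define $p^{(m)}_{ij}:C(\mathbb{R}^m)\to C(\mathbb{R}^{m-1})$ by $$p^{(m)}_{ij}f(x_1,\dots,x_{m-1})=f(x_1,\dots,x_{m-1},\dots,x_{m-1},\dots,x_{m-2}),$$ where $x_{m-1}$ occupies the $i$th and $j$th places on the right and $x_1,\dots,x_{m-2}$ fill the remaining places in order. Let $\mathcal{D}^{(m)}$ be the set of $f\in\mathcal{D}_0^{(m)}$ such that $p^{(m-k)}_{i_kj_k}\cdots p^{(m)}_{i_0j_0}f\in\mathcal{D}_0^{(m-k-1)}$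 for all $0\le k\le m-2$ and all $1\le i_l<j_l\le m-l$, $0\le l\le k$. For $f\in\mathcal{D}^{(m)}$ let $G_0^{(m)}f=\frac12\rho\,\Delta_mf$, where $\Delta_m$ is the $m$-dimensional Laplacian, evaluated on the boundaries of the sets $\mathbb{R}^m_{i_1\cdots i_m}$ through the continuous extensions (the value does not depend on the set used). A continuous process $\{(x_1(t),\dots,x_m(t))\}$ solves the $(G_0^{(m)},\mathcal{D}^{(m)})$-martingale problem if for each $f\in\mathcal{D}^{(m)}$ the process $f(x_1(t),\dots,x_m(t))-f(x_1(0),\dots,x_m(0))-\int_0^tG_0^{(m)}f(x_1(s),\dots,x_m(s))\,ds$ is a martingale (relative to the natural filtration of the process). *)

(* Defs.v *)
From HB Require Import structures.
From mathcomp Require Import all_boot all_order all_algebra all_fingroup.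
From mathcomp Require Import all_classical all_reals all_analysis.

Set Implicit Arguments.
Unset Strict Implicit.
Unset Printing Implicit Defensive.

Import Order.TTheory GRing.Theory Num.Theory.
Import numFieldNormedType.Exports.

Local Open Scope classical_set_scope.
Local Open Scope ring_scope.

(** ** The path space C([0, +oo), R^m) *)

Definition time (R : realType) : Type := set_type [set t : R | 0 <= t].

HB.instance Definition _ (R : realType) :=
  SubChoice.copy (time R) (set_type [set t : R | 0 <= t]).
HB.instance Definition _ (R : realType) :=
  Topological.copy (time R) (set_type [set t : R | 0 <= t]).

Definition time0 (R : realType) : time R := exist _ 0 (mem_set (lexx 0)).

(* [to_time s] is [s] for [0 <= s]; negative reals are sent to [0]. *)
Definition to_time (R : realType) (s : R) : time R := insubd (time0 R) s.

Definition cpath (R : realType) (m : nat) : Type :=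
  continuousType (time R) 'rV[R]_m.

(* The compact-open topology is that of locally uniform convergence
   ([compact_open_fam_compactP]; [0, +oo) is locally compact). *)
HB.instance Definition _ (R : realType) (m : nat) := Choice.on (cpath R m).
HB.instance Definition _ (R : realType) (m : nat) :=
  Topological.copy (cpath R m)
    (@initial_topology (cpath R m) {compact-open, time R -> 'rV[R]_m} id).

Definition cst_cpath (R : realType) (m : nat) : cpath R m :=
  [the continuousType (time R) 'rV[R]_m of cst 0].
HB.instance Definition _ (R : realType) (m : nat) :=
  isPointed.Build (cpath R m) (cst_cpath R m).

(* The same set of paths, equipped with its Borel sigma-algebra. *)
Notation borel_cpath R m := (g_sigma_algebraType (@open (cpath R m))).

Definition coord_process (R : realType) (m : nat) (t : time R)
    (w : borel_cpath R m) : 'rV[R]_m :=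
  (w : continuousType (time R) 'rV[R]_m) t.

(** ** Filtrations, martingales, Brownian motions *)

Section processes.
Context {R : realType} {d : measure_display} {Omega : measurableType d}.
Variable Pr : probability Omega R.

Definition natural_filtration (m : nat) (X : time R -> Omega -> 'rV[R]_m)
    (t : time R) : set (set Omega) :=
  <<s [set A | exists (s : time R) (i : 'I_m) (U : set R),
         [/\ \val s <= \val t, measurable U &
             A = [set w | U (X s w ord0 i)]] ]>>.

Definition adapted (F : time R -> set (set Omega)) (X : time R -> Omega -> R) :=
  forall (t : time R) (U : set R), measurable U -> F t (X t @^-1` U).

(* The last clause is E[M t | F s] = M s. *)
Definition martingale (F : time R -> set (set Omega))
    (M : time R -> Omega -> R) : Prop :=
  [/\ adapted F M,
      forall t, Pr.-integrable setT (EFin \o M t) &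
      forall s t, \val s <= \val t -> forall A, F s A ->
        (\int[Pr]_(w in A) (M t w)%:E = \int[Pr]_(w in A) (M s w)%:E)%E].

(* [normal_prob mu s] has standard deviation [s]; the initial value of [B]
   is arbitrary. *)
Definition brownian (F : time R -> set (set Omega)) (rho : R)
    (B : time R -> Omega -> R) : Prop :=
  [/\ forall w, continuous (B ^~ w),
      adapted F B &
      forall s t, \val s < \val t -> forall U : set R, measurable U ->
        let increment w := B t w - B s w in
        Pr (increment @^-1` U) =
          normal_prob 0 (Num.sqrt (rho * (\val t - \val s))) U /\
        forall A, F s A ->
          Pr (A `&` increment @^-1` U) = (Pr A * Pr (increment @^-1` U))%E].

Definition hitting0 (z : time R -> R) : \bar R :=
  ereal_inf [set (\val t)%:E | t in [set t : time R | z t = 0]].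

Definition stop_at0 (z : time R -> R) (t : time R) : R :=
  z (to_time (fine (Order.min (\val t)%:E (hitting0 z)))).

Definition stopped_brownian (F : time R -> set (set Omega)) (rho : R)
    (Z : time R -> Omega -> R) : Prop :=
  exists2 B, brownian F rho B &
    {ae Pr, forall w, forall t, Z t w = stop_at0 (B ^~ w) t}.

Definition SCBM (m : nat) (rho : R) (Y : time R -> Omega -> 'rV[R]_m) : Prop :=
  let F := natural_filtration Y in
  (forall i : 'I_m, brownian F rho (fun t w => Y t w ord0 i)) /\
  (forall i j : 'I_m, i != j ->
     stopped_brownian F (2 * rho)
       (fun t w => `|Y t w ord0 i - Y t w ord0 j|)).

End processes.

(** ** The operator G_0 and its domain *)

Section generator.
Context {R : realType}.

Definition bounded_continuous (m : nat) (f : 'rV[R]_m -> R) : Prop :=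
  continuous f /\ exists M, forall x, `|f x| <= M.

Definition pderiv (m : nat) (i : 'I_m) (f : 'rV[R]_m -> R) : 'rV[R]_m -> R :=
  fun x => 'D_(delta_mx ord0 i) f x.

Definition laplacian (m : nat) (f : 'rV[R]_m -> R) : 'rV[R]_m -> R :=
  fun x => \sum_(i < m) pderiv i (pderiv i f) x.

(* To be used on open sets [U]. *)
Definition C2_bounded_on (m : nat) (U : set 'rV[R]_m) (f : 'rV[R]_m -> R) :
    Prop :=
  [/\ forall x, U x -> forall i, derivable f x (delta_mx ord0 i),
      forall x, U x -> forall i j,
        derivable (pderiv j f) x (delta_mx ord0 i),
      forall x, U x -> (forall i, {for x, continuous (pderiv i f)}) /\
        (forall i j, {for x, continuous (pderiv i (pderiv j f))}) &
      exists M, forall x, U x -> (forall i, `|pderiv i f x| <= M) /\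
        (forall i j, `|pderiv i (pderiv j f) x| <= M)].

Definition chamber (m : nat) (s : 'S_m) : set 'rV[R]_m :=
  [set x | forall a b : 'I_m, (a < b)%N -> x ord0 (s a) < x ord0 (s b)].

Definition uc_extension (m : nat) (U : set 'rV[R]_m) (g h : 'rV[R]_m -> R) :
    Prop :=
  (forall x, U x -> h x = g x) /\
  unif_continuous (fun x : set_type (closure U) => h (\val x)).

Definition D0 (m : nat) (f : 'rV[R]_m -> R) : Prop :=
  [/\ bounded_continuous f,
      forall s : 'S_m, C2_bounded_on (chamber s) f,
      forall (s : 'S_m) (i : 'I_m),
        exists h, uc_extension (chamber s) (pderiv i f) h &
      forall (s : 'S_m) (i j : 'I_m),
        exists2 h, uc_extension (chamber s) (pderiv i (pderiv j f)) h &
          i != j -> forall x, closure (chamber s) x ->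
            x ord0 i = x ord0 j -> h x = 0].

Definition D0_dim1 (f : 'rV[R]_1 -> R) : Prop :=
  bounded_continuous f /\ C2_bounded_on setT f.

(* [diag_embed i j x] has the last entry of [x] at places [i] and [j] and the
   other entries of [x], in order, at the remaining places: place [k] is
   preceded by [(i < k) + (j < k)] of the two distinguished places. *)
Definition diag_embed (n : nat) (i j : 'I_n.+2) (x : 'rV[R]_n.+1) :
    'rV[R]_n.+2 :=
  \row_(k < n.+2)
    if (k == i) || (k == j) then x ord0 ord_max
    else x ord0 (inord (k - ((i < k) + (j < k)))).

Definition diag_restr (n : nat) (i j : 'I_n.+2) (f : 'rV[R]_n.+2 -> R) :
    'rV[R]_n.+1 -> R := fun x => f (diag_embed i j x).

Fixpoint gen_dom (n : nat) : ('rV[R]_n.+1 -> R) -> Prop :=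
  match n with
  | 0 => fun f => D0_dim1 f
  | n'.+1 => fun f => D0 f /\
      forall i j : 'I_n'.+2, (i < j)%N -> gen_dom (diag_restr i j f)
  end.

(* A permutation [s] such that [x] lies in the closure of [chamber s]. *)
Definition chamber_at (m : nat) (x : 'rV[R]_m) : 'S_m :=
  xget 1%g [set s : 'S_m | closure (chamber s) x].

(* The limit is the value at [x] of the continuous extension of the Laplacian
   from a chamber to its closure. *)
Definition G0 (m : nat) (rho : R) (f : 'rV[R]_m -> R) (x : 'rV[R]_m) : R :=
  2^-1 * rho *
    lim (laplacian f z @[z --> within (chamber (chamber_at x)) (nbhs x)]).

Definition solves_martingale_problem (n : nat) (rho : R)
    (d : measure_display) (Omega : measurableType d) (Pr : probability Omega R)
    (X : time R -> Omega -> 'rV[R]_n.+1) : Prop :=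
  forall f, gen_dom f ->
    martingale Pr (natural_filtration X) (fun t w =>
      f (X t w) - f (X (time0 R) w) -
      \int[lebesgue_measure]_(s in `[0, \val t])
        G0 rho f (X (to_time s) w)).

End generator.

(* Main.v *)
Require Import Defs.
From HB Require Import structures.
From mathcomp Require Import all_boot all_order all_algebra all_fingroup.
From mathcomp Require Import all_classical all_reals all_analysis.
From mathcomp Require Import measurable_realfun ring lra.

Set Implicit Arguments.
Unset Strict Implicit.
Unset Printing Implicit Defensive.

Import Order.TTheory GRing.Theory Num.Theory.
Import numFieldNormedType.Exports.

Local Open Scope classical_set_scope.
Local Open Scope ring_scope.

(** Both halves of the theorem pass through one description of the process, the
    record [coalescing]: the initial state is [b]; given the past, the increments
    of every coordinate have mean [0], variance [rho (t - s)] and fourth moment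
    of order [(t - s) ^ 2]; and for every pair of coordinates the conditional
    mean of [sin (l |x_i - x_j|)] decays like [exp (- rho l ^ 2 t)].  The last
    clause expresses the absorption of the distance: the sine vanishes at the
    origin and so does not see the stopping.

    A system of coalescing Brownian motions fits this description
    ([SCBM_coalescing]).  The moments are those of the normal law, and the
    martingale [sin (l B) exp (rho l ^ 2 t)] of a Brownian motion of speed
    [2 rho] survives the absorption at the origin ([stopped_sin_martingale]).

    A process that fits the description solves the martingale problem
    ([coalescing_solves]).  Small frequencies show that the distance of two
    coordinates has the same mean as their difference, so coordinates never
    exchange their order ([co_order]) and the state stays in the closure of one
    chamber, where a function of the domain is smooth up to the boundary.  As
    long as two coordinates are apart their increments are uncorrelated
    ([co_cross]).  In the second order Taylor expansion over a short interval of
    time a mixed term is therefore negligible, either because the coordinates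
    are apart or because the mixed derivative is small near the points where
    they meet.  The Laplacian is all that remains ([local_ito]), and adding up
    along a grid gives Dynkin's formula ([dynkin]).

    Conversely a solution of the martingale problem fits the description
    ([problem_coalescing]): the functions [sin (l x_i + th)] and
    [sin (l |x_i - x_j|)] belong to the domain and are eigenfunctions of the
    operator, so that their conditional means decay exponentially
    ([eigenfunction_decay]).  Letting [l] tend to [0] gives the moments.

    For the uniqueness, list the coordinates in the order of the initial state,
    [x_1 <= ... <= x_m].  The condition on the mixed derivatives is met by the
    determinants of the matrices with entries
    [sin (la_k x_a + th_k) + c_(k,a)], where row [k] has [la_k = 0] or [c_k = 0]:
    a mixed derivative on a face has two equal columns.  They are eigenfunctions
    too, so their conditional means are known ([wave_rows_decay]).  A
    determinant is linear in each of its rows, and bounded pointwise limits of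
    sums of sines include the indicators of half-lines; hence the rows may be
    replaced by [1(x_a <= z_k) - 1(a < k)] ([rows_good]).  For nondecreasing
    thresholds [z_k] the determinant then is the indicator of the event that
    [x_k <= z_k] for all [k] ([indicator_det]).  So the law of the state at a
    later time is determined jointly with the past; the finite-dimensional laws
    follow by induction ([coordinates_agree]), and they determine a measure on
    the Borel sets of the path space, which the coordinates generate
    ([borel_generated]). *)

(** * Expectations of real random variables *)

Section expectation.
Context {d : measure_display} {T : measurableType d} {R : realType}.
Variable P : probability T R.
Implicit Types (f g : T -> R) (A : set T).

Definition L1 f := P.-integrable setT (EFin \o f).

Definition Ex f : R := \int[P]_w f w.

Lemma L1_measurable f : L1 f -> measurable_fun setT f.
Proof. by move=> /measurable_int /measurable_EFinP. Qed.

Lemma L1_le f g : measurable_fun setT f -> (forall w, `|f w| <= g w) ->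
  L1 g -> L1 f.
Proof.
move=> mf fg; apply: le_integrable => //; first exact/measurable_EFinP.
by move=> w _ /=; rewrite lee_fin (le_trans (fg w)) ?ler_norm.
Qed.

Lemma L1_cst c : L1 (fun _ => c).
Proof. exact: finite_measure_integrable_cst. Qed.

Lemma L1_bounded f K : measurable_fun setT f -> (forall w, `|f w| <= K) -> L1 f.
Proof. by move=> mf fK; apply: (L1_le mf fK); exact: L1_cst. Qed.

Lemma L1D f g : L1 f -> L1 g -> L1 (fun w => f w + g w).
Proof. by move=> fi gi; exact: (integrableD _ fi gi). Qed.

Lemma L1Z c f : L1 f -> L1 (fun w => c * f w).
Proof. by move=> fi; exact: (integrableZl _ c fi). Qed.

Lemma L1N f : L1 f -> L1 (fun w => - f w).
Proof.
by move=> /(L1Z (-1)); congr L1; apply/funext => w; rewrite mulN1r.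
Qed.

Lemma L1B f g : L1 f -> L1 g -> L1 (fun w => f w - g w).
Proof. by move=> fi /L1N gi; exact: L1D. Qed.

Lemma L1_norm f : L1 f -> L1 (fun w => `|f w|).
Proof. exact: integrable_norm. Qed.

Lemma L1_sum (I : Type) (s : seq I) (p : pred I) (F : I -> T -> R) :
  (forall i, p i -> L1 (F i)) -> L1 (fun w => \sum_(i <- s | p i) F i w).
Proof.
move=> Fi; elim: s => [|i s IH].
  by under eq_fun do rewrite big_nil; exact: L1_cst.
case pi: (p i); under eq_fun do rewrite big_cons pi; last exact: IH.
by apply: L1D => //; exact: Fi.
Qed.

Lemma L1_bM f g K : measurable_fun setT f -> (forall w, `|f w| <= K) -> L1 g ->
  L1 (fun w => f w * g w).
Proof.
move=> mf fK gi; apply: (@L1_le _ (fun w => K * `|g w|)).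
- by apply: measurable_funM => //; exact: L1_measurable.
- by move=> w; rewrite normrM ler_wpM2r.
- by apply: L1Z; exact: L1_norm.
Qed.

Lemma ExD f g : L1 f -> L1 g -> Ex (fun w => f w + g w) = Ex f + Ex g.
Proof. by move=> fi gi; exact: RintegralD. Qed.

Lemma ExZ c f : L1 f -> Ex (fun w => c * f w) = c * Ex f.
Proof. by move=> fi; exact: RintegralZl. Qed.

Lemma ExB f g : L1 f -> L1 g -> Ex (fun w => f w - g w) = Ex f - Ex g.
Proof. by move=> fi gi; exact: RintegralB. Qed.

Lemma Ex_cst c : Ex (fun _ => c) = c.
Proof.
by rewrite /Ex Rintegral_cst//= (@probability_setT _ _ _ P) mulr1.
Qed.

Lemma Ex_sum (I : Type) (s : seq I) (p : pred I) (F : I -> T -> R) :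
  (forall i, p i -> L1 (F i)) ->
  Ex (fun w => \sum_(i <- s | p i) F i w) = \sum_(i <- s | p i) Ex (F i).
Proof.
move=> Fi; elim: s => [|i s IH].
  by under eq_fun do rewrite big_nil; rewrite Ex_cst big_nil.
rewrite big_cons; case pi: (p i); under eq_fun do rewrite big_cons pi; last exact: IH.
by rewrite ExD ?IH//; [exact: Fi|exact: L1_sum].
Qed.

Lemma Ex_le f g : L1 f -> L1 g -> (forall w, f w <= g w) -> Ex f <= Ex g.
Proof. by move=> fi gi fg; apply: le_Rintegral => // w _; exact: fg. Qed.

Lemma Ex_ge0 f : (forall w, 0 <= f w) -> 0 <= Ex f.
Proof. by move=> f0; apply: Rintegral_ge0 => w _; exact: f0. Qed.

Lemma Ex_abs f : L1 f -> `|Ex f| <= Ex (fun w => `|f w|).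
Proof. by move=> fi; exact: le_normr_Rintegral. Qed.

Lemma Ex_abs_le f g : L1 f -> L1 g -> (forall w, `|f w| <= g w) ->
  `|Ex f| <= Ex g.
Proof.
move=> fi gi fg; apply: (le_trans (Ex_abs fi)); apply: Ex_le => //.
exact: L1_norm.
Qed.

Lemma Ex_abs_cst f K : measurable_fun setT f -> (forall w, `|f w| <= K) ->
  `|Ex f| <= K.
Proof.
move=> mf fK; rewrite -[leRHS]Ex_cst; apply: Ex_abs_le => //.
  exact: L1_bounded fK.
exact: L1_cst.
Qed.

Lemma Ex_ae f g : measurable_fun setT f -> measurable_fun setT g ->
  {ae P, forall w, f w = g w} -> Ex f = Ex g.
Proof.
move=> mf mg fg; rewrite /Ex /Rintegral; congr fine; apply: ae_eq_integral => //.
- exact/measurable_EFinP.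
- exact/measurable_EFinP.
- by apply: filterS fg => w /= ->.
Qed.

Lemma L1_ae f g : measurable_fun setT f -> L1 g -> {ae P, forall w, f w = g w} ->
  L1 f.
Proof.
move=> mf gi fg; apply/integrableP; split; first exact/measurable_EFinP.
have /integrableP[_] := gi; congr (_ < _)%E; apply: ae_eq_integral => //.
- by apply: measurableT_comp => //; exact/measurable_EFinP/L1_measurable.
- by apply: measurableT_comp => //; exact/measurable_EFinP.
- by apply: filterS fg => w /= ->.
Qed.

Lemma Ex_le_ae f g : L1 f -> L1 g -> {ae P, forall w, f w <= g w} -> Ex f <= Ex g.
Proof.
move=> fi gi fg; have [mf mg] := (L1_measurable fi, L1_measurable gi).
have mi : measurable_fun setT (fun w => Num.min (f w) (g w)).
  exact: measurable_minr.
have -> : Ex f = Ex (fun w => Num.min (f w) (g w)).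
  by apply: Ex_ae => //; apply: filterS fg => w /= ?; rewrite min_l.
apply: Ex_le => // [|w]; last by rewrite ge_min lexx orbT.
apply: (@L1_le _ (fun w => `|f w| + `|g w|)) => //; last by apply: L1D; exact: L1_norm.
move=> w; rewrite minEle; case: ifP => _; first by rewrite lerDl.
by rewrite lerDr.
Qed.

Lemma Ex_abs_le_ae f g : L1 f -> L1 g -> {ae P, forall w, `|f w| <= g w} ->
  `|Ex f| <= Ex g.
Proof.
move=> fi gi fg; apply: (le_trans (Ex_abs fi)); apply: Ex_le_ae => //.
exact: L1_norm.
Qed.

Lemma Ex_eq0_ae f : L1 f -> (forall w, 0 <= f w) -> Ex f = 0 ->
  {ae P, forall w, f w = 0}.
Proof.
move=> fi f0 Ef0.
have : (\int[P]_w (f w)%:E = 0)%E.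
  rewrite -[LHS]fineK; first by congr EFin; exact: Ef0.
  exact: (@integrable_fin_num _ _ _ P setT measurableT _ fi).
under eq_integral => w _ do rewrite -[X in X%:E]ger0_norm//.
move=> /(ae_eq_integral_abs P measurableT (measurable_int _ fi)).1.
by apply: filterS => w /= /(_ I) [].
Qed.

Lemma Ex_indic A : measurable A -> Ex \1_A = fine (P A).
Proof. by move=> mA; rewrite /Ex /Rintegral integral_indic// setIT. Qed.

Lemma Ex_dct (f_ : nat -> T -> R) f g :
  (forall n, measurable_fun setT (f_ n)) -> measurable_fun setT f ->
  {ae P, forall w, f_ ^~ w @ \oo --> f w} -> L1 g ->
  {ae P, forall w, forall n, `|f_ n w| <= g w} ->
  L1 f /\ (fun n => Ex (f_ n)) @ \oo --> Ex f.
Proof.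
move=> mf_ mf cf gi fg.
have [] := @dominated_convergence _ _ _ P setT measurableT
  (fun n => EFin \o f_ n) (EFin \o f) (EFin \o g).
- by move=> n; exact/measurable_EFinP.
- exact/measurable_EFinP.
- by apply: filterS cf => w cw _; apply: cvg_EFin; [exact: nearW|exact: cw].
- exact: gi.
- by apply: filterS fg => w fw n _; rewrite lee_fin; exact: fw.
move=> fi _ cv; split => //; apply/fine_cvg.
by rewrite fineK//; exact: (@integrable_fin_num _ _ _ P setT measurableT _ fi).
Qed.

Lemma Ex_bct (f_ : nat -> T -> R) f K :
  (forall n, measurable_fun setT (f_ n)) -> measurable_fun setT f ->
  {ae P, forall w, f_ ^~ w @ \oo --> f w} ->
  (forall n w, `|f_ n w| <= K) -> (fun n => Ex (f_ n)) @ \oo --> Ex f.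
Proof.
move=> mf_ mf cf fK; have [] // := @Ex_dct f_ f (fun=> K) mf_ mf cf.
  exact: L1_cst.
by apply: aeW => w n; exact: fK.
Qed.

Lemma L1_fatou (f_ : nat -> T -> R) f K :
  (forall n, measurable_fun setT (f_ n)) -> measurable_fun setT f ->
  (forall n w, 0 <= f_ n w) -> (forall w, f_ ^~ w @ \oo --> f w) ->
  (forall n, L1 (f_ n)) -> (forall n, Ex (f_ n) <= K) ->
  L1 f /\ Ex f <= K.
Proof.
move=> mf_ mf f0 cf fi fK.
have ff0 w : 0 <= f w.
  by rewrite -(cvg_lim _ (cf w))//; apply: limr_ge; [apply/cvg_ex; eexists; exact: cf|exact: nearW].
have EE n : (\int[P]_w (f_ n w)%:E = (Ex (f_ n))%:E)%E.
  by rewrite fineK//; exact: (@integrable_fin_num _ _ _ P setT measurableT _ (fi n)).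
have le : (\int[P]_w (f w)%:E <= K%:E)%E.
  have := @fatou _ _ _ P setT measurableT (fun n w => (f_ n w)%:E)
    (fun n => (measurable_EFinP _ _).2 (mf_ n)).
  have f0E n w : setT w -> (0 <= (f_ n w)%:E)%E by rewrite lee_fin.
  move=> /(_ f0E).
  rewrite (_ : (fun w => limn_einf _) = EFin \o f); last first.
    apply/funext => w; rewrite is_cvg_limn_einfE.
      by apply/cvg_lim => //; apply: cvg_EFin; [exact: nearW|exact: cf].
    by apply/cvg_ex; eexists; apply: cvg_EFin; [exact: nearW|exact: cf].
  move=> /le_trans; apply; rewrite limn_einf_lim; apply: lime_le.
    exact: is_cvg_einfs.
  apply: nearW => n; apply: (@le_trans _ _ (\int[P]_w (f_ n w)%:E)%E).
    by apply: ereal_inf_lbound; exists n => /=.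
  by rewrite EE lee_fin.
have fL1 : L1 f.
  apply/integrableP; split; first exact/measurable_EFinP.
  apply: (@le_lt_trans _ _ (\int[P]_w (f w)%:E)%E); last first.
    by apply: (le_lt_trans le); exact: ltry.
  by apply: ge0_le_integral => //= [||w _];
    [exact/measurable_EFinP/measurableT_comp|exact/measurable_EFinP|rewrite lee_fin ger0_norm].
split => //; rewrite -lee_fin /Ex /Rintegral fineK//.
exact: (@integrable_fin_num _ _ _ P setT measurableT _ fL1).
Qed.

End expectation.

(** * Bounded functions of the past *)

Section sub_sigma_algebra.
Context {d : measure_display} {T : measurableType d} {R : realType}.
Variable P : probability T R.
Variable G : set (set T).
Hypothesis GT : <<s G >> `<=` measurable.

(** Conditional expectations given [<<s G>>] enter only through means of
    products with such functions. *)
Definition test (Y : T -> R) :=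
  measurable_fun setT (Y : g_sigma_algebraType G -> R) /\
  exists K, forall w, `|Y w| <= K.

Lemma sub_measurable (Y : T -> R) :
  measurable_fun setT (Y : g_sigma_algebraType G -> R) -> measurable_fun setT Y.
Proof. by move=> mY _ U mU; apply: GT; exact: (mY measurableT U mU). Qed.

Lemma test_measurable Y : test Y -> measurable_fun setT Y.
Proof. by move=> [mY _]; exact: sub_measurable. Qed.

Lemma test_bounded Y : test Y -> exists2 K, 0 <= K & forall w, `|Y w| <= K.
Proof.
move=> [_ [K YK]]; exists `|K| => // w.
exact: (le_trans (YK w) (ler_norm _)).
Qed.

Lemma test_cst c : test (fun=> c).
Proof. by split; [exact: measurable_cst|exists `|c|]. Qed.

Lemma test_indic (A : set T) : <<s G >> A -> test \1_A.
Proof.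
move=> GA; split; first exact: (@measurable_indic _ (g_sigma_algebraType G)).
by exists 1 => w; rewrite indicE; case: (_ \in _); rewrite ?normr1 ?normr0.
Qed.

Lemma testM Y Z : test Y -> test Z -> test (fun w => Y w * Z w).
Proof.
move=> [mY [K YK]] [mZ [L ZL]]; split; first exact: measurable_funM.
exists (K * L) => w; rewrite normrM ler_pM//.
Qed.

Lemma testD Y Z : test Y -> test Z -> test (fun w => Y w + Z w).
Proof.
move=> [mY [K YK]] [mZ [L ZL]]; split; first exact: measurable_funD.
by exists (K + L) => w; rewrite (le_trans (ler_normD _ _))// lerD.
Qed.

Lemma test_comp (h : R -> R) (Y : T -> R) K :
  measurable_fun setT h -> (forall x, `|h x| <= K) ->
  measurable_fun setT (Y : g_sigma_algebraType G -> R) -> test (h \o Y).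
Proof.
move=> mh hK mY; split; first exact: measurableT_comp.
by exists K => w /=.
Qed.

Lemma test_L1 Y f : test Y -> L1 P f -> L1 P (fun w => Y w * f w).
Proof.
by move=> tY fi; have [K _ YK] := test_bounded tY; apply: (L1_bM _ YK) => //;
  exact: test_measurable.
Qed.

Lemma test_L1_self Y : test Y -> L1 P Y.
Proof.
move=> tY; have [K _ YK] := test_bounded tY.
by apply: (L1_bounded _ _ YK); exact: test_measurable.
Qed.

(** Rounding down is a sum of indicators. *)
Lemma layer_cake (N : nat) (x : R) : 0 <= x <= N%:R ->
  `|x - \sum_(j < N) (j.+1%:R <= x)%R%:R| <= 1.
Proof.
suff H : 0 <= x <= N%:R -> 0 <= x - \sum_(j < N) (j.+1%:R <= x)%R%:R <= 1.
  by move=> /H /andP[a b]; rewrite ger0_norm.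
elim: N => [|N IH] /andP[x0 xN].
  by rewrite big_ord0; apply/andP; split; lra.
rewrite big_ord_recr/=; have [xN1|xN1] := lerP N.+1%:R x.
  have -> : x = N.+1%:R by apply/eqP; rewrite eq_le xN.
  rewrite (eq_bigr (fun=> 1)); last first.
    by move=> i _; rewrite ler_nat ltnS ltnW ?ltn_ord.
  rewrite sumr_const card_ord -natr1 /=; apply/andP; split; lra.
have [xN'|xN'] := lerP x N%:R.
  by rewrite addr0; apply: IH; rewrite x0.
rewrite (eq_bigr (fun=> 1)); last first.
  by move=> i _; rewrite (_ : (_ <= _) = true)//; apply: le_trans (ltW xN'); rewrite ler_nat ltn_ord.
by rewrite sumr_const card_ord addr0; move: xN1; rewrite -natr1 => xN1; apply/andP; split; lra.
Qed.

(** Orthogonality to the events of a sub-sigma-algebra extends to its bounded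
    random variables, which are uniform limits of staircases. *)
Lemma orthogonal_test f : L1 P f ->
  (forall A, <<s G >> A -> Ex P (fun w => \1_A w * f w) = 0) ->
  forall Y, test Y -> Ex P (fun w => Y w * f w) = 0.
Proof.
move=> fi fA Y tY.
have Ef0 : Ex P f = 0.
  rewrite -[RHS](fA setT); last exact: (@measurableT _ (g_sigma_algebraType G)).
  by congr Ex; apply/funext => w; rewrite indicE in_setT mul1r.
have [K K0 YK] := test_bounded tY.
have [M MK] : exists M : nat, K <= M%:R.
  by exists (Num.truncn K).+1; exact/ltW/truncnS_gt.
(* a nonnegative function has a staircase made of the events of [layer_cake] *)
pose Y' w := Y w + M%:R.
have Y'0 w : 0 <= Y' w.
  by rewrite /Y' -lerBlDr sub0r; have := YK w; rewrite ler_norml => /andP[? _]; lra.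
have Y'M w : Y' w <= (M + M)%:R.
  by rewrite natrD lerD2r; have := YK w; rewrite ler_norml => /andP[_ ?]; lra.
have tY' : test Y' by apply: testD => //; exact: test_cst.
suff E0 : Ex P (fun w => Y' w * f w) = 0.
  transitivity (Ex P (fun w => Y' w * f w - M%:R * f w)).
    by congr Ex; apply/funext => w; rewrite /Y'; ring.
  by rewrite ExB ?ExZ ?E0 ?Ef0 ?mulr0 ?subr0//; [exact: test_L1|exact: L1Z].
pose N n := ((M + M) * n.+1)%N.
pose St n w : R := n.+1%:R^-1 * \sum_(j < N n) (j.+1%:R <= n.+1%:R * Y' w)%R%:R.
have mS n j : <<s G >> [set w | j.+1%:R <= n.+1%:R * Y' w].
  rewrite [X in <<s _ >> X](_ : _ = setT `&` Y' @^-1` `[j.+1%:R / n.+1%:R, +oo[).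
    exact: (tY'.1 measurableT).
  apply/seteqP; split => w /=; rewrite in_itv/= andbT ler_pdivrMr// mulrC//.
  by move=> [].
have ES n : Ex P (fun w => St n w * f w) = 0.
  transitivity (Ex P (fun w => \sum_(j < N n)
      n.+1%:R^-1 * (\1_[set w | j.+1%:R <= n.+1%:R * Y' w] w * f w))).
    congr Ex; apply/funext => w; rewrite /St mulr_sumr mulr_suml.
    by apply: eq_bigr => j _; rewrite indicE mulrA; congr (_ * _ * _); rewrite mem_setE.
  rewrite Ex_sum; last by move=> j _; apply/L1Z/test_L1 => //; exact: test_indic (mS _ _).
  rewrite big1// => j _; rewrite ExZ ?fA ?mulr0//.
  by apply/test_L1 => //; exact: test_indic (mS _ _).
have dS n w : `|Y' w - St n w| <= n.+1%:R^-1.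
  have -> : Y' w - St n w = n.+1%:R^-1 *
      (n.+1%:R * Y' w - \sum_(j < N n) (j.+1%:R <= n.+1%:R * Y' w)%R%:R).
    by rewrite /St mulrBr mulrA mulVf// mul1r.
  rewrite normrM ger0_norm// ler_piMr// layer_cake// mulr_ge0//=.
  by rewrite /N mulnC natrM ler_pM2l.
have tS n : test (St n).
  have -> : St n = fun w => n.+1%:R^-1 * \sum_(j < N n)
      \1_[set w | j.+1%:R <= n.+1%:R * Y' w] w.
    apply/funext => w; rewrite /St; congr (_ * _); apply: eq_bigr => j _.
    by rewrite indicE mem_setE.
  apply: testM; first exact: test_cst.
  elim: (N n) => [|k IH]; first by under eq_fun do rewrite big_ord0; exact: test_cst.
  by under eq_fun do rewrite big_ord_recr; apply: testD => //; exact: test_indic (mS _ _).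
have bd n : `|Ex P (fun w => Y' w * f w)| <= n.+1%:R^-1 * Ex P (fun w => `|f w|).
  have -> : Ex P (fun w => Y' w * f w) = Ex P (fun w => Y' w * f w - St n w * f w).
    by rewrite ExB ?ES ?subr0//; apply: test_L1.
  rewrite -ExZ; last exact: L1_norm.
  apply: Ex_abs_le; first by apply: L1B; exact: test_L1.
    by apply: L1Z; exact: L1_norm.
  by move=> w; rewrite -mulrBl normrM ler_wpM2r.
apply/eqP; rewrite -normr_le0; apply/ler_addgt0Pr => e e0; rewrite add0r.
have E1 : 0 <= Ex P (fun w => `|f w|) by exact: Ex_ge0.
pose n := Num.truncn (Ex P (fun w => `|f w|) / e).
apply: (le_trans (bd n)); rewrite mulrC ler_pdivrMr// mulrC -ler_pdivrMr//.
exact/ltW/truncnS_gt.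
Qed.

End sub_sigma_algebra.

(** * Elementary calculus *)

Section calculus.
Context {R : realType}.
Implicit Types (x y s t u v : R).

Lemma ge0_of_derive (f df : R -> R) : (forall x, is_derive x 1 f (df x)) ->
  f 0 = 0 -> (forall x, 0 <= x -> 0 <= df x) -> forall x, 0 <= x -> 0 <= f x.
Proof.
move=> fdf f0 df0 x; rewrite le_eqVlt => /predU1P[<-|x0]; first by rewrite f0.
have cf : {within `[0, x], continuous f}.
  apply: derivable_within_continuous => z _.
  by have [] := fdf z.
have [z] := MVT x0 (fun z _ => fdf z) cf; rewrite in_itv/= => /andP[z0 _].
by rewrite f0 !subr0 => ->; rewrite mulr_ge0 ?df0// ltW.
Qed.

(** Each of the following bounds arises from the previous one by integration.
    *)
Lemma sin_le_id x : 0 <= x -> sin x <= x.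
Proof.
move=> x0; rewrite -subr_ge0; move: x x0.
apply: (@ge0_of_derive (fun x => x - sin x) (fun x => 1 - cos x)).
- by rewrite sin0 subr0.
- by move=> x _; rewrite subr_ge0 cos_le1.
Qed.

Lemma cos_ge_taylor2 x : 0 <= x -> 0 <= cos x - 1 + x ^+ 2 / 2.
Proof.
move: x; apply: (@ge0_of_derive _ (fun x => x - sin x)).
- by move=> x; apply: is_derive_eq; rewrite /GRing.scale/=; field.
- by rewrite cos0 expr0n/= mul0r addr0 subrr.
- by move=> x x0; rewrite subr_ge0 sin_le_id.
Qed.

Lemma sin_ge_taylor3 x : 0 <= x -> 0 <= sin x - x + x ^+ 3 / 6.
Proof.
move: x; apply: (@ge0_of_derive _ (fun x => cos x - 1 + x ^+ 2 / 2)).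
- by move=> x; apply: is_derive_eq; rewrite /GRing.scale/=; field.
- by rewrite sin0 expr0n/= mul0r addr0 subrr.
- by move=> x x0; apply: cos_ge_taylor2.
Qed.

Lemma cos_le_taylor4 x : 0 <= x -> 0 <= 1 - cos x - x ^+ 2 / 2 + x ^+ 4 / 24.
Proof.
move: x; apply: (@ge0_of_derive _ (fun x => sin x - x + x ^+ 3 / 6)).
- by move=> x; apply: is_derive_eq; rewrite /GRing.scale/=; field.
- by rewrite cos0 !expr0n/= !mul0r addr0 subrr subr0.
- by move=> x x0; apply: sin_ge_taylor3.
Qed.

Lemma abs_sin_sub x : `|sin x - x| <= `|x| ^+ 3.
Proof.
wlog x0 : x / 0 <= x.
  move=> H; have [|x0] := lerP 0 x; first exact: H.
  have := H (- x); rewrite oppr_ge0 ltW// => /(_ isT).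
  by rewrite sinN -opprD !normrN.
rewrite (ger0_norm x0) ler0_norm ?subr_le0 ?sin_le_id//.
have := sin_ge_taylor3 x0; have : 0 <= x ^+ 3 by rewrite exprn_ge0.
lra.
Qed.

Lemma abs_cos_sub x : `|cos x - 1 + x ^+ 2 / 2| <= x ^+ 4.
Proof.
wlog x0 : x / 0 <= x.
  move=> H; have [|x0] := lerP 0 x; first exact: H.
  have := H (- x); rewrite oppr_ge0 ltW// => /(_ isT).
  by rewrite cosN sqrrN (exprM _ 2 2) sqrrN -exprM.
rewrite ger0_norm ?cos_ge_taylor2//.
have := cos_le_taylor4 x0; have : 0 <= x ^+ 4 by rewrite exprn_ge0.
lra.
Qed.

Lemma abs_sin_taylor x y :
  `|sin (x + y) - sin x - y * cos x + y ^+ 2 / 2 * sin x| <= `|y| ^+ 3 + y ^+ 4.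
Proof.
have -> : sin (x + y) - sin x - y * cos x + y ^+ 2 / 2 * sin x =
    cos x * (sin y - y) + sin x * (cos y - 1 + y ^+ 2 / 2).
  by rewrite sinD; ring.
rewrite (le_trans (ler_normD _ _))// !normrM lerD//.
  rewrite -[leRHS]mul1r ler_pM// ?abs_sin_sub//.
  by rewrite ler_norml cos_geN1 cos_le1.
rewrite -[leRHS]mul1r ler_pM// ?abs_cos_sub//.
by rewrite ler_norml sin_geN1 sin_le1.
Qed.

Lemma expRN_taylor x : 0 <= x -> `|expR (- x) - 1 + x| <= x ^+ 2.
Proof.
move=> x0; have e1 := expR_ge1Dx (- x).
rewrite ger0_norm; last by lra.
have : expR (- x) <= (1 + x)^-1.
  by rewrite expRN lef_pV2 ?posrE ?expR_gt0 ?expR_ge1Dx// ltr_pwDl.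
move=> /le_trans e2; rewrite -subr_ge0.
have : 0 <= (x ^+ 2 - ((1 + x)^-1 - 1 + x)).
  rewrite (_ : _ - _ = x ^+ 3 / (1 + x)); last by field; apply/eqP; lra.
  by rewrite divr_ge0 ?exprn_ge0// addr_ge0.
have := e2 _ (lexx _); lra.
Qed.

(** With a small [e], third moments are bounded by a small multiple of the
    second ones and a large multiple of the fourth ones. *)
Lemma cube_young x e : 0 < e -> `|x| ^+ 3 <= e * x ^+ 2 + e^-1 * x ^+ 4.
Proof.
move=> e0; rewrite -(real_normK (num_real x)) -[x ^+ 4](_ : `|x| ^+ 4 = _); last first.
  by rewrite -normrX ger0_norm// exprn_even_ge0.
set y := `|x|; have y0 : 0 <= y by exact: normr_ge0.
have -> : e * y ^+ 2 + e^-1 * y ^+ 4 = e^-1 * y ^+ 2 * (e ^+ 2 + y ^+ 2).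
  by field; exact: lt0r_neq0.
have -> : y ^+ 3 = e^-1 * y ^+ 2 * (e * y) by field; exact: lt0r_neq0.
rewrite ler_wpM2l ?mulr_ge0 ?exprn_ge0 ?invr_ge0 ?(ltW e0)//.
have := sqr_ge0 (e - y); have : 0 <= e * y by rewrite mulr_ge0// ltW.
by rewrite sqrrB; lra.
Qed.

Definition grid s t (n k : nat) := s + k%:R * ((t - s) / n%:R).

Lemma grid0 s t n : grid s t n 0 = s.
Proof. by rewrite /grid mul0r addr0. Qed.

Lemma gridn s t n : grid s t n.+1 n.+1 = t.
Proof. by rewrite /grid mulrC divfK// addrC subrK. Qed.

Lemma gridS s t n k : grid s t n k.+1 = grid s t n k + (t - s) / n%:R.
Proof. by rewrite /grid -natr1; ring. Qed.

Lemma grid_mem s t n k : s <= t -> (k <= n.+1)%N -> s <= grid s t n.+1 k <= t.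
Proof.
move=> st kn; rewrite -[X in _ <= _ <= X](gridn s t n) /grid lerDl lerD2l ler_wpM2r ?ler_nat//.
  by rewrite mulr_ge0// divr_ge0// subr_ge0.
by rewrite divr_ge0// subr_ge0.
Qed.

Lemma grid_mesh s t : s <= t -> forall e, 0 < e ->
  exists N, forall n, (N <= n)%N -> (t - s) / n.+1%:R <= e.
Proof.
move=> st e e0; exists (Num.truncn ((t - s) / e)) => n Nn.
rewrite ler_pdivrMr// mulrC -ler_pdivrMr//.
by apply/ltW/(lt_le_trans (truncnS_gt _)); rewrite ler_nat.
Qed.

(** The errors of the local expansions are proportional to the lengths of the
    cells and add up to [e] times the total length. *)
Lemma telescope_grid (a b : R -> R) s t e h n : s <= t ->
  (forall u v, s <= u -> u <= v -> v <= t -> v - u <= h ->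
     `|a v - a u - (v - u) * b u| <= e * (v - u)) ->
  (t - s) / n.+1%:R <= h ->
  `|a t - a s - \sum_(k < n.+1) (t - s) / n.+1%:R * b (grid s t n.+1 k)|
    <= e * (t - s).
Proof.
move=> st ab th; set m := (t - s) / n.+1%:R.
have H k : (k <= n.+1)%N -> `|a (grid s t n.+1 k) - a s -
    \sum_(j < k) m * b (grid s t n.+1 j)| <= e * (k%:R * m).
  elim: k => [_|k IH kn].
    by rewrite grid0 big_ord0 subrr subr0 normr0 mul0r mulr0.
  have d : grid s t n.+1 k.+1 - grid s t n.+1 k = m by rewrite gridS addrAC subrr add0r.
  have m0 : 0 <= m by rewrite divr_ge0// subr_ge0.
  have /andP[k1 _] := grid_mem st (ltnW kn).
  have /andP[_ k2] := grid_mem st kn.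
  have le12 : grid s t n.+1 k <= grid s t n.+1 k.+1 by rewrite -subr_ge0 d.
  have := ab _ _ k1 le12 k2; rewrite d => /(_ th) abk.
  have {IH} := IH (ltnW kn) => IH.
  rewrite big_ord_recr/= -natr1.
  set A := a (grid s t n.+1 k.+1) in abk *.
  set S := \sum_(j < k) _ in IH *.
  rewrite (_ : _ - _ - _ = (A - a (grid s t n.+1 k) - m * b (grid s t n.+1 k)) +
    (a (grid s t n.+1 k) - a s - S)); last by ring.
  rewrite (le_trans (ler_normD _ _))// mulrDl mulrDr mul1r addrC lerD//.
have := H n.+1 (leqnn _); rewrite gridn; congr (_ <= _ * _).
by rewrite /m mulrC divfK.
Qed.

(** Means along a process are known only through such uniform estimates, so
    constancy comes from telescoping instead of a derivative. *)
Lemma flat_eq (a : R -> R) s t : s <= t ->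
  (forall e, 0 < e -> exists2 h, 0 < h & forall u v, s <= u -> u <= v -> v <= t ->
     v - u <= h -> `|a v - a u| <= e * (v - u)) -> a t = a s.
Proof.
move=> st H; apply/eqP; rewrite -subr_eq0 -normr_le0.
apply/ler_addgt0Pr => e e0; rewrite add0r.
have e1 : 0 < e / (t - s + 1) by rewrite divr_gt0// ltr_wpDl// subr_ge0.
have [h h0 ah] := H _ e1; have [N HN] := grid_mesh st h0.
have K u v : s <= u -> u <= v -> v <= t -> v - u <= h ->
    `|a v - a u - (v - u) * 0| <= e / (t - s + 1) * (v - u).
  by move=> su uv vt vu; rewrite mulr0 subr0; exact: ah.
have := telescope_grid st K (HN N (leqnn _)).
rewrite big1 ?subr0; last by move=> i _; rewrite mulr0.
move=> /le_trans; apply; rewrite mulrAC ler_pdivrMr ?ltr_wpDl ?subr_ge0//.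
by rewrite ler_pM2l// lerDl.
Qed.

(** The unique solution of a' = - c a, for a function known only through
    uniform first-order expansions. *)
Lemma exponential_decay (a : R -> R) c K s t : 0 <= c -> s <= t ->
  (forall u, s <= u -> u <= t -> `|a u| <= K) ->
  (forall e, 0 < e -> exists2 h, 0 < h & forall u v, s <= u -> u <= v -> v <= t ->
     v - u <= h -> `|a v - a u + c * (v - u) * a u| <= e * (v - u)) ->
  a t = expR (- (c * (t - s))) * a s.
Proof.
move=> c0 st aK H.
suff : expR (c * t) * a t = expR (c * s) * a s.
  move=> /(congr1 (fun z => expR (- (c * t)) * z)); rewrite !mulrA -!expRD.
  by rewrite addrC subrr expR0 mul1r => ->; congr (expR _ * _); ring.
apply: (@flat_eq (fun u => expR (c * u) * a u) s t st) => e e0.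
have K0 : 0 <= K by apply: le_trans (aK s (lexx s) st).
set M := expR (c * t).
have M0 : 0 < M by exact: expR_gt0.
have M20 : 0 < M * 2 by rewrite mulr_gt0.
have [h h0 ah] := H _ (divr_gt0 e0 M20).
pose B := M * K * c ^+ 2 + 1.
have B0 : 0 < B by rewrite ltr_wpDl// !mulr_ge0 ?exprn_ge0// ltW.
exists (Num.min h (e / (2 * B))).
  by rewrite lt_min h0 divr_gt0// mulr_gt0.
move=> u v su uv vt; rewrite le_min => /andP[vuh vue].
have x0 : 0 <= c * (v - u) by rewrite mulr_ge0// subr_ge0.
have -> : expR (c * v) * a v - expR (c * u) * a u =
   expR (c * v) * ((a v - a u + c * (v - u) * a u) -
     a u * (expR (- (c * (v - u))) - 1 + c * (v - u))).
  have <- : expR (c * v) * expR (- (c * (v - u))) = expR (c * u).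
    by rewrite -expRD; congr expR; ring.
  ring.
rewrite normrM (ger0_norm (expR_ge0 _)).
apply: (@le_trans _ _ (M * (e / (M * 2) * (v - u) + K * (c * (v - u)) ^+ 2))).
  rewrite ler_pM ?expR_ge0// ?ler_expR ?ler_wpM2l//.
  rewrite (le_trans (ler_normB _ _))// lerD ?ah//.
  rewrite normrM ler_pM ?expRN_taylor// aK// (le_trans uv)//.
rewrite mulrDr (_ : M * (e / (M * 2) * (v - u)) = e / 2 * (v - u)); last first.
  by field; exact: lt0r_neq0.
have -> : M * (K * (c * (v - u)) ^+ 2) = M * K * c ^+ 2 * (v - u) * (v - u) by ring.
rewrite -mulrDl ler_wpM2r ?subr_ge0//.
suff : M * K * c ^+ 2 * (v - u) <= e / 2 by lra.
apply: (@le_trans _ _ (B * (v - u))).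
  by rewrite ler_wpM2r ?subr_ge0// /B lerDl.
rewrite mulrC -ler_pdivlMr//; apply: (le_trans vue).
by rewrite invfM mulrA.
Qed.

End calculus.

(** * Processes with Gaussian moments *)

Section gaussian_moments.
Context {d : measure_display} {T : measurableType d} {R : realType}.
Variable P : probability T R.
Variable F : R -> set (set T).
Hypothesis FT : forall u, <<s F u>> `<=` measurable.
Hypothesis Fmono : forall u v, u <= v -> <<s F u>> `<=` <<s F v>>.

Definition adapted_to (X : R -> T -> R) :=
  forall u, measurable_fun setT (X u : g_sigma_algebraType (F u) -> R).

Lemma test_mono u v (Y : T -> R) : u <= v -> test (F u) Y -> test (F v) Y.
Proof.
move=> uv [mY bY]; split => // _ U mU.
by apply: (Fmono uv); exact: (mY measurableT U mU).
Qed.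

(** What Ito's formula needs to know about a Brownian motion of speed [rho]:
    the mean and the variance govern the terms of first and second order, and
    the fourth moment makes the remainder negligible. *)
Record gaussian_moments (rho : R) (X : R -> T -> R) : Prop := GaussianMoments {
  gm_adapted : adapted_to X;
  gm_mean : forall u v (Y : T -> R), 0 <= u -> u <= v -> test (F u) Y ->
    Ex P (fun w => Y w * (X v w - X u w)) = 0;
  gm_var : forall u v (Y : T -> R), 0 <= u -> u <= v -> test (F u) Y ->
    Ex P (fun w => Y w * (X v w - X u w) ^+ 2) = rho * (v - u) * Ex P Y;
  gm_fourth : exists C, forall u v, 0 <= u -> u <= v ->
    L1 P (fun w => (X v w - X u w) ^+ 4) /\
    Ex P (fun w => (X v w - X u w) ^+ 4) <= C * (v - u) ^+ 2 }.

Section consequences.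
Variables (rho : R) (X : R -> T -> R).
Hypothesis gX : gaussian_moments rho X.

Lemma gm_measurable u : measurable_fun setT (X u).
Proof.
apply: (sub_measurable (@FT u)).
exact: (gm_adapted gX).
Qed.

Lemma gm_fourth_bound : exists2 C, 0 <= C & forall u v, 0 <= u -> u <= v ->
  Ex P (fun w => (X v w - X u w) ^+ 4) <= C * (v - u) ^+ 2.
Proof.
have [C CX] := gm_fourth gX; exists `|C| => // u v u0 uv.
have [_ /le_trans] := CX u v u0 uv; apply.
by rewrite ler_wpM2r ?exprn_ge0 ?subr_ge0// ler_norm.
Qed.

Lemma gm_incr_measurable u v : measurable_fun setT (fun w => X v w - X u w).
Proof. by apply: measurable_funB; exact: gm_measurable. Qed.

Lemma gm_incr_L1 (h : R -> R) c u v : 0 <= u -> u <= v ->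
  measurable_fun setT h -> (forall x, `|h x| <= c * (1 + x ^+ 4)) ->
  L1 P (fun w => h (X v w - X u w)).
Proof.
move=> u0 uv mh hc.
apply: (@L1_le _ _ _ P _ (fun w => c * (1 + (X v w - X u w) ^+ 4))).
- by apply: (measurableT_comp mh); exact: gm_incr_measurable.
- by move=> w.
- have [C /(_ u v u0 uv)[L4 _]] := gm_fourth gX.
  by apply/L1Z/L1D => //; exact: L1_cst.
Qed.

Lemma gm_incr_pow_L1 k u v : (k <= 4)%N -> 0 <= u -> u <= v ->
  L1 P (fun w => `|X v w - X u w| ^+ k).
Proof.
move=> k4 u0 uv; apply: (@gm_incr_L1 (fun x => `|x| ^+ k) 1) => //.
  by apply: measurable_funX; exact: normr_measurable.
move=> x; rewrite mul1r normrX normr_id -[x ^+ 4]ger0_norm ?exprn_even_ge0// normrX.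
have [x1|x1] := lerP `|x| 1.
  by rewrite (le_trans (exprn_ile1 _ _ x1))// lerDl exprn_ge0.
by rewrite (le_trans (ler_weXn2l (ltW x1) k4))// lerDr.
Qed.

Lemma gm_incr_id_L1 u v : 0 <= u -> u <= v -> L1 P (fun w => X v w - X u w).
Proof.
move=> u0 uv; apply: (@L1_le _ _ _ P _ (fun w => `|X v w - X u w| ^+ 1)) => //.
  exact: gm_incr_measurable.
exact: gm_incr_pow_L1.
Qed.

Lemma gm_incr_sqr_L1 u v : 0 <= u -> u <= v -> L1 P (fun w => (X v w - X u w) ^+ 2).
Proof.
move=> u0 uv; have := @gm_incr_pow_L1 2 u v isT u0 uv.
by congr L1; apply/funext => w; rewrite real_normK ?num_real.
Qed.

Lemma gm_incr_fourth_L1 u v : 0 <= u -> u <= v ->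
  L1 P (fun w => (X v w - X u w) ^+ 4).
Proof. by move=> u0 uv; have [C /(_ u v u0 uv)[]] := gm_fourth gX. Qed.

Lemma gm_var0 u v : 0 <= u -> u <= v ->
  Ex P (fun w => (X v w - X u w) ^+ 2) = rho * (v - u).
Proof.
move=> u0 uv; have := gm_var gX u0 uv (test_cst (F u) 1).
by rewrite Ex_cst mulr1 => <-; congr Ex; apply/funext => w; rewrite mul1r.
Qed.

Lemma gm_speed_ge0 : 0 <= rho.
Proof.
have := @gm_var0 0 1 (lexx _) ler01; rewrite subr0 mulr1 => <-.
by apply: Ex_ge0 => w; exact: sqr_ge0.
Qed.

(** By [cube_young] the third moment is of smaller order than the length of the
    interval. *)
Lemma gm_cube e : 0 < e -> exists2 h, 0 < h & forall u v, 0 <= u -> u <= v ->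
  v - u <= h -> Ex P (fun w => `|X v w - X u w| ^+ 3) <= e * (v - u).
Proof.
move=> e0; have [C C0 X4] := gm_fourth_bound.
have r0 := gm_speed_ge0.
pose e1 := e / (2 * (rho + 1)).
have e10 : 0 < e1 by rewrite divr_gt0// mulr_gt0// ltr_wpDl.
exists (e * e1 / (2 * (C + 1))).
  by apply: divr_gt0; rewrite mulr_gt0// ltr_wpDl.
move=> u v u0 uv vuh.
apply: (@le_trans _ _ (Ex P (fun w => e1 * (X v w - X u w) ^+ 2 +
   e1^-1 * (X v w - X u w) ^+ 4))).
  apply: Ex_le => [||w]; first exact: gm_incr_pow_L1.
  - by apply: L1D; apply: L1Z; [exact: gm_incr_sqr_L1|exact: gm_incr_fourth_L1].
  - exact: cube_young.
rewrite ExD ?ExZ; [|exact: gm_incr_fourth_L1|exact: gm_incr_sqr_L1|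
  exact/L1Z/gm_incr_sqr_L1|exact/L1Z/gm_incr_fourth_L1].
rewrite gm_var0// [X in _ <= X * _]splitr [leRHS]mulrDl lerD//.
  rewrite mulrA ler_wpM2r ?subr_ge0// /e1 -mulrA ler_wpM2l ?(ltW e0)//.
  by rewrite invfM -mulrA ler_piMr// mulrC ler_pdivrMr ?mul1r ?lerDl// ltr_wpDl.
rewrite ler_pdivrMl//; apply: (le_trans (X4 _ _ u0 uv)).
rewrite expr2 mulrA [leRHS]mulrA ler_wpM2r ?subr_ge0//.
apply: (@le_trans _ _ ((C + 1) * (v - u))).
  by rewrite ler_wpM2r ?subr_ge0// lerDl.
rewrite mulrC -ler_pdivlMr ?ltr_wpDl//; apply: (le_trans vuh).
by rewrite le_eqVlt; apply/orP; left; apply/eqP; field; apply/eqP; lra.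
Qed.

Lemma gm_cube_fourth a b e : 0 <= a -> 0 <= b -> 0 < e ->
  exists2 h, 0 < h & forall u v, 0 <= u -> u <= v -> v - u <= h ->
    Ex P (fun w => a * `|X v w - X u w| ^+ 3 + b * (X v w - X u w) ^+ 4)
      <= e * (v - u).
Proof.
move=> a0 b0 e0; have [C C0 X4] := gm_fourth_bound.
have a1 : 0 < 2 * (a + 1) by lra.
have [h h0 X3] := gm_cube (divr_gt0 e0 a1).
pose B := b * C + 1.
have B0 : 0 < B by rewrite ltr_wpDl// mulr_ge0.
exists (Num.min h (e / (2 * B))).
  by rewrite lt_min h0 divr_gt0// mulr_gt0.
move=> u v u0 uv; rewrite le_min => /andP[vuh vue].
have vu0 : 0 <= v - u by rewrite subr_ge0.
have i3 := @gm_incr_pow_L1 3 u v isT u0 uv.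
have i4 := gm_incr_fourth_L1 u0 uv.
rewrite ExD ?ExZ//; [|exact: L1Z|exact: L1Z].
apply: (@le_trans _ _ (a * (e / (2 * (a + 1)) * (v - u)) + b * (C * (v - u) ^+ 2))).
  by rewrite lerD// ler_wpM2l// ?X3// X4.
rewrite [X in _ <= X * _]splitr [leRHS]mulrDl lerD//.
  rewrite mulrA ler_wpM2r// mulrCA ler_wpM2l ?(ltW e0)//.
  by rewrite invfM mulrCA ler_piMr// ler_pdivrMr ?mul1r ?lerDl// ltr_wpDl.
rewrite expr2 !mulrA ler_wpM2r//.
apply: (@le_trans _ _ (B * (v - u))); first by rewrite ler_wpM2r// lerDl.
rewrite mulrC -ler_pdivlMr//; apply: (le_trans vue).
by rewrite invfM mulrA.
Qed.

(** The second order expansion of [sin (l X)] at the left end of a short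
    interval involves just the mean and the variance of the increment, and
    yields the equation a' = - (rho l ^ 2 / 2) a. *)
Lemma gm_sin_martingale l s t (Y : T -> R) : 0 <= s -> s <= t -> test (F s) Y ->
  Ex P (fun w => Y w * sin (l * X t w)) =
  expR (- (rho * l ^+ 2 / 2 * (t - s))) * Ex P (fun w => Y w * sin (l * X s w)).
Proof.
move=> s0 st tY; have [K K0 YK] := test_bounded tY.
have mY u : s <= u -> test (F u) Y by move=> su; exact: test_mono tY.
have tsin u : test (F u) (fun w => sin (l * X u w)).
  apply: (@test_comp _ _ _ (F u) (fun x => sin (l * x)) (X u) 1).
  - by apply: continuous_measurable_fun => x; apply: continuous_comp; [exact: mulrl_continuous|exact: continuous_sin].
  - by move=> x; rewrite ler_norml sin_geN1 sin_le1.
  - exact: (gm_adapted gX).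
have tcos u : test (F u) (fun w => cos (l * X u w)).
  apply: (@test_comp _ _ _ (F u) (fun x => cos (l * x)) (X u) 1).
  - by apply: continuous_measurable_fun => x; apply: continuous_comp; [exact: mulrl_continuous|exact: continuous_cos].
  - by move=> x; rewrite ler_norml cos_geN1 cos_le1.
  - exact: (gm_adapted gX).
have iY u : s <= u -> L1 P (fun w => Y w * sin (l * X u w)).
  move=> su; have tm := testM (mY _ su) (tsin u).
  have [L L0 bL] := test_bounded tm.
  by apply: (L1_bounded _ _ bL); exact: (test_measurable (@FT u) tm).
apply: (@exponential_decay _ (fun u => Ex P (fun w => Y w * sin (l * X u w)))
  _ K) => //.
- by rewrite divr_ge0// mulr_ge0 ?sqr_ge0// gm_speed_ge0.
- move=> u su ut; apply: Ex_abs_cst; first exact: L1_measurable (iY u su).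
  move=> w; rewrite normrM -[leRHS]mulr1 ler_pM//.
  by rewrite ler_norml sin_geN1 sin_le1.
move=> e e0.
have l4 : 0 <= l ^+ 4 by exact: exprn_even_ge0.
have [h h0 Xh] := @gm_cube_fourth (K * `|l| ^+ 3) (K * l ^+ 4) e
  (mulr_ge0 K0 (exprn_ge0 _ (normr_ge0 _)))
  (mulr_ge0 K0 l4) e0.
exists h => // u v su uv vt vuh.
have u0 : 0 <= u by exact: le_trans su.
have sv : s <= v by exact: le_trans uv.
have tc : test (F u) (fun w => l * (Y w * cos (l * X u w))).
  by apply: testM; [exact: test_cst|apply: testM => //; exact: mY].
have ts : test (F u) (fun w => l ^+ 2 / 2 * (Y w * sin (l * X u w))).
  by apply: testM; [exact: test_cst|apply: testM => //; exact: mY].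
have Ec := gm_mean gX u0 uv tc.
have Es := gm_var gX u0 uv ts.
have ic := test_L1 (@FT u) tc (gm_incr_id_L1 u0 uv).
have i_s := test_L1 (@FT u) ts (gm_incr_sqr_L1 u0 uv).
rewrite ExZ in Es; last exact: iY.
set D := Ex P _ - Ex P _ + _.
have -> : D = Ex P (fun w => Y w * (sin (l * X v w) - sin (l * X u w) -
    l * (X v w - X u w) * cos (l * X u w) +
    (l * (X v w - X u w)) ^+ 2 / 2 * sin (l * X u w))).
  transitivity (Ex P (fun w => (Y w * sin (l * X v w) - Y w * sin (l * X u w)) -
     l * (Y w * cos (l * X u w)) * (X v w - X u w) +
     l ^+ 2 / 2 * (Y w * sin (l * X u w)) * (X v w - X u w) ^+ 2)).
    have i1 := L1B (iY v sv) (iY u su); have i2 := L1B i1 ic.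
    rewrite (ExD i2 i_s) (ExB i1 ic) (ExB (iY v sv) (iY u su)) Ec Es /D.
    ring.
  by congr Ex; apply/funext => w; field.
have i34 : L1 P (fun w => K * `|l| ^+ 3 * `|X v w - X u w| ^+ 3 +
    K * l ^+ 4 * (X v w - X u w) ^+ 4).
  by apply: L1D; apply: L1Z; [exact: gm_incr_pow_L1|exact: gm_incr_fourth_L1].
have H w : `|Y w * (sin (l * X v w) - sin (l * X u w) -
    l * (X v w - X u w) * cos (l * X u w) +
    (l * (X v w - X u w)) ^+ 2 / 2 * sin (l * X u w))| <=
    K * `|l| ^+ 3 * `|X v w - X u w| ^+ 3 + K * l ^+ 4 * (X v w - X u w) ^+ 4.
  rewrite [leRHS](_ : _ = K * (`|l * (X v w - X u w)| ^+ 3 +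
      (l * (X v w - X u w)) ^+ 4)); last by rewrite normrM !exprMn; ring.
  rewrite normrM ler_pM//.
  have := abs_sin_taylor (l * X u w) (l * (X v w - X u w)).
  by rewrite (_ : l * X u w + l * (X v w - X u w) = l * X v w)//; ring.
apply: le_trans (Xh u v u0 uv vuh); apply: Ex_abs_le => //.
apply: (L1_le _ H i34); apply: measurable_funM.
  exact: (test_measurable (@FT u) (mY _ su)).
have mX := gm_measurable; have mXl r : measurable_fun setT (fun w => l * X r w).
  exact: measurable_funM.
have msX r : measurable_fun setT (fun w => sin (l * X r w)).
  exact: (test_measurable (@FT r) (tsin r)).
have mcX r : measurable_fun setT (fun w => cos (l * X r w)).
  exact: (test_measurable (@FT r) (tcos r)).
have md := gm_incr_measurable u v.
apply: measurable_funD.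
  apply: measurable_funB; first exact: measurable_funB.
  by apply: measurable_funM => //; exact: measurable_funM.
apply: measurable_funM => //; apply: measurable_funM => //.
by apply: measurable_funX; exact: measurable_funM.
Qed.

End consequences.
End gaussian_moments.

(** * Moments of the normal distribution *)

Section exponential_taylor.
Context {R : realType}.
Implicit Types x y : R.

Lemma exp_taylor2_ge0 x : 0 <= x -> 0 <= expR x - 1 - x.
Proof. by move=> _; have := expR_ge1Dx x; lra. Qed.

Lemma exp_taylor3_ge0 x : 0 <= x -> 0 <= expR x - 1 - x - x ^+ 2 / 2.
Proof.
move: x; apply: (@ge0_of_derive _ _ (fun x => expR x - 1 - x)) => [x||].
- by apply: is_derive_eq; rewrite /GRing.scale/=; field.
- by rewrite expR0; field.
- exact: exp_taylor2_ge0.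
Qed.

Lemma exp_taylor2_le x : 0 <= x -> 0 <= x ^+ 2 * expR x - (expR x - 1 - x).
Proof.
move: x; apply: (@ge0_of_derive _ _
  (fun x => (2 * x + x ^+ 2) * expR x - (expR x - 1))) => [x||].
- by apply: is_derive_eq; rewrite /GRing.scale/=; ring.
- by rewrite expR0; field.
apply: (@ge0_of_derive _ _
  (fun x => (1 + 4 * x + x ^+ 2) * expR x)) => [x||x x0].
- by apply: is_derive_eq; rewrite /GRing.scale/=; ring.
- by rewrite expR0 expr0n/= mulr0 addr0 mul0r subrr subr0.
by rewrite mulr_ge0 ?expR_ge0// addr_ge0 ?sqr_ge0//; lra.
Qed.

Lemma exp_taylor3_le x : 0 <= x ->
  0 <= x ^+ 3 * expR x - (expR x - 1 - x - x ^+ 2 / 2).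
Proof.
move: x; apply: (@ge0_of_derive _ _
  (fun x => (3 * x ^+ 2 + x ^+ 3) * expR x - (expR x - 1 - x))) => [x||].
- by apply: is_derive_eq; rewrite /GRing.scale/=; field.
- by rewrite expR0; field.
apply: (@ge0_of_derive _ _
  (fun x => (6 * x + 6 * x ^+ 2 + x ^+ 3) * expR x - (expR x - 1))) => [x||].
- by apply: is_derive_eq; rewrite /GRing.scale/=; ring.
- by rewrite expR0; ring.
apply: (@ge0_of_derive _ _
  (fun x => (5 + 18 * x + 9 * x ^+ 2 + x ^+ 3) * expR x)) => [x||x x0].
- by apply: is_derive_eq; rewrite /GRing.scale/=; ring.
- by rewrite expR0; ring.
by rewrite mulr_ge0 ?expR_ge0// !addr_ge0 ?mulr_ge0 ?exprn_ge0.
Qed.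

Lemma expN_taylor2 x : 0 <= x -> 0 <= 1 - x + x ^+ 2 / 2 - expR (- x).
Proof.
move: x; apply: (@ge0_of_derive _ _ (fun x => expR (- x) - 1 + x)) => [x||x _].
- by apply: is_derive_eq; rewrite /GRing.scale/=; field.
- by rewrite oppr0 expR0; field.
- by have := expR_ge1Dx (- x); lra.
Qed.

Lemma expN_taylor3 x : 0 <= x -> 0 <= expR (- x) - 1 + x - x ^+ 2 / 2 + x ^+ 3 / 6.
Proof.
move: x; apply: (@ge0_of_derive _ _
  (fun x => 1 - x + x ^+ 2 / 2 - expR (- x))) => [x||x x0].
- by apply: is_derive_eq; rewrite /GRing.scale/=; field.
- by rewrite oppr0 expR0 !expr0n/= !mul0r subr0 !addr0 subrr.
- exact: expN_taylor2.
Qed.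

Lemma abs_exp_taylor2 x : `|expR x - 1 - x| <= x ^+ 2 * expR `|x|.
Proof.
have [x0|x0] := lerP 0 x.
  rewrite !ger0_norm ?exp_taylor2_ge0//.
  by have := exp_taylor2_le x0; lra.
have y0 : 0 <= - x by lra.
rewrite ger0_norm; last by have := expR_ge1Dx x; lra.
rewrite ltr0_norm//; have := expN_taylor2 y0; rewrite opprK sqrrN.
have : x ^+ 2 <= x ^+ 2 * expR (- x).
  by rewrite ler_peMr ?sqr_ge0// -[leLHS]expR0 ler_expR.
by have := sqr_ge0 x; lra.
Qed.

Lemma abs_exp_taylor3 x :
  `|expR x - 1 - x - x ^+ 2 / 2| <= `|x| ^+ 3 * expR `|x|.
Proof.
have [x0|x0] := lerP 0 x.
  rewrite !ger0_norm ?exp_taylor3_ge0//.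
  by have := exp_taylor3_le x0; lra.
have y0 : 0 <= - x by lra.
have a := expN_taylor2 y0; have b := expN_taylor3 y0.
rewrite opprK sqrrN in a b.
have y30 : 0 <= (- x) ^+ 3 by rewrite exprn_ge0.
have : (- x) ^+ 3 <= (- x) ^+ 3 * expR (- x).
  by rewrite ler_peMr// -[leLHS]expR0 ler_expR.
rewrite (ltr0_norm x0) ler0_norm; lra.
Qed.

Lemma pow_le_exp n x : `|x| ^+ n <= n`!%:R * (expR x + expR (- x)).
Proof.
have e : expR `|x| <= expR x + expR (- x).
  have [x0|x0] := lerP 0 x; first by rewrite ger0_norm// lerDl expR_ge0.
  by rewrite ltr0_norm// lerDr expR_ge0.
apply: (@le_trans _ _ (n`!%:R * expR `|x|)); last by rewrite ler_wpM2l.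
rewrite mulrC -ler_pdivrMr ?ltr0n ?fact_gt0//.
case: n => [|n]; first by rewrite expr0 fact0 divr1 -[leLHS]expR0 ler_expR.
have := expR_ge1Dxn n (normr_ge0 x); have := exprn_ge0 n (normr_ge0 x).
lra.
Qed.

(** Compares coefficients of two expansions in powers of [a]: their difference
    is [z]. *)
Lemma small_eq0 (z C : R) : (forall a, 0 < a -> a <= 1 -> `|z| <= a * C) -> z = 0.
Proof.
move=> H; apply/eqP; rewrite -normr_le0; apply/ler_addgt0Pr => e e0; rewrite add0r.
have C1 : 0 < `|C| + 1 by rewrite ltr_wpDl.
have a0 : 0 < Num.min 1 (e / (`|C| + 1)) by rewrite lt_min ltr01 divr_gt0.
have := H _ a0; rewrite ge_min lexx => /(_ isT) /le_trans; apply.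
apply: (@le_trans _ _ (e / (`|C| + 1) * (`|C| + 1))); last by rewrite divfK// lt0r_neq0.
apply: (@le_trans _ _ (Num.min 1 (e / (`|C| + 1)) * (`|C| + 1))).
  by rewrite ler_wpM2l ?(ltW a0)// (le_trans (ler_norm _))// lerDl.
by rewrite ler_wpM2r ?(ltW C1)// ge_min lexx orbT.
Qed.

End exponential_taylor.

Section normal_moments.
Context {R : realType}.
Variable s : R.
Hypothesis s0 : s != 0.
Notation mu := (@lebesgue_measure R).
Notation N := (normal_prob 0 s : probability _ R).

Lemma ge0_integral_normal (f : R -> R) : (forall x, 0 <= f x) ->
  measurable_fun setT f ->
  (\int[N]_x (f x)%:E = \int[mu]_x (f x * normal_pdf 0 s x)%:E)%E.
Proof.
move=> f0 mf.
have dom := @normal_prob_dominates R 0 s.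
have f0E x : (0 <= (f x)%:E)%E by rewrite lee_fin.
have mfE : measurable_fun setT (EFin \o f) by exact/measurable_EFinP.
rewrite -(Radon_Nikodym_SigmaFinite.change_of_variables dom f0E measurableT mfE).
apply: ae_eq_integral => //.
- apply: emeasurable_funM => //; apply: (measurable_int mu).
  exact: Radon_Nikodym_SigmaFinite.f_integrable.
- apply/measurable_EFinP; apply: measurable_funM => //.
  exact: measurable_normal_pdf.
under [X in ae_eq _ _ _ X]eq_fun do rewrite EFinM.
apply: ae_eqe_mul2l => /=; apply: integral_ae_eq => //=.
- exact: Radon_Nikodym_SigmaFinite.f_integrable.
- by apply/measurable_EFinP; exact: measurable_normal_pdf.
- by move=> E ET mE; rewrite -Radon_Nikodym_SigmaFinite.f_integral.
Qed.

(** Completing the square. *)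
Lemma normal_tilt a x : expR (a * x) * normal_pdf 0 s x =
  expR (a ^+ 2 * s ^+ 2 / 2) * normal_pdf (a * s ^+ 2) s x.
Proof.
rewrite !normal_pdfE// mulrCA [RHS]mulrCA; congr (_ * _).
rewrite /normal_fun -!expRD; congr expR.
by rewrite -mulr_natr; field.
Qed.

Lemma integral_normal_exp a :
  (\int[N]_x (expR (a * x))%:E = (expR (a ^+ 2 * s ^+ 2 / 2))%:E)%E.
Proof.
rewrite ge0_integral_normal.
- under eq_integral => x _ do rewrite normal_tilt EFinM.
  rewrite integralZl//; last exact: integrable_normal_pdf.
  by rewrite integral_normal_pdf mule1.
- by move=> x; exact: expR_ge0.
- by apply: measurableT_comp => //; apply: measurable_funM.
Qed.

Lemma normal_exp_L1 a : L1 N (fun x => expR (a * x)).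
Proof.
apply/integrableP; split.
  by apply/measurable_EFinP; apply: measurableT_comp => //; apply: measurable_funM.
under eq_integral => x _ do rewrite /= ger0_norm ?expR_ge0//.
by rewrite integral_normal_exp ltry.
Qed.

Lemma normal_exp a : Ex N (fun x => expR (a * x)) = expR (a ^+ 2 * s ^+ 2 / 2).
Proof. by rewrite /Ex /Rintegral integral_normal_exp. Qed.

Lemma normal_pow_exp_L1 k (c : R) : 0 <= c <= 1 ->
  L1 N (fun x => `|x| ^+ k * expR (c * `|x|)) /\
  Ex N (fun x => `|x| ^+ k * expR (c * `|x|)) <=
    k`!%:R * (expR (2 * s ^+ 2) + expR (2 * s ^+ 2)).
Proof.
move=> /andP[c0 c1].
pose g (x : R) := k`!%:R * (expR (2 * x) + expR (-2 * x)).
have gL : L1 N g by apply/L1Z/L1D; exact: normal_exp_L1.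
have le x : `|x| ^+ k * expR (c * `|x|) <= g x.
  have H : forall z : R, 0 <= z -> z ^+ k * expR (c * z) <= k`!%:R * expR (2 * z).
    move=> z z0; rewrite mulr_natl (_ : 2 * z = z + z); last by ring.
    rewrite expRD -mulrnAl ler_pM ?exprn_ge0 ?expR_ge0//; last first.
      by rewrite ler_expR ler_piMl.
    rewrite -mulr_natl mulrC -ler_pdivrMr ?ltr0n ?fact_gt0//.
    case: {c0 c1 gL g} k => [|k]; first by rewrite expr0 fact0 divr1 -[leLHS]expR0 ler_expR.
    by have := expR_ge1Dxn k z0; have := exprn_ge0 k z0; lra.
  apply: (le_trans (H _ (normr_ge0 x))); rewrite ler_wpM2l//.
  have [x0|x0] := lerP 0 x; first by rewrite ger0_norm// lerDl expR_ge0.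
  by rewrite ltr0_norm// mulrN mulNr lerDr expR_ge0.
have m : measurable_fun [set: R] (fun x => `|x| ^+ k * expR (c * `|x|)).
  apply: measurable_funM; first by apply: measurable_funX; exact: normr_measurable.
  by apply: measurableT_comp => //; apply: measurable_funM => //; exact: normr_measurable.
have ge0 (x : R) : 0 <= `|x| ^+ k * expR (c * `|x|).
  by rewrite mulr_ge0 ?expR_ge0// exprn_ge0.
have fL : L1 N (fun x => `|x| ^+ k * expR (c * `|x|)).
  by apply: (@L1_le _ _ _ N _ g m _ gL) => x; rewrite ger0_norm.
split => //; apply: (le_trans (Ex_le fL gL le)).
rewrite /g ExZ ?ExD ?normal_exp; [|exact: normal_exp_L1..|by apply: L1D; exact: normal_exp_L1].
by rewrite ler_wpM2l// sqrrN expr2 (_ : 2 * 2 * s ^+ 2 / 2 = 2 * s ^+ 2)//; field.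
Qed.

Lemma normal_pow_L1 k : L1 N (fun x => `|x| ^+ k).
Proof.
have [|L _] := @normal_pow_exp_L1 k 0; first by rewrite lexx ler01.
by move: L; congr L1; apply/funext => x; rewrite mul0r expR0 mulr1.
Qed.

Lemma normal_id_L1 : L1 N id.
Proof.
by apply: (L1_le _ _ (normal_pow_L1 1)) => [|x]; [exact: measurable_id|rewrite expr1].
Qed.

Lemma normal_sqr_L1 : L1 N (fun x => x ^+ 2).
Proof.
have := normal_pow_L1 2; congr L1; apply/funext => x.
by rewrite real_normK// num_real.
Qed.

Lemma exp_sub1_le (h : R) : 0 <= h -> h <= s ^+ 2 ->
  `|expR h - 1 - h| <= h ^+ 2 * expR (s ^+ 2).
Proof.
move=> h0 hs; apply: (le_trans (abs_exp_taylor2 h)).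
by rewrite ger0_norm// ler_wpM2l ?sqr_ge0// ler_expR.
Qed.

(** The coefficients of [a] in both sides of [normal_exp]. *)
Lemma normal_mean : Ex N id = 0.
Proof.
pose C := 2`!%:R * (expR (2 * s ^+ 2) + expR (2 * s ^+ 2)).
apply: (@small_eq0 _ _ (C + s ^+ 2 + s ^+ 4 * expR (s ^+ 2))) => a a0 a1.
have e1 : `|Ex N (fun x => expR (a * x) - 1 - a * x)| <= a ^+ 2 * C.
  have [|L EL] := @normal_pow_exp_L1 2 a; first by rewrite (ltW a0).
  apply: (le_trans _ (ler_wpM2l (sqr_ge0 a) EL)); rewrite -ExZ//.
  apply: Ex_abs_le.
  - by apply: L1B; [apply: L1B; [exact: normal_exp_L1|exact: L1_cst]|exact: (L1Z a normal_id_L1)].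
  - exact: L1Z.
  move=> x; apply: (le_trans (abs_exp_taylor2 _)).
  by rewrite real_normK ?num_real// normrM (gtr0_norm a0) exprMn -!mulrA.
rewrite ExB in e1; last 2 first.
  by apply: L1B; [exact: normal_exp_L1|exact: L1_cst].
  exact: (L1Z a normal_id_L1).
rewrite ExB ?Ex_cst ?normal_exp in e1; [|exact: normal_exp_L1|exact: L1_cst].
rewrite (ExZ a normal_id_L1) in e1.
have h0 : 0 <= a ^+ 2 * s ^+ 2 / 2 by rewrite divr_ge0// mulr_ge0 ?sqr_ge0.
have a2 : a ^+ 2 <= 1 by rewrite exprn_ile1// ltW.
have hs : a ^+ 2 * s ^+ 2 / 2 <= s ^+ 2.
  have := ler_wpM2r (sqr_ge0 s) a2; have := sqr_ge0 s; lra.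
have := exp_sub1_le h0 hs.
set E := expR (a ^+ 2 * s ^+ 2 / 2) in e1 *; set Z := Ex N id in e1 *.
set D := expR (s ^+ 2) => e2.
rewrite -(ler_pM2l a0) -[X in X * `|_|](gtr0_norm a0) -normrM.
rewrite (_ : a * Z = - (E - 1 - a * Z) + (E - 1 - a ^+ 2 * s ^+ 2 / 2) + a ^+ 2 * s ^+ 2 / 2); last by ring.
apply: (le_trans (ler_normD _ _)); rewrite (ger0_norm h0).
apply: (le_trans (lerD (ler_normD _ _) (lexx _))); rewrite normrN.
have : (a ^+ 2 * s ^+ 2 / 2) ^+ 2 * D <= a ^+ 2 * (s ^+ 4 * D).
  rewrite [leLHS](_ : _ = a ^+ 2 * (s ^+ 4 * D * (a ^+ 2 / 4))); last by field.
  rewrite ler_wpM2l ?sqr_ge0// ler_piMr//; last lra.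
  by rewrite mulr_ge0 ?expR_ge0// exprn_even_ge0.
have : 0 <= a ^+ 2 * s ^+ 2 by rewrite mulr_ge0 ?sqr_ge0.
lra.
Qed.

(** The coefficients of [a ^ 2] in both sides of [normal_exp]. *)
Lemma normal_variance : Ex N (fun x => x ^+ 2) = s ^+ 2.
Proof.
pose C := 3`!%:R * (expR (2 * s ^+ 2) + expR (2 * s ^+ 2)).
apply/eqP; rewrite -subr_eq0; apply/eqP.
apply: (@small_eq0 _ _ (2 * C + s ^+ 4 * expR (s ^+ 2))) => a a0 a1.
have [iD i1 i2] : [/\ L1 N (fun x => expR (a * x) - 1),
    L1 N (fun x => a * x) & L1 N (fun x => (a * x) ^+ 2 / 2)].
  split; [by apply: L1B; [exact: normal_exp_L1|exact: L1_cst]|exact: (L1Z a normal_id_L1)|].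
  have := L1Z (a ^+ 2 / 2) normal_sqr_L1; congr L1; apply/funext => x; ring.
have e1 : `|Ex N (fun x => expR (a * x) - 1 - a * x - (a * x) ^+ 2 / 2)| <= a ^+ 3 * C.
  have [|L EL] := @normal_pow_exp_L1 3 a; first by rewrite (ltW a0).
  have a30 : 0 <= a ^+ 3 by rewrite exprn_ge0// ltW.
  apply: (le_trans _ (ler_wpM2l a30 EL)); rewrite -ExZ//.
  apply: Ex_abs_le.
  - by apply: L1B => //; exact: L1B.
  - exact: L1Z.
  move=> x; apply: (le_trans (abs_exp_taylor3 _)).
  by rewrite normrM (gtr0_norm a0) exprMn -!mulrA.
rewrite (ExB (L1B iD i1) i2) (ExB iD i1) (ExZ a normal_id_L1) normal_mean in e1.
rewrite (ExB (normal_exp_L1 a) (L1_cst _ 1)) Ex_cst normal_exp in e1.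
have E2 : Ex N (fun x => (a * x) ^+ 2 / 2) = a ^+ 2 / 2 * Ex N (fun x => x ^+ 2).
  by rewrite -ExZ; [congr Ex; apply/funext => x; ring|exact: normal_sqr_L1].
rewrite E2 mulr0 subr0 in e1.
have h0 : 0 <= a ^+ 2 * s ^+ 2 / 2 by rewrite divr_ge0// mulr_ge0 ?sqr_ge0.
have a2 : a ^+ 2 <= 1 by rewrite exprn_ile1// ltW.
have hs : a ^+ 2 * s ^+ 2 / 2 <= s ^+ 2.
  have := ler_wpM2r (sqr_ge0 s) a2; have := sqr_ge0 s; lra.
have := exp_sub1_le h0 hs.
set E := expR (a ^+ 2 * s ^+ 2 / 2) in e1 *; set Z := Ex N _ in e1 *.
set D := expR (s ^+ 2) => e2.
have a20 : 0 < a ^+ 2 / 2 by rewrite divr_gt0// exprn_gt0.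
rewrite -(ler_pM2l a20) -[X in X * `|_|](gtr0_norm a20) -normrM.
rewrite (_ : a ^+ 2 / 2 * (Z - s ^+ 2) = - (E - 1 - a ^+ 2 / 2 * Z) + (E - 1 - a ^+ 2 * s ^+ 2 / 2)); last by field.
apply: (le_trans (ler_normD _ _)); rewrite normrN.
have : (a ^+ 2 * s ^+ 2 / 2) ^+ 2 * D <= a ^+ 2 / 2 * (a * (s ^+ 4 * D)).
  rewrite [leLHS](_ : _ = a ^+ 2 / 2 * (a * (s ^+ 4 * D) * (a / 2))); last by field.
  rewrite ler_wpM2l ?(ltW a20)// ler_piMr//; last lra.
  by apply: mulr_ge0; [exact: ltW|apply: mulr_ge0; [exact: exprn_even_ge0|exact: expR_ge0]].
rewrite (_ : a ^+ 2 / 2 * (a * (2 * C + s ^+ 4 * D)) = a ^+ 3 * C + a ^+ 2 / 2 * (a * (s ^+ 4 * D))); last by field.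
lra.
Qed.

Lemma normal_fourth : Ex N (fun x => x ^+ 4) <= 48 * expR 1 * s ^+ 4.
Proof.
have L4 : L1 N (fun x => x ^+ 4).
  have := normal_pow_L1 4; congr L1; apply/funext => x.
  by rewrite -normrX ger0_norm// exprn_even_ge0.
have Le : L1 N (fun x => s ^+ 4 * (24 * (expR (s^-1 * x) + expR (- s^-1 * x)))).
  by apply/L1Z/L1Z/L1D; exact: normal_exp_L1.
(* the frequency [s^-1] makes the bound scale like [s ^ 4] *)
apply: (@le_trans _ _ (Ex N (fun x => s ^+ 4 * (24 * (expR (s^-1 * x) + expR (- s^-1 * x)))))).
  apply: Ex_le => // x.
  have := pow_le_exp 4 (s^-1 * x); rewrite -normrX ger0_norm ?exprn_even_ge0//.
  rewrite exprMn exprVn mulNr => H.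
  rewrite -[x ^+ 4](@mulVKf _ (s ^+ 4)) ?expf_neq0// ler_wpM2l//.
  by rewrite exprn_even_ge0.
rewrite ExZ ?ExZ ?ExD ?normal_exp; try exact: normal_exp_L1; try by apply: L1D; exact: normal_exp_L1.
  rewrite sqrrN exprVn mulVf ?expf_neq0// mul1r.
  have s4 : 0 <= s ^+ 4 by rewrite exprn_even_ge0.
  rewrite mulrC ler_wpM2r// (_ : 48 = 24 * 2); last by ring.
  rewrite -mulrA ler_wpM2l// mulrDl !mul1r lerD// ler_expR; lra.
by apply/L1Z/L1D; exact: normal_exp_L1.
Qed.

End normal_moments.

(** * Brownian motions have Gaussian moments *)

Section independence.
Context {d : measure_display} {T : measurableType d} {R : realType}.
Variable P : probability T R.

(** The centred indicator of [A] is orthogonal to the events described by [Z],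
    hence to the truncations of [Z], hence to [Z]. *)
Lemma indep_mean (A : set T) (Z : T -> R) : measurable A -> L1 P Z ->
  (forall U, measurable U -> P (A `&` Z @^-1` U) = (P A * P (Z @^-1` U))%E) ->
  Ex P (fun w => \1_A w * Z w) = fine (P A) * Ex P Z.
Proof.
move=> mA iZ ind; have mZ := L1_measurable iZ.
have finP (B : set T) : measurable B -> P B = (fine (P B))%:E.
  by move=> mB; rewrite fineK// fin_num_measure.
pose G := preimage_set_system setT Z (@measurable _ R).
have sG : <<s G >> = G.
  by apply: sigma_algebra_id; exact: sigma_algebra_preimage (@sigma_algebra_measurable _ _).
have GT : <<s G >> `<=` measurable.
  by rewrite sG => _ [U mU <-]; exact: mZ.
have mi B : measurable B -> measurable_fun setT (\1_B : T -> R).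
  by move=> mB; exact: measurable_indic.
have indL B : measurable B -> L1 P \1_B.
  move=> mB; apply: (@L1_bounded _ _ _ P _ 1); first exact: mi.
  by move=> w; rewrite indicE; case: (_ \in _); rewrite ?normr1 ?normr0.
have indM B C w : \1_B w * \1_C w = \1_(B `&` C) w :> R by rewrite indicI.
pose f w : R := \1_A w - fine (P A).
have fL : L1 P f by apply: L1B; [exact: indL|exact: L1_cst].
have ortho Y : test G Y -> Ex P (fun w => Y w * f w) = 0.
  apply: (orthogonal_test GT fL) => B; rewrite sG => -[U mU <-].
  rewrite setTI; have mB : measurable (Z @^-1` U) by rewrite -[_ @^-1` _]setTI; exact: mZ.
  transitivity (Ex P (fun w => \1_(A `&` Z @^-1` U) w - fine (P A) * \1_(Z @^-1` U) w)).
    by congr Ex; apply/funext => w; rewrite /f -indM; ring.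
  rewrite ExB ?ExZ; [|exact: indL..|exact/indL/measurableI|exact/L1Z/indL].
  rewrite !Ex_indic//; last exact: measurableI.
  by rewrite ind// (finP _ mA) (finP _ mB) -EFinM /= subrr.
have Zf : Ex P (fun w => Z w * f w) = 0.
  pose Y n w := Z w * \1_[set x : R | `|x| <= n%:R] (Z w).
  have mN n : measurable [set x : R | `|x| <= n%:R].
    rewrite (_ : [set _ | _] = `[- n%:R, n%:R]%classic)//.
    by apply/seteqP; split => x /=; rewrite in_itv/= ler_norml.
  have tY n : test G (Y n).
    have mZG : measurable_fun setT (Z : g_sigma_algebraType G -> R).
      by move=> _ U mU; rewrite /measurable/= sG; exists U.
    split.
      apply: measurable_funM => //.
      by apply: (measurableT_comp (measurable_indic _)) => //; exact: mN.
    exists n%:R => w; rewrite /Y indicE.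
    by have [/set_mem|] := boolP (Z w \in _); rewrite ?mulr1 ?mulr0 ?normr0.
  have Yle n w : `|Y n w| <= `|Z w|.
    rewrite /Y normrM indicE; case: (_ \in _); rewrite ?normr1 ?mulr1//.
    by rewrite normr0 mulr0.
  have f2 w : `|f w| <= 2.
    rewrite (le_trans (ler_normB _ _))// (_ : 2 = 1 + 1)// lerD//.
      by rewrite indicE; case: (_ \in _); rewrite ?normr1 ?normr0.
    rewrite ger0_norm ?fine_ge0// -lee_fin -finP//.
    exact: probability_le1.
  have [] := @Ex_dct _ _ _ P (fun n w => Y n w * f w) (fun w => Z w * f w)
    (fun w => 2 * `|Z w|).
  - move=> n; apply: measurable_funM; last exact: (L1_measurable fL).
    exact: (test_measurable GT (tY n)).
  - by apply: measurable_funM => //; exact: (L1_measurable fL).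
  - apply: aeW => w; apply: cvgM; last exact: cvg_cst.
    apply: cvg_near_cst; exists (Num.truncn `|Z w|).+1 => //= n /= nZ.
    rewrite /Y indicE mem_set ?mulr1//=.
    by apply/ltW/(lt_le_trans (truncnS_gt _)); rewrite ler_nat.
  - by apply: L1Z; exact: L1_norm.
  - by apply: aeW => w n; rewrite normrM mulrC ler_pM.
  move=> _; rewrite (_ : (fun n => _) = fun=> 0); last first.
    by apply/funext => n; exact: ortho (tY n).
  by move=> /cvg_lim <-//; rewrite lim_cst.
have iA : L1 P (fun w => \1_A w * Z w).
  apply: (@L1_bM _ _ _ P \1_A Z 1); last exact: iZ.
    exact: mi.
  by move=> w; rewrite indicE; case: (_ \in _); rewrite ?normr1 ?normr0.
apply/eqP; rewrite -subr_eq0 -ExZ// -ExB//; last exact: L1Z.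
apply/eqP; rewrite -[RHS]Zf; congr Ex; apply/funext => w; rewrite /f; ring.
Qed.

End independence.

Section time_index.
Context {R : realType}.

Lemma val_to_time (u : R) : 0 <= u -> \val (to_time u) = u.
Proof.
by move=> u0; rewrite /to_time insubdK//; apply/mem_set.
Qed.

Lemma val_to_time_neg (u : R) : u < 0 -> \val (to_time u) = 0.
Proof.
move=> u0; rewrite /to_time /insubd insubN//; apply/negP => /set_mem/=.
by rewrite leNgt u0.
Qed.

Lemma to_timeK (t : time R) : to_time (\val t) = t.
Proof. by rewrite /to_time valKd. Qed.

Lemma val_to_time_mono (u v : R) : u <= v -> \val (to_time u) <= \val (to_time v).
Proof.
move=> uv; have [v0|v0] := lerP 0 v.
  rewrite (val_to_time v0); have [u0|u0] := lerP 0 u; first by rewrite val_to_time.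
  by rewrite val_to_time_neg.
by rewrite !val_to_time_neg//; exact: le_lt_trans v0.
Qed.

Lemma time_ge0 (t : time R) : 0 <= \val t.
Proof. by have := set_mem (valP t). Qed.

End time_index.

Section past.
Context {d : measure_display} {T : measurableType d} {R : realType}.
Variables (m : nat) (X : time R -> T -> 'rV[R]_m).
Hypothesis mX : forall t i, measurable_fun setT (fun w => X t w ord0 i).

(** Indexed by real numbers, so that times can be subtracted and subdivided;
    [to_time] sends negative ones to [0]. *)
Definition past (u : R) : set (set T) :=
  [set A | exists (s : time R) (i : 'I_m) (U : set R),
     [/\ \val s <= \val (to_time u), measurable U & A = [set w | U (X s w ord0 i)]]].

Lemma past_filtration t : <<s past (\val t) >> = natural_filtration X t.
Proof. by rewrite /past to_timeK. Qed.

Lemma past_measurable u : <<s past u >> `<=` measurable.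
Proof.
apply: smallest_sub; first exact: sigma_algebra_measurable.
move=> _ [s [i [U [_ mU ->]]]].
by rewrite -[X in measurable X]setTI; exact: (mX s i).
Qed.

Lemma past_mono u v : u <= v -> <<s past u >> `<=` <<s past v >>.
Proof.
move=> uv; apply: sub_sigma_algebra2 => A [s [i [U [su mU ->]]]].
exists s, i, U; split => //; apply: (le_trans su); exact: val_to_time_mono.
Qed.

Lemma past_coord u v i : u <= v ->
  measurable_fun setT
    ((fun w => X (to_time u) w ord0 i) : g_sigma_algebraType (past v) -> R).
Proof.
move=> uv _ U mU; rewrite setTI; apply: sub_sigma_algebra.
by exists (to_time u), i, U; split => //; exact: val_to_time_mono.
Qed.

End past.

Section brownian_moments.
Context {d : measure_display} {T : measurableType d} {R : realType}.
Variable P : probability T R.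
Variables (m : nat) (X : time R -> T -> 'rV[R]_m).
Hypothesis mX : forall t i, measurable_fun setT (fun w => X t w ord0 i).

(** An increment is independent of the past, so its conditional moments are
    moments of the normal law. *)
Lemma brownian_gaussian_moments rho (B : time R -> T -> R) : 0 < rho ->
  brownian P (natural_filtration X) rho B ->
  gaussian_moments P (past X) rho (fun u => B (to_time u)).
Proof.
move=> rho0 [_ adB incB].
have FT := past_measurable mX.
have ad u : measurable_fun setT ((B (to_time u)) : g_sigma_algebraType (past X u) -> R).
  by move=> _ U mU; rewrite setTI; exact: adB.
have mB u : measurable_fun setT (B (to_time u)) := sub_measurable (@FT u) (ad u).
have law u v (h : R -> R) : 0 <= u -> u < v -> measurable_fun setT h ->
    L1 (normal_prob 0 (Num.sqrt (rho * (v - u)))) h ->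
    L1 P (fun w => h (B (to_time v) w - B (to_time u) w)) /\
    forall Y, test (past X u) Y ->
    Ex P (fun w => Y w * h (B (to_time v) w - B (to_time u) w)) =
    Ex P Y * Ex (normal_prob 0 (Num.sqrt (rho * (v - u)))) h.
  move=> u0 uv mh hL; set D := fun w => B (to_time v) w - B (to_time u) w.
  have v0 : 0 <= v by rewrite (le_trans u0)// ltW.
  have mD : measurable_fun setT D by apply: measurable_funB; exact: mB.
  have uv' : \val (to_time u) < \val (to_time v) by rewrite !val_to_time.
  have lawD U : measurable U -> P (D @^-1` U) = normal_prob 0 (Num.sqrt (rho * (v - u))) U.
    by move=> mU; have [-> _] := incB _ _ uv' U mU; rewrite !val_to_time.
  have indD A U : <<s past X u >> A -> measurable U ->
      P (A `&` D @^-1` U) = (P A * P (D @^-1` U))%E.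
    by move=> FA mU; have [_ ->] := incB _ _ uv' U mU.
  set s := Num.sqrt _ in hL lawD *.
  have mD' : measurable_fun setT (D : T -> measurableTypeR R) by exact: mD.
  pose Dm : {RV P >-> measurableTypeR R} := HB.pack (D : T -> measurableTypeR R) (isMeasurableFun.Build _ _ _ _ _ mD').
  have eN (f : R -> \bar R) : (\int[distribution P Dm]_x f x = \int[normal_prob 0 s]_x f x)%E.
    have := @eq_measure_integral _ _ _ setT (normal_prob 0 s) (distribution P Dm) f.
    move=> H; apply: H => U mU _; exact: lawD.
  have hDL : L1 P (h \o D).
    apply/integrableP; split.
      by apply/measurable_EFinP; exact: measurableT_comp.
    have /integrableP[_] := hL; rewrite -eN ge0_integral_distribution//=.
    by apply/measurable_EFinP; exact: measurableT_comp.
  have EhD : Ex P (h \o D) = Ex (normal_prob 0 s) h.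
    rewrite /Ex /Rintegral -eN; congr fine.
    rewrite integral_distribution//.
    exact/measurable_EFinP.
  split => // Y tY.
  have E0 : Ex P (fun w => Y w * (h (D w) - Ex (normal_prob 0 s) h)) = 0.
    apply: (orthogonal_test (@FT u)) => //; first by apply: L1B => //; exact: L1_cst.
    move=> A FA; have mA := @FT u A FA.
    have iA : L1 P \1_A.
      exact: (test_L1_self _ (@FT u) (test_indic FA)).
    transitivity (Ex P (fun w => \1_A w * h (D w) - Ex (normal_prob 0 s) h * \1_A w)).
      by congr Ex; apply/funext => w; ring.
    rewrite ExB ?ExZ//; [|exact: (test_L1 (@FT u) (test_indic FA))|exact: L1Z].
    rewrite (@indep_mean _ _ _ P A (h \o D))//; last first.
      move=> U mU; rewrite comp_preimage; apply: indD => //.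
      by rewrite -[_ @^-1` _]setTI; exact: mh.
    by rewrite Ex_indic// EhD mulrC subrr.
  transitivity (Ex P (fun w => Y w * (h (D w) - Ex (normal_prob 0 s) h) + Ex (normal_prob 0 s) h * Y w)).
    by congr Ex; apply/funext => w; ring.
  rewrite ExD ?E0 ?add0r ?ExZ ?(mulrC (Ex P Y))//.
  - exact: (test_L1_self _ (@FT u) tY).
  - by apply: (test_L1 (@FT u) tY); apply: L1B => //; exact: L1_cst.
  - by apply: L1Z; exact: (test_L1_self _ (@FT u) tY).
have s_neq0 u v : u < v -> Num.sqrt (rho * (v - u)) != 0.
  by move=> uv; rewrite sqrtr_eq0 -ltNge mulr_gt0// subr_gt0.
have sqs u v : u < v -> Num.sqrt (rho * (v - u)) ^+ 2 = rho * (v - u).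
  by move=> uv; rewrite sqr_sqrtr// mulr_ge0 ?subr_ge0// ltW.
have N4 s : s != 0 -> L1 (normal_prob 0 s) (fun x : R => x ^+ 4).
  move=> s0; have := normal_pow_L1 s0 4; congr L1; apply/funext => x.
  by rewrite -normrX ger0_norm// exprn_even_ge0.
split => //.
- move=> u v Y u0; rewrite le_eqVlt => /predU1P[<- _|uv tY].
    by under eq_fun do rewrite subrr mulr0; rewrite Ex_cst.
  have [_ ->//] := law u v id u0 uv (@measurable_id _ _ _) (normal_id_L1 (s_neq0 _ _ uv)).
  by rewrite normal_mean ?mulr0// s_neq0.
- move=> u v Y u0; rewrite le_eqVlt => /predU1P[<- _|uv tY].
    by under eq_fun do rewrite subrr expr0n/= mulr0; rewrite Ex_cst subrr mulr0 mul0r.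
  have [_ ->//] := law u v (fun x => x ^+ 2) u0 uv (@exprn_measurable _ _ _) (normal_sqr_L1 (s_neq0 _ _ uv)).
  by rewrite normal_variance ?s_neq0// sqs// mulrC.
exists (48 * expR 1 * rho ^+ 2) => u v u0; rewrite le_eqVlt => /predU1P[<-|uv].
  under eq_fun do rewrite subrr expr0n/=; split; first exact: L1_cst.
  by rewrite Ex_cst subrr expr0n/= mulr0.
have [L E] := law u v (fun x => x ^+ 4) u0 uv (@exprn_measurable _ _ _) (N4 _ (s_neq0 _ _ uv)).
split => //.
have := E (fun=> 1) (test_cst _ _); rewrite Ex_cst mul1r => {}E.
rewrite (_ : Ex P _ = Ex P (fun w => 1 * (B (to_time v) w - B (to_time u) w) ^+ 4)); last first.
  by congr Ex; apply/funext => w; rewrite mul1r.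
rewrite E; apply: (le_trans (normal_fourth (s_neq0 _ _ uv))).
by rewrite (exprM _ 2 2) sqs// exprMn mulrA.
Qed.

End brownian_moments.

(** * Absorption at the origin *)

Section compactness.
Context {R : realType} {V : normedModType R}.

Lemma compact_unif_continuous (f : V -> R) (K : set V) : continuous f -> compact K ->
  forall e, 0 < e -> exists2 h, 0 < h &
    forall x y, K x -> `|x - y| < h -> `|f x - f y| < e.
Proof.
move=> cf /compact_near_coveringP cK e e0.
pose Q (h : R) (x : V) := forall y, `|x - y| < h -> `|f x - f y| < e.
have : \forall h \near 0^'+, K `<=` Q h.
  apply: cK => x Kx.
  have : \forall z \near x, `|f x - f z| < e / 2.
    by have /cvgrPdist_lt/(_ _ (divr_gt0 e0 (ltr0n _ 2))) := cf x.
  move=> /nbhs_normP[r /= r0 xr].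
  exists (ball x (r / 2), [set h : R | 0 < h < r / 2]) => /=.
    split; first by apply: nbhsx_ballx; rewrite divr_gt0.
    exists (r / 2) => /=; first by rewrite divr_gt0.
    move=> h /=; rewrite sub0r normrN => hr h0; rewrite h0/=.
    exact: le_lt_trans (ler_norm _) hr.
  move=> [z h]/= [xz /andP[h0 hr]] y zy.
  move: xz; rewrite -ball_normE/= => xz.
  have a : `|f x - f z| < e / 2 by apply: xr => /=; apply: (lt_trans xz); lra.
  have b : `|f x - f y| < e / 2.
    apply: xr => /=; rewrite -(subrK z x) -addrA.
    by apply: (le_lt_trans (ler_normD _ _)); lra.
  rewrite -(subrK (f x) (f z)) -addrA.
  by apply: (le_lt_trans (ler_normD _ _)); rewrite distrC; lra.
move=> [r /= r0 Hr]; exists (r / 2); first by rewrite divr_gt0.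
move=> x y Kx xy; apply: (Hr (r / 2)) => //=.
  by rewrite sub0r normrN gtr0_norm ?divr_gt0//; lra.
by rewrite divr_gt0.
Qed.

End compactness.

Section stopping.
Context {R : realType}.

Lemma val_to_timeE (u : R) : \val (to_time u) = Num.max u 0.
Proof.
have [u0|u0] := lerP 0 u; first by rewrite val_to_time// max_l.
by rewrite val_to_time_neg// max_r// ltW.
Qed.

Lemma to_time_continuous : continuous (@to_time R).
Proof.
apply: (@continuous_comp_initial _ _ _ set_val).
rewrite (_ : _ \o _ = (fun u : R => Num.max u 0)); last first.
  by apply/funext => u /=; rewrite -val_to_timeE set_valE.
by move=> u; apply: (@continuous_max _ _ id (fun=> 0)); [exact: cvg_id|exact: cvg_cst].
Qed.

Lemma hitting0_ge (z : time R -> R) (t : time R) :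
  (forall r, \val r <= \val t -> z r != 0) -> ((\val t)%:E <= hitting0 z)%E.
Proof.
move=> zt; apply: le_ereal_inf_tmp => _ [r /= zr <-]; rewrite lee_fin leNgt.
by apply/negP => rt; have := zt r (ltW rt); rewrite zr eqxx.
Qed.

Lemma stop_at0_nohit (z : time R -> R) (t : time R) :
  (forall r, \val r <= \val t -> z r != 0) -> stop_at0 z t = z t.
Proof.
by move=> /hitting0_ge zt; rewrite /stop_at0 min_l//= to_timeK.
Qed.

Lemma stop_at0_hit (z : time R -> R) (r t : time R) : continuous z ->
  \val r <= \val t -> z r = 0 -> stop_at0 z t = 0.
Proof.
move=> cz rt zr.
have hr : (hitting0 z <= (\val r)%:E)%E by apply: ereal_inf_lbound; exists r.
have h0 : (0%:E <= hitting0 z)%E.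
  by apply: le_ereal_inf_tmp => _ [q _ <-]; rewrite lee_fin time_ge0.
have hE : hitting0 z = (fine (hitting0 z))%:E.
  by rewrite fineK// ge0_fin_numE// (le_lt_trans hr)// ltry.
rewrite /stop_at0 min_r; last by rewrite (le_trans hr)// lee_fin.
set h := fine _ in hE *.
have h_ge0 : 0 <= h by rewrite -lee_fin -hE.
apply/eqP; apply: contraT => zh.
have cz' : continuous (z \o @to_time R).
  by move=> u; apply: continuous_comp; [exact: to_time_continuous|exact: cz].
have /(_ h)/cvgrPdist_lt/(_ `|z (to_time h)|) := cz'.
rewrite normr_gt0 => /(_ zh)/nbhs_normP[e /= e0 he].
suff : ((h + e)%:E <= hitting0 z)%E by rewrite hE lee_fin; lra.
apply: le_ereal_inf_tmp => _ [q /= zq <-]; rewrite lee_fin leNgt; apply/negP => qe.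
have hq : h <= \val q by rewrite -lee_fin -hE; apply: ereal_inf_lbound; exists q.
have /= := he (\val q); rewrite to_timeK zq subr0 ltxx => H.
suff : false by []; apply: H.
by rewrite distrC ger0_norm ?subr_ge0//; lra.
Qed.

End stopping.

Section stopped_martingale.
Context {d : measure_display} {T : measurableType d} {R : realType}.
Variable P : probability T R.
Variables (m : nat) (X : time R -> T -> 'rV[R]_m).
Hypothesis mX : forall t i, measurable_fun setT (fun w => X t w ord0 i).
Let FT := past_measurable mX.
Let Fmono := @past_mono _ _ _ _ X.

(** Stopping a Brownian motion at the origin does not affect the martingale
    sin(l B) exp(rho l^2 u / 2), since the sine vanishes there.  The optional
    stopping argument runs along a grid: the absorbed process itself tells, at a
    grid time, whether the origin has been hit, and a path hitting it between
    two grid times is small at the second one. *)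
Lemma stopped_sin_martingale rho (Z : time R -> T -> R) l s t (Y : T -> R) :
  0 < rho -> (forall u, measurable_fun setT
      (Z (to_time u) : g_sigma_algebraType (past X u) -> R)) ->
  stopped_brownian P (natural_filtration X) rho Z ->
  0 <= s -> s <= t -> test (past X s) Y ->
  Ex P (fun w => Y w * sin (l * Z (to_time t) w)) =
  expR (- (rho * l ^+ 2 / 2 * (t - s))) *
  Ex P (fun w => Y w * sin (l * Z (to_time s) w)).
Proof.
move=> rho0 adZ [B bB ZB] s0 st tY.
have gB := brownian_gaussian_moments mX rho0 bB.
have [K K0 YK] := test_bounded tY.
have cB w : continuous (B ^~ w) by have [] := bB.
pose c := rho * l ^+ 2 / 2.
have c0 : 0 <= c by rewrite divr_ge0// mulr_ge0 ?sqr_ge0// ltW.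
pose b u w := B (to_time u) w.
pose z u w := Z (to_time u) w.
pose alive u : set T := [set w | z u w != 0].
have aliveF u : <<s past X u >> (alive u).
  have -> : alive u = (z u : g_sigma_algebraType (past X u) -> R) @^-1` [set~ 0].
    by apply/seteqP; split => w /= /eqP.
  rewrite -[X in <<s _ >> X]setTI; apply: adZ => //.
  exact: measurableC.
have tal u v : u <= v -> test (past X v) (\1_(alive u) : T -> R).
  by move=> uv; apply: (test_mono Fmono uv); exact: test_indic.
have tsin u : test (past X u) (fun w => sin (l * b u w)).
  apply: (@test_comp _ _ _ (past X u) (fun x => sin (l * x)) (b u) 1).
  - by apply: continuous_measurable_fun => x; apply: continuous_comp;
      [exact: mulrl_continuous|exact: continuous_sin].
  - by move=> x; rewrite ler_norml sin_geN1 sin_le1.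
  - exact: (gm_adapted gB).
have tYu u : s <= u -> test (past X u) Y by move=> su; exact: (test_mono Fmono su).
have hit w u v : (forall r : time R, Z r w = stop_at0 (B ^~ w) r) -> 0 <= u -> u <= v ->
    z u w = 0 -> z v w = 0.
  move=> Zw u0 uv; rewrite /z !Zw => zu.
  have [H|H] := pselect (forall r : time R, \val r <= \val (to_time u) -> B r w != 0).
    move: zu; rewrite stop_at0_nohit// => zu.
    by have := H (to_time u) (lexx _); rewrite zu eqxx.
  have [r [ru /eqP Br]] : exists r : time R, \val r <= \val (to_time u) /\ B r w == 0.
    apply: contrapT => H'; apply: H => r ru; apply/negP => Br; apply: H'.
    by exists r.
  by apply: (stop_at0_hit (@cB w) _ Br); rewrite (le_trans ru)// val_to_time_mono.
(* a path that is still alive has not met the origin and is not yet stopped *)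
have zb w u : (forall r : time R, Z r w = stop_at0 (B ^~ w) r) -> z u w != 0 ->
    z u w = b u w.
  move=> Zw; rewrite /z Zw => zu; apply: stop_at0_nohit => r ru; apply/eqP => Br.
  by move: zu; rewrite (stop_at0_hit (@cB w) ru Br) eqxx.
have cross w u v : (forall r : time R, Z r w = stop_at0 (B ^~ w) r) -> 0 <= u -> u <= v ->
    z u w != 0 -> z v w = 0 -> exists2 r, u <= r <= v & b r w = 0.
  move=> Zw u0 uv zu zv.
  have [H|H] := pselect (exists r : time R, \val r <= \val (to_time v) /\ B r w = 0); last first.
    exists v; rewrite ?uv ?lexx// -[RHS]zv /z Zw stop_at0_nohit// => r rv.
    by apply/eqP => Br; apply: H; exists r.
  have [r [rv Br]] := H; exists (\val r); last by rewrite /b to_timeK.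
  rewrite val_to_time ?(le_trans u0)// in rv; rewrite rv andbT.
  rewrite leNgt; apply/negP => ru; move: zu; rewrite /z Zw.
  by rewrite (stop_at0_hit (@cB w) _ Br) ?eqxx// val_to_time// ltW.
(* survivors move like [B], so [g] changes only through the paths that die *)
pose g u := expR (c * u) * Ex P (fun w => Y w * \1_(alive u) w * sin (l * b u w)).
have gE u : s <= u -> expR (c * u) * Ex P (fun w => Y w * sin (l * z u w)) = g u.
  move=> su; congr (_ * _); have tYu' := tYu u su.
  have mz : measurable_fun setT (fun w => sin (l * z u w)).
    apply: (measurableT_comp (f := fun x : R => sin (l * x))).
      by apply: continuous_measurable_fun => x; apply: continuous_comp;
        [exact: mulrl_continuous|exact: continuous_sin].
    exact: (sub_measurable (@FT u) (adZ u)).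
  apply: Ex_ae.
  - by apply: measurable_funM => //; exact: (test_measurable (@FT u) tYu').
  - apply: measurable_funM; last exact: (test_measurable (@FT u) (tsin u)).
    apply: measurable_funM; first exact: (test_measurable (@FT u) tYu').
    by apply: measurable_indic; exact: (@FT u).
  apply: filterS ZB => w /= Zw; rewrite -mulrA; congr (_ * _).
  have [z0|z0] := eqVneq (z u w) 0.
    have nal : ~ alive u w by move=> /eqP; apply.
    by rewrite z0 mulr0 sin0 indicE memNset// mul0r.
  by rewrite indicE mem_set// mul1r zb.
suff : g t = g s.
  rewrite -!gE// => /(congr1 (fun x => expR (- (c * t)) * x)); rewrite !mulrA -!expRD.
  by rewrite addrC subrr expR0 mul1r => ->; congr (expR _ * _); rewrite /c; ring.
(* the paths alive at [u] and dead at [v] have just met the origin *)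
pose dead u v : set T := alive u `\` alive v.
pose e u v := expR (c * v) * Ex P (fun w => Y w * \1_(dead u v) w * sin (l * b v w)).
have tdead u v : s <= u -> u <= v -> test (past X v) (fun w => Y w * \1_(dead u v) w).
  move=> su uv; apply: testM; first by apply: tYu; exact: le_trans uv.
  apply: test_indic; apply: (@measurableD _ (g_sigma_algebraType (past X v))).
    by apply: (Fmono uv); exact: aliveF.
  exact: aliveF.
have step u v : s <= u -> u <= v -> g v = g u - e u v.
  move=> su uv; have sv := le_trans su uv.
  have u0 := le_trans s0 su.
  have gu : g u = expR (c * v) * Ex P (fun w => Y w * \1_(alive u) w * sin (l * b v w)).
    have tt : test (past X u) (fun w => Y w * \1_(alive u) w).
      by apply: testM; [exact: tYu|exact: tal].
    rewrite (gm_sin_martingale FT Fmono gB l u0 uv tt) mulrA -expRD.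
    by congr (expR _ * _); rewrite /c; ring.
  rewrite gu /e /g -mulrBr; congr (_ * _).
  have tu : test (past X v) (fun w => Y w * \1_(alive u) w * sin (l * b v w)).
    by apply: testM => //; apply: testM; [exact: tYu|exact: tal].
  have td : test (past X v) (fun w => Y w * \1_(dead u v) w * sin (l * b v w)).
    by apply: testM => //; exact: tdead.
  rewrite -ExB; [|exact: test_L1_self tu|exact: test_L1_self td].
  apply: Ex_ae.
  - apply: (test_measurable (@FT v)); apply: testM => //; apply: testM; [exact: tYu|exact: tal].
  - by apply: measurable_funB; [exact: (test_measurable (@FT v) tu)|exact: (test_measurable (@FT v) td)].
  apply: filterS ZB => w /= Zw; rewrite -mulrBl -mulrBr; congr (_ * _ * _).
  rewrite !indicE in_setD; have [|au] := boolP (w \in alive u) => /=.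
    by case: (w \in alive v); rewrite /= ?subr0 ?subrr.
  rewrite subr0 memNset//= => av; move/negP: au; apply; apply/mem_set.
  by apply/eqP => /(hit _ _ _ Zw u0 uv) zv; move: av; rewrite /alive/= zv eqxx.
pose loss n w := \sum_(k < n.+1) expR (c * grid s t n.+1 k.+1) *
  (Y w * \1_(dead (grid s t n.+1 k) (grid s t n.+1 k.+1)) w *
   sin (l * b (grid s t n.+1 k.+1) w)).
have gk n k : (k <= n.+1)%N -> s <= grid s t n.+1 k.
  by move=> kn; have /andP[] := grid_mem st kn.
have gk1 n k : (k <= n)%N -> grid s t n.+1 k <= grid s t n.+1 k.+1.
  by move=> kn; rewrite gridS lerDl divr_ge0// subr_ge0.
have tloss n k : (k <= n)%N -> test (past X t) (fun w => expR (c * grid s t n.+1 k.+1) *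
    (Y w * \1_(dead (grid s t n.+1 k) (grid s t n.+1 k.+1)) w *
    sin (l * b (grid s t n.+1 k.+1) w))).
  move=> kn; have /andP[a1 a2] := grid_mem st (kn : (k.+1 <= n.+1)%N).
  apply: (test_mono Fmono a2); apply: testM; first exact: test_cst.
  by apply: testM => //; apply: tdead; [apply: gk; exact: leqW|exact: gk1].
have gloss n : g t = g s - Ex P (loss n).
  have H k : (k <= n.+1)%N -> g (grid s t n.+1 k) = g s -
      \sum_(j < k) e (grid s t n.+1 j) (grid s t n.+1 j.+1).
    elim: k => [_|k IH kn]; first by rewrite grid0 big_ord0 subr0.
    rewrite big_ord_recr/= (step _ _ (gk n k (ltnW kn)) (gk1 n k kn)) IH ?(ltnW kn)//.
    by rewrite opprD addrA.
  have := H n.+1 (leqnn _); rewrite gridn => ->; congr (_ - _).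
  rewrite /loss Ex_sum.
    apply: eq_bigr => k _; rewrite /e ExZ//.
    apply: (@test_L1_self _ _ _ P _ (@FT (grid s t n.+1 k.+1))); apply: testM => //.
    by apply: tdead; [apply: gk; rewrite ltnW|apply: gk1; rewrite -ltnS].
  move=> k _; apply: (test_L1_self P (@FT t)); apply: tloss.
  by rewrite -ltnS.
have M0 : 0 <= expR (c * t) * K by rewrite mulr_ge0// expR_ge0.
(* a path dies at most once, so at most one term of its loss is nonzero *)
have lossE w n : (forall r : time R, Z r w = stop_at0 (B ^~ w) r) ->
    loss n w = 0 \/ exists u v, [/\ s <= u, u <= v <= t,
      v - u <= (t - s) / n.+1%:R, (exists2 r, u <= r <= v & b r w = 0) &
      `|loss n w| <= expR (c * t) * K * `|sin (l * b v w)|].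
  move=> Zw.
  have [[k kd]|nk] := pselect (exists k : 'I_n.+1,
      dead (grid s t n.+1 k) (grid s t n.+1 k.+1) w); last first.
    left; rewrite /loss big1// => k _; rewrite indicE memNset ?mulr0 ?mul0r ?mulr0//.
    by move=> kd; apply: nk; exists k.
  right; exists (grid s t n.+1 k), (grid s t n.+1 k.+1).
  have /andP[k1 k2] := grid_mem st (ltn_ord k).
  have k3 : s <= grid s t n.+1 k by apply: gk; rewrite ltnW.
  have k4 : grid s t n.+1 k <= grid s t n.+1 k.+1 by apply: gk1; rewrite -ltnS.
  split => //; first by rewrite k4.
  - by rewrite gridS addrAC subrr add0r.
  - have [au /negP/negPn/eqP av] := kd.
    by apply: cross => //; exact: le_trans k3.
  rewrite /loss (bigD1 k)//= big1 ?addr0; last first.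
    move=> j jk; rewrite indicE memNset ?mulr0 ?mul0r ?mulr0//= => -[ju jv].
    have [au /negP/negPn/eqP av] := kd; move/negP/negPn/eqP : jv => jv.
    have gmono i1 i2 : (i1 <= i2)%N -> grid s t n.+1 i1 <= grid s t n.+1 i2.
      by move=> i12; rewrite /grid lerD2l ler_wpM2r ?ler_nat// divr_ge0// subr_ge0.
    have [jk'|kj|/val_inj jk'] := ltngtP j k; last by rewrite jk' eqxx in jk.
    + have := hit w (grid s t n.+1 j.+1) (grid s t n.+1 k) Zw _ (gmono _ _ jk') jv.
      rewrite (le_trans s0) ?gk ?ltn_ord// => /(_ isT) zk.
      by move: au; rewrite /alive/= zk eqxx.
    + have := hit w (grid s t n.+1 k.+1) (grid s t n.+1 j) Zw _ (gmono _ _ kj) av.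
      rewrite (le_trans s0) ?gk ?ltn_ord// => /(_ isT) zk.
      by move: ju; rewrite /alive/= zk eqxx.
  rewrite !normrM ger0_norm ?expR_ge0// !mulrA ler_wpM2r// -mulrA.
  apply: ler_pM; rewrite ?expR_ge0 ?mulr_ge0//; first by rewrite ler_expR ler_wpM2l.
  rewrite -[leRHS]mulr1 ler_pM// indicE; case: (_ \in _); rewrite ?normr1 ?normr0//.
have loss0 : {ae P, forall w, loss ^~ w @ \oo --> (0 : R)}.
  apply: filterS ZB => w /= Zw; apply/cvgrPdist_le => eps eps0.
  have cb : continuous (fun u : R => sin (l * b u w)).
    move=> u; apply: (continuous_comp (f := fun u => l * b u w)); last exact: continuous_sin.
    apply: (continuous_comp (f := fun u => b u w)); last exact: mulrl_continuous.
    by apply: (continuous_comp (f := @to_time R) (g := B ^~ w));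
      [exact: to_time_continuous|exact: cB].
  have K1 : 0 < expR (c * t) * K + 1 by rewrite ltr_wpDl.
  have [h h0 bh] := compact_unif_continuous cb (@segment_compact _ s t) (divr_gt0 eps0 K1).
  have [n0 Hn] := grid_mesh st (divr_gt0 h0 (ltr0n _ 2)).
  exists n0 => // n /= /Hn hn; rewrite sub0r normrN.
  have [->|[u [v [su /andP[uv vt] vuh [r /andP[ur rv] br] le]]]] := lossE w n Zw.
    by rewrite normr0 ltW.
  apply: (le_trans le).
  have := bh r v; rewrite br mulr0 sin0 sub0r normrN.
  rewrite /= in_itv/= (le_trans su ur) (le_trans rv vt) => /(_ isT) H.
  have {}H : `|sin (l * b v w)| < eps / (expR (c * t) * K + 1).
    apply: H; rewrite distrC ger0_norm ?subr_ge0//.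
    apply: (@le_lt_trans _ _ (v - u)); first by rewrite lerD2l lerN2.
    apply: (le_lt_trans vuh); apply: (le_lt_trans hn).
    by rewrite ltr_pdivrMr// ltr_pMr// ltr1n.
  apply: (@le_trans _ _ (expR (c * t) * K * (eps / (expR (c * t) * K + 1)))).
    by rewrite ler_wpM2l// ltW.
  by rewrite mulrCA ler_piMr ?(ltW eps0)// ler_pdivrMr// mul1r lerDl.
have Eloss : (fun n => Ex P (loss n)) @ \oo --> Ex P (fun=> 0).
  have [] // := @Ex_dct _ _ _ P loss (fun=> 0) (fun=> expR (c * t) * K) _ _ loss0.
  - move=> n; apply: (@measurable_sum _ _ _ _ _ _ (fun k w => _)) => k.
    by apply: (test_measurable (@FT t)); apply: tloss; rewrite -ltnS.
  - exact: L1_cst.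
  - apply: filterS ZB => w /= Zw n.
    have [->|[u [v [_ _ _ _ le]]]] := lossE w n Zw; first by rewrite normr0.
    apply: (le_trans le); rewrite ler_piMr//.
    by rewrite ler_norml sin_geN1 sin_le1.
have : (fun n => Ex P (loss n)) = fun=> g s - g t.
  by apply/funext => n; rewrite (gloss n); ring.
rewrite Ex_cst in Eloss => EE; rewrite EE in Eloss.
have E0 : g s - g t = 0.
  exact: (@cvg_unique _ (@Rhausdorff R) _ _ _ _ (@cvg_cst _ (g s - g t) _ \oo _) Eloss).
by apply/eqP; rewrite eq_sym -subr_eq0 E0.
Qed.

End stopped_martingale.

(** * Pairs of coalescing coordinates *)

Section coalescing.
Context {d : measure_display} {T : measurableType d} {R : realType}.
Variable P : probability T R.
Variables (m : nat) (X : time R -> T -> 'rV[R]_m).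
Hypothesis mX : forall t i, measurable_fun setT (fun w => X t w ord0 i).
Variables (rho : R) (b : 'rV[R]_m).

Let FT := past_measurable mX.
Let Fmono := @past_mono _ _ _ _ X.

Local Notation x u i := (fun w => X (to_time u) w ord0 i).

(** The common core of the two descriptions of coalescing Brownian motions:
    Gaussian conditional moments for every coordinate, and a sine martingale
    for every distance, which is where the absorption at the origin enters. *)
Record coalescing : Prop := Coalescing {
  co_init : {ae P, forall w, X (to_time 0) w = b};
  co_moments : forall i, gaussian_moments P (past X) rho (fun u => x u i);
  co_sin : forall i j l s t (Y : T -> R), i != j -> 0 <= s -> s <= t ->
    test (past X s) Y ->
    Ex P (fun w => Y w * sin (l * `|x t i w - x t j w|)) =
    expR (- (rho * l ^+ 2 * (t - s))) *
    Ex P (fun w => Y w * sin (l * `|x s i w - x s j w|)) }.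

Hypothesis rho0 : 0 < rho.
Hypothesis coX : coalescing.

Lemma sin_scale_continuous (l : R) : continuous (fun z : R => sin (l * z)).
Proof.
by move=> z; apply: continuous_comp; [exact: mulrl_continuous|exact: continuous_sin].
Qed.

Lemma diff_coord_measurable u i j :
  measurable_fun setT
    ((fun w => x u j w - x u i w) : g_sigma_algebraType (past X u) -> R).
Proof. by apply: measurable_funB; exact: past_coord. Qed.

Lemma co_displacement u i : 0 <= u ->
  L1 P (fun w => (x u i w - b ord0 i) ^+ 2) /\
  Ex P (fun w => (x u i w - b ord0 i) ^+ 2) = rho * u.
Proof.
move=> u0; have g := co_moments coX i.
have L := gm_incr_sqr_L1 FT g (lexx 0) u0.
have ae : {ae P, forall w, (x u i w - b ord0 i) ^+ 2 = (x u i w - x 0 i w) ^+ 2}.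
  by apply: filterS (co_init coX) => w /= ->.
have m1 : measurable_fun setT (fun w => (x u i w - b ord0 i) ^+ 2).
  by apply: measurable_funX; apply: measurable_funB => //; exact: mX.
split; first exact: L1_ae ae.
rewrite (Ex_ae m1 (L1_measurable L) ae) (gm_var0 g (lexx 0) u0).
by rewrite subr0.
Qed.

(** As [l] tends to [0] the sine martingale bounds the mean distance at time
    [t] by the initial distance, which is the mean of the difference; so the
    distance and the difference coincide almost surely. *)
Lemma co_order t i j : 0 <= t -> b ord0 i <= b ord0 j ->
  {ae P, forall w, x t i w <= x t j w}.
Proof.
move=> t0 bij; have [<-|ij] := eqVneq i j.
  by apply: aeW => w; exact: lexx.
have gi := co_moments coX i; have gj := co_moments coX j.
pose be := b ord0 j - b ord0 i.
have be0 : 0 <= be by rewrite subr_ge0.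
pose di w := x t i w - x 0 i w; pose dj w := x t j w - x 0 j w.
have idi : L1 P di := gm_incr_id_L1 FT gi (lexx 0) t0.
have idj : L1 P dj := gm_incr_id_L1 FT gj (lexx 0) t0.
pose D w := dj w - di w + be.
have iD : L1 P D by apply: L1D; [exact: L1B|exact: L1_cst].
have aeD : {ae P, forall w, x t j w - x t i w = D w}.
  by apply: filterS (co_init coX) => w /= e; rewrite /D /dj /di /be e; ring.
have ED : Ex P D = be.
  have ti := gm_mean gi (lexx 0) t0 (test_cst (past X 0) 1).
  have tj := gm_mean gj (lexx 0) t0 (test_cst (past X 0) 1).
  have e1 z : Ex P (fun w => 1 * z w) = Ex P z.
    by congr Ex; apply/funext => w; rewrite mul1r.
  rewrite !e1 in ti tj.
  by rewrite /D (ExD (L1B idj idi) (L1_cst P be)) (ExB idj idi) ti tj Ex_cst subrr add0r.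
have mD := L1_measurable iD.
have iD3 : L1 P (fun w => `|D w| ^+ 3).
  apply: (@L1_le _ _ _ P _ (fun w => 27 * (`|dj w| ^+ 3 + `|di w| ^+ 3 + be ^+ 3))).
  - by apply: measurable_funX; exact: measurableT_comp.
  - move=> w; rewrite ger0_norm ?exprn_ge0//.
    set M := Num.max `|dj w| (Num.max `|di w| be).
    have M1 : `|dj w| <= M by rewrite le_max lexx.
    have M2 : `|di w| <= M by rewrite /M !le_max lexx orbT.
    have M3 : be <= M by rewrite /M !le_max lexx !orbT.
    have M0 : 0 <= M by apply: le_trans M1.
    apply: (@le_trans _ _ ((3 * M) ^+ 3)).
      rewrite lerXn2r ?nnegrE ?mulr_ge0// /D.
      rewrite (le_trans (ler_normD _ _))// (le_trans (lerD (ler_normB _ _) (lexx _)))//.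
      by rewrite (ger0_norm be0); lra.
    rewrite exprMn (_ : 3 ^+ 3 = 27); last by rewrite -natrX.
    rewrite ler_wpM2l// {1}/M; have d3 : 0 <= `|dj w| ^+ 3 by rewrite exprn_ge0.
    have i3 : 0 <= `|di w| ^+ 3 by rewrite exprn_ge0.
    have b3 : 0 <= be ^+ 3 by rewrite exprn_ge0.
    by rewrite maxEle; case: ifP => _; rewrite ?maxEle; try case: ifP => _; lra.
  - apply/L1Z/L1D; last exact: L1_cst.
    by apply: L1D; [exact: (gm_incr_pow_L1 FT gj (_ : (3 <= 4)%N) (lexx 0) t0)|exact: (gm_incr_pow_L1 FT gi (_ : (3 <= 4)%N) (lexx 0) t0)].
have iaD : L1 P (fun w => `|D w|) by exact: L1_norm.
have le_sin l : 0 < l -> l <= 1 -> Ex P (fun w => `|D w|) <= be + l ^+ 2 * Ex P (fun w => `|D w| ^+ 3).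
  move=> l0 l1; have := co_sin coX l ij (lexx 0) t0 (test_cst (past X 0) 1).
  have msin u : measurable_fun setT (fun w => 1 * sin (l * `|x u i w - x u j w|)).
    apply: measurable_funM => //; apply: (measurableT_comp (f := fun z => sin (l * z))).
      by apply: continuous_measurable_fun; exact: sin_scale_continuous.
    by apply: measurableT_comp => //; apply: measurable_funB; exact: mX.
  have msD : measurable_fun setT (fun w => sin (l * `|D w|)).
    apply: (measurableT_comp (f := fun z => sin (l * z))).
      by apply: continuous_measurable_fun; exact: sin_scale_continuous.
    exact: measurableT_comp.
  rewrite (@Ex_ae _ _ _ P _ (fun w => sin (l * `|D w|)) (msin t) msD); last first.
    by apply: filterS aeD => w /= <-; rewrite mul1r distrC.
  rewrite (@Ex_ae _ _ _ P _ (fun=> sin (l * be)) (msin 0))//; last first.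
    apply: filterS (co_init coX) => w /= ->; rewrite mul1r distrC.
    by rewrite -/be ger0_norm.
  rewrite Ex_cst => E.
  have isD : L1 P (fun w => sin (l * `|D w|)).
    by apply: (L1_bounded _ msD (K := 1)) => w; rewrite ler_norml sin_geN1 sin_le1.
  have H : Ex P (fun w => l * `|D w|) <=
      Ex P (fun w => sin (l * `|D w|) + l ^+ 3 * `|D w| ^+ 3).
    apply: Ex_le; [exact: L1Z|by apply: L1D => //; exact: L1Z|move=> w].
    have z0 : 0 <= l * `|D w| by rewrite mulr_ge0// ltW.
    have := sin_ge_taylor3 z0; rewrite -exprMn.
    have : 0 <= (l * `|D w|) ^+ 3 by rewrite exprn_ge0.
    lra.
  rewrite ExZ// ExD// ?ExZ// in H; last exact: L1Z.
  rewrite -(ler_pM2l l0); apply: (le_trans H).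
  rewrite [leRHS](_ : _ = l * be + l ^+ 3 * Ex P (fun w => `|D w| ^+ 3)); last by ring.
  rewrite lerD2r E; have lb : 0 <= l * be by rewrite mulr_ge0// ltW.
  apply: (@le_trans _ _ (expR (- (rho * l ^+ 2 * (t - 0))) * (l * be))).
    by rewrite ler_wpM2l ?expR_ge0// sin_le_id.
  rewrite -[leRHS]mul1r ler_wpM2r// -[leRHS]expR0 ler_expR oppr_le0.
  by rewrite !mulr_ge0 ?sqr_ge0 ?subr0// ltW.
have EaD : Ex P (fun w => `|D w|) <= be.
  apply/ler_addgt0Pr => e e0.
  set C := Ex P (fun w => `|D w| ^+ 3) in le_sin.
  have C0 : 0 <= C by apply: Ex_ge0 => w; rewrite exprn_ge0.
  have C1 : 0 < C + 1 by rewrite ltr_wpDl.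
  have l0 : 0 < Num.min 1 (e / (C + 1)) by rewrite lt_min ltr01 divr_gt0.
  have l1 : Num.min 1 (e / (C + 1)) <= 1 by rewrite ge_min lexx.
  apply: (le_trans (le_sin _ l0 l1)); rewrite lerD2l.
  apply: (@le_trans _ _ (e / (C + 1) * C)).
    rewrite ler_wpM2r// expr2 -[leRHS]mul1r ler_pM// ?(ltW l0)//.
    by rewrite ge_min lexx orbT.
  by rewrite mulrAC ler_pdivrMr// ler_pM2l// lerDl.
have : {ae P, forall w, `|D w| - D w = 0}.
  apply: Ex_eq0_ae; first exact: L1B.
    by move=> w; rewrite subr_ge0 ler_norm.
  apply/eqP; rewrite eq_le; apply/andP; split.
    by rewrite ExB// ED subr_le0.
  by apply: Ex_ge0 => w; rewrite subr_ge0 ler_norm.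
move=> aeN.
apply: filterS2 aeD aeN => w /= e1 e2.
rewrite -subr_ge0 e1; have := normr_ge0 (D w); lra.
Qed.

Lemma co_diff_mean s t i j (Y : T -> R) : 0 <= s -> s <= t -> test (past X s) Y ->
  Ex P (fun w => Y w * ((x t j w - x t i w) - (x s j w - x s i w))) = 0.
Proof.
move=> s0 st tY.
have ei := gm_mean (co_moments coX i) s0 st tY.
have ej := gm_mean (co_moments coX j) s0 st tY.
have ii := test_L1 (@FT s) tY (gm_incr_id_L1 FT (co_moments coX i) s0 st).
have ij := test_L1 (@FT s) tY (gm_incr_id_L1 FT (co_moments coX j) s0 st).
transitivity (Ex P (fun w => Y w * (x t j w - x s j w) - Y w * (x t i w - x s i w))).
  by congr Ex; apply/funext => w; ring.
by rewrite ExB// ei ej subrr.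
Qed.

(** Away from each other two coordinates are nearly uncorrelated over short
    times: the Taylor expansion of the sine martingale of their distance gives
    the variance of the difference, and polarization the covariance. *)
Lemma co_cross i j l e : i != j -> b ord0 i <= b ord0 j -> 0 < l -> 0 < e ->
  exists2 h, 0 < h & forall s t (Y : T -> R) K, 0 <= s -> s <= t -> t - s <= h ->
    test (past X s) Y -> 0 <= K -> (forall w, `|Y w| <= K) ->
    `|Ex P (fun w => Y w * sin (l * (x s j w - x s i w)) *
       ((x t i w - x s i w) * (x t j w - x s j w)))| <= K * e * (t - s).
Proof.
move=> ij bij l0 e0.
have gi := co_moments coX i; have gj := co_moments coX j.
pose ra := l ^- 2 * (l ^+ 3 * 8); pose rb := l ^- 2 * (l ^+ 4 * 16).
have ra0 : 0 <= ra by rewrite !mulr_ge0 ?invr_ge0 ?exprn_ge0// ltW.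
have rb0 : 0 <= rb by rewrite !mulr_ge0 ?invr_ge0 ?exprn_ge0// ltW.
have e30 : 0 < e / 3 by rewrite divr_gt0.
have [hi hi0 Hi] := gm_cube_fourth FT gi ra0 rb0 e30.
have [hj hj0 Hj] := gm_cube_fourth FT gj ra0 rb0 e30.
pose B := rho ^+ 2 * l ^+ 2.
have B0 : 0 < B by rewrite mulr_gt0// exprn_gt0.
exists (Num.min (e / 3 / B) (Num.min hi hj)).
  by rewrite !lt_min hi0 hj0 !divr_gt0.
move=> s t Y K s0 st; rewrite !le_min => /and3P[hB thi thj] tY K0 YK.
pose h := t - s.
have h0 : 0 <= h by rewrite subr_ge0.
have t0 : 0 <= t by exact: le_trans st.
pose di w := x t i w - x s i w; pose dj w := x t j w - x s j w.
pose D u w := x u j w - x u i w.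
pose S w := sin (l * D s w).
have tS : test (past X s) S.
  apply: (@test_comp _ _ _ (past X s) (fun z => sin (l * z)) (D s) 1).
  - by apply: continuous_measurable_fun; exact: sin_scale_continuous.
  - by move=> z; rewrite ler_norml sin_geN1 sin_le1.
  - exact: diff_coord_measurable.
have tC : test (past X s) (fun w => cos (l * D s w)).
  apply: (@test_comp _ _ _ (past X s) (fun z => cos (l * z)) (D s) 1).
  - by apply: continuous_measurable_fun => z; apply: continuous_comp;
      [exact: mulrl_continuous|exact: continuous_cos].
  - by move=> z; rewrite ler_norml cos_geN1 cos_le1.
  - exact: diff_coord_measurable.
have tYS := testM tY tS; have tYC := testM tY tC.
have mD u : measurable_fun setT (D u) by apply: measurable_funB; exact: mX.
have msD u : measurable_fun setT (fun w => sin (l * D u w)).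
  apply: (measurableT_comp (f := fun z => sin (l * z))) => //.
  by apply: continuous_measurable_fun; exact: sin_scale_continuous.
have mY := test_measurable (@FT s) tY.
have iYs u : L1 P (fun w => Y w * sin (l * D u w)).
  apply: (@L1_bounded _ _ _ P _ K); first exact: measurable_funM.
  move=> w; rewrite normrM -[leRHS]mulr1 ler_pM//.
  by rewrite ler_norml sin_geN1 sin_le1.
have Esin u : 0 <= u ->
    Ex P (fun w => Y w * sin (l * `|x u i w - x u j w|)) = Ex P (fun w => Y w * sin (l * D u w)).
  move=> u0; apply: Ex_ae; [|exact: L1_measurable (iYs u)|].
  - apply: measurable_funM => //; apply: (measurableT_comp (f := fun z => sin (l * z))).
      by apply: continuous_measurable_fun; exact: sin_scale_continuous.
    by apply: measurableT_comp => //; apply: measurable_funB; exact: mX.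
  - apply: filterS (co_order u0 bij) => w /= le.
    by rewrite distrC ger0_norm ?subr_ge0.
have := co_sin coX l ij s0 st tY; rewrite !Esin// => E1.
have i2i := test_L1 (@FT s) tYS (gm_incr_sqr_L1 FT gi s0 st).
have i2j := test_L1 (@FT s) tYS (gm_incr_sqr_L1 FT gj s0 st).
have v2i := gm_var gi s0 st tYS; have v2j := gm_var gj s0 st tYS.
have E2 := co_diff_mean i j s0 st tYC.
have iidi := gm_incr_id_L1 FT gi s0 st; have iidj := gm_incr_id_L1 FT gj s0 st.
have mdi : measurable_fun setT di := L1_measurable iidi.
have mdj : measurable_fun setT dj := L1_measurable iidj.
have iC : L1 P (fun w => Y w * cos (l * D s w) * (D t w - D s w)).
  have := test_L1 (@FT s) tYC (L1B iidj iidi).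
  by congr L1; apply/funext => w; rewrite /D; ring.
pose r w := sin (l * D t w) - sin (l * D s w) - l * (D t w - D s w) * cos (l * D s w) +
   (l * (D t w - D s w)) ^+ 2 / 2 * sin (l * D s w).
have rle w : `|r w| <= l ^+ 3 * 8 * (`|di w| ^+ 3 + `|dj w| ^+ 3) +
    l ^+ 4 * 16 * (di w ^+ 4 + dj w ^+ 4).
  have := abs_sin_taylor (l * D s w) (l * (D t w - D s w)).
  rewrite (_ : l * D s w + l * (D t w - D s w) = l * D t w); last by ring.
  move=> /le_trans; apply; rewrite normrM (gtr0_norm l0) !exprMn.
  have -> : D t w - D s w = dj w - di w by rewrite /D /dj /di; ring.
  set M := Num.max `|dj w| `|di w|.
  have M1 : `|dj w| <= M by rewrite le_max lexx.
  have M2 : `|di w| <= M by rewrite /M le_max lexx orbT.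
  have M0 : 0 <= M by apply: le_trans M1.
  have d2M : `|dj w - di w| <= 2 * M by rewrite (le_trans (ler_normB _ _))//; lra.
  have p k : M ^+ k <= `|di w| ^+ k + `|dj w| ^+ k.
    by rewrite /M maxEle; case: ifP => _; rewrite ?lerDl ?lerDr exprn_ge0.
  have q4 (z : R) : z ^+ 4 = `|z| ^+ 4 by rewrite -normrX ger0_norm// exprn_even_ge0.
  have pow2 k : `|dj w - di w| ^+ k <= 2 ^+ k * (`|di w| ^+ k + `|dj w| ^+ k).
    apply: (@le_trans _ _ ((2 * M) ^+ k)).
      by apply: lerXn2r; rewrite ?nnegrE ?mulr_ge0.
    by rewrite exprMn ler_wpM2l// p.
  apply: lerD; rewrite -[leRHS]mulrA ler_wpM2l ?exprn_ge0 ?(ltW l0)//.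
    by apply: (le_trans (pow2 3%N)); rewrite (_ : 2 ^+ 3 = 8)// -natrX.
  rewrite (q4 (dj w - di w)) (q4 (di w)) (q4 (dj w)).
  by apply: (le_trans (pow2 4%N)); rewrite (_ : 2 ^+ 4 = 16)// -natrX.
have i3i := @gm_incr_pow_L1 _ _ _ _ _ FT _ _ gi 3 s t isT s0 st.
have i3j := @gm_incr_pow_L1 _ _ _ _ _ FT _ _ gj 3 s t isT s0 st.
have i4i := gm_incr_fourth_L1 gi s0 st; have i4j := gm_incr_fourth_L1 gj s0 st.
have mr : measurable_fun setT r.
  apply: measurable_funD.
    apply: measurable_funB; first exact: measurable_funB.
    apply: measurable_funM; last exact: (test_measurable (@FT s) tC).
    by apply: measurable_funM => //; exact: measurable_funB.
  apply: measurable_funM => //; apply: measurable_funM => //.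
  by apply: measurable_funX; apply: measurable_funM => //; exact: measurable_funB.
have ir : L1 P r.
  by apply: (L1_le mr rle); apply: L1D; apply: L1Z; exact: L1D.
have iYr : L1 P (fun w => Y w * r w) := test_L1 (@FT s) tY ir.
have iA : L1 P (fun w => ra * `|di w| ^+ 3 + rb * di w ^+ 4).
  by apply: L1D; exact: L1Z.
have iB : L1 P (fun w => ra * `|dj w| ^+ 3 + rb * dj w ^+ 4).
  by apply: L1D; exact: L1Z.
have EYr : `|Ex P (fun w => Y w * r w)| <= K * (l ^+ 2 * (e / 3 * h + e / 3 * h)).
  apply: (@le_trans _ _ (Ex P (fun w => K * (l ^+ 2 *
      ((ra * `|di w| ^+ 3 + rb * di w ^+ 4) + (ra * `|dj w| ^+ 3 + rb * dj w ^+ 4)))))).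
    apply: Ex_abs_le => //; first by do !apply: L1Z; apply: L1D; apply: L1D; exact: L1Z.
    move=> w; rewrite normrM ler_pM//; apply: (le_trans (rle w)).
    rewrite le_eqVlt; apply/orP; left; apply/eqP; rewrite /ra /rb; field.
    exact: lt0r_neq0.
  rewrite (ExZ _ (L1Z _ (L1D iA iB))) (ExZ _ (L1D iA iB)) (ExD iA iB).
  rewrite ler_wpM2l// ler_wpM2l ?exprn_ge0 ?(ltW l0)// lerD//.
    exact: (Hi _ _ s0 st thi).
  exact: (Hj _ _ s0 st thj).
(* 2 di dj = di ^ 2 + dj ^ 2 - (dj - di) ^ 2, where the last square appears in
   the expansion of the sine *)
have E3 : Ex P (fun w => Y w * S w * (di w * dj w)) =
   (l ^- 2 * (expR (- (rho * l ^+ 2 * h)) - 1 + rho * l ^+ 2 * h)) *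
     Ex P (fun w => Y w * sin (l * D s w)) - l ^- 2 * Ex P (fun w => Y w * r w).
  have -> : Ex P (fun w => Y w * r w) = Ex P (fun w => Y w * sin (l * D t w)) -
       Ex P (fun w => Y w * sin (l * D s w)) +
       l ^+ 2 / 2 * Ex P (fun w => Y w * S w * (dj w - di w) ^+ 2).
    have iS2 : L1 P (fun w => Y w * S w * (dj w - di w) ^+ 2).
      apply: (test_L1 (@FT s) tYS).
      apply: (@L1_le _ _ _ P _ (fun w => 2 * (dj w ^+ 2 + di w ^+ 2))).
      - by apply: measurable_funX; exact: measurable_funB.
      - move=> w; rewrite ger0_norm ?sqr_ge0// sqrrB.
        by have := sqr_ge0 (dj w + di w); rewrite sqrrD; lra.
      - by apply/L1Z/L1D; [exact: (gm_incr_sqr_L1 FT gj s0 st)|exact: (gm_incr_sqr_L1 FT gi s0 st)].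
    transitivity (Ex P (fun w => (Y w * sin (l * D t w) - Y w * sin (l * D s w)) -
       l * (Y w * cos (l * D s w) * (D t w - D s w)) +
       l ^+ 2 / 2 * (Y w * S w * (dj w - di w) ^+ 2))).
      by congr Ex; apply/funext => w; rewrite /r /S /D /dj /di; field.
    rewrite ExD ?ExB ?ExZ//; try (do ?apply: L1B => //; exact: L1Z).
    by rewrite /D E2 mulr0 subr0.
  have -> : Ex P (fun w => Y w * S w * (dj w - di w) ^+ 2) =
     2 * (rho * h * Ex P (fun w => Y w * S w)) - 2 * Ex P (fun w => Y w * S w * (di w * dj w)).
    have iP : L1 P (fun w => Y w * S w * (di w * dj w)).
      apply: (test_L1 (@FT s) tYS).
      apply: (@L1_le _ _ _ P _ (fun w => dj w ^+ 2 + di w ^+ 2)).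
      - exact: measurable_funM.
      - move=> w; rewrite normrM -(real_normK (num_real (dj w))) -(real_normK (num_real (di w))).
        have := sqr_ge0 (`|dj w| - `|di w|); rewrite sqrrB.
        by have := sqr_ge0 `|dj w|; have := sqr_ge0 `|di w|; lra.
      - by apply/L1D; [exact: (gm_incr_sqr_L1 FT gj s0 st)|exact: (gm_incr_sqr_L1 FT gi s0 st)].
    transitivity (Ex P (fun w => (Y w * S w * (di w) ^+ 2 + Y w * S w * (dj w) ^+ 2) -
        2 * (Y w * S w * (di w * dj w)))).
      by congr Ex; apply/funext => w; ring.
    rewrite ExB ?ExD ?ExZ//; [|exact: L1D|exact: L1Z].
    by rewrite v2i v2j -/h; ring.
  rewrite E1 -/h /S; field; exact: lt0r_neq0.
rewrite E3; apply: (le_trans (ler_normB _ _)).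
have l20 : 0 < l ^+ 2 by rewrite exprn_gt0.
have lV0 : 0 <= l ^- 2 by rewrite invr_ge0 ltW.
have z0 : 0 <= rho * l ^+ 2 * h by rewrite !mulr_ge0 ?sqr_ge0// ltW.
have EYs : `|Ex P (fun w => Y w * sin (l * D s w))| <= K.
  apply: Ex_abs_cst; first exact: L1_measurable (iYs s).
  move=> w; rewrite normrM -[leRHS]mulr1 ler_pM//.
  by rewrite ler_norml sin_geN1 sin_le1.
have A1 : `|l ^- 2 * (expR (- (rho * l ^+ 2 * h)) - 1 + rho * l ^+ 2 * h) *
     Ex P (fun w => Y w * sin (l * D s w))| <= K * (e / 3 * h).
  rewrite mulrC normrM ler_pM// normrM ger0_norm//.
  apply: (@le_trans _ _ (l ^- 2 * (rho * l ^+ 2 * h) ^+ 2)).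
    by rewrite ler_wpM2l// expRN_taylor.
  rewrite (_ : _ * _ ^+ 2 = B * h * h); last first.
    by rewrite /B; field; exact: lt0r_neq0.
  by rewrite ler_wpM2r// mulrC -ler_pdivlMr.
have A2 : `|l ^- 2 * Ex P (fun w => Y w * r w)| <= K * (e / 3 * h + e / 3 * h).
  rewrite normrM (ger0_norm lV0) -ler_pdivlMl ?invr_gt0// invrK.
  by apply: (le_trans EYr); rewrite mulrCA.
apply: (le_trans (lerD A1 A2)).
by rewrite le_eqVlt; apply/orP; left; apply/eqP; rewrite -/h; field.
Qed.

End coalescing.

(** * Topology of row vectors *)

Section row_vectors.
Context {R : realType}.
Variable m : nat.
Implicit Types x y : 'rV[R]_m.

Lemma ball_rV x y e : 0 < e ->
  ball x e y <-> forall i, `|x ord0 i - y ord0 i| < e.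
Proof.
move=> e0; split=> [[_ xy] i|xy]; first exact: xy.
by split=> // i j; rewrite (ord1 i); exact: xy.
Qed.

Lemma norm_rV_lt x y e : 0 < e ->
  `|x - y| < e <-> forall i, `|x ord0 i - y ord0 i| < e.
Proof. by move=> e0; rewrite -(ball_rV _ _ e0) -ball_normE. Qed.

Lemma nbhs_rVP x (A : set 'rV[R]_m) : nbhs x A <-> exists2 e, 0 < e &
  forall y, (forall i, `|x ord0 i - y ord0 i| < e) -> A y.
Proof.
split.
  move=> /nbhs_ballP[e /= e0 xA]; exists e => // y xy; apply: xA.
  exact/(ball_rV _ _ e0).
move=> [e e0 H]; apply/nbhs_ballP; exists e => //= y /(ball_rV _ _ e0).
exact: H.
Qed.

Lemma compact_box (N : R) : compact [set x : 'rV[R]_m | forall i, `|x ord0 i| <= N].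
Proof.
have := @rV_compact R m (fun=> `[- N, N]%classic) (fun=> @segment_compact _ _ _).
congr compact; apply/seteqP; split => x /= H i; have := H i;
  by rewrite /= in_itv/= ler_norml.
Qed.

Lemma box_unif_continuous (f : 'rV[R]_m -> R) N : continuous f ->
  forall e, 0 < e -> exists2 h, 0 < h & forall x y,
    (forall i, `|x ord0 i| <= N) -> (forall i, `|y ord0 i - x ord0 i| <= h) ->
    `|f y - f x| <= e.
Proof.
move=> cf e e0.
have [h h0 H] := compact_unif_continuous cf (@compact_box N) e0.
exists (h / 2); first by rewrite divr_gt0.
move=> x y xN xy; rewrite distrC ltW//; apply: H => //.
apply/norm_rV_lt => // i; rewrite distrC (le_lt_trans (xy i))//.
by rewrite ltr_pdivrMr// ltr_pMr// ltr1n.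
Qed.

Lemma rat_approx (z : R) e : 0 < e -> exists q : rat, `|z - ratr q| < e.
Proof.
move=> e0; have [q] : exists q : rat, z - e < ratr q < z + e.
  have ze : z - e < z + e by lra.
  by have [q] := rat_in_itvoo ze; rewrite in_itv/= => ?; exists q.
by move=> /andP[a b]; exists q; rewrite ltr_norml; apply/andP; split; lra.
Qed.

Context {d : measure_display} {T : measurableType d}.

(** Rational boxes form a countable base, so coordinatewise measurability is
    Borel measurability. *)
Lemma open_rV_measurable (V : T -> 'rV[R]_m) (U : set 'rV[R]_m) :
  (forall i, measurable_fun setT (fun w => V w ord0 i)) -> open U ->
  measurable (V @^-1` U).
Proof.
move=> mV oU.
pose box (qk : 'rV[rat]_m * nat) : set 'rV[R]_m :=
  [set y | forall i, `|ratr (qk.1 ord0 i) - y ord0 i| < qk.2.+1%:R^-1].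
pose J qk := box qk `<=` U.
have -> : V @^-1` U = \bigcup_(qk : 'rV[rat]_m * nat)
    (if `[< J qk >] then V @^-1` box qk else set0).
  apply/seteqP; split => [w /= Uw|w [qk _]]; last first.
    by case: asboolP => // JJ /= ?; exact: JJ.
  move: oU; rewrite openE => /(_ _ Uw)/nbhs_rVP[e e0 HU].
  pose k := Num.truncn (2 / e).
  have ke : k.+1%:R^-1 < e / 2.
    rewrite invf_plt ?posrE ?divr_gt0// invf_div; exact: truncnS_gt.
  have k0 : 0 < (k.+1%:R : R)^-1 by rewrite invr_gt0.
  have /choice[q Hq] : forall i : 'I_m, exists q : rat,
      `|V w ord0 i - ratr q| < k.+1%:R^-1.
    by move=> i; exact: rat_approx.
  exists (\row_i q i, k) => //.
  rewrite ifT; last first.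
    apply/asboolP => y /= by_; apply: HU => i.
    rewrite -(subrK (ratr (q i)) (V w ord0 i)) -addrA.
    have := by_ i; rewrite mxE => H1; have H2 := Hq i.
    apply: (le_lt_trans (ler_normD _ _)); rewrite (splitr e) ltrD//.
      exact: lt_trans ke.
    exact: lt_trans ke.
  by move=> i /=; rewrite mxE distrC; exact: Hq.
apply: countable_bigcupT_measurable; first exact: countableP.
move=> qk; case: asboolP => // _.
rewrite (_ : _ @^-1` _ = \bigcap_(i in [set: 'I_m])
    [set w | `|ratr (qk.1 ord0 i) - V w ord0 i| < qk.2.+1%:R^-1]); last first.
  by apply/seteqP; split => w /= H i; [move=> _|]; exact: H.
apply: fin_bigcap_measurable => // i _.
rewrite -[X in measurable X]setTI.
have mf : measurable_fun setT (fun w => `|ratr (qk.1 ord0 i) - V w ord0 i|).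
  by apply: measurableT_comp => //; apply: measurable_funB.
rewrite (_ : [set _ | _] = (fun w => `|ratr (qk.1 ord0 i) - V w ord0 i|) @^-1` `]-oo, qk.2.+1%:R^-1[).
  exact: mf.
by apply/seteqP; split => w /=; rewrite in_itv.
Qed.

Lemma continuous_rV_measurable (V : T -> 'rV[R]_m) (f : 'rV[R]_m -> R) :
  (forall i, measurable_fun setT (fun w => V w ord0 i)) -> continuous f ->
  measurable_fun setT (fun w => f (V w)).
Proof.
move=> mV /continuousP cf; apply: (measurability _ (RGenOpens.measurableE R)).
move=> _ [_ [a [b ->] <-]]; rewrite setTI.
by apply: (@open_rV_measurable V (f @^-1` `]a, b[%classic)) => //; exact: cf.
Qed.

End row_vectors.

(** * Ito's formula without boundary terms *)

Section thresholds.
Context {R : realType}.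

Lemma common_threshold (J : finType) (Q : J -> R -> Prop) :
  (forall j, exists2 h, 0 < h & Q j h) ->
  (forall j h h', h' <= h -> Q j h -> Q j h') ->
  exists2 h, 0 < h & forall j, Q j h.
Proof.
move=> ex mono; have /choice[h hQ] : forall j, exists h, 0 < h /\ Q j h.
  by move=> j; have [h h0 Qh] := ex j; exists h.
(* the inverse of [\sum_j (h j)^-1 + 1] lies below every [h j], also when there
   is none *)
have S0 : 0 <= \sum_j (h j)^-1.
  by apply: sumr_ge0 => j _; rewrite invr_ge0 ltW//; have [] := hQ j.
exists (\sum_j (h j)^-1 + 1)^-1; first by rewrite invr_gt0 ltr_wpDl.
move=> j; have [hj Qj] := hQ j; apply: mono Qj.
rewrite -[leRHS]invrK lef_pV2 ?posrE ?invr_gt0// ?ltr_wpDl//.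
rewrite (bigD1 j)//= -addrA lerDl addr_ge0//.
by apply: sumr_ge0 => k _; rewrite invr_ge0 ltW//; have [] := hQ k.
Qed.

End thresholds.

Section jets.
Context {R : realType}.
Variables (m : nat) (C : set 'rV[R]_m).
Variables (f : 'rV[R]_m -> R) (g : 'I_m -> 'rV[R]_m -> R)
  (H : 'I_m -> 'I_m -> 'rV[R]_m -> R).
Implicit Types x y : 'rV[R]_m.

Definition sqdist x y := \sum_i (y ord0 i - x ord0 i) ^+ 2.

Definition jet_rem x y := f y - f x -
  \sum_i g i x * (y ord0 i - x ord0 i) -
  2^-1 * \sum_i \sum_j H i j x *
    ((y ord0 i - x ord0 i) * (y ord0 j - x ord0 j)).

(** Second order Taylor expansions on [C] whose mixed coefficients fade out
    where two coordinates meet. *)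
Record jets (M : R) : Prop := Jets {
  jf_cont : continuous f;
  jg_cont : forall i, continuous (g i);
  jH_cont : forall i j, continuous (H i j);
  jf_le : forall x, `|f x| <= M;
  jg_le : forall i x, `|g i x| <= M;
  jH_le : forall i j x, `|H i j x| <= M;
  jrem_le : forall x y, C x -> C y -> `|jet_rem x y| <= M * sqdist x y;
  jrem_small : forall N e, 0 < e -> exists2 h, 0 < h & forall x y,
    C x -> C y -> (forall i, `|x ord0 i| <= N) ->
    (forall i, `|y ord0 i - x ord0 i| <= h) -> `|jet_rem x y| <= e * sqdist x y;
  jdiag : forall N e, 0 < e -> exists2 h, 0 < h & forall x i j,
    i != j -> C x -> (forall i, `|x ord0 i| <= N) ->
    `|x ord0 i - x ord0 j| <= h -> `|H i j x| <= e }.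

End jets.

(** The states reachable from [b]: order is kept, and coordinates that start
    together stay together. *)
Definition cone (R : realType) (m : nat) (b : 'rV[R]_m) : set 'rV[R]_m :=
  [set x | forall i j, b ord0 i <= b ord0 j -> x ord0 i <= x ord0 j].

Section local_ito.
Context {d : measure_display} {T : measurableType d} {R : realType}.
Variable P : probability T R.
Variables (m : nat) (X : time R -> T -> 'rV[R]_m).
Hypothesis mX : forall t i, measurable_fun setT (fun w => X t w ord0 i).
Variables (rho : R) (b : 'rV[R]_m).
Hypothesis rho0 : 0 < rho.
Hypothesis coX : coalescing P X rho b.

Let FT := past_measurable mX.
Local Notation x u i := (fun w => X (to_time u) w ord0 i).

Lemma co_cone t : 0 <= t -> {ae P, forall w, cone b (X (to_time t) w)}.
Proof.
move=> t0; pose Q (p : 'I_m * 'I_m) w := b ord0 p.1 <= b ord0 p.2 -> x t p.1 w <= x t p.2 w.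
have : {ae P, forall w, forall p, Q p w}.
  apply: filter_forall => p.
  have [bp|nbp] := boolP (b ord0 p.1 <= b ord0 p.2).
    by apply: filterS (co_order mX rho0 coX t0 bp) => w /= ? _.
  by apply: aeW => w; rewrite /Q (negbTE nbp).
by apply: filterS => w H i j bij; exact: (H (i, j)).
Qed.

Lemma state_measurable u (f : 'rV[R]_m -> R) : continuous f ->
  measurable_fun setT
    ((fun w => f (X (to_time u) w)) : g_sigma_algebraType (past X u) -> R).
Proof.
move=> cf; apply: (@continuous_rV_measurable R m _ (g_sigma_algebraType (past X u))) => //.
by move=> i; exact: past_coord.
Qed.

Lemma state_test u (f : 'rV[R]_m -> R) M : continuous f -> (forall z, `|f z| <= M) ->
  test (past X u) (fun w => f (X (to_time u) w)).
Proof.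
by move=> cf fM; split; [exact: state_measurable|exists M => w; exact: fM].
Qed.

Definition far_out N u : set T := [set w | exists i, N < `|x u i w|].

Lemma far_out_past N u : <<s past X u >> (far_out N u).
Proof.
have -> : far_out N u = \bigcup_(i in [set: 'I_m]) [set w | N < `|x u i w|].
  by apply/seteqP; split => w [i]; [exists i|move=> _; exists i].
apply: (@fin_bigcup_measurable _ (g_sigma_algebraType (past X u))) => // i _.
have mf : measurable_fun setT
    ((fun w => `|x u i w|) : g_sigma_algebraType (past X u) -> R).
  by apply: measurableT_comp => //; exact: past_coord.
rewrite (_ : [set _ | _] = setT `&` (fun w => `|x u i w|) @^-1` `]N, +oo[).
  exact: mf.
by apply/seteqP; split => w /=; rewrite in_itv/= andbT// => -[].
Qed.

(** Chebyshev's inequality for the displacement from [b]. *)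
Lemma co_tail S e : 0 <= S -> 0 < e -> exists2 N, 0 <= N & forall u, 0 <= u -> u <= S ->
  Ex P (\1_(far_out N u)) <= e.
Proof.
move=> S0 e0; pose B := \sum_i `|b ord0 i|.
have B0 : 0 <= B by apply: sumr_ge0.
have Bi i : `|b ord0 i| <= B by rewrite /B (bigD1 i)//= lerDl sumr_ge0.
pose N' := m%:R * (rho * S) / e + 1.
have q0 : 0 <= m%:R * (rho * S) / e.
  by rewrite divr_ge0 ?(ltW e0)// !mulr_ge0// ltW.
have N0 : 1 <= N' by rewrite /N' lerDr.
have N'0 : 0 < N' by exact: lt_le_trans N0.
exists (N' + B); first by rewrite addr_ge0// ltW.
move=> u u0 uS.
have L i : L1 P (fun w => (x u i w - b ord0 i) ^+ 2).
  by have [] := co_displacement mX coX i u0.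
apply: (@le_trans _ _ (Ex P (fun w => N' ^- 2 * \sum_i (x u i w - b ord0 i) ^+ 2))).
  apply: Ex_le.
  - by apply: (test_L1_self P (@FT u)); apply: test_indic; exact: far_out_past.
  - by apply: L1Z; apply: L1_sum => i _; exact: L.
  move=> w; rewrite indicE; have [/set_mem[i Ni]|_] := boolP (w \in _); last first.
    by rewrite mulr_ge0 ?invr_ge0 ?exprn_ge0 ?(ltW N'0)// sumr_ge0// => i _; exact: sqr_ge0.
  rewrite mulrC ler_pdivlMr ?exprn_gt0// mul1r.
  rewrite (bigD1 i)//= -[leLHS]addr0 lerD//; last by apply: sumr_ge0 => j _; exact: sqr_ge0.
  rewrite -(real_normK (num_real (x u i w - b ord0 i))).
  apply: lerXn2r; rewrite ?nnegrE ?(ltW N'0)//.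
  have := lerB_dist (x u i w) (b ord0 i); have := Bi i; have := Ni; rewrite /=; lra.
rewrite ExZ; last by apply: L1_sum => i _; exact: L.
rewrite Ex_sum; last by move=> i _; exact: L.
rewrite (eq_bigr (fun=> rho * u)); last first.
  by move=> i _; have [] := co_displacement mX coX i u0.
rewrite sumr_const card_ord -mulr_natl mulrC ler_pdivrMr ?exprn_gt0//.
apply: (@le_trans _ _ (e * N')).
  have -> : e * N' = m%:R * (rho * S) + e by rewrite /N'; field; exact: lt0r_neq0.
  by rewrite -[leLHS]addr0 lerD ?(ltW e0)// ler_wpM2l// ler_wpM2l// ltW.
by rewrite ler_pM2l// expr2 ler_peMl// ltW.
Qed.

Lemma abs_mul_le_sqr (p q : R) : `|p * q| <= 2^-1 * (p ^+ 2 + q ^+ 2).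
Proof.
rewrite normrM -(real_normK (num_real p)) -(real_normK (num_real q)).
by have := sqr_ge0 (`|p| - `|q|); rewrite sqrrB; lra.
Qed.

Lemma incr_mul_L1 u v i j : 0 <= u -> u <= v ->
  L1 P (fun w => (x v i w - x u i w) * (x v j w - x u j w)).
Proof.
move=> u0 uv.
have i2 k := gm_incr_sqr_L1 FT (co_moments coX k) u0 uv.
apply: (@L1_le _ _ _ P _ (fun w => 2^-1 *
    ((x v i w - x u i w) ^+ 2 + (x v j w - x u j w) ^+ 2))).
- by apply: measurable_funM; apply: measurable_funB; exact: mX.
- by move=> w; exact: abs_mul_le_sqr.
- by apply: L1Z; exact: L1D.
Qed.

(** The sample space is split in three. States far out have small probability.
    Where the two coordinates are close, the coefficient [h] is small. Where
    they are apart, the sine of their scaled difference is bounded below, and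
    after division by it [co_cross] applies. *)
Lemma mixed_term_aux (h : 'rV[R]_m -> R) M S i j :
  i != j -> b ord0 i <= b ord0 j -> 0 <= S ->
  continuous h -> (forall z, `|h z| <= M) ->
  (forall N e, 0 < e -> exists2 r, 0 < r & forall z, cone b z ->
    (forall i, `|z ord0 i| <= N) -> `|z ord0 i - z ord0 j| <= r -> `|h z| <= e) ->
  forall e, 0 < e -> exists2 r, 0 < r & forall u v (Y : T -> R),
    0 <= u -> u <= v -> v <= S -> v - u <= r -> test (past X u) Y ->
    (forall w, `|Y w| <= 1) ->
    `|Ex P (fun w => Y w * h (X (to_time u) w) *
      ((x v i w - x u i w) * (x v j w - x u j w)))| <= e * (v - u).
Proof.
move=> ij bij S0 ch hM hd e e0.
have M0 : 0 <= M by exact: le_trans (normr_ge0 _) (hM 0).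
have r2 : 0 < 2 * rho + 1 by rewrite addr_gt0// mulr_gt0.
pose e1 := e / (2 * rho + 1).
have e10 : 0 < e1 by rewrite divr_gt0.
have M1 : 0 < M + 1 by rewrite ltr_wpDl.
have [N N0 tailN] := co_tail S0 (divr_gt0 e10 M1).
have [de de0 Hde] := hd N e1 e10.
(* in the box of size [N] this keeps the argument of the sine below [1], where
   the sine is at least half of its argument *)
pose l := (2 * N + 1)^-1.
have N1 : 0 < 2 * N + 1 by rewrite ltr_wpDl// mulr_ge0.
have l0 : 0 < l by rewrite invr_gt0.
pose k := l * de / 2.
have k0 : 0 < k by rewrite divr_gt0// mulr_gt0.
have Mk1 : 0 < M * k^-1 + 1 by rewrite ltr_wpDl// divr_ge0// ltW.
have [r r0 Hr] := co_cross mX rho0 coX ij bij l0 (divr_gt0 e10 Mk1).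
exists r => // u v Y u0 uv vS vur tY Y1.
have uS : u <= S by exact: le_trans vS.
have vu0 : 0 <= v - u by rewrite subr_ge0.
pose D w := x u j w - x u i w.
pose bad := far_out N u.
pose near := ~` bad `&` [set w | D w <= de].
pose far := ~` bad `&` [set w | de < D w].
have mDF : measurable_fun setT (D : g_sigma_algebraType (past X u) -> R).
  by apply: measurable_funB; exact: past_coord.
have Fbad : <<s past X u >> bad := @far_out_past N u.
have FCbad : <<s past X u >> (~` bad).
  exact: (@measurableC _ (g_sigma_algebraType (past X u))).
have Fnear : <<s past X u >> near.
  apply: (@measurableI _ (g_sigma_algebraType (past X u))) => //.
  rewrite (_ : [set _ | _] = setT `&` D @^-1` `]-oo, de]); first exact: mDF.
  by apply/seteqP; split => w /=; rewrite in_itv/= // => -[].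
have Ffar : <<s past X u >> far.
  apply: (@measurableI _ (g_sigma_algebraType (past X u))) => //.
  rewrite (_ : [set _ | _] = setT `&` D @^-1` `]de, +oo[); first exact: mDF.
  by apply/seteqP; split => w /=; rewrite in_itv/= andbT// => -[].
pose Z w := h (X (to_time u) w).
have tZ : test (past X u) Z by apply: (@state_test u h M).
have tYZ := testM tY tZ.
pose di w := x v i w - x u i w; pose dj w := x v j w - x u j w.
have iW A : <<s past X u >> A -> L1 P (fun w => \1_A w * (Y w * Z w) * (di w * dj w)).
  move=> FA; apply: (test_L1 (@FT u)); last exact: incr_mul_L1.
  by apply: testM => //; exact: test_indic.
have split3 : Ex P (fun w => Y w * Z w * (di w * dj w)) =
   Ex P (fun w => \1_bad w * (Y w * Z w) * (di w * dj w)) +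
   Ex P (fun w => \1_near w * (Y w * Z w) * (di w * dj w)) +
   Ex P (fun w => \1_far w * (Y w * Z w) * (di w * dj w)).
  rewrite -ExD ?iW// -ExD ?iW//; last by apply: L1D; exact: iW.
  congr Ex; apply/funext => w; rewrite -!mulrDl.
  suff -> : \1_bad w + \1_near w + \1_far w = 1 :> R by rewrite mul1r.
  rewrite !indicE !in_setI in_setC.
  have [bw|bw] := boolP (w \in bad); first by rewrite /= !addr0.
  have n1 : (w \in [set w | D w <= de]) = (D w <= de).
    by apply/idP/idP => [/set_mem|/mem_set].
  have n2 : (w \in [set w | de < D w]) = (de < D w).
    by apply/idP/idP => [/set_mem|/mem_set].
  by rewrite n1 n2 add0r /=; case: lerP => _; rewrite ?addr0 ?add0r.
rewrite split3.
have i2 q := gm_incr_sqr_L1 FT (co_moments coX q) u0 uv.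
have v2 q (V : T -> R) (tV : test (past X u) V) := gm_var (co_moments coX q) u0 uv tV.
have Ebad : `|Ex P (fun w => \1_bad w * (Y w * Z w) * (di w * dj w))| <= e1 * (rho * (v - u)).
  have tb := test_indic Fbad (R := R).
  have ib q := test_L1 (@FT u) tb (i2 q).
  apply: (@le_trans _ _ (Ex P (fun w => M * 2^-1 * (\1_bad w * (di w) ^+ 2 + \1_bad w * (dj w) ^+ 2)))).
    apply: Ex_abs_le; [exact: iW|by apply: L1Z; apply: L1D; exact: ib|].
    move=> w; rewrite normrM.
    apply: (@le_trans _ _ (\1_bad w * M * (2^-1 * (di w ^+ 2 + dj w ^+ 2)))).
      apply: ler_pM => //; last exact: abs_mul_le_sqr.
      rewrite !normrM indicE; case: (_ \in _); rewrite ?normr1 ?normr0 ?mul0r// !mul1r.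
      by rewrite -[leRHS]mul1r ler_pM//; exact: hM.
    by rewrite le_eqVlt; apply/orP; left; apply/eqP; ring.
  rewrite (ExZ _ (L1D (ib i) (ib j))) (ExD (ib i) (ib j)) !v2//.
  rewrite (_ : M * 2^-1 * _ = M * Ex P \1_bad * (rho * (v - u))); last by field.
  rewrite ler_wpM2r ?mulr_ge0 ?(ltW rho0)//.
  apply: (@le_trans _ _ (M * (e1 / (M + 1)))); first by rewrite ler_wpM2l// tailN.
  by rewrite mulrCA ler_piMr ?(ltW e10)// ler_pdivrMr// mul1r lerDl.
have Enear : `|Ex P (fun w => \1_near w * (Y w * Z w) * (di w * dj w))| <= e1 * (rho * (v - u)).
  apply: (@le_trans _ _ (Ex P (fun w => e1 * 2^-1 * ((di w) ^+ 2 + (dj w) ^+ 2)))).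
    apply: Ex_abs_le_ae; [exact: iW|by apply: L1Z; apply: L1D; exact: i2|].
    apply: filterS (co_cone u0) => w /= cw; rewrite normrM -mulrA.
    apply: ler_pM => //; last exact: abs_mul_le_sqr.
    rewrite !normrM indicE; have [/set_mem[nb dw]|_] := boolP (_ \in _); last first.
      by rewrite normr0 mul0r ltW.
    rewrite normr1 mul1r -[leRHS]mul1r ler_pM//; apply: Hde => //.
      by move=> q; rewrite leNgt; apply/negP => Nq; apply: nb; exists q.
    by rewrite distrC ger0_norm// subr_ge0; exact: cw.
  rewrite (ExZ _ (L1D (i2 i) (i2 j))) (ExD (i2 i) (i2 j)).
  rewrite (gm_var0 (co_moments coX i) u0 uv) (gm_var0 (co_moments coX j) u0 uv).
  by rewrite le_eqVlt; apply/orP; left; apply/eqP; field.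
have Efar : `|Ex P (fun w => \1_far w * (Y w * Z w) * (di w * dj w))| <= e1 * (v - u).
  (* the reciprocal of the sine, cut off so as to stay bounded *)
  pose q (z : R) := (Num.max (sin (l * z)) k)^-1.
  have cq : continuous q.
    move=> z; rewrite /q; apply: cvgV.
      by rewrite gt_eqF// lt_max k0 orbT.
    apply: (@continuous_max _ _ (fun z => sin (l * z)) (fun=> k)); last exact: cvg_cst.
    exact: sin_scale_continuous.
  have q0 z : 0 <= q z by rewrite invr_ge0 le_max (ltW k0) orbT.
  have qk z : q z <= k^-1.
    by rewrite lef_pV2 ?posrE ?lt_max ?k0 ?orbT// le_max lexx orbT.
  have tq : test (past X u) (fun w => q (D w)).
    apply: (@test_comp _ _ _ (past X u) q D k^-1) => //.
      exact: continuous_measurable_fun.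
    by move=> z; rewrite ger0_norm.
  pose V w := \1_far w * (Y w * Z w) * q (D w).
  have tV : test (past X u) V.
    by apply: testM => //; apply: testM => //; exact: test_indic.
  have VM w : `|V w| <= M * k^-1.
    rewrite /V !normrM ler_pM//; last by rewrite ger0_norm.
    rewrite indicE; case: (_ \in _); rewrite ?normr1 ?normr0 ?mul0r// !mul1r.
    by rewrite -[leRHS]mul1r ler_pM//; exact: hM.
  have Mk0 : 0 <= M * k^-1 by rewrite divr_ge0// ltW.
  have -> : Ex P (fun w => \1_far w * (Y w * Z w) * (di w * dj w)) =
      Ex P (fun w => V w * sin (l * (x u j w - x u i w)) * (di w * dj w)).
    congr Ex; apply/funext => w; congr (_ * _); rewrite /V -/(D w).
    rewrite indicE; have [/set_mem[nb dw]|_] := boolP (_ \in _); last by rewrite !mul0r.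
    rewrite mul1r -[LHS]mulr1 -[RHS]mulrA; congr (_ * _).
    have nbq o : `|x u o w| <= N by rewrite leNgt; apply/negP => No; apply: nb; exists o.
    have D0 : 0 < D w by exact: lt_trans dw.
    have lD : 0 <= l * D w <= 1.
      rewrite mulr_ge0 ?(ltW D0) ?(ltW l0)//= mulrC ler_pdivrMr// mul1r.
      have := nbq j; have := nbq i; rewrite !ler_norml /D => /andP[? ?] /andP[? ?]; lra.
    have sk : k <= sin (l * D w).
      have /andP[z0 z1] := lD.
      have zde : l * de <= l * D w by rewrite ler_pM2l// ltW.
      have := sin_ge_taylor3 z0.
      have : (l * D w) ^+ 3 <= l * D w by rewrite -[leRHS]expr1 ler_wiXn2l.
      rewrite /k; lra.
    by rewrite /q max_l// mulVf// gt_eqF//; exact: lt_le_trans sk.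
  apply: (le_trans (Hr u v V (M * k^-1) u0 uv vur tV Mk0 VM)).
  by rewrite ler_wpM2r// mulrCA ler_piMr ?(ltW e10)// ler_pdivrMr// mul1r lerDl.
apply: (le_trans (ler_normD _ _)); apply: (le_trans (lerD (ler_normD _ _) (lexx _))).
apply: (le_trans (lerD (lerD Ebad Enear) Efar)).
by rewrite le_eqVlt; apply/orP; left; apply/eqP; rewrite /e1; field; exact: lt0r_neq0.
Qed.

Variables (f : 'rV[R]_m -> R) (g : 'I_m -> 'rV[R]_m -> R)
  (H : 'I_m -> 'I_m -> 'rV[R]_m -> R) (M : R).
Hypothesis J : jets (cone b) f g H M.

Lemma mixed_term S e i j : i != j -> 0 <= S -> 0 < e ->
  exists2 r, 0 < r & forall u v (Y : T -> R),
    0 <= u -> u <= v -> v <= S -> v - u <= r -> test (past X u) Y ->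
    (forall w, `|Y w| <= 1) ->
    `|Ex P (fun w => Y w * H i j (X (to_time u) w) *
      ((x v i w - x u i w) * (x v j w - x u j w)))| <= e * (v - u).
Proof.
move=> ij S0 e0; have [bij|bji] := lerP (b ord0 i) (b ord0 j).
  apply: (@mixed_term_aux (H i j) M S i j) => //.
  - exact: (jH_cont J).
  - exact: (jH_le J).
  - move=> N e' e'0; have [r r0 Hr] := jdiag J N e'0.
    by exists r => // z cz zN zij; exact: Hr.
have [||||r r0 Hr] := @mixed_term_aux (H i j) M S j i _ (ltW bji) S0 _ _ _ e e0.
- by rewrite eq_sym.
- exact: (jH_cont J).
- exact: (jH_le J).
- move=> N e' e'0; have [r r0 Hr] := jdiag J N e'0.
  by exists r => // z cz zN zij; apply: Hr => //; rewrite distrC.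
exists r => // u v Y u0 uv vS vur tY Y1.
have := Hr u v Y u0 uv vS vur tY Y1; congr (`|_| <= _).
by congr Ex; apply/funext => w; congr (_ * _); rewrite mulrC.
Qed.

Lemma jets_bound_ge0 : 0 <= M.
Proof. exact: le_trans (normr_ge0 _) (jf_le J 0). Qed.

(** Small increments fall under [jrem_small]. For large ones the square is
    dominated by a multiple of the fourth power, whose mean is quadratic in the
    length of the interval. *)
Lemma remainder_term S e : 0 <= S -> 0 < e ->
  exists2 r, 0 < r & forall u v (Y : T -> R),
    0 <= u -> u <= v -> v <= S -> v - u <= r -> test (past X u) Y ->
    (forall w, `|Y w| <= 1) ->
    L1 P (fun w => Y w * jet_rem f g H (X (to_time u) w) (X (to_time v) w)) /\
    `|Ex P (fun w => Y w * jet_rem f g H (X (to_time u) w) (X (to_time v) w))|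
      <= e * (v - u).
Proof.
move=> S0 e0.
have M0 := jets_bound_ge0.
pose c := 2 * (m%:R * rho) + 1.
have c0 : 0 < c by rewrite ltr_wpDl// !mulr_ge0// ltW.
pose e1 := e / c.
have e10 : 0 < e1 by rewrite divr_gt0.
have M1 : 0 < M + 1 by rewrite ltr_wpDl.
have [N N0 tailN] := co_tail S0 (divr_gt0 e10 M1).
have [de de0 Hde] := jrem_small J N e10.
have /choice[K HK] : forall i, exists K, 0 <= K /\ forall u v, 0 <= u -> u <= v ->
    Ex P (fun w => (x v i w - x u i w) ^+ 4) <= K * (v - u) ^+ 2.
  by move=> i; have [K K0 HK] := gm_fourth_bound (co_moments coX i); exists K.
pose K4 := \sum_i K i.
have K40 : 0 <= K4 by apply: sumr_ge0 => i _; have [] := HK i.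
pose A := M * m%:R / de ^+ 2.
have A0 : 0 <= A by rewrite divr_ge0 ?exprn_ge0 ?(ltW de0)// mulr_ge0.
have AK : 0 < A * K4 + 1 by rewrite ltr_wpDl// mulr_ge0.
exists (e1 / (A * K4 + 1)); first by rewrite divr_gt0.
move=> u v Y u0 uv vS vur tY Y1.
have v0 : 0 <= v by exact: le_trans uv.
have vu0 : 0 <= v - u by rewrite subr_ge0.
have uS : u <= S by exact: le_trans vS.
pose dl i w := x v i w - x u i w.
pose bad := far_out N u.
have Fbad : <<s past X u >> bad := @far_out_past N u.
pose S2 w := \sum_i dl i w ^+ 2; pose S4 w := \sum_i dl i w ^+ 4.
have i2 q : L1 P (fun w => dl q w ^+ 2) := gm_incr_sqr_L1 FT (co_moments coX q) u0 uv.
have i4 q : L1 P (fun w => dl q w ^+ 4) := gm_incr_fourth_L1 (co_moments coX q) u0 uv.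
have iS2 : L1 P S2 by apply: L1_sum => i _; exact: i2.
have iS4 : L1 P S4 by apply: L1_sum => i _; exact: i4.
have tb := test_indic Fbad (R := R).
have ibS2 := test_L1 (@FT u) tb iS2.
have S20 w : 0 <= S2 w by apply: sumr_ge0 => i _; exact: sqr_ge0.
have S40 w : 0 <= S4 w by apply: sumr_ge0 => i _; exact: exprn_even_ge0.
have remle : {ae P, forall w, `|Y w * jet_rem f g H (X (to_time u) w) (X (to_time v) w)| <=
    e1 * S2 w + A * S4 w + M * (\1_bad w * S2 w)}.
  apply: filterS2 (co_cone u0) (co_cone v0) => w /= cu cv.
  apply: (@le_trans _ _ `|jet_rem f g H (X (to_time u) w) (X (to_time v) w)|).
    by rewrite normrM ler_piMl.
  have b1 : `|jet_rem f g H (X (to_time u) w) (X (to_time v) w)| <= M * S2 w.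
    exact: (jrem_le J).
  rewrite indicE; have [bw|/negP bw] := boolP (w \in bad).
    rewrite mul1r (le_trans b1)// lerDr addr_ge0// mulr_ge0//; exact: ltW.
  rewrite mul0r mulr0 addr0.
  have nbq p : `|x u p w| <= N.
    by rewrite leNgt; apply/negP => Np; apply: bw; apply/mem_set; exists p.
  have [small|/existsNP[p /negP]] := pselect (forall p, `|dl p w| <= de).
    rewrite -[leLHS]addr0; apply: lerD; first exact: Hde.
    exact: mulr_ge0.
  rewrite -ltNge => dp.
  apply: (le_trans b1); rewrite -[leLHS]add0r; apply: lerD.
    by apply: mulr_ge0; first exact: ltW.
  rewrite /A -!mulrA ler_wpM2l//.
  apply: (@le_trans _ _ (\sum_(i < m) (de ^- 2 * S4 w))); last first.
    by rewrite sumr_const card_ord mulr_natl.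
  apply: ler_sum => i _.
  have de2 : 0 < de ^+ 2 by rewrite exprn_gt0.
  have le4 k : dl k w ^+ 4 <= S4 w.
    rewrite /S4 (bigD1 k)//= lerDl; apply: sumr_ge0 => k' _; exact: exprn_even_ge0.
  have big k : de < `|dl k w| -> de ^+ 2 <= dl k w ^+ 2.
    move=> dk; rewrite -(real_normK (num_real (dl k w))).
    by apply: lerXn2r; rewrite ?nnegrE ?(ltW de0)// ltW.
  have sq k : dl k w ^+ 4 = dl k w ^+ 2 * dl k w ^+ 2 by rewrite -exprD.
  rewrite mulrC ler_pdivlMr//.
  have [di|di] := lerP `|dl i w| de.
    have b2 : dl i w ^+ 2 <= de ^+ 2.
      rewrite -(real_normK (num_real (dl i w))).
      by apply: lerXn2r; rewrite ?nnegrE ?(ltW de0).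
    apply: (le_trans _ (le4 p)); rewrite sq; apply: ler_pM; rewrite ?sqr_ge0 ?(ltW de2)//.
      by apply: (le_trans b2); exact: big.
    exact: big.
  by apply: (le_trans _ (le4 i)); rewrite sq ler_wpM2l ?sqr_ge0// big.
have mrem : measurable_fun setT
    (fun w => Y w * jet_rem f g H (X (to_time u) w) (X (to_time v) w)).
  have ms r (h : 'rV[R]_m -> R) : continuous h -> measurable_fun setT (fun w => h (X (to_time r) w)).
    by move=> ch; apply: (sub_measurable (@FT r)); exact: state_measurable.
  have md i : measurable_fun setT (dl i) by apply: measurable_funB; exact: mX.
  apply: measurable_funM; first exact: (test_measurable (@FT u) tY).
  apply: measurable_funB; first apply: measurable_funB; first apply: measurable_funB.
  - by apply: ms; exact: (jf_cont J).
  - by apply: ms; exact: (jf_cont J).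
  - apply: measurable_sum => i; apply: measurable_funM; [by apply: ms; exact: (jg_cont J)|exact: md].
  - apply: measurable_funM => //; apply: measurable_sum => i; apply: measurable_sum => j.
    apply: measurable_funM; first by apply: ms; exact: (jH_cont J).
    by apply: measurable_funM; exact: md.
have ibound : L1 P (fun w => e1 * S2 w + A * S4 w + M * (\1_bad w * S2 w)).
  by apply: L1D; [apply: L1D; exact: L1Z|exact: L1Z].
have irem : L1 P (fun w => Y w * jet_rem f g H (X (to_time u) w) (X (to_time v) w)).
  apply/integrableP; split; first exact/measurable_EFinP.
  have /integrableP[_] := ibound; apply: le_lt_trans.
  apply: ae_ge0_le_integral => //.
  - by apply: measurableT_comp => //; exact/measurable_EFinP.
  - by apply: measurableT_comp => //; apply/measurable_EFinP; exact: (L1_measurable ibound).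
  - by apply: filterS remle => w /= le _; rewrite lee_fin (le_trans le)// ler_norm.
split=> //; apply: (le_trans (Ex_abs_le_ae irem ibound remle)).
rewrite (ExD (L1D (L1Z e1 iS2) (L1Z A iS4)) (L1Z M ibS2)) (ExD (L1Z e1 iS2) (L1Z A iS4)).
rewrite !ExZ//.
have E2 : Ex P S2 = m%:R * (rho * (v - u)).
  rewrite /S2 Ex_sum; last by move=> i _; exact: i2.
  rewrite (eq_bigr (fun=> rho * (v - u))); first by rewrite sumr_const card_ord mulr_natl.
  by move=> i _; exact: (gm_var0 (co_moments coX i) u0 uv).
have E4 : Ex P S4 <= K4 * (v - u) ^+ 2.
  rewrite /S4 Ex_sum; last by move=> i _; exact: i4.
  by rewrite /K4 mulr_suml; apply: ler_sum => i _; have [_] := HK i; exact.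
have Eb : Ex P (fun w => \1_bad w * S2 w) = m%:R * (rho * (v - u)) * Ex P \1_bad.
  transitivity (Ex P (fun w => \sum_i \1_bad w * dl i w ^+ 2)).
    by congr Ex; apply/funext => w; rewrite /S2 mulr_sumr.
  rewrite Ex_sum; last by move=> i _; exact: (test_L1 (@FT u) tb (i2 i)).
  rewrite (eq_bigr (fun=> rho * (v - u) * Ex P \1_bad)).
    by rewrite sumr_const card_ord -[LHS]mulr_natl !mulrA.
  by move=> i _; exact: (gm_var (co_moments coX i) u0 uv tb).
rewrite E2 Eb.
have T2 : A * Ex P S4 <= e1 * (v - u).
  apply: (@le_trans _ _ (A * (K4 * (v - u) ^+ 2))); first by rewrite ler_wpM2l.
  rewrite expr2 !mulrA ler_wpM2r//.
  apply: (@le_trans _ _ ((A * K4 + 1) * (v - u))); first by rewrite ler_wpM2r// lerDl.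
  by rewrite mulrC -ler_pdivlMr.
have T3 : M * (m%:R * (rho * (v - u)) * Ex P \1_bad) <= e1 * (m%:R * (rho * (v - u))).
  rewrite mulrCA (mulrC e1) ler_wpM2l//; first by rewrite !mulr_ge0// ltW.
  apply: (@le_trans _ _ (M * (e1 / (M + 1)))); first by rewrite ler_wpM2l// tailN.
  by rewrite mulrCA ler_piMr ?(ltW e10)// ler_pdivrMr// mul1r lerDl.
apply: (le_trans (lerD (lerD (lexx _) T2) T3)).
by rewrite le_eqVlt; apply/orP; left; apply/eqP; rewrite /e1 /c; field; exact: lt0r_neq0.
Qed.

(** Ito's formula in the form of a short-time expansion: no boundary term
    appears, as the process never leaves the cone and the mixed second
    derivatives vanish on its faces. *)
Lemma local_ito S e : 0 <= S -> 0 < e ->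
  exists2 r, 0 < r & forall u v (Y : T -> R),
    0 <= u -> u <= v -> v <= S -> v - u <= r -> test (past X u) Y ->
    (forall w, `|Y w| <= 1) ->
    `|Ex P (fun w => Y w * f (X (to_time v) w)) - Ex P (fun w => Y w * f (X (to_time u) w)) -
      (v - u) * (rho / 2 * Ex P (fun w => Y w * \sum_i H i i (X (to_time u) w)))|
    <= e * (v - u).
Proof.
move=> S0 e0.
have e20 : 0 < e / 2 by rewrite divr_gt0.
have [r1 r10 R1] := remainder_term S0 e20.
have m20 : 0 < (m%:R * m%:R + 1 : R) by rewrite ltr_wpDl// mulr_ge0.
pose em := e / (m%:R * m%:R + 1).
have em0 : 0 < em by rewrite divr_gt0.
have [|j h h' h'h Q jj u v Y u0 uv vS vuh|r2 r20 R2] := @common_threshold R ('I_m * 'I_m)%type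
  (fun p r => p.1 != p.2 -> forall u v (Y : T -> R),
    0 <= u -> u <= v -> v <= S -> v - u <= r -> test (past X u) Y ->
    (forall w, `|Y w| <= 1) ->
    `|Ex P (fun w => Y w * H p.1 p.2 (X (to_time u) w) *
      ((x v p.1 w - x u p.1 w) * (x v p.2 w - x u p.2 w)))| <= em * (v - u)).
- move=> [i j]; have [->|ij] := eqVneq i j; first by exists 1 => //=; rewrite eqxx.
  by have [r r0 Hr] := mixed_term ij S0 em0; exists r.
- by apply: Q => //; exact: le_trans h'h.
exists (Num.min r1 r2); first by rewrite lt_min r10.
move=> u v Y u0 uv vS; rewrite le_min => /andP[vu1 vu2] tY Y1.
have v0 : 0 <= v by exact: le_trans uv.
have vu0 : 0 <= v - u by rewrite subr_ge0.
have [iR ER] := R1 u v Y u0 uv vS vu1 tY Y1.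
pose dl i w := x v i w - x u i w.
pose G i w := g i (X (to_time u) w); pose HH i j w := H i j (X (to_time u) w).
have tG i : test (past X u) (G i).
  by apply: (@state_test u (g i) M); [exact: (jg_cont J)|exact: (jg_le J)].
have tH i j : test (past X u) (HH i j).
  by apply: (@state_test u (H i j) M); [exact: (jH_cont J)|exact: (jH_le J)].
have iG i : L1 P (fun w => Y w * G i w * dl i w).
  by apply: (test_L1 (@FT u) (testM tY (tG i))); exact: (gm_incr_id_L1 FT (co_moments coX i) u0 uv).
have iH i j : L1 P (fun w => Y w * HH i j w * (dl i w * dl j w)).
  by apply: (test_L1 (@FT u) (testM tY (tH i j))); exact: incr_mul_L1.
have iYf r : u <= r -> L1 P (fun w => Y w * f (X (to_time r) w)).
  move=> ur; have tr : test (past X r) (fun w => f (X (to_time r) w)).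
    by apply: (@state_test r f M); [exact: (jf_cont J)|exact: (jf_le J)].
  apply: (test_L1_self P (@FT r)); apply: testM => //.
  exact: (test_mono (@past_mono _ _ _ _ X) ur tY).
have iSG : L1 P (fun w => \sum_i Y w * G i w * dl i w) by apply: L1_sum => i _; exact: iG.
have iSH : L1 P (fun w => \sum_i \sum_j Y w * HH i j w * (dl i w * dl j w)).
  by apply: L1_sum => i _; apply: L1_sum => j _; exact: iH.
have E : Ex P (fun w => Y w * f (X (to_time v) w)) - Ex P (fun w => Y w * f (X (to_time u) w)) =
    2^-1 * (\sum_i \sum_j Ex P (fun w => Y w * HH i j w * (dl i w * dl j w))) +
    Ex P (fun w => Y w * jet_rem f g H (X (to_time u) w) (X (to_time v) w)).
  rewrite -(ExB (iYf _ uv) (iYf _ (lexx u))).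
  transitivity (Ex P (fun w => \sum_i Y w * G i w * dl i w +
     2^-1 * (\sum_i \sum_j Y w * HH i j w * (dl i w * dl j w)) +
     Y w * jet_rem f g H (X (to_time u) w) (X (to_time v) w))).
    congr Ex; apply/funext => w.
    have -> : \sum_i Y w * G i w * dl i w = Y w * \sum_i G i w * dl i w.
      by rewrite mulr_sumr; apply: eq_bigr => i _; rewrite -mulrA.
    have -> : \sum_i \sum_j Y w * HH i j w * (dl i w * dl j w) =
        Y w * \sum_i \sum_j HH i j w * (dl i w * dl j w).
      rewrite mulr_sumr; apply: eq_bigr => i _; rewrite mulr_sumr.
      by apply: eq_bigr => j _; rewrite -mulrA.
    by rewrite /jet_rem /G /HH /dl; ring.
  rewrite (ExD (L1D iSG (L1Z _ iSH)) iR) (ExD iSG (L1Z _ iSH)) (ExZ _ iSH).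
  rewrite Ex_sum; last by move=> i _; exact: iG.
  rewrite big1 ?add0r; last first.
    by move=> i _; exact: (gm_mean (co_moments coX i) u0 uv (testM tY (tG i))).
  congr (_ * _ + _); rewrite Ex_sum; last by move=> i _; apply: L1_sum => j _; exact: iH.
  by apply: eq_bigr => i _; rewrite Ex_sum// => j _; exact: iH.
have Ediag : Ex P (fun w => Y w * \sum_i H i i (X (to_time u) w)) =
    \sum_i Ex P (fun w => Y w * HH i i w).
  rewrite -Ex_sum; last by move=> i _; exact: (test_L1_self P (@FT u) (testM tY (tH i i))).
  by congr Ex; apply/funext => w; rewrite mulr_sumr.
have Esq i : Ex P (fun w => Y w * HH i i w * (dl i w * dl i w)) = rho * (v - u) * Ex P (fun w => Y w * HH i i w).
  rewrite -(gm_var (co_moments coX i) u0 uv (testM tY (tH i i))).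
  by congr Ex; apply/funext => w; rewrite -expr2.
rewrite E Ediag.
set RR := Ex P (fun w => Y w * jet_rem _ _ _ _ _) in ER *.
have -> : 2^-1 * (\sum_i \sum_j Ex P (fun w => Y w * HH i j w * (dl i w * dl j w))) + RR -
    (v - u) * (rho / 2 * \sum_i Ex P (fun w => Y w * HH i i w)) =
  2^-1 * (\sum_i \sum_(j | j != i) Ex P (fun w => Y w * HH i j w * (dl i w * dl j w))) + RR.
  have -> : \sum_i \sum_j Ex P (fun w => Y w * HH i j w * (dl i w * dl j w)) =
     \sum_i rho * (v - u) * Ex P (fun w => Y w * HH i i w) +
     \sum_i \sum_(j | j != i) Ex P (fun w => Y w * HH i j w * (dl i w * dl j w)).
    rewrite -big_split /=; apply: eq_bigr => i _.
    by rewrite (bigD1 i)//= Esq.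
  by rewrite -mulr_sumr; field.
apply: (le_trans (ler_normD _ _)); rewrite [e in leRHS]splitr [leRHS]mulrDl lerD//.
rewrite normrM ger0_norm// mulrC ler_pdivrMr// mulrAC divfK//.
apply: (@le_trans _ _ (\sum_(i < m) \sum_(j < m) em * (v - u))).
  apply: (le_trans (ler_norm_sum _ _ _)); apply: ler_sum => i _.
  apply: (le_trans (ler_norm_sum _ _ _)); rewrite big_mkcond; apply: ler_sum => j _.
  case: ifPn => [ji|_]; last by rewrite mulr_ge0// ltW.
  by apply: (R2 (i, j)); rewrite //= eq_sym.
rewrite !sumr_const card_ord -mulrnA -mulr_natl mulrA ler_wpM2r// natrM.
by rewrite /em mulrCA ler_piMr ?(ltW e0)// ler_pdivrMr// mul1r lerDl.
Qed.

End local_ito.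

(** * Time integrals and Dynkin's formula *)

Section riemann_sums.
Context {R : realType}.
Notation mu := (@lebesgue_measure R).

Lemma continuous_integrable_itv (phi : R -> R) a b : continuous phi ->
  mu.-integrable `[a, b] (EFin \o phi).
Proof.
move=> cphi; apply: continuous_compact_integrable; first exact: segment_compact.
exact: continuous_subspaceT.
Qed.

Lemma itv_integral_approx (phi : R -> R) a b e : a <= b -> continuous phi ->
  (forall r, a <= r <= b -> `|phi r - phi a| <= e) ->
  `|\int[mu]_(r in `[a, b]) phi r - (b - a) * phi a| <= e * (b - a).
Proof.
move=> ab cphi H.
have mab : fine (mu `[a, b]%classic) = b - a.
  rewrite lebesgue_measure_itv/= lte_fin; case: ltP => // ba.
  by apply/eqP; rewrite eq_sym subr_eq0 eq_le ba ab.
have ci c : mu.-integrable `[a, b] (EFin \o (fun=> c)).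
  by apply: continuous_integrable_itv => z; exact: cvg_cst.
have -> : (b - a) * phi a = \int[mu]_(r in `[a, b]) (phi a).
  by rewrite Rintegral_cst// mab mulrC.
have ip := continuous_integrable_itv a b cphi.
rewrite -(RintegralB _ ip (ci (phi a)))//.
apply: (le_trans (le_normr_Rintegral _ _)) => //.
  exact: (integrableB _ ip (ci (phi a))).
rewrite -mab -Rintegral_cst//; apply: le_Rintegral => //.
by apply: integrable_norm; exact: (integrableB _ ip (ci (phi a))).
Qed.

Definition riemann (phi : R -> R) s t n :=
  \sum_(k < n.+1) (t - s) / n.+1%:R * phi (grid s t n.+1 k).

Lemma riemann_cvg (phi : R -> R) s t : s <= t -> continuous phi ->
  riemann phi s t @ \oo --> \int[mu]_(r in `[s, t]) phi r.
Proof.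
move=> st cphi; pose F u := \int[mu]_(r in `[s, u]) phi r.
have Fs : F s = 0 by rewrite /F set_itv1 Rintegral_set1.
apply/cvgrPdist_le => e e0.
have ts1 : 0 < t - s + 1 by rewrite ltr_wpDl// subr_ge0.
pose e1 := e / (t - s + 1).
have e10 : 0 < e1 by rewrite divr_gt0.
have [h h0 Hh] := compact_unif_continuous cphi (@segment_compact _ s t) e10.
have h20 : 0 < h / 2 by rewrite divr_gt0.
have [N HN] := grid_mesh st h20.
exists N => // n /= /HN hn.
have Fstep u v : s <= u -> u <= v -> v <= t -> v - u <= h / 2 ->
    `|F v - F u - (v - u) * phi u| <= e1 * (v - u).
  move=> su uv vt vuh.
  have -> : F v - F u = \int[mu]_(r in `[u, v]) phi r.
    rewrite /F Rintegral_itvB ?bnd_simp//; last exact: continuous_integrable_itv.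
    rewrite Rintegral_itv_obnd_cbnd//.
    by apply: integrableS (continuous_integrable_itv u v cphi) => //;
      exact: subset_itv_oc_cc.
  apply: itv_integral_approx => // r /andP[ur rv]; rewrite distrC ltW//; apply: Hh.
    by rewrite /= in_itv/= su (le_trans uv).
  rewrite distrC ger0_norm ?subr_ge0//.
  apply: (@le_lt_trans _ _ (v - u)); first by rewrite lerD2r.
  by apply: (le_lt_trans vuh); rewrite ltr_pdivrMr// ltr_pMr// ltr1n.
have := telescope_grid st Fstep hn; rewrite Fs subr0 => /le_trans; apply.
by rewrite /e1 mulrAC ler_pdivrMr// ler_pM2l// lerDl.
Qed.

End riemann_sums.

Section time_integral.
Context {d : measure_display} {T : measurableType d} {R : realType}.
Variable P : probability T R.
Variables (m : nat) (X : time R -> T -> 'rV[R]_m).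
Hypothesis mX : forall t i, measurable_fun setT (fun w => X t w ord0 i).
Hypothesis cX : forall w, continuous (X ^~ w).
Variables (G : 'rV[R]_m -> R) (K : R).
Hypothesis cG : continuous G.
Hypothesis GK : forall z, `|G z| <= K.

Let FT := past_measurable mX.
Let Fmono := @past_mono _ _ _ _ X.

Lemma path_continuous w : continuous (fun r : R => G (X (to_time r) w)).
Proof.
move=> r; apply: (continuous_comp (f := fun r => X (to_time r) w)); last exact: cG.
apply: (continuous_comp (f := @to_time R) (g := X ^~ w)); first exact: to_time_continuous.
exact: cX.
Qed.

Let J s t w := \int[lebesgue_measure]_(r in `[s, t]) G (X (to_time r) w).

Lemma path_test u : test (past X u) (fun w => G (X (to_time u) w)).
Proof.
split; last by exists K => w; exact: GK.
apply: (@continuous_rV_measurable R m _ (g_sigma_algebraType (past X u))) => //.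
by move=> i; exact: past_coord.
Qed.

Lemma time_integral_measurable s t : s <= t ->
  measurable_fun setT (J s t : g_sigma_algebraType (past X t) -> R).
Proof.
move=> st; apply: (@measurable_fun_cvg _ (g_sigma_algebraType (past X t)) R setT
  (fun n w => riemann (fun r => G (X (to_time r) w)) s t n)).
- move=> n; apply: measurable_sum => k; apply: measurable_funM => //.
  have kn : (k <= n.+1)%N by rewrite ltnW.
  have /andP[_ kt] := grid_mem st kn.
  by have [] := test_mono Fmono kt (path_test (grid s t n.+1 k)).
- by move=> w _; apply: riemann_cvg => //; exact: path_continuous.
Qed.

Lemma riemann_le w s t n : s <= t ->
  `|riemann (fun r => G (X (to_time r) w)) s t n| <= (t - s) * K.
Proof.
move=> st; apply: (le_trans (ler_norm_sum _ _ _)).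
apply: (@le_trans _ _ (\sum_(k < n.+1) (t - s) / n.+1%:R * K)).
  apply: ler_sum => k _; rewrite normrM ger0_norm ?divr_ge0 ?subr_ge0//.
  by rewrite ler_wpM2l ?divr_ge0 ?subr_ge0.
by rewrite sumr_const card_ord -[leLHS]mulr_natr [leLHS]mulrAC divfK.
Qed.

Lemma time_integral_le w s t : s <= t -> `|J s t w| <= (t - s) * K.
Proof.
move=> st; have cv := riemann_cvg st (@path_continuous w).
rewrite -(cvg_lim (@Rhausdorff R) (cvg_norm cv)).
apply: limr_le; first by apply/cvg_ex; eexists; exact: cvg_norm cv.
by apply: nearW => n; exact: riemann_le.
Qed.

Lemma time_integral_test s t : s <= t -> test (past X t) (J s t).
Proof.
move=> st; split; first exact: time_integral_measurable.
by exists ((t - s) * K) => w; exact: time_integral_le.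
Qed.

(** Riemann sums exchange the mean with the time integral; no joint
    measurability in time and sample point is involved. *)
Lemma Ex_time_integral s t (Y : T -> R) : 0 <= s -> s <= t -> test (past X s) Y ->
  riemann (fun r => Ex P (fun w => Y w * G (X (to_time r) w))) s t @ \oo -->
    Ex P (fun w => Y w * J s t w).
Proof.
move=> s0 st tY; have [L L0 YL] := test_bounded tY.
have mY := test_measurable (@FT s) tY.
have iYG r : s <= r -> L1 P (fun w => Y w * G (X (to_time r) w)).
  move=> sr; apply: (test_L1_self P (@FT r)); apply: testM; last exact: path_test.
  exact: (test_mono Fmono sr tY).
have -> : riemann (fun r => Ex P (fun w => Y w * G (X (to_time r) w))) s t =
    (fun n => Ex P (fun w => Y w * riemann (fun r => G (X (to_time r) w)) s t n)).
  apply/funext => n; rewrite /riemann.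
  under [in RHS]eq_fun do rewrite mulr_sumr.
  have sk (k : 'I_n.+1) : s <= grid s t n.+1 k.
    by have /andP[] := grid_mem st (ltnW (ltn_ord k)).
  have e k w : Y w * ((t - s) / n.+1%:R * G (X (to_time (grid s t n.+1 k)) w)) =
     (t - s) / n.+1%:R * (Y w * G (X (to_time (grid s t n.+1 k)) w)).
    by rewrite mulrCA.
  under [in RHS]eq_fun do under eq_bigr do rewrite e.
  rewrite Ex_sum; last by move=> k _; apply: L1Z; exact: iYG.
  by apply: eq_bigr => k _; rewrite ExZ//; exact: iYG.
apply: (@Ex_bct _ _ _ P _ _ (L * ((t - s) * K))).
- move=> n; apply: measurable_funM => //; apply: measurable_sum => k.
  apply: measurable_funM => //; exact: (test_measurable (@FT _) (path_test _)).
- apply: measurable_funM => //.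
  exact: (sub_measurable (@FT t) (time_integral_measurable st)).
- apply: aeW => w; apply: cvgM; first exact: cvg_cst.
  by apply: riemann_cvg => //; exact: path_continuous.
- by move=> n w; rewrite normrM ler_pM// riemann_le.
Qed.

(** A uniform first-order expansion integrates to Dynkin's formula. *)
Lemma dynkin (a : R -> R) s t (Y : T -> R) : 0 <= s -> s <= t -> test (past X s) Y ->
  (forall e, 0 < e -> exists2 h, 0 < h & forall u v, s <= u -> u <= v -> v <= t ->
     v - u <= h ->
     `|a v - a u - (v - u) * Ex P (fun w => Y w * G (X (to_time u) w))| <= e * (v - u)) ->
  a t - a s = Ex P (fun w => Y w * J s t w).
Proof.
move=> s0 st tY H; apply/eqP; rewrite -subr_eq0 -normr_le0.
apply/ler_addgt0Pr => e e0; rewrite add0r.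
have ts1 : 0 < t - s + 1 by rewrite ltr_wpDl// subr_ge0.
have e10 : 0 < e / (t - s + 1) / 2 by rewrite !divr_gt0.
have [h h0 Hh] := H _ e10; have [N HN] := grid_mesh st h0.
have /cvgrPdist_le/(_ (e / 2)) := Ex_time_integral s0 st tY.
rewrite divr_gt0// => /(_ isT)[N' _ HN'].
pose n := maxn N N'.
have A1 := HN' n (leq_maxr _ _); rewrite /= in A1.
have A2 := telescope_grid st Hh (HN n (leq_maxl _ _)).
rewrite -/(riemann (fun u => Ex P (fun w => Y w * G (X (to_time u) w))) s t n) in A2.
set S := riemann _ s t n in A1 A2.
rewrite (_ : a t - a s - _ = (a t - a s - S) - (Ex P (fun w => Y w * J s t w) - S)); last by ring.
apply: (le_trans (ler_normB _ _)); rewrite [leRHS]splitr lerD//.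
apply: (le_trans A2); rewrite mulrAC ler_wpM2r// mulrAC ler_pdivrMr// ler_pM2l//.
by rewrite lerDl.
Qed.

End time_integral.

(** * Taylor's formula from partial derivatives *)

Section directional.
Context {R : realType} {m : nat}.
Implicit Types (x y z v : 'rV[R]_m) (f : 'rV[R]_m -> R).

Lemma is_derive_line f x v (t : R) : derivable f (t *: v + x) v ->
  is_derive t 1 (fun r : R => f (r *: v + x)) ('D_v f (t *: v + x)).
Proof.
have E : (fun h : R => h^-1 *: (((fun r : R => f (r *: v + x)) \o shift t) (h *: 1) - f (t *: v + x))) =
    (fun h => h^-1 *: ((f \o shift (t *: v + x)) (h *: v) - f (t *: v + x))).
  apply/funext => h /=; congr (_ *: (f _ - _)).
  by rewrite scaler1 scalerDl addrA.
by move=> df; split; rewrite /derivable /derive E.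
Qed.

Lemma line_mvt f x v (D : R -> R) :
  (forall t : R, 0 <= t <= 1 -> is_derive t 1 (fun r : R => f (r *: v + x)) (D t)) ->
  exists2 t, 0 <= t <= 1 & f (v + x) - f x = D t.
Proof.
move=> dD; have [t] : exists2 t, t \in `[0, 1] &
    f (1 *: v + x) - f (0 *: v + x) = D t * (1 - 0).
  apply: (@MVT_segment _ (fun r : R => f (r *: v + x)) D) => //.
    by move=> t; rewrite in_itv/= => /andP[t0 t1]; apply: dD; rewrite !ltW.
  apply: derivable_within_continuous => t; rewrite in_itv/= => t01.
  by have [] := dD t t01.
rewrite in_itv/= => t01; rewrite scale1r scale0r add0r subr0 mulr1 => E.
by exists t.
Qed.

(** Moving one coordinate at a time, the mean value theorem turns continuous
    partial derivatives into a total differential. *)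
Lemma total_differential (U : set 'rV[R]_m) f : open U ->
  (forall z, U z -> forall i, derivable f z (delta_mx ord0 i)) ->
  (forall z, U z -> forall i, {for z, continuous (pderiv i f)}) ->
  forall z, U z -> forall e, 0 < e -> exists2 h, 0 < h & forall y,
    (forall i, `|y ord0 i - z ord0 i| < h) ->
    `|f y - f z - \sum_i pderiv i f z * (y ord0 i - z ord0 i)|
      <= e * \sum_i `|y ord0 i - z ord0 i|.
Proof.
move=> oU df cf z Uz e e0.
have [h1 h10 HU] : exists2 h, 0 < h & forall y, (forall i, `|z ord0 i - y ord0 i| < h) -> U y.
  by apply/nbhs_rVP; move: oU; rewrite openE; exact.
have [|i h h' h'h Q y zy|h2 h20 Hc] := @common_threshold R 'I_m (fun i h => forall y,
   (forall k, `|z ord0 k - y ord0 k| < h) -> `|pderiv i f z - pderiv i f y| < e).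
- move=> i; have /cvgrPdist_lt/(_ e e0) := cf z Uz i.
  by move=> /nbhs_rVP[h h0 H]; exists h.
- by apply: Q => k; exact: lt_le_trans (zy k) h'h.
exists (Num.min h1 h2); first by rewrite lt_min h10.
move=> y zy.
have zy1 i : `|y ord0 i - z ord0 i| < h1 by apply: lt_le_trans (zy i) _; rewrite ge_min lexx.
have zy2 i : `|y ord0 i - z ord0 i| < h2 by apply: lt_le_trans (zy i) _; rewrite ge_min lexx orbT.
pose hyb (k : nat) : 'rV[R]_m := \row_i (if (i < k)%N then y ord0 i else z ord0 i).
have hyb0 : hyb 0%N = z by apply/rowP => i; rewrite mxE.
have hybm : hyb m = y by apply/rowP => i; rewrite mxE ltn_ord.
have hybS (k : 'I_m) : hyb k.+1 = (y ord0 k - z ord0 k) *: delta_mx ord0 k + hyb k.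
  apply/rowP => i; rewrite !mxE eqxx/= ltnS leq_eqVlt.
  have [->|ik] := eqVneq i k; first by rewrite eqxx ltnn/= mulr1 subrK.
  by rewrite (negbTE (ik : (i : nat) != k)) mulr0 add0r.
have near k (t : R) : (k < m)%N -> 0 <= t <= 1 -> forall (kk : 'I_m), k = kk ->
    forall i, `|z ord0 i - (t *: ((y ord0 kk - z ord0 kk) *: delta_mx ord0 kk) + hyb k) ord0 i|
      <= `|y ord0 i - z ord0 i|.
  move=> km /andP[t0 t1] kk kE i; rewrite !mxE eqxx/= kE.
  have [->|ik] := eqVneq i kk.
    rewrite mulr1 ltnn opprD addrC -addrA addNr addr0 normrN normrM ger0_norm//.
    by rewrite ler_piMl.
  by rewrite !mulr0 add0r; case: ifP => _; rewrite ?subrr ?normr0// distrC.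
have step (k : 'I_m) : `|f (hyb k.+1) - f (hyb k) - pderiv k f z * (y ord0 k - z ord0 k)|
    <= e * `|y ord0 k - z ord0 k|.
  set c := y ord0 k - z ord0 k; pose v : 'rV[R]_m := c *: delta_mx ord0 k.
  have nb t : 0 <= t <= 1 -> forall i, `|z ord0 i - (t *: v + hyb k) ord0 i| <= `|y ord0 i - z ord0 i|.
    by move=> t01; exact: (near k t (ltn_ord k) t01 k erefl).
  have inU t : 0 <= t <= 1 -> U (t *: v + hyb k).
    by move=> t01; apply: HU => i; exact: le_lt_trans (nb t t01 i) (zy1 i).
  have D (t : R) : 0 <= t <= 1 -> is_derive t 1 (fun r : R => f (r *: v + hyb k))
      (c * pderiv k f (t *: v + hyb k)).
    move=> t01; have E : (fun r : R => f (r *: v + hyb k)) =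
        (fun q => f (q *: delta_mx ord0 k + hyb k)) \o (fun r => r * c).
      by apply/funext => r /=; rewrite /v scalerA.
    rewrite E; have d1 : is_derive t 1 (fun r : R => r * c) c.
      by apply: is_derive_eq; rewrite /GRing.scale/=; ring.
    have d2 : is_derive (t * c) 1 (fun q : R => f (q *: delta_mx ord0 k + hyb k))
        (pderiv k f (t *: v + hyb k)).
      rewrite /pderiv /v scalerA; apply: is_derive_line.
      by rewrite -scalerA; apply: df; exact: inU.
    have := is_derive1_comp (f := fun q : R => f (q *: delta_mx ord0 k + hyb k)) (g := fun r => r * c).
    by move=> /(_ _ _ _ d2 d1); rewrite [X in is_derive _ _ _ X]mulrC.
  have [t t01 E] := line_mvt D.
  rewrite hybS -/c -/v E mulrC -mulrBl normrM ler_wpM2r// distrC ltW//.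
  by apply: Hc => i; exact: le_lt_trans (nb t t01 i) (zy2 i).
have tel k : (k <= m)%N -> `|f (hyb k) - f z - \sum_(i < m | (i < k)%N) pderiv i f z * (y ord0 i - z ord0 i)|
   <= e * \sum_(i < m | (i < k)%N) `|y ord0 i - z ord0 i|.
  elim: k => [_|k IH km].
    by rewrite !big_pred0 ?hyb0 ?subrr ?subr0 ?normr0 ?mulr0.
  have sumS (F : 'I_m -> R) : \sum_(i < m | (i < k.+1)%N) F i =
      F (Ordinal km) + \sum_(i < m | (i < k)%N) F i.
    rewrite (bigD1 (Ordinal km))//=; congr (_ + _); apply: eq_bigl => i.
    by rewrite ltnS [RHS]ltn_neqAle andbC.
  rewrite !sumS [leRHS]mulrDr; have S := step (Ordinal km).
  rewrite (_ : f (hyb k.+1) - f z - _ = (f (hyb k.+1) - f (hyb k) -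
     pderiv (Ordinal km) f z * (y ord0 (Ordinal km) - z ord0 (Ordinal km))) +
     (f (hyb k) - f z - \sum_(i < m | (i < k)%N) pderiv i f z * (y ord0 i - z ord0 i))); last by ring.
  apply: (le_trans (ler_normD _ _)); apply: lerD; first exact: S.
  by apply: IH; exact: ltnW.
have := tel m (leqnn _); rewrite hybm.
have all (F : 'I_m -> R) : \sum_(i < m | (i < m)%N) F i = \sum_i F i.
  by apply: eq_bigl => i; rewrite ltn_ord.
by rewrite !all.
Qed.

Lemma derive_segment (U : set 'rV[R]_m) f : open U ->
  (forall z, U z -> forall i, derivable f z (delta_mx ord0 i)) ->
  (forall z, U z -> forall i, {for z, continuous (pderiv i f)}) ->
  forall x v (t : R), U (t *: v + x) ->
  is_derive t 1 (fun r : R => f (r *: v + x)) (\sum_i pderiv i f (t *: v + x) * v ord0 i).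
Proof.
move=> oU df cf x v t Uz; set z := t *: v + x.
have cv : h^-1 *: (((fun r : R => f (r *: v + x)) \o shift t) (h *: 1) - f z) @[h --> 0^'] -->
    \sum_i pderiv i f z * v ord0 i.
  apply/cvgrPdist_le => e e0.
  pose V := \sum_i `|v ord0 i| + 1.
  have S0 : 0 <= \sum_i `|v ord0 i| by apply: sumr_ge0.
  have V0 : 0 < V by rewrite ltr_wpDl.
  have [h h0 H] := total_differential oU df cf Uz (divr_gt0 e0 V0).
  exists (h / V) => /=; first by rewrite divr_gt0.
  move=> r /=; rewrite sub0r normrN => rh r0.
  have E i : ((r + t) *: v + x) ord0 i - z ord0 i = r * v ord0 i.
    by rewrite /z !mxE; ring.
  rewrite [_%:A]mulr1 distrC.
  rewrite (_ : _ - \sum_i _ = r^-1 * (f ((r + t) *: v + x) - f z - \sum_i pderiv i f z * (r * v ord0 i))); last first.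
    rewrite [in RHS]mulrBr; congr (_ - _); rewrite mulr_sumr; apply: eq_bigr => i _.
    by rewrite mulrCA mulKf.
  rewrite normrM normfV ler_pdivrMl ?normr_gt0//.
  have -> : \sum_i pderiv i f z * (r * v ord0 i) =
      \sum_i pderiv i f z * (((r + t) *: v + x) ord0 i - z ord0 i).
    by apply: eq_bigr => i _; rewrite E.
  apply: (le_trans (H ((r + t) *: v + x) _)).
    move=> i; rewrite E normrM.
    apply: (@le_lt_trans _ _ (`|r| * V)).
      by rewrite ler_wpM2l// /V (bigD1 i)//= -addrA lerDl addr_ge0// sumr_ge0.
    by rewrite -ltr_pdivlMr.
  under eq_bigr do rewrite E normrM.
  rewrite -mulr_sumr mulrCA ler_wpM2l// mulrAC ler_pdivrMr// ler_pM2l//.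
  by rewrite /V lerDl.
split; first by apply/cvg_ex; eexists; exact: cv.
exact: cvg_lim cv.
Qed.

Definition C2_on (U : set 'rV[R]_m) f :=
  [/\ forall z, U z -> forall i, derivable f z (delta_mx ord0 i),
      forall z, U z -> forall i j, derivable (pderiv j f) z (delta_mx ord0 i),
      forall z, U z -> forall i, {for z, continuous (pderiv i f)} &
      forall z, U z -> forall i j, {for z, continuous (pderiv i (pderiv j f))}].

Lemma sum_abs_sqr (v : 'rV[R]_m) :
  \sum_i \sum_j `|v ord0 i * v ord0 j| <= m%:R * \sum_i v ord0 i ^+ 2.
Proof.
apply: (@le_trans _ _ (\sum_i \sum_j 2^-1 * (v ord0 i ^+ 2 + v ord0 j ^+ 2))).
  by apply: ler_sum => i _; apply: ler_sum => j _; exact: abs_mul_le_sqr.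
rewrite le_eqVlt; apply/orP; left; apply/eqP.
set S := \sum_i _ ^+ 2; under eq_bigr do rewrite -mulr_sumr big_split/= sumr_const card_ord -/S.
rewrite -mulr_sumr big_split/= sumr_const card_ord sumrMnl -/S -mulr_natl.
by rewrite -[S *+ m]mulr_natl; field.
Qed.

(** Second order Taylor formula on a convex open set, with the modulus of
    continuity of the second derivatives as error. *)
Lemma taylor2 (U : set 'rV[R]_m) f x y om : open U -> C2_on U f ->
  (forall t : R, 0 <= t <= 1 -> U (t *: (y - x) + x)) ->
  (forall (t : R) i j, 0 <= t <= 1 ->
     `|pderiv i (pderiv j f) (t *: (y - x) + x) - pderiv i (pderiv j f) x| <= om) ->
  `|f y - f x - \sum_i pderiv i f x * (y ord0 i - x ord0 i) -
    2^-1 * \sum_i \sum_j pderiv i (pderiv j f) x *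
      ((y ord0 i - x ord0 i) * (y ord0 j - x ord0 j))| <= om * m%:R * sqdist x y.
Proof.
move=> oU [d1 d2 c1 c2] seg Hom; set v := y - x.
have vE i : y ord0 i - x ord0 i = v ord0 i by rewrite !mxE.
have om0 : 0 <= om \/ m = 0%N.
  have [m0|m0] := posnP m; [by right|left].
  by apply: le_trans (Hom 0 (Ordinal m0) (Ordinal m0) _); rewrite // lexx ler01.
pose p1 t := \sum_i pderiv i f (t *: v + x) * v ord0 i.
pose p2 t := \sum_j (\sum_i pderiv i (pderiv j f) (t *: v + x) * v ord0 i) * v ord0 j.
pose E := om * m%:R * sqdist x y.
have x0 : 0 *: v + x = x by rewrite scale0r add0r.
have D1 (t : R) : 0 <= t <= 1 -> is_derive t 1 (fun r : R => f (r *: v + x)) (p1 t).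
  by move=> t01; apply: (derive_segment oU d1 c1); exact: seg.
have D2 (t : R) : 0 <= t <= 1 -> is_derive t 1 p1 (p2 t).
  move=> t01.
  have Dj j : is_derive t 1 (fun r : R => pderiv j f (r *: v + x) * v ord0 j)
      ((\sum_i pderiv i (pderiv j f) (t *: v + x) * v ord0 i) * v ord0 j).
    have := derive_segment oU (fun z Uz i => d2 z Uz i j) (fun z Uz i => c2 z Uz i j) (seg t t01).
    move=> dj; apply: is_derive_eq; rewrite /GRing.scale/=; ring.
  have -> : p1 = \sum_j (fun r : R => pderiv j f (r *: v + x) * v ord0 j).
    by apply/funext => r; rewrite fct_sumE.
  by apply: is_derive_sum => j; exact: Dj.
have B2 (t : R) : 0 <= t <= 1 -> `|p2 t - p2 0| <= E.
  move=> t01; rewrite /p2 -sumrB; apply: (@le_trans _ _ (om * \sum_i \sum_j `|v ord0 i * v ord0 j|)).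
    rewrite mulr_sumr; apply: (le_trans (ler_norm_sum _ _ _)); apply: ler_sum => j _.
    rewrite -mulrBl -sumrB mulr_suml mulr_sumr; apply: (le_trans (ler_norm_sum _ _ _)).
    apply: ler_sum => i _; rewrite -mulrBl -mulrA normrM (mulrC (v _ j)) ler_wpM2r//.
    by rewrite x0; exact: Hom.
  have [omp|m0] := om0.
    rewrite /E -mulrA ler_wpM2l//; apply: (le_trans (sum_abs_sqr v)).
    by rewrite /sqdist; under [in leRHS]eq_bigr do rewrite vE.
  rewrite big1 ?mulr0; last by move=> i _; exfalso; case: i; rewrite m0.
  by have m00 : m%:R = 0 :> R by [rewrite m0]; rewrite /E m00 mulr0 mul0r.
have E0 : 0 <= E by apply: le_trans (B2 0 _); rewrite // lexx ler01.
(* integrate the bound on the second derivative twice *)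
have mvt (q q' : R -> R) (t : R) : 0 <= t <= 1 ->
    (forall r : R, 0 <= r <= 1 -> is_derive r 1 q (q' r)) ->
    (forall r : R, 0 <= r <= 1 -> `|q' r| <= E) -> q 0 = 0 -> `|q t| <= E.
  move=> /andP[t0 t1] dq q'E q0.
  have [r] : exists2 r, r \in `[0, t] & q t - q 0 = q' r * (t - 0).
    apply: MVT_segment => // [r|].
      rewrite in_itv/= => /andP[r0 rt]; apply: dq.
      by rewrite (ltW r0) (le_trans (ltW rt)).
    apply: derivable_within_continuous => r; rewrite in_itv/= => /andP[r0 rt].
    by have [] := dq r; rewrite // r0 (le_trans rt).
  rewrite in_itv/= => /andP[r0 rt]; rewrite q0 !subr0 => ->.
  rewrite normrM (ger0_norm t0) -[leRHS]mulr1 ler_pM// q'E// r0.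
  exact: le_trans t1.
pose q1 (t : R) := p1 t - p1 0 - t * p2 0.
have Dq1 (t : R) : 0 <= t <= 1 -> is_derive t 1 q1 (p2 t - p2 0).
  move=> t01; have := D2 t t01 => dp; apply: is_derive_eq.
  by rewrite subr0 scaler0 add0r [_%:A]mulr1.
have q1E (t : R) : 0 <= t <= 1 -> `|q1 t| <= E.
  move=> t01; apply: (mvt q1 (fun t => p2 t - p2 0)) => //.
  by rewrite /q1 mul0r subr0 subrr.
pose q0 (t : R) := f (t *: v + x) - f x - t * p1 0 - 2^-1 * t ^+ 2 * p2 0.
have Dq0 (t : R) : 0 <= t <= 1 -> is_derive t 1 q0 (q1 t).
  move=> t01; have := D1 t t01 => dp; apply: is_derive_eq.
  rewrite /q1; move: (p1 t) (p1 0) (p2 0) => a c e; rewrite /GRing.scale/=.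
  by field.
have := mvt q0 q1 1 _ Dq0 q1E; rewrite lexx ler01 => /(_ isT).
rewrite /q0 x0 => H.
have {H} := H _; rewrite subrr mul0r expr0n/= mulr0 mul0r !subr0 => /(_ erefl).
rewrite /v scale1r subrK -/v /E mul1r expr1n mulr1 /p1 /p2 x0.
congr (`|_ - _ - _ * _| <= _).
  by apply: eq_bigr => i _; rewrite vE.
rewrite exchange_big/=; apply: eq_bigr => j _; rewrite mulr_suml.
by apply: eq_bigr => i _; rewrite !vE; ring.
Qed.

End directional.

(** * Chambers *)

Section chambers.
Context {R : realType} {m : nat}.
Implicit Types (s : 'S_m) (x y z : 'rV[R]_m).

Definition closed_chamber s : set 'rV[R]_m :=
  [set x | forall a b : 'I_m, (a <= b)%N -> x ord0 (s a) <= x ord0 (s b)].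

Lemma chamber_closed s x : chamber s x -> closed_chamber s x.
Proof.
move=> cx a b; rewrite leq_eqVlt => /orP[/eqP/val_inj->//|ab].
exact/ltW/cx.
Qed.

(** A point of the open chamber; adding a small multiple of it moves the closed
    chamber into the open one. *)
Definition spread s : 'rV[R]_m := \row_i ((s^-1)%g i : nat)%:R.

Lemma spread_chamber s x e : 0 < e -> closed_chamber s x -> chamber s (e *: spread s + x).
Proof.
move=> e0 cx a b ab; rewrite !mxE !permK ltr_leD ?cx 1?ltnW// ltr_pM2l//.
by rewrite ltr_nat.
Qed.

Lemma closure_chamber s : closure (chamber s) = closed_chamber s.
Proof.
apply/seteqP; split => x.
  move=> clx a b ab; rewrite leNgt; apply/negP => xba.
  have h0 : 0 < (x ord0 (s a) - x ord0 (s b)) / 2 by rewrite divr_gt0// subr_gt0.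
  have [] := clx [set y | forall i, `|x ord0 i - y ord0 i| < (x ord0 (s a) - x ord0 (s b)) / 2].
    by apply/nbhs_rVP; exists ((x ord0 (s a) - x ord0 (s b)) / 2).
  move=> y [/chamber_closed/(_ a b ab) yab xy].
  have := xy (s a); have := xy (s b); rewrite !ltr_norml => /andP[? ?] /andP[? ?].
  lra.
move=> cx B /nbhs_rVP[h h0 HB]; exists (h / m.+1%:R *: spread s + x); split.
  by apply: spread_chamber => //; rewrite divr_gt0.
apply: HB => i; rewrite !mxE opprD addrCA subrr addr0 normrN ger0_norm; last first.
  by rewrite mulr_ge0// divr_ge0// ltW.
rewrite mulrAC ltr_pdivrMr// ltr_pM2l// ltr_nat; apply: leq_trans (ltn_ord _) _.
exact: leqnSn.
Qed.

Lemma open_chamber s : open (chamber s : set 'rV[R]_m).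
Proof.
rewrite openE => x cx; apply/nbhs_rVP.
have [|p h h' h'h Q y xy|h h0 H] := @common_threshold R ('I_m * 'I_m)%type
   (fun p h => forall y, (forall i, `|x ord0 i - y ord0 i| < h) -> (p.1 < p.2)%N ->
      y ord0 (s p.1) < y ord0 (s p.2)).
- move=> [a b] /=; have [ab|nab] := boolP (a < b)%N; last by exists 1.
  have xab := cx a b ab; exists ((x ord0 (s b) - x ord0 (s a)) / 2).
    by rewrite divr_gt0// subr_gt0.
  move=> y xy _; have := xy (s a); have := xy (s b).
  by rewrite !ltr_norml => /andP[? ?] /andP[? ?]; lra.
- by apply: Q => i; exact: lt_le_trans (xy i) h'h.
by exists h => // y xy a b ab; exact: (H (a, b) y xy ab).
Qed.

Lemma chamber_convex s x y (t : R) : 0 <= t <= 1 -> chamber s x -> chamber s y ->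
  chamber s (t *: (y - x) + x).
Proof.
move=> /andP[t0 t1] cx cy a b ab; rewrite !mxE.
have := cx a b ab; have := cy a b ab.
move: (x _ (s a)) (x _ (s b)) (y _ (s a)) (y _ (s b)) => p q p' q' pq' pq.
rewrite -subr_gt0 (_ : _ - _ = t * (q' - p') + (1 - t) * (q - p)); last by ring.
have [->|tn0] := eqVneq t 0; first by rewrite mul0r add0r subr0 mul1r subr_gt0.
rewrite ltr_pwDl//; first by rewrite mulr_gt0 ?subr_gt0// lt_neqAle eq_sym tn0.
by rewrite mulr_ge0 ?subr_ge0// ltW.
Qed.

Lemma sorting_permutation x : exists s, closed_chamber s x.
Proof.
pose le (i j : 'I_m) := x ord0 i <= x ord0 j.
have le_tot : total le by move=> i j; exact: le_total.
have le_tr : transitive le by move=> j i k; exact: le_trans.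
have /tuple_permP[s sE] : perm_eq (sort le (ord_tuple m)) (ord_tuple m).
  by rewrite perm_sort.
exists s => a b ab; have so := sort_sorted le_tot (ord_tuple m).
have nthE (c : 'I_m) : nth a (sort le (ord_tuple m)) c = s c.
  by rewrite sE -tnth_nth tnth_mktuple tnth_ord_tuple.
have := sorted_leq_nth le_tr (fun i => lexx _) a so.
have sz (c : 'I_m) : (c < size (sort le (ord_tuple m)))%N.
  by rewrite size_sort size_tuple.
by move=> /(_ a b (sz a) (sz b) ab); rewrite !nthE.
Qed.

Lemma cone_chamber s x : closed_chamber s x -> cone x `<=` closed_chamber s.
Proof. by move=> cx y cy a b ab; apply: cy; exact: cx. Qed.

(** Running maxima along the order prescribed by [s] turn a function defined on
    the closed chamber into one defined everywhere. *)
Definition retract s x : 'rV[R]_m :=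
  \row_i \big[Num.max/x ord0 i]_(c < m | (c <= (s^-1)%g i)%N) x ord0 (s c).

Lemma retract_in s x : closed_chamber s (retract s x).
Proof.
move=> a b ab; rewrite !mxE !permK; apply: bigmax_le => [|c ca].
  by apply: le_trans (le_bigmax_cond _ _ ab).
by apply: (le_bigmax_cond _ (fun c => x ord0 (s c))); exact: leq_trans ab.
Qed.

Lemma retract_id s x : closed_chamber s x -> retract s x = x.
Proof.
move=> cx; apply/rowP => i; rewrite mxE; apply/le_anti/andP; split.
  by apply: bigmax_le => // c ci; rewrite -[in leRHS](permKV s i); exact: cx.
exact: bigmax_ge_id.
Qed.

Lemma continuous_rV (T : topologicalType) (f : T -> 'rV[R]_m) :
  (forall i, continuous (fun x : T => f x ord0 i)) -> continuous f.
Proof.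
move=> cf x; apply/cvg_ballP => e e0.
have : \forall y \near x, forall i, `|f x ord0 i - f y ord0 i| < e.
  by apply: filter_forall => i; have /cvgrPdist_lt/(_ e e0) := cf i x.
by apply: filterS => y xy; exact/ball_rV.
Qed.

Lemma coordinate_continuous i : continuous (fun x : 'rV[R]_m => x ord0 i).
Proof. exact: coord_continuous. Qed.

Lemma retract_continuous s : continuous (retract s).
Proof.
apply: continuous_rV => i.
have -> : (fun x => retract s x ord0 i) = (fun x =>
   \big[Num.max/x ord0 i]_(c < m | (c <= (s^-1)%g i)%N) x ord0 (s c)).
  by apply/funext => x; rewrite mxE.
elim: (index_enum _) => [|c r IH].
  by rewrite (_ : (fun _ => _) = (fun x => x ord0 i)); [exact: coordinate_continuous
    |apply/funext => x; rewrite big_nil].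
have [ci|nci] := boolP (c <= (s^-1)%g i)%N; last first.
  rewrite (_ : (fun _ => _) = (fun x =>
    \big[Num.max/x ord0 i]_(c <- r | (c <= (s^-1)%g i)%N) x ord0 (s c)))//.
  by apply/funext => x; rewrite big_cons (negbTE nci).
rewrite (_ : (fun _ => _) = (fun x => x ord0 (s c)) \max (fun x =>
    \big[Num.max/x ord0 i]_(c <- r | (c <= (s^-1)%g i)%N) x ord0 (s c))).
  by move=> x; apply: continuous_max; [exact: coordinate_continuous|exact: IH].
by apply/funext => x; rewrite big_cons ci.
Qed.

Lemma unif_continuous_cvg (U V : uniformType) (f : U -> V) :
  unif_continuous f -> continuous f.
Proof.
move=> uf x; apply/cvg_entourageP => E entE.
have := uf E entE => /= entE'.
by apply/nbhsP; exists ((fun xy => (f xy.1, f xy.2)) @^-1` E) => // y /xsectionP.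
Qed.

Lemma uc_extension_continuous s g h : uc_extension (chamber s) g h ->
  continuous (fun x => h (retract s x)).
Proof.
move=> [_ /unif_continuous_cvg ch].
have mem x : retract s x \in closure (chamber s).
  by rewrite closure_chamber; apply/mem_set; exact: retract_in.
pose q x : set_type (closure (chamber s)) := exist _ (retract s x) (mem x).
have cq : continuous q by apply: continuous_comp_initial; exact: retract_continuous.
by move=> x; exact: (continuous_comp (cq x) (ch (q x))).
Qed.

(** Near the face, a monotone change of all coordinates merges the two given
    ones, which leads to a nearby zero of [h] inside the closed chamber. *)
Lemma diag_modulus s (h : 'rV[R]_m -> R) i j : continuous h ->
  (forall x, closed_chamber s x -> x ord0 i = x ord0 j -> h x = 0) ->
  forall N e, 0 < e -> exists2 r, 0 < r & forall x, closed_chamber s x ->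
    (forall k, `|x ord0 k| <= N) -> `|x ord0 i - x ord0 j| <= r -> `|h x| <= e.
Proof.
move=> ch h0 N e e0; have [r r0 H] := box_unif_continuous N ch e0.
exists r => // x cx xN xr.
wlog xij : i j h0 xr / x ord0 i <= x ord0 j => [W|].
  have [|/ltW] := lerP (x ord0 i) (x ord0 j); first exact: W.
  by apply: W; rewrite 1?distrC// => y cy yji; apply: h0.
pose de := x ord0 j - x ord0 i.
have de0 : 0 <= de by rewrite subr_ge0.
have der : de <= r by move: xr; rewrite distrC ger0_norm.
(* the identity up to [x_i], then constant over the gap, then the translation
   by [- de] *)
pose phi p := Num.max (Num.min p (x ord0 i)) (p - de).
have phi_mono p q : p <= q -> phi p <= phi q.
  move=> pq; rewrite /phi ge_max; apply/andP; split; rewrite le_max.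
    by rewrite le_min !ge_min pq lexx orbT.
  by rewrite lerD2r pq orbT.
have phi_near p : `|p - phi p| <= r.
  rewrite ger0_norm; first apply: le_trans der.
    by rewrite lerBlDl -lerBlDr le_max lexx orbT.
  by rewrite subr_ge0 ge_max ge_min lexx/= lerBlDr lerDl.
pose x' : 'rV[R]_m := \row_k phi (x ord0 k).
have hx' : h x' = 0.
  apply: h0 => [a b ab|]; first by rewrite !mxE; apply: phi_mono; exact: cx.
  rewrite !mxE /phi /de min_l// min_r// max_l; last by rewrite lerBlDr lerDl.
  by rewrite opprB addrCA subrr addr0 maxxx.
rewrite -[h x]subr0 -hx' distrC; apply: H => // k.
by rewrite mxE distrC.
Qed.

End chambers.

(** * Smooth functions on a closed chamber *)

Section smooth_chamber.
Context {R : realType} {m : nat}.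
Implicit Types (s : 'S_m) (x y z : 'rV[R]_m).

(** The extensions [g] and [H] of the derivatives are functions on the whole
    space, so that they can be composed with the state of a process at every
    sample point. *)
Record smooth_chamber s (f : 'rV[R]_m -> R) (g : 'I_m -> 'rV[R]_m -> R)
    (H : 'I_m -> 'I_m -> 'rV[R]_m -> R) (M : R) : Prop := SmoothChamber {
  sc_C2 : C2_on (chamber s) f;
  sc_cont : continuous f;
  sc_gcont : forall i, continuous (g i);
  sc_Hcont : forall i j, continuous (H i j);
  sc_le : forall x, `|f x| <= M;
  sc_gle : forall i x, `|g i x| <= M;
  sc_Hle : forall i j x, `|H i j x| <= M;
  sc_g : forall i x, chamber s x -> g i x = pderiv i f x;
  sc_H : forall i j x, chamber s x -> H i j x = pderiv i (pderiv j f) x;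
  sc_diag : forall i j x, i != j -> closed_chamber s x -> x ord0 i = x ord0 j ->
    H i j x = 0 }.

Lemma sqdist_shift v x y : sqdist (v + x) (v + y) = sqdist x y.
Proof. by apply: eq_bigr => i _; rewrite !mxE; congr (_ ^+ 2); ring. Qed.

Lemma sqdist_ge0 x y : 0 <= sqdist x y.
Proof. by apply: sumr_ge0 => i _; exact: sqr_ge0. Qed.

Lemma translate_cvg x y : (n.+1%:R^-1 : R) *: y + x @[n --> \oo] --> x.
Proof.
rewrite -[X in _ --> X]add0r -(scale0r y); apply: cvgD; last exact: cvg_cst.
by apply: cvgZl; exact: cvg_harmonic.
Qed.

Section one_chamber.
Variables (s : 'S_m) (f : 'rV[R]_m -> R) (g : 'I_m -> 'rV[R]_m -> R)
  (H : 'I_m -> 'I_m -> 'rV[R]_m -> R) (M : R).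
Hypothesis S : smooth_chamber s f g H M.

Let rem := jet_rem f g H.

Lemma rem_shift_cvg v x y : rem (n.+1%:R^-1 *: v + x) (n.+1%:R^-1 *: v + y) @[n --> \oo] --> rem x y.
Proof.
have co i n : (n.+1%:R^-1 *: v + y) ord0 i - (n.+1%:R^-1 *: v + x) ord0 i = y ord0 i - x ord0 i.
  by rewrite !mxE; ring.
have comp (h : 'rV[R]_m -> R) z : continuous h -> h (n.+1%:R^-1 *: v + z) @[n --> \oo] --> h z.
  by move=> ch; apply: continuous_cvg; [exact: ch|exact: translate_cvg].
rewrite /rem /jet_rem; apply: cvgB.
  apply: cvgB; first by apply: cvgB; apply: comp; exact: (sc_cont S).
  apply: cvg_big => [|i _]; first exact: add_continuous.
  under eq_fun do rewrite co.
  by apply: cvgM; [apply: comp; exact: (sc_gcont S)|exact: cvg_cst].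
apply: cvgM; first exact: cvg_cst.
apply: cvg_big => [|i _]; first exact: add_continuous.
apply: cvg_big => [|j _]; first exact: add_continuous.
under eq_fun do rewrite !co.
by apply: cvgM; [apply: comp; exact: (sc_Hcont S)|exact: cvg_cst].
Qed.

Lemma open_rem_le x y om : chamber s x -> chamber s y ->
  (forall (t : R) i j, 0 <= t <= 1 ->
     `|H i j (t *: (y - x) + x) - H i j x| <= om) ->
  `|rem x y| <= om * m%:R * sqdist x y.
Proof.
move=> cx cy Hom; have seg (t : R) : 0 <= t <= 1 -> chamber s (t *: (y - x) + x).
  by move=> t01; exact: chamber_convex.
have := taylor2 (@open_chamber R m s) (sc_C2 S) seg => /(_ om).
rewrite /rem /jet_rem => T.
under eq_bigr do rewrite (sc_g S)//.
under [X in _ - 2^-1 * X]eq_bigr do under eq_bigr do rewrite (sc_H S)//.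
by apply: T => t i j t01; rewrite -!(sc_H S)//; [exact: Hom|exact: seg].
Qed.

(** Taylor's bound passes to the boundary: translating into the open chamber
    does not change the increment. *)
Lemma closed_rem_le x y om : closed_chamber s x -> closed_chamber s y -> 0 <= om ->
  (\forall n \near \oo, forall (t : R) i j, 0 <= t <= 1 ->
     let e := n.+1%:R^-1 *: spread s in
     `|H i j (t *: (y - x) + (e + x)) - H i j (e + x)| <= om) ->
  `|rem x y| <= om * m%:R * sqdist x y.
Proof.
move=> cx cy om0 Hom; have cv : `|rem (n.+1%:R^-1 *: spread s + x) (n.+1%:R^-1 *: spread s + y)| @[n --> \oo]
    --> `|rem x y| by apply: cvg_norm; exact: rem_shift_cvg.
rewrite -(cvg_lim (@Rhausdorff R) cv); apply: limr_le.
  by apply/cvg_ex; eexists; exact: cv.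
apply: filterS Hom => n Hom; set e := n.+1%:R^-1 *: spread s.
rewrite -(sqdist_shift e); apply: open_rem_le.
- exact: spread_chamber.
- exact: spread_chamber.
move=> t i j t01; rewrite (_ : e + y - (e + x) = y - x); first exact: Hom.
by rewrite opprD addrACA subrr add0r.
Qed.

Lemma smooth_M_ge0 : 0 <= M.
Proof. exact: le_trans (normr_ge0 _) (sc_le S 0). Qed.

Lemma smooth_jets : jets (closed_chamber s) f g H
  (M + 2 * M * m%:R).
Proof.
have M0 := smooth_M_ge0.
have M1 : M <= M + 2 * M * m%:R by rewrite lerDl !mulr_ge0.
split => [|i|i j|x|i x|i j x|x y cx cy|N e e0|N e e0].
- exact: (sc_cont S).
- exact: (sc_gcont S).
- exact: (sc_Hcont S).
- exact: le_trans (sc_le S x) M1.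
- exact: le_trans (sc_gle S i x) M1.
- exact: le_trans (sc_Hle S i j x) M1.
- apply: (@le_trans _ _ (2 * M * m%:R * sqdist x y)); last first.
    by rewrite ler_wpM2r ?sqdist_ge0// lerDr.
  apply: closed_rem_le => //; first by rewrite mulr_ge0.
  apply: nearW => n t i j _ /=; apply: (le_trans (ler_normB _ _)).
  by rewrite mulrDl mul1r lerD// (sc_Hle S).
- have m1 : 0 < m%:R + 1 :> R by rewrite ltr_wpDl.
  have [|p h h' h'h Q x y xN xy|h h0 Hh] := @common_threshold R ('I_m * 'I_m)%type (fun p h =>
     forall x y, (forall i, `|x ord0 i| <= N + 1) -> (forall i, `|y ord0 i - x ord0 i| <= h) ->
      `|H p.1 p.2 y - H p.1 p.2 x| <= e / (m%:R + 1)).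
  + by move=> p; apply: box_unif_continuous; [exact: (sc_Hcont S)|exact: divr_gt0].
  + by apply: Q => // i; exact: le_trans (xy i) h'h.
  exists h => // x y cx cy xN xy.
  apply: (@le_trans _ _ (e / (m%:R + 1) * m%:R * sqdist x y)); last first.
    rewrite ler_wpM2r ?sqdist_ge0// mulrAC ler_pdivrMr// ler_pM2l//.
    by rewrite lerDl.
  apply: closed_rem_le => //; first by rewrite divr_ge0// ltW.
  have : \forall n \near \oo, forall i, `|(n.+1%:R^-1 *: spread s : 'rV[R]_m) ord0 i| <= 1.
    exists m => // n /= mn i; rewrite !mxE ger0_norm ?mulr_ge0//.
    rewrite mulrC ler_pdivrMr// mul1r ler_nat; apply: ltnW; apply: leq_trans (ltn_ord _) _.
    exact: leqW.
  apply: filterS => n en t i j /andP[t0 t1] /=; apply: (Hh (i, j)) => k.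
    rewrite mxE; apply: (le_trans (ler_normD _ _)); rewrite addrC lerD ?xN//.
  rewrite mxE addrK !mxE normrM ger0_norm//; apply: le_trans (xy k).
  by rewrite ler_piMl.
- have [|p h h' h'h Q x pn cx xN xh|h h0 Hh] := @common_threshold R ('I_m * 'I_m)%type (fun p h =>
     forall x, p.1 != p.2 -> closed_chamber s x -> (forall i, `|x ord0 i| <= N) ->
       `|x ord0 p.1 - x ord0 p.2| <= h -> `|H p.1 p.2 x| <= e).
  + move=> [i j] /=; have [->|ij] := eqVneq i j; first by exists 1.
    have cH : continuous (H i j) by exact: (sc_Hcont S).
    have H0 x : closed_chamber s x -> x ord0 i = x ord0 j -> H i j x = 0.
      exact: (sc_diag S).
    have [r r0 Hr] := diag_modulus cH H0 N e0.
    by exists r => // x _; exact: Hr.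
  + by apply: Q => //; exact: le_trans h'h.
  by exists h => // x i j ij cx; exact: (Hh (i, j)).
Qed.

(** Moving a block of coinciding coordinates together stays inside every chamber
    containing the point; the mixed derivatives inside the block vanish there. *)
Lemma block_second_difference x i : closed_chamber s x -> forall e, 0 < e ->
  exists2 h, 0 < h & forall t, 0 < t -> t <= h ->
    let v : 'rV[R]_m := \row_k (x ord0 k == x ord0 i)%:R in
    `|f (t *: v + x) + f (- t *: v + x) - 2 * f x -
      t ^+ 2 * \sum_(k | x ord0 k == x ord0 i) H k k x| <= e * t ^+ 2.
Proof.
move=> cx e e0; set v : 'rV[R]_m := \row_k _.
have v01 k : 0 <= v ord0 k <= 1 by rewrite mxE; case: (_ == _); rewrite ?lexx ?ler01.
have [|p h h' h'h Q|h1 h10 H1] := @common_threshold R ('I_m * 'I_m)%type (fun p h =>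
   x ord0 p.1 < x ord0 p.2 -> 2 * h <= x ord0 p.2 - x ord0 p.1).
- move=> [a b] /=; have [ab|ba] := ltrP (x ord0 a) (x ord0 b); last by exists 1.
  exists ((x ord0 b - x ord0 a) / 2); first by rewrite divr_gt0// subr_gt0.
  by move=> _; rewrite mulrC divfK.
- by move=> /Q; apply: le_trans; rewrite ler_pM2l.
have stay t : `|t| <= h1 -> closed_chamber s (t *: v + x).
  move=> th a b ab; rewrite !mxE.
  have := cx a b ab; rewrite le_eqVlt => /orP[/eqP->//|xab].
  have := H1 (_, _) xab => /=.
  have : `|t * (x ord0 (s a) == x ord0 i)%:R| <= h1.
    by case: (_ == _); rewrite ?mulr1// mulr0 normr0 ltW.
  have : `|t * (x ord0 (s b) == x ord0 i)%:R| <= h1.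
    by case: (_ == _); rewrite ?mulr1// mulr0 normr0 ltW.
  by rewrite !ler_norml => /andP[? ?] /andP[? ?] ?; lra.
pose N := \sum_k `|x ord0 k|.
have xN k : `|x ord0 k| <= N by rewrite /N (bigD1 k)//= lerDl sumr_ge0.
have m2 : 0 < 2 * m%:R + 1 :> R by rewrite ltr_wpDl// mulr_ge0.
have [h2 h20 H2] := jrem_small smooth_jets N (divr_gt0 e0 m2).
exists (Num.min h1 h2); first by rewrite lt_min h10.
move=> t t0; rewrite le_min => /andP[th1 th2].
have dl (q : R) k : (q *: v + x) ord0 k - x ord0 k = q * v ord0 k by rewrite !mxE; ring.
have near (q : R) : `|q| = t -> `|rem x (q *: v + x)| <= e / (2 * m%:R + 1) * (t ^+ 2 * m%:R).
  move=> qt; have cq : closed_chamber s (q *: v + x) by apply: stay; rewrite qt.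
  apply: (le_trans (H2 x _ cx cq xN _)).
    move=> k; rewrite dl normrM qt; apply: le_trans th2.
    by have /andP[v0 v1] := v01 k; rewrite ger0_norm// ler_piMr// ltW.
  rewrite ler_wpM2l ?divr_ge0 ?(ltW e0) ?(ltW m2)//.
  rewrite /sqdist; under eq_bigr do rewrite dl exprMn -(real_normK (num_real q)) qt.
  rewrite -mulr_sumr ler_wpM2l ?sqr_ge0//.
  apply: (@le_trans _ _ (\sum_(k < m) 1)); last by rewrite sumr_const card_ord.
  by apply: ler_sum => k _; have /andP[v0 v1] := v01 k; rewrite exprn_ile1.
have E : f (t *: v + x) + f (- t *: v + x) - 2 * f x -
      t ^+ 2 * \sum_(k | x ord0 k == x ord0 i) H k k x = rem x (t *: v + x) + rem x (- t *: v + x).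
  have quad (q : R) : \sum_k \sum_l H k l x * (((q *: v + x) ord0 k - x ord0 k) *
      ((q *: v + x) ord0 l - x ord0 l)) = q ^+ 2 * \sum_(k | x ord0 k == x ord0 i) H k k x.
    rewrite [in RHS]big_mkcond mulr_sumr; apply: eq_bigr => k _.
    rewrite (bigD1 k)//= big1 => [|l lk].
      by rewrite addr0 !dl mxE; case: (_ == _); rewrite ?mulr1 ?mulr0//; ring.
    rewrite !dl !mxE; have [xk|] := eqVneq (x ord0 k) (x ord0 i); last by rewrite mulr0 mul0r mulr0.
    have [xl|] := eqVneq (x ord0 l) (x ord0 i); last by rewrite !mulr0.
    by rewrite (sc_diag S) ?mul0r 1?eq_sym// xk xl.
  have lin (q : R) : \sum_k g k x * ((q *: v + x) ord0 k - x ord0 k) = q * \sum_k g k x * v ord0 k.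
    by rewrite mulr_sumr; apply: eq_bigr => k _; rewrite dl; ring.
  by rewrite /rem /jet_rem !quad !lin sqrrN; field.
rewrite /= E; apply: (le_trans (ler_normD _ _)).
apply: (le_trans (lerD (near t _) (near (- t) _))); rewrite ?normrN ?gtr0_norm//.
rewrite [leLHS](_ : _ = e * ((2 * m%:R) / (2 * m%:R + 1)) * t ^+ 2); last first.
  by field; exact: lt0r_neq0.
rewrite ler_wpM2r ?sqr_ge0// ler_piMr ?(ltW e0)// ler_pdivrMr// mul1r lerDl.
by [].
Qed.

End one_chamber.

(** By [block_second_difference] the pure second derivatives of a block of
    coinciding coordinates add up to a second difference of [f] itself. *)
Lemma trace_indep s s' f g H M g' H' M' x :
  smooth_chamber s f g H M -> smooth_chamber s' f g' H' M' ->
  closed_chamber s x -> closed_chamber s' x -> \sum_i H i i x = \sum_i H' i i x.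
Proof.
move=> S S' cx cx'; pose de k := H k k x - H' k k x.
have block i : \sum_(k | x ord0 k == x ord0 i) de k = 0.
  apply/eqP; rewrite -normr_le0; apply/ler_addgt0Pr => e e0; rewrite add0r.
  have e20 : 0 < e / 2 by rewrite divr_gt0.
  have [h h0 Hh] := block_second_difference S i cx e20.
  have [h' h'0 Hh'] := block_second_difference S' i cx' e20.
  pose t := Num.min h h'; have t0 : 0 < t by rewrite lt_min h0.
  have := Hh t t0; rewrite ge_min lexx => /(_ isT) /= A.
  have := Hh' t t0; rewrite ge_min lexx orbT => /(_ isT) /= B.
  rewrite sumrB; move: A B; set D := f _ + _ - _; set U := \sum_(k | _) H _ _ _.
  set V := \sum_(k | _) H' _ _ _ => A B.
  have t20 : 0 < t ^+ 2 by rewrite exprn_gt0.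
  rewrite -(ler_pM2r t20) -[X in _ * X]gtr0_norm// -normrM.
  rewrite (_ : (U - V) * t ^+ 2 = (D - t ^+ 2 * V) - (D - t ^+ 2 * U)); last by ring.
  apply: (le_trans (ler_normB _ _)); apply: (le_trans (lerD B A)).
  by rewrite -mulrDl -splitr.
apply/eqP; rewrite -subr_eq0 -sumrB; apply/eqP.
(* each coordinate is weighted by the inverse of the size of its block *)
pose w k : R := (\sum_(i | x ord0 i == x ord0 k) 1)^-1.
have wE k : \sum_(i | x ord0 i == x ord0 k) w i = 1.
  rewrite (eq_bigr (fun=> w k * 1)) => [|i /eqP xik]; last by rewrite mulr1 /w xik.
  rewrite -mulr_sumr mulVf// gt_eqF// (bigD1 k)//= ltr_pwDl// sumr_ge0//.
transitivity (\sum_k \sum_i if x ord0 i == x ord0 k then w i * de k else 0).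
  by apply: eq_bigr => k _; rewrite -big_mkcond -mulr_suml wE mul1r.
rewrite exchange_big big1//= => i _; rewrite -big_mkcond.
rewrite (eq_bigl (fun k => x ord0 k == x ord0 i)) => [|k]; last by rewrite eq_sym.
by rewrite -mulr_sumr block mulr0.
Qed.

End smooth_chamber.

(** * The operator *)

Section operator.
Context {R : realType}.

Lemma continuous_sum (T : topologicalType) (I : Type) (r : seq I) (F : I -> T -> R) :
  (forall i, continuous (F i)) -> continuous (fun x => \sum_(i <- r) F i x).
Proof.
by move=> cF x; apply: cvg_big => [|i _]; [exact: add_continuous|exact: cF].
Qed.

Lemma continuous_scale (T : topologicalType) (h : T -> R) c : continuous h ->
  continuous (fun x => c * h x).
Proof. by move=> ch x; apply: cvgM; [exact: cvg_cst|exact: ch]. Qed.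

Lemma near_gt_norm (T : topologicalType) (h : T -> R) x c : continuous h -> c < `|h x| ->
  \forall y \near x, c < `|h y|.
Proof.
move=> ch hx; have e0 : 0 < `|h x| - c by rewrite subr_gt0.
have /cvgrPdist_lt/(_ _ e0) := ch x; apply: filterS => y.
have := ler_normD (h x - h y) (h y); rewrite subrK.
by move: (`|h x|) (`|h y|) (`|h x - h y|) => p q r; lra.
Qed.

Lemma near_close (T : topologicalType) (h : T -> R) x e : continuous h -> 0 < e ->
  \forall y \near x, `|h x - h y| <= e.
Proof. by move=> ch e0; have /cvgrPdist_le/(_ e e0) := ch x. Qed.

Section dimension.
Context {m : nat}.
Implicit Types (s : 'S_m) (x y z : 'rV[R]_m).

Definition smooth (f : 'rV[R]_m -> R) :=
  forall s, exists g H M, smooth_chamber s f g H M.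

(** The uniformly continuous extensions to the closed chamber are continued to
    the whole space by [retract]. *)
Lemma D0_smooth (f : 'rV[R]_m -> R) : D0 f -> smooth f.
Proof.
move=> [[cf [M0 fM0]] C2 ext1 ext2] s.
have [d1 d2 dc [M1 M1f]] := C2 s.
have /choice[g' gE] := ext1 s.
have /choice[H' HE] : forall p : 'I_m * 'I_m, exists h,
    uc_extension (chamber s) (pderiv p.1 (pderiv p.2 f)) h /\
    (p.1 != p.2 -> forall x, closure (chamber s) x -> x ord0 p.1 = x ord0 p.2 -> h x = 0).
  by move=> [i j]; have [h h1 h2] := ext2 s i j; exists h.
pose g i x := g' i (retract s x); pose H i j x := H' (i, j) (retract s x).
have cg i : continuous (g i) by exact: uc_extension_continuous (gE i).
have cH i j : continuous (H i j) by exact: uc_extension_continuous (HE (i, j)).1.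
have gpd i x : chamber s x -> g i x = pderiv i f x.
  move=> cx; rewrite /g retract_id; last exact: chamber_closed.
  by apply: (gE i).1.
have Hpd i j x : chamber s x -> H i j x = pderiv i (pderiv j f) x.
  move=> cx; rewrite /H retract_id; last exact: chamber_closed.
  by apply: (HE (i, j)).1.1.
have closed_le (h : 'rV[R]_m -> R) : continuous h -> (forall x, chamber s x -> `|h x| <= M1) ->
    forall x, closed_chamber s x -> `|h x| <= M1.
  move=> ch hM x cx; rewrite leNgt; apply/negP => hx.
  have := cx; rewrite -closure_chamber => /(_ [set y | M1 < `|h y|]) [].
    exact: (@near_gt_norm _ h x _ ch hx).
  by move=> y [/hM + /=]; rewrite leNgt => /negP.
have gM i x : `|g i x| <= M1.
  rewrite /g -(retract_id (retract_in s x)); apply: closed_le (cg i) _ _ (retract_in s x).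
  by move=> y cy; rewrite gpd//; have [] := M1f y cy.
have HM i j x : `|H i j x| <= M1.
  rewrite /H -(retract_id (retract_in s x)); apply: closed_le (cH i j) _ _ (retract_in s x).
  by move=> y cy; rewrite Hpd//; have [_] := M1f y cy.
exists g, H, (Num.max M0 M1); split => //.
- by split => // z Uz; have [? ?] := dc z Uz.
- by move=> x; rewrite le_max fM0.
- by move=> i x; rewrite le_max gM orbT.
- by move=> i j x; rewrite le_max HM orbT.
- move=> i j x ij cx xij; rewrite /H retract_id//; apply: (HE (i, j)).2 => //.
  by rewrite closure_chamber.
Qed.

Variable rho : R.

(** The definition takes the limit inside one chamber around [x]; by
    [trace_indep] the others give the same value. *)
Lemma G0E f x s g H M : smooth f -> smooth_chamber s f g H M -> closed_chamber s x ->
  G0 rho f x = rho / 2 * \sum_i H i i x.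
Proof.
move=> sf S cx; rewrite /G0 mulrC (mulrC 2^-1) -mulrA.
have [s' s'E] : exists s', chamber_at x = s' by eexists.
have cx' : closure (chamber s') x.
  rewrite -s'E /chamber_at.
  have : [set s0 : 'S_m | closure (chamber s0) x] !=set0.
    by exists s; rewrite /= closure_chamber.
  by move=> /(xgetPex 1%g).
rewrite s'E; have [g' [H' [M' S']]] := sf s'.
have PF : ProperFilter (within (chamber s') (nbhs x)).
  by apply: within_nbhs_proper.
rewrite (_ : lim _ = \sum_i H' i i x); last first.
  apply: (@cvg_lim _ (@Rhausdorff R)).
  apply: (@cvg_trans _ (\sum_i H' i i z @[z --> within (chamber s') (nbhs x)])).
    apply: near_eq_cvg; apply: (filterS _ (withinT (chamber s') _)) => z cz.
    by apply: eq_bigr => i _; rewrite (sc_H S').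
  apply: cvg_trans (_ : \sum_i H' i i z @[z --> x] --> _); last first.
    by apply: continuous_sum => i; exact: (sc_Hcont S').
  by apply: cvg_app; exact: cvg_within.
rewrite mulrC mulrA; congr (_ * _).
by apply: trace_indep S' S _ _ => //; rewrite -closure_chamber.
Qed.

(** The closed chambers form a finite closed cover, and the operator is
    continuous on each of them. *)
Lemma G0_continuous f : smooth f -> continuous (G0 rho f).
Proof.
move=> sf x; apply: (@cvgrPdist_le _ _ _ (nbhs x) _ _ _).2 => e e0.
have nb s : \forall y \near x, closed_chamber s y -> `|G0 rho f x - G0 rho f y| <= e.
  have [g [H [M S]]] := sf s.
  have [cx|ncx] := pselect (closed_chamber s x); last first.
    have : open (~` closed_chamber s : set 'rV[R]_m).
      by apply: closed_openC; rewrite -closure_chamber; exact: closed_closure.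
    by rewrite openE => /(_ x ncx); apply: (@filterS _ (nbhs x) (nbhs_filter x)).
  have cH : continuous (fun y => rho / 2 * \sum_i H i i y).
    by apply: continuous_scale; apply: continuous_sum => i; exact: (sc_Hcont S).
  apply: (@filterS _ (nbhs x) (nbhs_filter x) _ _ _ (near_close x cH e0)) => y yx cy.
  by rewrite (G0E sf S cx) (G0E sf S cy).
have : \forall y \near x, forall s, closed_chamber s y -> `|G0 rho f x - G0 rho f y| <= e.
  by have := @filter_forall _ _ _ _ (nbhs_filter x) nb.
apply: (@filterS _ (nbhs x) (nbhs_filter x)) => y H; have [s cs] := sorting_permutation y; exact: H cs.
Qed.

Lemma G0_bounded f : smooth f -> exists K, forall x, `|G0 rho f x| <= K.
Proof.
move=> sf; have /choice[B HB] : forall s, exists B, forall x, closed_chamber s x -> `|G0 rho f x| <= B.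
  move=> s; have [g [H [M S]]] := sf s; exists (`|rho / 2| * (M *+ m)) => x cx.
  rewrite (G0E sf S cx) normrM ler_wpM2l//; apply: (le_trans (ler_norm_sum _ _ _)).
  rewrite -[in leRHS](card_ord m) -sumr_const; apply: ler_sum => i _.
  exact: (sc_Hle S).
have B0 s : 0 <= `|B s| by [].
exists (\sum_s `|B s|) => x; have [s cs] := sorting_permutation x.
apply: (le_trans (HB s x cs)); apply: (le_trans (ler_norm _)).
by rewrite (bigD1 s)//= lerDl sumr_ge0.
Qed.

End dimension.

Lemma chamber1T (s : 'S_1) : chamber s = [set: 'rV[R]_1].
Proof. by apply/seteqP; split => // x _ a b; rewrite !ord1. Qed.

Lemma gen_dom_smooth n (f : 'rV[R]_n.+1 -> R) : gen_dom f -> smooth f.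
Proof.
case: n f => [|n] f; last by move=> [/D0_smooth].
move=> [[cf [M0 fM0]] [d1 d2 dc [M1 M1f]]] s; rewrite -(chamber1T s) in d1 d2 dc M1f.
have T (x : 'rV[R]_1) : chamber s x by move=> a b; rewrite !ord1.
exists (fun i => pderiv i f), (fun i j => pderiv i (pderiv j f)), (Num.max M0 M1).
split => //.
- by split => // z Uz; have [? ?] := dc z Uz.
- by move=> i x; have [+ _] := dc x (T x); exact.
- by move=> i j x; have [_] := dc x (T x); exact.
- by move=> x; rewrite le_max fM0.
- by move=> i x; rewrite le_max (M1f x (T x)).1 orbT.
- by move=> i j x; rewrite le_max (M1f x (T x)).2 orbT.
- by move=> i j x; rewrite (ord1 i) (ord1 j) eqxx.
Qed.

End operator.

(** * The martingale problem *)

Section set_integral.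
Context {d : measure_display} {T : measurableType d} {R : realType}.
Variable P : probability T R.

Lemma set_integral_Ex A f : measurable A -> L1 P f ->
  (\int[P]_(w in A) (f w)%:E)%E = (Ex P (fun w => \1_A w * f w))%:E.
Proof.
move=> mA fi; have i1 : L1 P (fun w => \1_A w * f w).
  apply: (@L1_bM _ _ _ P _ _ 1) => // w.
  by rewrite indicE; case: (_ \in _); rewrite ?normr1 ?normr0.
rewrite /Ex /Rintegral fineK; last exact: integrable_fin_num.
rewrite [LHS]integral_mkcond; apply: eq_integral => w _.
by rewrite patchE indicE; case: (_ \in _); rewrite ?mul1r ?mul0r.
Qed.

End set_integral.

Lemma time0E (R : realType) : time0 R = to_time 0.
Proof. by rewrite -[LHS]to_timeK. Qed.

Lemma jets_sub (R : realType) m (C C' : set 'rV[R]_m) (f : 'rV[R]_m -> R) g H M :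
  C' `<=` C -> jets C f g H M -> jets C' f g H M.
Proof.
move=> CC [cf cg cH fM gM HM rM rs jd]; split => //.
- by move=> x y /CC cx /CC cy; exact: rM.
- move=> N e e0; have [h h0 Q] := rs N e e0; exists h => // x y /CC cx /CC cy.
  exact: Q.
- move=> N e e0; have [h h0 Q] := jd N e e0; exists h => // x i j ij /CC cx.
  exact: Q.
Qed.

Section martingale_problem.
Context {d : measure_display} {T : measurableType d} {R : realType}.
Variable P : probability T R.
Variables (n : nat) (X : time R -> T -> 'rV[R]_n.+1).
Hypothesis mX : forall t i, measurable_fun setT (fun w => X t w ord0 i).
Hypothesis cX : forall w, continuous (X ^~ w).
Variable rho : R.
Implicit Types f : 'rV[R]_n.+1 -> R.

Let FT := past_measurable mX.
Let Fmono := @past_mono _ _ _ _ X.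

Let J f s t w := \int[lebesgue_measure]_(r in `[s, t]) G0 rho f (X (to_time r) w).
Let M f t w := f (X (to_time t) w) - f (X (time0 R) w) - J f 0 t w.

Lemma gen_dom_continuous f : gen_dom f -> continuous f.
Proof. by move=> /gen_dom_smooth/(_ 1%g)[g [H [K S]]]; exact: (sc_cont S). Qed.

Lemma gen_dom_bounded f : gen_dom f -> exists K, forall x, `|f x| <= K.
Proof. by move=> /gen_dom_smooth/(_ 1%g)[g [H [K S]]]; exists K; exact: (sc_le S). Qed.

Lemma gen_dom_test f u : gen_dom f -> test (past X u) (fun w => f (X (to_time u) w)).
Proof.
move=> df; have [K fK] := gen_dom_bounded df.
exact: (path_test X (gen_dom_continuous df) fK u).
Qed.

Lemma G0_integral_test f s t : gen_dom f -> s <= t -> test (past X t) (J f s t).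
Proof.
move=> df st; have sf := gen_dom_smooth df; have [K GK] := G0_bounded rho sf.
exact: (time_integral_test cX (G0_continuous sf) GK st).
Qed.

Lemma problem_test f t : gen_dom f -> 0 <= t -> test (past X t) (M f t).
Proof.
move=> df t0.
have tN Y : test (past X t) Y -> test (past X t) (fun w => - Y w).
  move=> tY; have := testM (test_cst (past X t) (-1)) tY.
  by under eq_fun do rewrite mulN1r.
apply: testD; last by apply: tN; exact: G0_integral_test.
apply: testD; first exact: gen_dom_test.
by apply: tN; rewrite time0E; exact: (test_mono Fmono t0 (gen_dom_test 0 df)).
Qed.

Lemma problem_incr f s t (Y : T -> R) : gen_dom f -> 0 <= s -> s <= t -> test (past X s) Y ->
  Ex P (fun w => Y w * (M f t w - M f s w)) =
  Ex P (fun w => Y w * f (X (to_time t) w)) - Ex P (fun w => Y w * f (X (to_time s) w)) -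
  Ex P (fun w => Y w * J f s t w).
Proof.
move=> df s0 st tY; have sf := gen_dom_smooth df.
have tYt := test_mono Fmono st tY.
have i1 := test_L1_self P (@FT t) (testM tYt (gen_dom_test t df)).
have i2 := test_L1_self P (@FT s) (testM tY (gen_dom_test s df)).
have i3 := test_L1_self P (@FT t) (testM tYt (G0_integral_test df st)).
rewrite -(ExB i1 i2) -(ExB (L1B i1 i2) i3); congr Ex; apply/funext => w.
rewrite /M; suff -> : J f 0 t w = J f 0 s w + J f s t w by ring.
have cp := @path_continuous _ _ _ _ _ cX _ (G0_continuous (rho := rho) sf) w.
apply/eqP; rewrite addrC -subr_eq; apply/eqP.
rewrite /J Rintegral_itvB ?bnd_simp//; last exact: continuous_integrable_itv.
rewrite Rintegral_itv_obnd_cbnd//.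
by apply: integrableS (continuous_integrable_itv s t cp) => //; exact: subset_itv_oc_cc.
Qed.

(** Almost surely the state stays in the closed chamber of [b], so [local_ito]
    and [dynkin] apply. *)
Lemma coalescing_solves b : 0 < rho -> coalescing P X rho b ->
  solves_martingale_problem rho P X.
Proof.
move=> rho0 coX f df; have sf := gen_dom_smooth df.
have [sg cb] := sorting_permutation b.
have [g [H [K S]]] := sf sg.
have Jc := jets_sub (cone_chamber cb) (smooth_jets S).
have [KG GK] := G0_bounded rho sf; have cG := G0_continuous (rho := rho) sf.
have ME (t : time R) : (fun w => f (X t w) - f (X (time0 R) w) -
   \int[lebesgue_measure]_(s in `[0, \val t]) G0 rho f (X (to_time s) w)) = M f (\val t).
  by rewrite /M to_timeK.
have incr0 s t A : 0 <= s -> s <= t -> <<s past X s >> A ->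
    Ex P (fun w => \1_A w * (M f t w - M f s w)) = 0.
  move=> s0 st FA; have tA := test_indic FA (R := R).
  have t0 := le_trans s0 st.
  rewrite problem_incr//; apply/eqP; rewrite subr_eq0; apply/eqP.
  apply: (dynkin mX cX cG GK (a := fun u => Ex P (fun w => \1_A w * f (X (to_time u) w))) s0 st tA).
  move=> e e0; have [h h0 Hh] := local_ito mX rho0 coX Jc t0 e0.
  exists h => // u v su uv vt vuh.
  have tAu := test_mono Fmono su tA.
  have u0 := le_trans s0 su.
  suff -> : Ex P (fun w => \1_A w * G0 rho f (X (to_time u) w)) =
      rho / 2 * Ex P (fun w => \1_A w * \sum_i H i i (X (to_time u) w)).
    apply: Hh => // w; rewrite indicE.
    by case: (_ \in _); rewrite ?normr1 ?normr0.
  have tH : test (past X u) (fun w => \sum_i H i i (X (to_time u) w)).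
    have cS : continuous (fun x => \sum_i H i i x).
      by apply: continuous_sum => i; exact: (sc_Hcont S).
    have SK z : `|\sum_i H i i z| <= \sum_(i < n.+1) K.
      apply: (le_trans (ler_norm_sum _ _ _)); apply: ler_sum => i _.
      exact: (sc_Hle S).
    exact: (path_test X cS SK u).
  rewrite -(ExZ _ (test_L1_self P (@FT u) (testM tAu tH))); apply: Ex_ae.
  - exact: (test_measurable (@FT u) (testM tAu (path_test X cG GK u))).
  - exact: (test_measurable (@FT u) (testM (test_cst _ _) (testM tAu tH))).
  apply: filterS (co_cone mX rho0 coX u0) => w /= cw.
  by rewrite (G0E rho sf S (cone_chamber cb cw)) mulrCA.
split.
- move=> t U mU; rewrite ME -past_filtration -[X in <<s _ >> X]setTI.
  by have [+ _] := problem_test df (time_ge0 t); apply.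
- move=> t; rewrite ME.
  exact: (test_L1_self P (@FT _) (problem_test df (time_ge0 t))).
- move=> s t st A; rewrite -past_filtration => FA.
  have mA : measurable A by exact: FT FA.
  have tA := test_indic FA (R := R).
  have i1 := test_L1_self P (@FT _) (problem_test df (time_ge0 t)).
  have i2 := test_L1_self P (@FT _) (problem_test df (time_ge0 s)).
  have := incr0 _ _ _ (time_ge0 s) st FA.
  under eq_fun do rewrite mulrBr.
  rewrite ExB; [|exact: (test_L1 (@FT _) tA i1)|exact: (test_L1 (@FT _) tA i2)].
  move/eqP; rewrite subr_eq0 => /eqP E.
  have -> : (fun w => (f (X t w) - f (X (time0 R) w) -
     \int[lebesgue_measure]_(s in `[0, \val t]) G0 rho f (X (to_time s) w))%:E) = EFin \o M f (\val t).
    by rewrite -ME.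
  have -> : (fun w => (f (X s w) - f (X (time0 R) w) -
     \int[lebesgue_measure]_(r in `[0, \val s]) G0 rho f (X (to_time r) w))%:E) = EFin \o M f (\val s).
    by rewrite -ME.
  transitivity (Ex P (fun w => \1_A w * M f (\val t) w))%:E; first exact: set_integral_Ex.
  by rewrite E; symmetry; exact: set_integral_Ex.
Qed.

Hypothesis MP : solves_martingale_problem rho P X.

Lemma problem_identity f s t (Y : T -> R) : gen_dom f -> 0 <= s -> s <= t ->
  test (past X s) Y ->
  Ex P (fun w => Y w * f (X (to_time t) w)) - Ex P (fun w => Y w * f (X (to_time s) w)) =
  Ex P (fun w => Y w * J f s t w).
Proof.
move=> df s0 st tY; have t0 := le_trans s0 st.
apply/eqP; rewrite -subr_eq0; apply/eqP; rewrite -problem_incr//.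
have i1 := test_L1_self P (@FT _) (problem_test df t0).
have i2 := test_L1_self P (@FT _) (problem_test df s0).
apply: (@orthogonal_test _ _ R P _ (@FT s)) tY; first exact: L1B.
move=> A FA; have mA : measurable A by exact: FT FA.
have tA := test_indic FA (R := R).
under eq_fun do rewrite mulrBr.
rewrite ExB; [|exact: (test_L1 (@FT _) tA i1)|exact: (test_L1 (@FT _) tA i2)].
have [_ _ /(_ (to_time s) (to_time t))] := MP df.
rewrite !val_to_time// => /(_ st A); rewrite -past_filtration val_to_time// => /(_ FA).
rewrite -/(M f t) -/(M f s).
have -> : (fun w => (f (X (to_time t) w) - f (X (time0 R) w) -
   \int[lebesgue_measure]_(s in `[0, t]) G0 rho f (X (to_time s) w))%:E) = EFin \o M f t by [].
have -> : (fun w => (f (X (to_time s) w) - f (X (time0 R) w) -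
   \int[lebesgue_measure]_(r in `[0, s]) G0 rho f (X (to_time r) w))%:E) = EFin \o M f s by [].
move=> E; apply/eqP; rewrite subr_eq0; apply/eqP; apply: EFin_inj.
transitivity (\int[P]_(w in A) (M f t w)%:E)%E; first by symmetry; exact: set_integral_Ex.
by transitivity (\int[P]_(w in A) (M f s w)%:E)%E; [exact: E|exact: set_integral_Ex].
Qed.

(** For an eigenfunction the martingale problem is a linear differential equation
    for the conditional means. *)
Lemma eigenfunction_decay f c s t (Y : T -> R) : gen_dom f -> 0 <= c ->
  (forall x, G0 rho f x = - c * f x) -> 0 <= s -> s <= t -> test (past X s) Y ->
  Ex P (fun w => Y w * f (X (to_time t) w)) =
  expR (- (c * (t - s))) * Ex P (fun w => Y w * f (X (to_time s) w)).
Proof.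
move=> df c0 Gf s0 st tY; have sf := gen_dom_smooth df.
have [KG GK] := G0_bounded rho sf; have cG := G0_continuous (rho := rho) sf.
have [Kf fK] := gen_dom_bounded df; have [L L0 YL] := test_bounded tY.
have mY := test_measurable (@FT s) tY.
pose a u := Ex P (fun w => Y w * f (X (to_time u) w)).
have KG0 : 0 <= KG by exact: le_trans (normr_ge0 _) (GK 0).
have lip u v : s <= u -> u <= v -> `|a v - a u| <= L * KG * (v - u).
  move=> su uv; rewrite /a problem_identity//; last first.
  - exact: (test_mono Fmono su tY).
  - exact: le_trans su.
  apply: Ex_abs_cst.
    apply: measurable_funM => //; exact: (test_measurable (@FT _) (G0_integral_test df uv)).
  move=> w; rewrite normrM -mulrA ler_pM// mulrC.
  exact: (time_integral_le cX cG GK).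
apply: (@exponential_decay _ a c (L * Kf)) => //.
- move=> u su _; apply: Ex_abs_cst.
    apply: measurable_funM => //; exact: (test_measurable (@FT _) (gen_dom_test u df)).
  by move=> w; rewrite normrM ler_pM.
move=> e e0; pose q := c * (L * KG) + 1.
have q0 : 0 < q by rewrite ltr_wpDl// !mulr_ge0.
exists (e / q); first by rewrite divr_gt0.
move=> u v su uv vt vuh.
have tYu := test_mono Fmono su tY.
have u0 := le_trans s0 su.
rewrite /a problem_identity//.
have cv := Ex_time_integral mX cX cG GK u0 uv tYu.
have aG r : s <= r -> Ex P (fun w => Y w * G0 rho f (X (to_time r) w)) = - c * a r.
  move=> sr; rewrite /a -ExZ; last first.
    by apply: (test_L1_self P (@FT r)); apply: testM; [exact: (test_mono Fmono sr tY)|exact: gen_dom_test].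
  by congr Ex; apply/funext => w; rewrite Gf mulrCA.
have cv' : `|riemann (fun r => Ex P (fun w => Y w * G0 rho f (X (to_time r) w))) u v n + c * (v - u) * a u|
    @[n --> \oo] --> `|Ex P (fun w => Y w * J f u v w) + c * (v - u) * a u|.
  by apply: cvg_norm; apply: cvgD; [exact: cv|exact: cvg_cst].
rewrite -(cvg_lim (@Rhausdorff R) cv'); apply: limr_le; first by apply/cvg_ex; eexists; exact: cv'.
apply: nearW => N.
have -> : c * (v - u) * a u = \sum_(k < N.+1) (v - u) / N.+1%:R * (c * a u).
  by rewrite sumr_const card_ord -[RHS]mulr_natr [RHS]mulrAC divfK// [RHS]mulrCA mulrA.
rewrite /riemann -big_split /=; apply: (le_trans (ler_norm_sum _ _ _)).
apply: (@le_trans _ _ (\sum_(k < N.+1) (v - u) / N.+1%:R * e)); last first.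
  by rewrite sumr_const card_ord -[leLHS]mulr_natr mulrAC divfK// mulrC.
apply: ler_sum => k _; rewrite -mulrDr normrM ger0_norm ?divr_ge0 ?subr_ge0//.
rewrite ler_wpM2l ?divr_ge0 ?subr_ge0//.
have /andP[uk kv] := grid_mem uv (ltnW (ltn_ord k)).
set r := grid _ _ _ _ in uk kv *.
rewrite aG; last exact: le_trans uk.
rewrite mulNr addrC -mulrBr normrM ger0_norm// distrC.
apply: (le_trans (ler_wpM2l c0 (lip u r su uk))).
apply: (@le_trans _ _ (q * (v - u))).
  rewrite mulrA ler_pM ?subr_ge0 ?mulr_ge0 ?lerD2r//.
  by rewrite /q lerDl.
by rewrite mulrC -ler_pdivlMr.
Qed.

End martingale_problem.

(** * Sine waves *)

Section sine_waves.
Context {R : realType} {m : nat}.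
Implicit Types (s : 'S_m) (x y v : 'rV[R]_m) (al : 'I_m -> R).

Lemma abs_sin_le (x : R) : `|sin x| <= `|x|.
Proof.
wlog x0 : x / 0 <= x.
  move=> H; have [|/ltW x0] := lerP 0 x; first exact: H.
  by rewrite -[`|x|]normrN -[`|sin x|]normrN -sinN; apply: H; rewrite oppr_ge0.
rewrite (ger0_norm x0) ler_norml sin_le_id// andbT -subr_ge0 opprK.
move: x x0; apply: (@ge0_of_derive R (fun z => sin z + z) (fun z => cos z + 1)).
- by rewrite sin0 addr0.
- by move=> z _; have := cos_geN1 z; lra.
Qed.

Lemma sin_lipschitz (x y : R) : `|sin x - sin y| <= `|x - y|.
Proof.
have [c [e [-> ->]]] : exists c e, x = c + e /\ y = c - e.
  by exists ((x + y) / 2), ((x - y) / 2); split; field.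
rewrite sinD sinB (_ : _ - _ = 2 * (cos c * sin e)); last by ring.
rewrite (_ : c + e - _ = 2 * e); last by ring.
rewrite !normrM ler_pM2l ?normr_gt0//.
apply: (@le_trans _ _ (1 * `|e|)); last by rewrite mul1r.
by apply: ler_pM => //; [exact: cos_max|exact: abs_sin_le].
Qed.

Definition lin al x : R := \sum_i al i * x ord0 i.

Definition wave c al th x : R := c * sin (lin al x + th).

Lemma lin_axpy al (r : R) v x : lin al (r *: v + x) = lin al v * r + lin al x.
Proof.
rewrite /lin mulr_suml -big_split /=; apply: eq_bigr => i _.
by rewrite !mxE; ring.
Qed.

Lemma lin_delta al i : lin al (delta_mx ord0 i) = al i.
Proof.
rewrite /lin (bigD1 i)//= mxE !eqxx mulr1 big1 ?addr0// => j ji.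
by rewrite mxE eqxx/= (negbTE ji) mulr0.
Qed.

Lemma is_derive_of_line (f : 'rV[R]_m -> R) x v l :
  is_derive (0 : R) 1 (fun r : R => f (r *: v + x)) l -> is_derive x v f l.
Proof.
have E : (fun h : R => h^-1 *: (((fun r : R => f (r *: v + x)) \o shift 0) (h *: 1) -
    f (0 *: v + x))) = (fun h => h^-1 *: ((f \o shift x) (h *: v) - f x)).
  apply/funext => h /=; rewrite scale0r add0r addr0.
  by rewrite [_%:A]mulr1.
by case=> D1 D2; split; [move: D1; rewrite /derivable E|rewrite -D2 /derive E].
Qed.

(** Differentiation is a shift of the phase by a quarter turn. *)
Lemma wave_derive c al th x i :
  is_derive x (delta_mx ord0 i) (wave c al th) (wave (c * al i) al (th + pi / 2) x).
Proof.
set e := delta_mx ord0 i.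
have D : is_derive (0 : R) 1 (fun r : R => wave c al th (r *: e + x))
    (wave (c * al i) al (th + pi / 2) x).
  have -> : (fun r : R => wave c al th (r *: e + x)) =
      (fun r => c * sin (al i * r + (lin al x + th))).
    by apply/funext => r; rewrite /wave lin_axpy lin_delta addrA.
  apply: is_derive_eq; rewrite /GRing.scale/= /wave mulr0 add0r addrA sinDpihalf.
  by ring.
exact: is_derive_of_line.
Qed.

Lemma wave_sub c al th x y : `|wave c al th x - wave c al th y| <=
  `|c| * \sum_i `|al i| * `|x ord0 i - y ord0 i|.
Proof.
rewrite /wave -mulrBr normrM ler_wpM2l//; apply: (le_trans (sin_lipschitz _ _)).
rewrite opprD addrACA subrr addr0 /lin -sumrB.
apply: (le_trans (ler_norm_sum _ _ _)); apply: ler_sum => i _.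
by rewrite -mulrBr normrM.
Qed.

Lemma wave_modulus c al th e : 0 < e -> exists2 h, 0 < h & forall x y,
  (forall i, `|x ord0 i - y ord0 i| < h) -> `|wave c al th x - wave c al th y| < e.
Proof.
move=> e0; pose q := `|c| * \sum_i `|al i| + 1.
have q0 : 0 < q by rewrite ltr_wpDl// mulr_ge0// sumr_ge0.
exists (e / q); first by rewrite divr_gt0.
move=> x y xy; apply: (le_lt_trans (wave_sub _ _ _ _ _)).
apply: (@le_lt_trans _ _ ((`|c| * \sum_i `|al i|) * (e / q))).
  rewrite -mulrA ler_wpM2l// mulr_suml; apply: ler_sum => i _.
  by rewrite ler_wpM2l// ltW.
by rewrite mulrCA gtr_pMr// ltr_pdivrMr// mul1r ltrDl.
Qed.

Lemma wave_continuous c al th : continuous (wave c al th).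
Proof.
move=> x; apply: (@cvgrPdist_lt _ _ _ (nbhs x) _ _ _).2 => e e0.
have [h h0 H] := wave_modulus c al th e0.
by apply/nbhs_rVP; exists h => // y xy; exact: H.
Qed.

Lemma wave_uc_extension s g c al th : (forall x, chamber s x -> g x = wave c al th x) ->
  uc_extension (chamber s) g (wave c al th).
Proof.
move=> gE; split => [x cx|]; first by rewrite gE.
move=> A; rewrite -entourage_ballE => -[e /= e0 HA].
have [h h0 H] := wave_modulus c al th e0.
exists [set xy | ball xy.1 h xy.2]; first by rewrite -entourage_ballE; exists h.
move=> [x y] /= xy; apply: HA; rewrite /= -ball_normE/=.
by apply: H; apply/(ball_rV _ _ h0).
Qed.

(** The squared length [k] of the wave vector is common to all chambers, which
    makes [f] an eigenfunction of the operator; the last clause is the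
    condition on the mixed derivatives. *)
Definition piecewise_wave k (f : 'rV[R]_m -> R) := [/\ continuous f,
  forall x, `|f x| <= 1 &
  forall s, exists al th,
    [/\ forall x, closed_chamber s x -> f x = wave 1 al th x,
        \sum_i al i ^+ 2 = k &
        forall i j x, i != j -> closed_chamber s x -> x ord0 i = x ord0 j ->
          al j * al i * sin (lin al x + th) = 0]].

Lemma pderiv_chamber s f c al th i : (forall x, chamber s x -> f x = wave c al th x) ->
  forall x, chamber s x -> derivable f x (delta_mx ord0 i) /\
    pderiv i f x = wave (c * al i) al (th + pi / 2) x.
Proof.
move=> fE x cx; have [w1 w2] := wave_derive c al th x i.
have nb : \forall y \near x, wave c al th y = f y.
  have := @open_chamber R m s; rewrite openE => /(_ x cx).
  by apply: (@filterS _ (nbhs x) (nbhs_filter x)) => y /fE.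
split; first exact: near_eq_derivable nb w1.
by rewrite -w2 /pderiv; apply: near_eq_derive; apply: (@filterS _ (nbhs x) (nbhs_filter x)) nb => y.
Qed.

Lemma piecewise_wave_D0 k f : piecewise_wave k f -> D0 f.
Proof.
move=> [cf f1 fw].
have E s : exists al th, [/\ forall x, closed_chamber s x -> f x = wave 1 al th x,
   forall i x, chamber s x -> derivable f x (delta_mx ord0 i) /\
     pderiv i f x = wave (al i) al (th + pi / 2) x,
   forall i j x, chamber s x -> derivable (pderiv j f) x (delta_mx ord0 i) /\
     pderiv i (pderiv j f) x = wave (al j * al i) al (th + pi / 2 + pi / 2) x &
   forall i j x, i != j -> closed_chamber s x -> x ord0 i = x ord0 j ->
          al j * al i * sin (lin al x + th) = 0].
  have [al [th [fE _ fd]]] := fw s; exists al, th.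
  have D1 i x : chamber s x -> derivable f x (delta_mx ord0 i) /\
     pderiv i f x = wave (al i) al (th + pi / 2) x.
    move=> cx; rewrite -[al i in X in _ /\ X]mul1r; apply: pderiv_chamber cx => y cy.
    by apply: fE; exact: chamber_closed.
  split => // i j x cx; apply: pderiv_chamber cx => y cy.
  by have [] := D1 j y cy.
have near_wave s (h : 'rV[R]_m -> R) c al th x : chamber s x ->
    (forall y, chamber s y -> h y = wave c al th y) -> {for x, continuous h}.
  move=> cx hE; have nb : \forall y \near x, wave c al th y = h y.
    have := @open_chamber R m s; rewrite openE => /(_ x cx).
    by apply: (@filterS _ (nbhs x) (nbhs_filter x)) => y /hE.
  rewrite /prop_for /continuous_at hE//.
  have cw := @wave_continuous c al th x.
  exact: cvg_trans (@near_eq_cvg _ _ (nbhs x) (nbhs_filter x) _ _ nb) cw.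
have wave_le c al th (x : 'rV[R]_m) : `|wave c al th x| <= `|c|.
  by rewrite /wave normrM ler_piMr// ler_norml sin_geN1 sin_le1.
split.
- by split => //; exists 1.
- move=> s; have [al [th [fE D1 D2 _]]] := E s; split.
  + by move=> x cx i; have [] := D1 i x cx.
  + by move=> x cx i j; have [] := D2 i j x cx.
  + move=> x cx; split => [i|i j].
      by apply: near_wave cx _ => y cy; have [_] := D1 i y cy; exact.
    by apply: near_wave cx _ => y cy; have [_] := D2 i j y cy; exact.
  + exists (\sum_i `|al i| + \sum_i \sum_j `|al j * al i|) => x cx; split => [i|i j].
      have [_ ->] := D1 i x cx; apply: (le_trans (wave_le _ _ _ _)).
      rewrite (bigD1 i)//= -addrA lerDl addr_ge0 ?sumr_ge0// => k' _.
      by apply: sumr_ge0.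
    have [_ ->] := D2 i j x cx; apply: (le_trans (wave_le _ _ _ _)).
    rewrite addrC (bigD1 i)//= (bigD1 j)//= -!addrA lerDl.
    by rewrite !addr_ge0 ?sumr_ge0// => k' _; apply: sumr_ge0.
- move=> s i; have [al [th [fE D1 D2 _]]] := E s.
  exists (wave (al i) al (th + pi / 2)); apply: wave_uc_extension => x cx.
  by have [] := D1 i x cx.
- move=> s i j; have [al [th [fE D1 D2 fd]]] := E s.
  exists (wave (al j * al i) al (th + pi / 2 + pi / 2)).
    by apply: wave_uc_extension => x cx; have [] := D2 i j x cx.
  move=> ij x; rewrite closure_chamber => cx xij.
  by rewrite /wave !addrA sinDpihalf cosDpihalf mulrN fd// oppr0.
Qed.

(** The identity holds inside the chambers and extends to their closures by
    continuity. *)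
Lemma piecewise_wave_G0 rho k f x : piecewise_wave k f ->
  G0 rho f x = - (rho / 2 * k) * f x.
Proof.
move=> pf; have sf := D0_smooth (piecewise_wave_D0 pf).
have [s cx] := sorting_permutation x; have [g [H [M S]]] := sf s.
have [cf f1 fw] := pf; have [al [th [fE alk _]]] := fw s.
rewrite (G0E rho sf S cx).
suff : \sum_i H i i x + k * f x = 0 by move/eqP; rewrite addr_eq0 => /eqP ->; ring.
have ch : continuous (fun y => \sum_i H i i y + k * f y).
  have c1 : continuous (fun y => \sum_i H i i y).
    by apply: continuous_sum => i; exact: (sc_Hcont S).
  have c2 := @continuous_scale R _ f k cf.
  move=> y; exact: (@cvgD _ _ _ (nbhs y) (nbhs_filter y) _ _ _ _ (c1 y) (c2 y)).
apply/eqP; rewrite -normr_le0 leNgt; apply/negP => hx.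
have := cx; rewrite -closure_chamber => /(_ _ (near_gt_norm ch hx))[y [cy /=]].
suff -> : \sum_i H i i y + k * f y = 0 by rewrite normr0 ltxx.
have D1 i z : chamber s z -> pderiv i f z = wave (al i) al (th + pi / 2) z.
  move=> cz; rewrite -[al i]mul1r; apply: (pderiv_chamber _ _ cz).2 => // z' cz'.
  by apply: fE; exact: chamber_closed.
rewrite fE; last exact: chamber_closed.
rewrite -alk mulr_suml -big_split big1//= => i _.
rewrite (sc_H S)// (pderiv_chamber i (D1 i) cy).2 /wave !addrA sinDpihalf cosDpihalf.
by ring.
Qed.

End sine_waves.

(** * Solutions of the martingale problem are coalescing *)

Section wave_domain.
Context {R : realType}.

Definition embed_index (n : nat) (i j k : 'I_n.+2) : 'I_n.+1 :=
  if (k == i) || (k == j) then ord_max else inord (k - ((i < k) + (j < k))).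

Lemma diag_embedE n i j (x : 'rV[R]_n.+1) (k : 'I_n.+2) :
  diag_embed i j x ord0 k = x ord0 (embed_index i j k).
Proof. by rewrite mxE /embed_index; case: ifP. Qed.

(** The definition of the domain iterates the restriction to diagonals down to
    dimension one, where it asks for less than [D0]. *)
Lemma gen_dom_of_D0 (C : forall n, ('rV[R]_n.+1 -> R) -> Prop) :
  (forall n f, C n f -> D0 f) ->
  (forall n f (i j : 'I_n.+2), C n.+1 f -> C n (diag_restr i j f)) ->
  forall n f, C n f -> gen_dom f.
Proof.
move=> CD Cr n; elim: n => [|n IH] f Cf.
  have [bf C2 _ _] := CD _ _ Cf; split=> //.
  by have := C2 1%g; rewrite chamber1T.
by split; [exact: CD Cf|move=> i j _; apply: IH; exact: Cr].
Qed.

Lemma coordinate_wave m (l th : R) (k : 'I_m) :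
  piecewise_wave (l ^+ 2) (fun x : 'rV[R]_m => sin (l * x ord0 k + th)).
Proof.
pose al i := l * (i == k)%:R.
have alE x : lin al x = l * x ord0 k.
  rewrite /lin (bigD1 k)//= /al eqxx mulr1 big1 ?addr0// => i ik.
  by rewrite (negbTE ik) mulr0 mul0r.
have E : (fun x : 'rV[R]_m => sin (l * x ord0 k + th)) = wave 1 al th.
  by apply/funext => x; rewrite /wave alE mul1r.
split.
- by rewrite E; exact: wave_continuous.
- by move=> x; rewrite ler_norml sin_geN1 sin_le1.
move=> s; exists al, th; split.
- by move=> x _; rewrite -E.
- rewrite (bigD1 k)//= /al eqxx mulr1 big1 ?addr0// => i ik.
  by rewrite (negbTE ik) mulr0 expr0n.
- move=> i j x ij _ _; rewrite /al; have [ik|_] := eqVneq i k; last by rewrite !mulr0 mul0r.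
  have [jk|_] := eqVneq j k; last by rewrite mulr0 !mul0r.
  by move: ij; rewrite ik jk eqxx.
Qed.

(** Within a chamber the distance is linear. Its only mixed derivatives are in
    the two coordinates themselves, and they are multiples of the sine, which
    vanishes where the coordinates meet. *)
Lemma distance_wave m (l : R) (k k' : 'I_m) :
  piecewise_wave (if k == k' then 0 else 2 * l ^+ 2)
    (fun x : 'rV[R]_m => sin (l * `|x ord0 k - x ord0 k'|)).
Proof.
have cc (i : 'I_m) : continuous (fun x : 'rV[R]_m => x ord0 i) by exact: coordinate_continuous.
split.
- move=> x; apply: (continuous_comp (f := fun x : 'rV[R]_m => `|x ord0 k - x ord0 k'|)
    (g := fun z => sin (l * z))); last exact: sin_scale_continuous.
  apply: (continuous_comp (f := fun x : 'rV[R]_m => x ord0 k - x ord0 k') (g := fun z : R => `|z|)).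
    by apply: (@cvgB _ _ _ (nbhs x) (nbhs_filter x)); exact: cc.
  exact: norm_continuous.
- by move=> x; rewrite ler_norml sin_geN1 sin_le1.
have alE (r : R) (x : 'rV[R]_m) :
    lin (fun i => r * ((i == k)%:R - (i == k')%:R)) x = r * (x ord0 k - x ord0 k').
  have one (q : 'I_m) : \sum_i (i == q)%:R * x ord0 i = x ord0 q.
    rewrite (bigD1 q)//= eqxx mul1r big1 ?addr0// => i iq.
    by rewrite (negbTE iq) mul0r.
  rewrite /lin -!one -sumrB mulr_sumr; apply: eq_bigr => i _; ring.
have main r s : (forall x, closed_chamber s x -> sin (l * `|x ord0 k - x ord0 k'|) =
      sin (r * (x ord0 k - x ord0 k'))) -> r ^+ 2 = l ^+ 2 ->
    exists al th, [/\ forall x, closed_chamber s x ->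
        sin (l * `|x ord0 k - x ord0 k'|) = wave 1 al th x,
      \sum_i al i ^+ 2 = (if k == k' then 0 else 2 * l ^+ 2) &
      forall i j x, i != j -> closed_chamber s x -> x ord0 i = x ord0 j ->
          al j * al i * sin (lin al x + th) = 0].
  move=> rE rl; exists (fun i => r * ((i == k)%:R - (i == k')%:R)), 0; split.
  - by move=> x cx; rewrite /wave alE addr0 mul1r rE.
  - have [->|kk'] := eqVneq k k'.
      by rewrite big1// => i _; rewrite subrr mulr0 expr0n.
    rewrite (bigD1 k)//= (bigD1 k')//=; last by rewrite eq_sym.
    rewrite big1 => [|i /andP[/negbTE-> /negbTE->]]; last by rewrite subrr mulr0 expr0n.
    by rewrite !eqxx (negbTE kk') [k' == k]eq_sym (negbTE kk') -rl/=; ring.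
  - move=> i j x ij _ xij; rewrite alE addr0.
    have [xk|xk] := eqVneq (x ord0 k) (x ord0 k'); first by rewrite xk subrr mulr0 sin0 mulr0.
    have kk' : k != k' by apply: contraNneq xk => ->.
    suff [->|->] : (i == k)%:R - (i == k')%:R = 0 :> R \/ (j == k)%:R - (j == k')%:R = 0 :> R.
    + by rewrite !mulr0 mul0r.
    + by rewrite mulr0 !mul0r.
    have [ik|ik] := eqVneq i k.
      right; rewrite -ik eq_sym (negbTE ij); have [jk|] := eqVneq j k'; last by rewrite subrr.
      by move: xk; rewrite -ik -jk xij eqxx.
    have [ik'|ik'] := eqVneq i k'; last by left; rewrite subrr.
    right; rewrite -ik' [j == i]eq_sym (negbTE ij); have [jk|] := eqVneq j k; last by rewrite subrr.
    by move: xk; rewrite -ik' -jk xij eqxx.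
move=> s; have [kk'|/ltnW k'k] := leqP ((s^-1)%g k) ((s^-1)%g k').
  apply: (main (- l)); last by rewrite sqrrN.
  move=> x cx; rewrite distrC ger0_norm ?mulNr ?mulrBr ?opprB//.
  by rewrite subr_ge0; have := cx _ _ kk'; rewrite !permKV.
apply: (main l) => // x cx; rewrite ger0_norm//.
by rewrite subr_ge0; have := cx _ _ k'k; rewrite !permKV.
Qed.

Lemma coordinate_wave_dom n (l th : R) (k : 'I_n.+1) :
  gen_dom (fun x : 'rV[R]_n.+1 => sin (l * x ord0 k + th)).
Proof.
apply: (@gen_dom_of_D0 (fun n f => exists k, f = (fun x => sin (l * x ord0 k + th)))).
- move=> {n k} n f [k ->]; exact: (piecewise_wave_D0 (coordinate_wave l th k)).
- move=> {n k} n f i j [k ->]; exists (embed_index i j k).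
  by apply/funext => x; rewrite /diag_restr diag_embedE.
by exists k.
Qed.

Lemma distance_wave_dom n (l : R) (k k' : 'I_n.+1) :
  gen_dom (fun x : 'rV[R]_n.+1 => sin (l * `|x ord0 k - x ord0 k'|)).
Proof.
apply: (@gen_dom_of_D0 (fun n f => exists k k', f = (fun x => sin (l * `|x ord0 k - x ord0 k'|)))).
- move=> {n k k'} n f [k [k' ->]]; exact: (piecewise_wave_D0 (distance_wave l k k')).
- move=> {n k k'} n f i j [k [k' ->]]; exists (embed_index i j k), (embed_index i j k').
  by apply/funext => x; rewrite /diag_restr !diag_embedE.
by exists k, k'.
Qed.

End wave_domain.

Section small_frequencies.
Context {R : realType}.

Lemma sinc_cvg (z : R) : n.+1%:R * sin (n.+1%:R^-1 * z) @[n --> \oo] --> z.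
Proof.
apply/cvgrPdist_le => e e0.
have c0 : (n.+1%:R^-1 : R) * (`|z| ^+ 3) @[n --> \oo] --> (0 : R).
  by rewrite -[X in _ --> X](mul0r (`|z| ^+ 3)); apply: cvgM; [exact: cvg_harmonic|exact: cvg_cst].
move/cvgrPdist_le: c0 => /(_ e e0); apply: filterS => n; rewrite sub0r normrN => ne.
have n0 : 0 < n.+1%:R :> R by [].
rewrite (_ : z - _ = - (n.+1%:R * (sin (n.+1%:R^-1 * z) - n.+1%:R^-1 * z))); last first.
  by field.
rewrite normrN normrM ger0_norm//; apply: (le_trans _ ne).
apply: (le_trans (ler_wpM2l (ltW n0) (abs_sin_sub _))).
rewrite [leRHS]ger0_norm ?mulr_ge0 ?exprn_ge0//.
rewrite normrM exprMn ger0_norm ?invr_ge0// mulrA ler_wpM2r ?exprn_ge0//.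
rewrite exprS mulrA mulfV ?gt_eqF// mul1r -[leRHS]expr1 ler_wiXn2l//.
by rewrite invf_le1// ler1n.
Qed.

Lemma cvg_pow (u : nat -> R) (l : R) j : u @ \oo --> l -> (fun n => u n ^+ j) @ \oo --> l ^+ j.
Proof.
move=> ul; elim: j => [|j IH].
  by under eq_fun do rewrite expr0; exact: cvg_cst.
by under eq_fun do rewrite exprS; rewrite exprS; exact: cvgM.
Qed.

Lemma sinc_le (z l : R) : 0 < l -> `|l * sin (l^-1 * z)| <= `|z|.
Proof.
move=> l0; rewrite normrM (ger0_norm (ltW l0)) -ler_pdivlMl//.
by apply: (le_trans (abs_sin_le _)); rewrite normrM ger0_norm// invr_ge0 ltW.
Qed.

End small_frequencies.

Section identification.
Context {d : measure_display} {T : measurableType d} {R : realType}.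
Variable P : probability T R.
Variables (n : nat) (X : time R -> T -> 'rV[R]_n.+1).
Hypothesis mX : forall t i, measurable_fun setT (fun w => X t w ord0 i).
Hypothesis cX : forall w, continuous (X ^~ w).
Variable rho : R.
Hypothesis rho0 : 0 < rho.
Hypothesis MP : solves_martingale_problem rho P X.

Let FT := past_measurable mX.
Local Notation x u i := (fun w => X (to_time u) w ord0 i).

Lemma problem_coordinate i l th s t (Y : T -> R) : 0 <= s -> s <= t -> test (past X s) Y ->
  Ex P (fun w => Y w * sin (l * x t i w + th)) =
  expR (- (rho / 2 * l ^+ 2 * (t - s))) * Ex P (fun w => Y w * sin (l * x s i w + th)).
Proof.
move=> s0 st tY.
have G x := piecewise_wave_G0 rho x (coordinate_wave l th i).
apply: (eigenfunction_decay mX cX MP (coordinate_wave_dom l th i) _ G) => //.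
by rewrite mulr_ge0 ?sqr_ge0// divr_ge0// ltW.
Qed.

Lemma problem_distance i j l s t (Y : T -> R) : i != j -> 0 <= s -> s <= t ->
  test (past X s) Y ->
  Ex P (fun w => Y w * sin (l * `|x t i w - x t j w|)) =
  expR (- (rho * l ^+ 2 * (t - s))) * Ex P (fun w => Y w * sin (l * `|x s i w - x s j w|)).
Proof.
move=> ij s0 st tY.
have G x := piecewise_wave_G0 rho x (distance_wave l i j).
have -> : rho * l ^+ 2 = rho / 2 * (if i == j then 0 else 2 * l ^+ 2).
  by rewrite (negbTE ij) [RHS]mulrA divfK.
apply: (eigenfunction_decay mX cX MP (distance_wave_dom l i j) _ G) => //.
rewrite (negbTE ij); apply: mulr_ge0; first by rewrite divr_ge0// ltW.
by apply: mulr_ge0 => //; exact: sqr_ge0.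
Qed.

Lemma trig_test s i l th (Y : T -> R) : test (past X s) Y ->
  test (past X s) (fun w => Y w * sin (l * x s i w + th)).
Proof.
move=> tY; apply: testM => //.
exact: (gen_dom_test X s (coordinate_wave_dom l th i)).
Qed.

(** The addition formula separates the state at time [s], which joins the test
    function, from the state at time [t]. *)
Lemma increment_wave i l th s t (Y : T -> R) : 0 <= s -> s <= t -> test (past X s) Y ->
  Ex P (fun w => Y w * sin (l * (x t i w - x s i w) + th)) =
  expR (- (rho / 2 * l ^+ 2 * (t - s))) * sin th * Ex P Y.
Proof.
move=> s0 st tY.
have FTt := @FT t; have Fm := @past_mono _ _ _ _ X.
have tr1 : test (past X s) (fun w => Y w * cos (th - l * x s i w)).
  have := trig_test i (- l) (th + pi / 2) tY; congr test; apply/funext => w.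
  by rewrite addrA sinDpihalf; congr (_ * cos _); ring.
have tr2 : test (past X s) (fun w => Y w * sin (th - l * x s i w)).
  have := trig_test i (- l) th tY; congr test; apply/funext => w.
  by congr (_ * sin _); ring.
have L u th' Z : s <= u -> test (past X s) Z -> L1 P (fun w => Z w * sin (l * x u i w + th')).
  move=> su tZ; apply: (test_L1_self P (@FT u)).
  by apply: trig_test; exact: (test_mono Fm su tZ).
have split u : s <= u -> Ex P (fun w => Y w * sin (l * (x u i w - x s i w) + th)) =
    Ex P (fun w => (Y w * cos (th - l * x s i w)) * sin (l * x u i w + 0)) +
    Ex P (fun w => (Y w * sin (th - l * x s i w)) * sin (l * x u i w + pi / 2)).
  move=> su; rewrite -ExD; [|exact: L|exact: L].
  congr Ex; apply/funext => w; rewrite addr0 sinDpihalf.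
  have -> : l * (x u i w - x s i w) + th = l * x u i w + (th - l * x s i w) by ring.
  by rewrite sinD; ring.
rewrite split// !(problem_coordinate i l _ s0 st)// -mulrDr -split// -[RHS]mulrA; congr (_ * _).
under eq_fun do rewrite subrr mulr0 add0r mulrC.
by rewrite ExZ//; exact: (test_L1_self P (@FT s)).
Qed.

Let a s t := rho / 2 * (t - s).

Lemma increment_measurable i s t : measurable_fun setT (fun w => x t i w - x s i w).
Proof. by apply: measurable_funB; exact: mX. Qed.

Lemma wave_measurable i l s t :
  measurable_fun setT (fun w => sin (l * (x t i w - x s i w))).
Proof.
have c := @sin_scale_continuous R l.
apply: (measurableT_comp (f := fun z => sin (l * z))); last exact: increment_measurable.
exact: continuous_measurable_fun.
Qed.

Lemma increment_cos i l s t (Y : T -> R) : 0 <= s -> s <= t -> test (past X s) Y ->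
  Ex P (fun w => Y w * cos (l * (x t i w - x s i w))) = expR (- (a s t * l ^+ 2)) * Ex P Y.
Proof.
move=> s0 st tY; have := increment_wave i l (pi / 2) s0 st tY.
under eq_fun do rewrite sinDpihalf.
by move=> ->; rewrite sin_pihalf mulr1; congr (expR _ * _); rewrite /a; ring.
Qed.

Lemma increment_sqr_sin i l s t (Y : T -> R) : 0 <= s -> s <= t -> test (past X s) Y ->
  Ex P (fun w => Y w * sin (l * (x t i w - x s i w)) ^+ 2) =
  2^-1 * (1 - expR (- (4 * a s t * l ^+ 2))) * Ex P Y.
Proof.
move=> s0 st tY; have iY := test_L1_self P (@FT s) tY.
have [K K0 YK] := test_bounded tY.
have mY := test_measurable (@FT s) tY.
have mc : measurable_fun setT (fun w => cos (2 * l * (x t i w - x s i w))).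
  apply: (measurableT_comp (f := fun z => cos (2 * l * z))); last exact: increment_measurable.
  apply: continuous_measurable_fun => z.
  apply: (continuous_comp (f := fun z : R => 2 * l * z)); last exact: continuous_cos.
  by apply: cvgM; [exact: cvg_cst|exact: cvg_id].
have ic : L1 P (fun w => Y w * cos (2 * l * (x t i w - x s i w))).
  apply: (@L1_bM _ _ _ P _ _ K) => //; apply: (@L1_bounded _ _ _ P _ 1) => // w.
  exact: cos_max.
transitivity (Ex P (fun w => 2^-1 * (Y w - Y w * cos (2 * l * (x t i w - x s i w))))).
  congr Ex; apply/funext => w; set z := x t i w - x s i w.
  rewrite (_ : 2 * l * z = (l * z) *+ 2); last by rewrite -mulr_natl; ring.
  rewrite cos_mulr2n; have := cos2Dsin2 (l * z); move: (cos _) (sin _) => p q pq.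
  have -> : p ^+ 2 = 1 - q ^+ 2 by rewrite -pq addrK.
  by field.
rewrite ExZ; last exact: L1B.
rewrite ExB// increment_cos// -mulrA; congr (_ * _).
by rewrite mulrBl mul1r; congr (_ - expR _ * _); ring.
Qed.

Lemma sqr_sin_mean (c : R) : 0 <= c ->
  `|2^-1 * (1 - expR (- (4 * c))) - 2 * c| <= 8 * c ^+ 2.
Proof.
move=> c0; have c4 : 0 <= 4 * c by rewrite mulr_ge0.
have := expRN_taylor c4; rewrite !ler_norml => /andP[h1 h2].
by apply/andP; split; nra.
Qed.

(** Fatou's lemma along frequencies tending to [0]; the means follow from
    sin(z) ^ 4 = sin(z) ^ 2 - sin(2 z) ^ 2 / 4. *)
Lemma increment_fourth i s t : 0 <= s -> s <= t ->
  L1 P (fun w => (x t i w - x s i w) ^+ 4) /\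
  Ex P (fun w => (x t i w - x s i w) ^+ 4) <= 10 * rho ^+ 2 * (t - s) ^+ 2.
Proof.
move=> s0 st; pose De w := x t i w - x s i w.
pose S k w := k.+1%:R * sin (k.+1%:R^-1 * De w).
have a0 : 0 <= a s t by rewrite /a mulr_ge0 ?subr_ge0// divr_ge0// ltW.
have mS k : measurable_fun setT (S k).
  by apply: measurable_funM => //; exact: wave_measurable.
have t1 : test (past X s) (fun=> 1 : R) by exact: test_cst.
have wave l w : `|sin (l * De w)| <= 1 by rewrite ler_norml sin_geN1 sin_le1.
have iS q : L1 P (fun w => sin (q * De w) ^+ 2).
  apply: (@L1_bounded _ _ _ P _ 1); first by apply: measurable_funX; exact: wave_measurable.
  by move=> w; rewrite normrX exprn_ile1.
apply: (@L1_fatou _ _ _ P (fun k w => S k w ^+ 4)).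
- by move=> k; apply: measurable_funX.
- by apply: measurable_funX; exact: increment_measurable.
- by move=> k w; rewrite exprn_even_ge0.
- by move=> w; apply: cvg_pow; exact: sinc_cvg.
- move=> k; apply: (@L1_bounded _ _ _ P _ (k.+1%:R ^+ 4)); first exact: measurable_funX.
  move=> w; rewrite normrX; apply: lerXn2r; rewrite ?nnegrE//.
  by rewrite normrM ger0_norm// ler_piMr.
move=> k; set N : R := k.+1%:R; have N0 : 0 < N by [].
pose q := a s t * N^-1 ^+ 2.
have q0 : 0 <= q by rewrite mulr_ge0// exprn_ge0// invr_ge0 ltW.
have -> : (fun w => S k w ^+ 4) =
    (fun w => N ^+ 4 * (sin (N^-1 * De w) ^+ 2 - 4^-1 * sin (2 * N^-1 * De w) ^+ 2)).
  apply/funext => w; rewrite /S exprMn -/N; congr (_ * _).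
  rewrite (_ : 2 * N^-1 * De w = (N^-1 * De w) *+ 2); last by rewrite -mulr_natl; ring.
  rewrite sin_mulr2n; have := cos2Dsin2 (N^-1 * De w); move: (cos _) (sin _) => p r pr.
  rewrite -[(p * r) *+ 2]mulr_natl !exprMn (_ : p ^+ 2 = 1 - r ^+ 2); last by rewrite -pr addrK.
  by field.
rewrite (ExZ _ (L1B (iS _) (L1Z _ (iS _)))) (ExB (iS _) (L1Z _ (iS _))) (ExZ _ (iS _)).
have sqr l : Ex P (fun w => sin (l * De w) ^+ 2) = 2^-1 * (1 - expR (- (4 * a s t * l ^+ 2))).
  have := increment_sqr_sin i l s0 st t1; rewrite Ex_cst mulr1 => <-.
  by congr Ex; apply/funext => w; rewrite mul1r.
rewrite !sqr.
have h1 := sqr_sin_mean q0; have h2 := sqr_sin_mean (mulr_ge0 (ler0n R 4) q0).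
have -> : 4 * a s t * N^-1 ^+ 2 = 4 * q by rewrite /q; ring.
have -> : 4 * a s t * (2 * N^-1) ^+ 2 = 4 * (4 * q) by rewrite /q; ring.
have -> : 10 * rho ^+ 2 * (t - s) ^+ 2 = N ^+ 4 * (40 * q ^+ 2).
  by rewrite /q /a; field; rewrite gt_eqF.
rewrite ler_pM2l ?exprn_gt0//.
move: h1 h2; rewrite !ler_norml => /andP[_ h1] /andP[h2 _].
have -> : 40 * q ^+ 2 = 8 * q ^+ 2 + 4^-1 * (8 * (4 * q) ^+ 2) by field.
lra.
Qed.

Lemma increment_L1 i s t : 0 <= s -> s <= t ->
  L1 P (fun w => `|x t i w - x s i w|) /\ L1 P (fun w => `|x t i w - x s i w| ^+ 2).
Proof.
move=> s0 st; have [i4 _] := increment_fourth i s0 st.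
have iD := L1D (L1_cst P 1) i4.
have m1 : measurable_fun setT (fun w => `|x t i w - x s i w|).
  by apply: measurableT_comp => //; exact: increment_measurable.
have pw (z : R) : z ^+ 4 = (`|z| ^+ 2) ^+ 2.
  by rewrite -exprM -normrX ger0_norm// exprn_even_ge0.
have le (z : R) : 0 <= z -> z <= 1 + z ^+ 2.
  by move=> z0; have := sqr_ge0 (z - 1); rewrite sqrrB1; lra.
split; apply: (L1_le _ _ iD) => //.
- move=> w; rewrite normr_id pw; set z := `|_|.
  have := sqr_ge0 (z ^+ 2 - 2^-1); have := sqr_ge0 (z - 2^-1).
  by rewrite !sqrrB; move: (z ^+ 2) ((z ^+ 2) ^+ 2) => z2 z4; lra.
- exact: measurable_funX.
- by move=> w; rewrite normrX normr_id pw; apply: le; exact: exprn_ge0.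
Qed.

(** As the frequency [l] tends to [0], [l^-1 sin (l z)] tends to [z] and stays
    below [|z|], which [increment_fourth] makes integrable. *)
Lemma increment_moments i : gaussian_moments P (past X) rho (fun u => x u i).
Proof.
split.
- by move=> u; exact: past_coord.
- move=> u v Y u0 uv tY; have [iDe _] := increment_L1 i u0 uv.
  have [K K0 YK] := test_bounded tY; have mY := test_measurable (@FT u) tY.
  pose De w := x v i w - x u i w.
  pose F k w := Y w * (k.+1%:R * sin (k.+1%:R^-1 * De w)).
  have F0 k : Ex P (F k) = 0.
    have iY : L1 P (fun w => Y w * sin (k.+1%:R^-1 * De w + 0)).
      apply: (test_L1 (@FT u) tY); apply: (@L1_bounded _ _ _ P _ 1).
        under eq_fun do rewrite addr0; exact: wave_measurable.
      by move=> w; rewrite ler_norml sin_geN1 sin_le1.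
    have -> : F k = (fun w => k.+1%:R * (Y w * sin (k.+1%:R^-1 * De w + 0))).
      by apply/funext => w; rewrite /F addr0 mulrCA.
    by rewrite ExZ// increment_wave// sin0 mulr0 mul0r mulr0.
  have [|||||_ cv] := @Ex_dct _ _ _ P F (fun w => Y w * De w) (fun w => K * `|De w|).
  + move=> k; apply: measurable_funM => //; apply: measurable_funM => //.
    exact: wave_measurable.
  + by apply: measurable_funM => //; exact: increment_measurable.
  + by apply: aeW => w; apply: cvgM; [exact: cvg_cst|exact: sinc_cvg].
  + exact: L1Z.
  + by apply: aeW => w k; rewrite normrM ler_pM// sinc_le.
  move: cv; under eq_fun do rewrite F0.
  by move=> /(cvg_lim (@Rhausdorff R)) <-; rewrite lim_cst.
- move=> u v Y u0 uv tY; have [_ iDe] := increment_L1 i u0 uv.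
  have [K K0 YK] := test_bounded tY; have mY := test_measurable (@FT u) tY.
  pose De w := x v i w - x u i w.
  pose F k w := Y w * (k.+1%:R * sin (k.+1%:R^-1 * De w)) ^+ 2.
  have FE k : Ex P (F k) = k.+1%:R ^+ 2 *
      (2^-1 * (1 - expR (- (4 * (a u v * k.+1%:R^-1 ^+ 2)))) * Ex P Y).
    have -> : F k = (fun w => k.+1%:R ^+ 2 * (Y w * sin (k.+1%:R^-1 * De w) ^+ 2)).
      by apply/funext => w; rewrite /F exprMn mulrCA.
    rewrite ExZ; first by rewrite increment_sqr_sin// !mulrA.
    apply: (test_L1 (@FT u) tY); apply: (@L1_bounded _ _ _ P _ 1).
      by apply: measurable_funX; exact: wave_measurable.
    by move=> w; rewrite normrX exprn_ile1// ler_norml sin_geN1 sin_le1.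
  have [|||||_ cv] := @Ex_dct _ _ _ P F (fun w => Y w * De w ^+ 2) (fun w => K * `|De w| ^+ 2).
  + move=> k; apply: measurable_funM => //; apply: measurable_funX; apply: measurable_funM => //.
    exact: wave_measurable.
  + by apply: measurable_funM => //; apply: measurable_funX; exact: increment_measurable.
  + apply: aeW => w; apply: cvgM; first exact: cvg_cst.
    by apply: cvg_pow; exact: sinc_cvg.
  + exact: L1Z.
  + apply: aeW => w k; rewrite normrM normrX ler_pM//.
    by apply: lerXn2r; rewrite ?nnegrE// sinc_le.
  have av : 0 <= a u v by rewrite /a mulr_ge0 ?subr_ge0// divr_ge0// ltW.
  have cv' : Ex P (F k) @[k --> \oo] --> rho * (v - u) * Ex P Y.
    under eq_fun do rewrite FE mulrA.
    apply: cvgM; last exact: cvg_cst.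
    apply/cvgrPdist_le => e e0.
    have c0 : (8 * a u v ^+ 2) * (k.+1%:R^-1 : R) @[k --> \oo] --> (0 : R).
      by rewrite -[X in _ --> X](mulr0 (8 * a u v ^+ 2)); apply: cvgM; [exact: cvg_cst|exact: cvg_harmonic].
    move/cvgrPdist_le: c0 => /(_ e e0); apply: filterS => k; rewrite sub0r normrN => ke.
    set N : R := k.+1%:R; have N0 : 0 < N by [].
    pose q := a u v * N^-1 ^+ 2.
    have q0 : 0 <= q by rewrite mulr_ge0// exprn_ge0// invr_ge0 ltW.
    rewrite -/q (_ : rho * (v - u) = N ^+ 2 * (2 * q)); last first.
      by rewrite /q /a; field; rewrite gt_eqF.
    rewrite -mulrBr normrM ger0_norm ?exprn_ge0 ?(ltW N0)// distrC; apply: (le_trans _ ke).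
    apply: (le_trans (ler_wpM2l (exprn_ge0 2 (ltW N0)) (sqr_sin_mean q0))).
    rewrite (@ger0_norm _ (8 * a u v ^+ 2 * N^-1)); last first.
      by apply: mulr_ge0; [apply: mulr_ge0 => //; exact: sqr_ge0|rewrite invr_ge0 ltW].
    have -> : N ^+ 2 * (8 * q ^+ 2) = 8 * a u v ^+ 2 * (N^-1 ^+ 2).
      by rewrite /q; field; rewrite gt_eqF.
    apply: ler_wpM2l; first by apply: mulr_ge0 => //; exact: sqr_ge0.
    rewrite -[leRHS]expr1; apply: ler_wiXn2l => //; first by rewrite invr_ge0 ltW.
    by rewrite invf_le1// ler1n.
  exact: (cvg_unique (@Rhausdorff R) cv cv').
- exists (10 * rho ^+ 2) => u v u0 uv; exact: increment_fourth.
Qed.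

Lemma problem_coalescing b : {ae P, forall w, X (to_time 0) w = b} -> coalescing P X rho b.
Proof.
move=> Xb; split => //; first exact: increment_moments.
by move=> i j l s t Y ij s0 st tY; exact: problem_distance.
Qed.

End identification.

(** * Determinants of sine waves *)

Section determinant_analysis.
Context {R : realType} {m : nat}.

Lemma det_bound (A : 'M[R]_m) E : (forall i j, `|A i j| <= E) ->
  `|\det A| <= #|'S_m|%:R * E ^+ m.
Proof.
move=> AE; apply: (le_trans (ler_norm_sum _ _ _)).
apply: (@le_trans _ _ (\sum_(s : 'S_m) E ^+ m)); last by rewrite sumr_const -[leLHS]mulr_natl.
apply: ler_sum => s _; rewrite normrM normrX normrN1 expr1n mul1r normr_prod.
rewrite -[in leRHS](card_ord m) -prodr_const; apply: ler_prod => i _.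
by rewrite normr_ge0 AE.
Qed.

Lemma continuous_prod (T : topologicalType) (I : Type) (r : seq I) (F : I -> T -> R) :
  (forall i, continuous (F i)) -> continuous (fun x => \prod_(i <- r) F i x).
Proof.
by move=> cF x; apply: cvg_big => [|i _]; [exact: mul_continuous|exact: cF].
Qed.

Lemma continuous_det (T : topologicalType) (A : T -> 'M[R]_m) :
  (forall i j, continuous (fun x => A x i j)) -> continuous (fun x => \det (A x)).
Proof.
move=> cA; apply: continuous_sum => s; apply: continuous_scale.
by apply: continuous_prod => i; exact: cA.
Qed.

End determinant_analysis.

Section wave_determinant.
Context {R : realType} {m : nat}.
Variables (s : 'S_m) (la th : 'I_m -> R) (c : 'I_m -> 'I_m -> R).
(** Each row is either a wave without constant term or independent of the
    state. *)
Hypothesis lac : forall k a, la k * c k a = 0.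
Implicit Types (x y : 'rV[R]_m) (tau : 'I_m -> nat).

(** The derivative of order [j] of [sin (la k * z + th k) + c k a]. *)
Definition entry k a j (z : R) : R :=
  la k ^+ j * sin (la k * z + th k + j%:R * (pi / 2)) + (if j is 0 then c k a else 0).

Lemma entry_derive k a j (z : R) : is_derive z 1 (entry k a j) (entry k a j.+1 z).
Proof.
rewrite /entry; move: (if j is 0 then _ else _) => q.
have -> : la k * z + th k + j.+1%:R * (pi / 2) = la k * z + th k + j%:R * (pi / 2) + pi / 2.
  by rewrite -natr1; ring.
rewrite sinDpihalf exprS; apply: is_derive_eq; rewrite /GRing.scale/=.
by ring.
Qed.

Lemma entry_continuous k a j : continuous (entry k a j).
Proof.
move=> z; apply: differentiable_continuous; apply/derivable1_diffP.
by have [] := entry_derive k a j z.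
Qed.

(** Column [a] is differentiated [tau a] times. *)
Definition wave_mx tau x : 'M[R]_m := \matrix_(k, a) entry k a (tau a) (x ord0 (s a)).

Definition wave_det tau x := \det (wave_mx tau x).

Definition incr a0 tau a := (tau a + (a == a0))%N.

Lemma cofactor_column tau tau' x x' k a0 :
  (forall a, a != a0 -> tau a = tau' a /\ x ord0 (s a) = x' ord0 (s a)) ->
  cofactor (wave_mx tau x) k a0 = cofactor (wave_mx tau' x') k a0.
Proof.
move=> H; rewrite /cofactor; congr (_ * \det _); apply/matrixP => i j; rewrite !mxE.
by have [|-> ->//] := H (lift a0 j); rewrite eq_sym neq_lift.
Qed.

(** Only column [a0] depends on the coordinate [s a0], so the determinant is
    expanded along it. *)
Lemma wave_det_derive tau a0 x :
  is_derive x (delta_mx ord0 (s a0)) (wave_det tau) (wave_det (incr a0 tau) x).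
Proof.
apply: is_derive_of_line; set e := delta_mx ord0 (s a0).
pose C k := cofactor (wave_mx tau x) k a0.
have -> : (fun r : R => wave_det tau (r *: e + x)) =
    \sum_k (fun r => entry k a0 (tau a0) (r + x ord0 (s a0)) * C k).
  apply/funext => r; rewrite fct_sumE /wave_det (expand_det_col _ a0).
  apply: eq_bigr => k _; rewrite !mxE !eqxx mulr1; congr (_ * _).
  apply: cofactor_column => a aa0; split=> //; rewrite !mxE eqxx/=.
  by rewrite (inj_eq perm_inj) (negbTE aa0) mulr0 add0r.
have -> : wave_det (incr a0 tau) x = \sum_k entry k a0 (tau a0).+1 (x ord0 (s a0)) * C k.
  rewrite /wave_det (expand_det_col _ a0); apply: eq_bigr => k _.
  rewrite mxE /incr eqxx addn1; congr (_ * _).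
  by apply: cofactor_column => a aa0; rewrite (negbTE aa0) addn0.
apply: is_derive_sum => k.
have D : is_derive (0 : R) 1 (fun r => entry k a0 (tau a0) (r + x ord0 (s a0)))
    (entry k a0 (tau a0).+1 (x ord0 (s a0))).
  have d1 := entry_derive k a0 (tau a0) (0 + x ord0 (s a0)).
  have d2 : is_derive (0 : R) 1 (fun r : R => r + x ord0 (s a0)) 1.
    by apply: is_derive_eq; rewrite addr0.
  have := @is_derive1_comp R (entry k a0 (tau a0)) (fun r => r + x ord0 (s a0)) _ _ _ d1 d2; rewrite mulr1 add0r; exact.
by apply: is_derive_eq; rewrite /GRing.scale/= mulr0 add0r mulrC.
Qed.

Lemma wave_det_continuous tau : continuous (wave_det tau).
Proof.
apply: continuous_det => k a; under eq_fun do rewrite mxE.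
move=> x; apply: (continuous_comp (f := fun x : 'rV[R]_m => x ord0 (s a))); last exact: entry_continuous.
exact: coordinate_continuous.
Qed.

Let B := \sum_k \sum_a ((1 + `|la k|) ^+ 2 + `|c k a|).

Lemma wave_det_le tau x : (forall a, (tau a <= 2)%N) ->
  `|wave_det tau x| <= #|'S_m|%:R * B ^+ m.
Proof.
move=> t2; apply: det_bound => k a; rewrite mxE.
have B0 k' a' : 0 <= (1 + `|la k'|) ^+ 2 + `|c k' a'| by rewrite addr_ge0 ?exprn_ge0 ?addr_ge0.
apply: (@le_trans _ _ ((1 + `|la k|) ^+ 2 + `|c k a|)); last first.
  rewrite /B (bigD1 k)//= (bigD1 a)//= -!addrA addrA lerDl.
  by rewrite addr_ge0 ?sumr_ge0// => k' _; apply: sumr_ge0.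
apply: (le_trans (ler_normD _ _)); apply: lerD; last by case: (tau a); rewrite ?normr0.
rewrite normrM normrX; apply: (@le_trans _ _ (`|la k| ^+ tau a * 1)).
  by rewrite ler_wpM2l ?exprn_ge0// ler_norml sin_geN1 sin_le1.
rewrite mulr1; apply: (@le_trans _ _ ((1 + `|la k|) ^+ tau a)).
  by apply: lerXn2r; rewrite ?nnegrE ?addr_ge0// lerDr.
by apply: ler_weXn2l => //; rewrite lerDl.
Qed.

Let tau0 : 'I_m -> nat := fun=> 0%N.
Let tau1 i := incr ((s^-1)%g i) tau0.
Let tau2 i j := incr ((s^-1)%g i) (tau1 j).

Lemma wave_det_pderiv tau i x : derivable (wave_det tau) x (delta_mx ord0 i) /\
  pderiv i (wave_det tau) x = wave_det (incr ((s^-1)%g i) tau) x.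
Proof. by have [] := wave_det_derive tau ((s^-1)%g i) x; rewrite permKV. Qed.

Lemma wave_det_smooth : exists M,
  smooth_chamber s (wave_det tau0) (fun i => wave_det (tau1 i)) (fun i j => wave_det (tau2 i j)) M.
Proof.
exists (#|'S_m|%:R * B ^+ m).
have p1 i : pderiv i (wave_det tau0) = wave_det (tau1 i).
  by apply/funext => x; have [_ ->] := wave_det_pderiv tau0 i x.
have p2 i j : pderiv i (pderiv j (wave_det tau0)) = wave_det (tau2 i j).
  by rewrite p1; apply/funext => x; have [_ ->] := wave_det_pderiv (tau1 j) i x.
split.
- split => z _ i; first by have [] := wave_det_pderiv tau0 i z.
  + by move=> j; rewrite p1; have [] := wave_det_pderiv (tau1 j) i z.
  + by rewrite p1; exact: wave_det_continuous.
  + by move=> j; rewrite p2; exact: wave_det_continuous.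
- exact: wave_det_continuous.
- by move=> i; exact: wave_det_continuous.
- by move=> i j; exact: wave_det_continuous.
- by move=> x; apply: wave_det_le.
- by move=> i x; apply: wave_det_le => a; rewrite /tau1 /incr; case: (_ == _).
- move=> i j x; apply: wave_det_le => a; rewrite /tau2 /tau1 /incr.
  by case: (_ == _); case: (_ == _).
- by move=> i x _; rewrite p1.
- by move=> i j x _; rewrite p2.
move=> i j x ij cx xij; rewrite /wave_det -det_tr.
apply: (@determinant_alternate _ _ _ ((s^-1)%g i) ((s^-1)%g j)).
  by rewrite (inj_eq perm_inj).
have ji : (s^-1%g i == s^-1%g j) = false by rewrite (inj_eq perm_inj) (negbTE ij).
move=> k; rewrite !mxE !permKV xij /tau2 /tau1 /incr !eqxx ji eq_sym ji.
by rewrite /entry.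
Qed.

(** Differentiating an entry twice multiplies it by [- la k ^ 2], a factor
    common to row [k]; the sum over the columns is an expansion along that row.
    *)
Lemma wave_det_trace x : \sum_i wave_det (tau2 i i) x = - (\sum_k la k ^+ 2) * wave_det tau0 x.
Proof.
rewrite (reindex_inj (@perm_inj _ s)) /=.
pose A := wave_mx tau0 x.
transitivity (\sum_a \sum_k - la k ^+ 2 * (A k a * cofactor A k a)).
  apply: eq_bigr => a _; rewrite /wave_det (expand_det_col _ a); apply: eq_bigr => k _.
  rewrite (@cofactor_column _ tau0 x x k a); last first.
    by move=> a' aa'; rewrite /tau2 /tau1 /incr permK (negbTE aa').
  rewrite !mxE /tau2 /tau1 /incr permK eqxx (_ : (tau0 a + true + true)%N = 2%N)//.
  rewrite /entry [RHS]mulrA; congr (_ * _).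
  rewrite (_ : 2%:R * (pi / 2) = pi / 2 + pi / 2); last by field.
  have c2 : la k ^+ 2 * c k a = 0 by rewrite expr2 -mulrA lac mulr0.
  rewrite /tau0 mul0r !addr0 !addrA sinDpihalf cosDpihalf expr0 mul1r.
  by rewrite [RHS]mulrDr !mulNr c2 oppr0 addr0 mulrN.
rewrite exchange_big /= -sumrN mulr_suml; apply: eq_bigr => k _.
by rewrite -mulr_sumr -(expand_det_row A k).
Qed.

Definition wave_rows x := \det (\matrix_(k, a) (sin (la k * x ord0 (s a) + th k) + c k a)).

Lemma wave_rowsE x : wave_rows x = wave_det tau0 x.
Proof.
congr (\det _); apply/matrixP => k a.
by rewrite !mxE /entry expr0 mul1r mul0r addr0.
Qed.

Section decay.
Context {d : measure_display} {T : measurableType d}.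
Variable P : probability T R.
Variable X : time R -> T -> 'rV[R]_m.
Hypothesis mX : forall t i, measurable_fun setT (fun w => X t w ord0 i).
Variables (rho : R) (b : 'rV[R]_m).
Hypothesis rho0 : 0 < rho.
Hypothesis coX : coalescing P X rho b.
Hypothesis bs : closed_chamber s b.

(** The determinant is an eigenfunction of the Laplacian, and two coinciding
    coordinates produce two equal differentiated columns. *)
Lemma wave_rows_decay u t (Y : T -> R) : 0 <= u -> u <= t -> test (past X u) Y ->
  (forall w, `|Y w| <= 1) ->
  Ex P (fun w => Y w * wave_rows (X (to_time t) w)) =
  expR (- (rho / 2 * (\sum_k la k ^+ 2) * (t - u))) *
  Ex P (fun w => Y w * wave_rows (X (to_time u) w)).
Proof.
move=> u0 ut tY Y1; have t0 := le_trans u0 ut.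
have FT := past_measurable mX.
have -> : wave_rows = wave_det tau0 by apply/funext => x; exact: wave_rowsE.
have [M S] := wave_det_smooth.
have Jc := jets_sub (cone_chamber bs) (smooth_jets S).
have wdM x : `|wave_det tau0 x| <= M by exact: (sc_le S).
have tW v : test (past X v) (fun w => wave_det tau0 (X (to_time v) w)).
  exact: (path_test X (@wave_det_continuous tau0) wdM v).
have la0 : 0 <= \sum_k la k ^+ 2 by apply: sumr_ge0 => k _; exact: sqr_ge0.
apply: (@exponential_decay _ (fun v => Ex P (fun w => Y w * wave_det tau0 (X (to_time v) w)))
  _ M) => //.
- by rewrite mulr_ge0// divr_ge0// ltW.
- move=> v uv _; apply: Ex_abs_cst.
    apply: measurable_funM; last exact: (test_measurable (@FT v) (tW v)).
    exact: (test_measurable (@FT u) tY).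
  by move=> w; rewrite normrM -[leRHS]mul1r ler_pM.
move=> e e0; have [h h0 Hh] := local_ito mX rho0 coX Jc t0 e0.
exists h => // v v' uv vv' v't vh.
have tYv := test_mono (@past_mono _ _ _ _ X) uv tY.
have v0 := le_trans u0 uv.
have := Hh v v' Y v0 vv' v't vh tYv Y1.
rewrite (_ : Ex P (fun w => Y w * \sum_i wave_det (tau2 i i) (X (to_time v) w)) =
   - (\sum_k la k ^+ 2) * Ex P (fun w => Y w * wave_det tau0 (X (to_time v) w))).
  by congr (`|_| <= _); ring.
rewrite -ExZ; last exact: (test_L1_self P (@FT v) (testM tYv (tW v))).
by congr Ex; apply/funext => w; rewrite wave_det_trace mulrCA.
Qed.

End decay.

End wave_determinant.

(** * Bounded limits of trigonometric functions *)

Section bounded_closure.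
Context {R : realType} {D : Type}.
Variable B : (D -> R) -> Prop.

(** The limits are those to which the dominated convergence theorem applies. *)
Inductive bounded_closure : (D -> R) -> Prop :=
| bc_base f : B f -> bounded_closure f
| bc_add f g : bounded_closure f -> bounded_closure g -> bounded_closure (fun x => f x + g x)
| bc_scale c f : bounded_closure f -> bounded_closure (fun x => c * f x)
| bc_lim (u : nat -> D -> R) f K : (forall n, bounded_closure (u n)) ->
    (forall n x, `|u n x| <= K) -> (forall x, u ^~ x @ \oo --> f x) -> bounded_closure f.

Lemma closure_bounded f : (forall g, B g -> exists K, forall x, `|g x| <= K) ->
  bounded_closure f -> exists K, forall x, `|f x| <= K.
Proof.
move=> BB; elim=> {f} [f /BB//|f g _ [K fK] _ [L gL]|c f _ [K fK]|u f K _ _ uK uf].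
- by exists (K + L) => x; rewrite (le_trans (ler_normD _ _))// lerD.
- by exists (`|c| * K) => x; rewrite normrM ler_wpM2l.
exists K => x; have cv : `|u n x| @[n --> \oo] --> `|f x| by apply: cvg_norm; exact: uf.
rewrite -(cvg_lim (@Rhausdorff R) cv); apply: limr_le; first by apply/cvg_ex; eexists; exact: cv.
by apply: nearW => n; exact: uK.
Qed.

End bounded_closure.

Lemma closure_comp (R : realType) (D D' : Type) (B : (D -> R) -> Prop) (B' : (D' -> R) -> Prop)
    (p : D' -> D) f :
  (forall g, B g -> bounded_closure B' (g \o p)) ->
  bounded_closure B f -> bounded_closure B' (f \o p).
Proof.
move=> BB; elim=> {f} [f /BB//|f g _ IHf _ IHg|c f _ IHf|u f K _ IHu uK uf].
- exact: bc_add IHf IHg.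
- exact: bc_scale IHf.
- by apply: (@bc_lim _ _ _ (fun n => u n \o p) _ K) => // [n x|x]; [exact: uK|exact: uf].
Qed.

Section trigonometric_closure.
Context {R : realType}.

Definition sine_function (f : R -> R) := exists la th, f = (fun z => sin (la * z + th)).

Local Notation trig := (bounded_closure sine_function).

Lemma trig_bounded f : trig f -> exists K, forall x, `|f x| <= K.
Proof.
apply: closure_bounded => _ [la [th ->]]; exists 1 => z.
by rewrite ler_norml sin_geN1 sin_le1.
Qed.

Lemma trig_cst c : trig (fun=> c).
Proof.
have -> : (fun=> c) = (fun z : R => c * sin (0 * z + pi / 2)).
  by apply/funext => z; rewrite mul0r add0r sin_pihalf mulr1.
by apply: bc_scale; apply: bc_base; exists 0, (pi / 2).
Qed.

(** Products of sines are sums of sines, so the closure is an algebra. *)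
Lemma trig_mul f g : trig f -> trig g -> trig (fun z => f z * g z).
Proof.
have mul_closure h f' : (forall la th, trig (fun z => h z * sin (la * z + th))) ->
    (exists K, forall z, `|h z| <= K) -> trig f' -> trig (fun z => h z * f' z).
  move=> hs [L hL]; elim=> {f'} [_ [la [th ->]]|f1 f2 _ I1 _ I2|c f1 _ I1|u f' K _ IHu uK uf].
  - exact: hs.
  - by under eq_fun do rewrite mulrDr; exact: bc_add.
  - by under eq_fun do rewrite mulrCA; exact: bc_scale.
  - apply: (@bc_lim _ _ _ (fun n z => h z * u n z) _ (L * K)) => // [n z|z].
      by rewrite normrM ler_pM.
    by apply: cvgM; [exact: cvg_cst|exact: uf].
move=> tf tg; have sg la th : trig (fun z => sin (la * z + th) * g z).
  apply: mul_closure tg; last by exists 1 => z; rewrite ler_norml sin_geN1 sin_le1.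
  move=> la' th'.
  have -> : (fun z => sin (la * z + th) * sin (la' * z + th')) =
    (fun z => 2^-1 * sin ((la - la') * z + (th - th' + pi / 2)) +
      - 2^-1 * sin ((la + la') * z + (th + th' + pi / 2))).
    apply/funext => z; rewrite !addrA !sinDpihalf.
    have -> : (la - la') * z + th - th' = (la * z + th) - (la' * z + th') by ring.
    have -> : (la + la') * z + th + th' = (la * z + th) + (la' * z + th') by ring.
    by move: (la * z + th) (la' * z + th') => p q; rewrite cosB cosD; field.
  by apply: bc_add; apply: bc_scale; apply: bc_base; do 2 eexists.
under eq_fun do rewrite mulrC.
apply: mul_closure tf; last exact: trig_bounded.
by move=> la th; under eq_fun do rewrite mulrC.
Qed.

(** The iterates of [(3 y - y ^ 3) / 2] converge to the sign on [[-1, 1]]. *)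
Definition sharpen (y : R) := (3 * y - y ^+ 3) / 2.

Lemma sharpen_ge (y : R) : 0 <= y <= 1 -> 0 <= y <= sharpen y /\ sharpen y <= 1.
Proof.
move=> /andP[y0 y1]; have y2 : y ^+ 2 <= 1 by rewrite exprn_ile1.
have E : sharpen y - y = y * (1 - y ^+ 2) / 2 by rewrite /sharpen; field.
have F : 1 - sharpen y = (1 - y) ^+ 2 * (2 + y) / 2 by rewrite /sharpen; field.
rewrite y0 -subr_ge0 E -(subr_ge0 (sharpen y)) F; split.
  by rewrite divr_ge0// mulr_ge0// subr_ge0.
by rewrite divr_ge0// mulr_ge0 ?sqr_ge0// addr_ge0.
Qed.

Lemma sharpenN y : sharpen (- y) = - sharpen y.
Proof. by rewrite /sharpen; field. Qed.

Lemma sharpen_iterN n y : iter n sharpen (- y) = - iter n sharpen y.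
Proof. by elim: n => //= n ->; rewrite sharpenN. Qed.

Lemma sharpen_rate (y : R) n : 0 <= y <= 1 ->
  y <= iter n sharpen y <= 1 /\ 1 - iter n sharpen y <= (1 - y / 2) ^+ n.
Proof.
move=> /andP[y0 y1]; elim: n => /= [|n [/andP[IH1 IH2] IH3]].
  by rewrite lexx y1 expr0 lerBlDr lerDl.
set z := iter n sharpen y in IH1 IH2 IH3 *.
have z0 : 0 <= z by exact: le_trans IH1.
have [/andP[_ zs] s1] := sharpen_ge (introT andP (conj z0 IH2)).
split; first by rewrite (le_trans IH1 zs).
have -> : 1 - sharpen z = (1 - z / 2 - z ^+ 2 / 2) * (1 - z).
  by rewrite /sharpen; field.
rewrite [leRHS]exprS; have z2 := sqr_ge0 z.
apply: (@le_trans _ _ ((1 - y / 2) * (1 - z))).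
  by rewrite ler_wpM2r ?subr_ge0//; lra.
by rewrite ler_wpM2l//; lra.
Qed.

Lemma sharpen_cvg (y : R) : 0 < y -> y <= 1 -> iter n sharpen y @[n --> \oo] --> (1 : R).
Proof.
move=> y0 y1; have y01 : 0 <= y <= 1 by rewrite (ltW y0).
apply/cvgrPdist_le => e e0.
have : (1 - y / 2) ^+ n @[n --> \oo] --> (0 : R).
  by apply: cvg_expr; rewrite ger0_norm; lra.
move=> /cvgrPdist_le/(_ e e0); apply: filterS => n; rewrite sub0r normrN.
have [/andP[_ s1] sn] := sharpen_rate n y01.
move=> /(le_trans (ler_norm _)) ne.
by rewrite ger0_norm ?subr_ge0// (le_trans sn).
Qed.

Lemma sharpen_sg (y : R) : `|y| <= 1 -> iter n sharpen y @[n --> \oo] --> Num.sg y.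
Proof.
rewrite ler_norml => /andP[yN1 y1]; have [y0|y0|->] := ltrgt0P y.
- by rewrite gtr0_sg//; exact: sharpen_cvg.
- rewrite ltr0_sg// -(opprK y); under eq_fun do rewrite sharpen_iterN.
  by apply: cvgN; apply: sharpen_cvg; rewrite ?oppr_gt0// lerNl.
- rewrite sgr0 (_ : (fun _ => _) = fun=> 0); first exact: cvg_cst.
  by apply/funext; elim=> //= n ->; rewrite /sharpen; field.
Qed.

Lemma sharpen_abs (y : R) n : `|y| <= 1 -> `|iter n sharpen y| <= 1.
Proof.
have pos (z : R) : 0 <= z <= 1 -> `|iter n sharpen z| <= 1.
  move=> z01; have [/andP[s0 s1] _] := sharpen_rate n z01.
  by rewrite ger0_norm//; apply: le_trans s0; have /andP[] := z01.
move=> y1; have [y0|y0] := lerP 0 y; first by apply: pos; rewrite y0 (le_trans (ler_norm _)).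
rewrite -(opprK y) sharpen_iterN normrN; apply: pos.
by rewrite oppr_ge0 (ltW y0)/= (le_trans _ y1)// -normrN ler_norm.
Qed.

Lemma trig_sg f : trig f -> (forall z, `|f z| <= 1) -> trig (fun z => Num.sg (f z)).
Proof.
move=> tf f1; apply: (@bc_lim _ _ _ (fun n z => iter n sharpen (f z)) _ 1).
- elim=> //= n IH.
  have -> : (fun z => sharpen (iter n sharpen (f z))) = (fun z => 3 / 2 * iter n sharpen (f z) +
      - 2^-1 * (iter n sharpen (f z) * (iter n sharpen (f z) * iter n sharpen (f z)))).
    by apply/funext => z; rewrite /sharpen; field.
  by apply: bc_add; apply: bc_scale => //; apply: trig_mul => //; exact: trig_mul.
- by move=> n z; exact: sharpen_abs.
- by move=> z; exact: sharpen_sg.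
Qed.

(** At low frequency the sine has the sign of its argument. *)
Lemma trig_sg_sub c : trig (fun z => Num.sg (z - c)).
Proof.
apply: (@bc_lim _ _ _ (fun n z => Num.sg (sin (n.+1%:R^-1 * z + - (n.+1%:R^-1 * c)))) _ 1).
- move=> n; apply: trig_sg; last by move=> z; rewrite ler_norml sin_geN1 sin_le1.
  by apply: bc_base; do 2 eexists.
- by move=> n z; rewrite normr_sg; case: (_ == _).
move=> z; have : n.+1%:R^-1 * (z - c) @[n --> \oo] --> (0 : R).
  rewrite -[X in _ --> X](mul0r (z - c)); apply: cvgM; last exact: cvg_cst.
  exact: cvg_harmonic.
move=> /cvgrPdist_lt/(_ 1 ltr01) near1; apply: cvg_near_cst.
apply: filterS near1 => n; rewrite sub0r normrN -mulrBr.
have n0 : 0 < n.+1%:R^-1 :> R by rewrite invr_gt0.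
have pi2 : 1 <= pi / 2 :> R by exact: pihalf_ge1.
have sin_pos (q : R) : 0 < q -> `|q| < 1 -> 0 < sin q.
  move=> q0; rewrite gtr0_norm// => q1; apply: sin_gt0_pihalf.
  by rewrite q0 (lt_le_trans q1).
move=> q1; have [zc|zc|->] := ltrgt0P (z - c).
- by rewrite !gtr0_sg//; apply: sin_pos => //; rewrite mulr_gt0.
- rewrite !ltr0_sg// -oppr_gt0 -sinN -mulrN; apply: sin_pos; last by rewrite mulrN normrN.
  by rewrite mulr_gt0// oppr_gt0.
- by rewrite mulr0 sin0.
Qed.

(** The thresholds [c + 1 / n] approach [c] from the right, so that [c] itself
    is included. *)
Lemma trig_le c : trig (fun z => (z <= c)%R%:R).
Proof.
apply: (@bc_lim _ _ _ (fun n z => 2^-1 + - 2^-1 * Num.sg (z - (c + n.+1%:R^-1))) _ 1).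
- by move=> n; apply: bc_add; [exact: trig_cst|apply: bc_scale; exact: trig_sg_sub].
- move=> n z; have : `|Num.sg (z - (c + n.+1%:R^-1))| <= 1 by rewrite normr_sg; case: (_ == _).
  by rewrite !ler_norml => /andP[? ?]; apply/andP; split; lra.
move=> z; have [zc|cz] := lerP z c.
  rewrite (_ : (fun _ => _) = fun=> 1); first exact: cvg_cst.
  apply/funext => n; rewrite ltr0_sg; first by field.
  by rewrite subr_lt0 (le_lt_trans zc)// ltrDl invr_gt0.
have /cvgrPdist_lt/(_ (z - c)) := @cvg_harmonic R; rewrite subr_gt0 => /(_ cz) nz.
apply: cvg_near_cst; apply: filterS nz => n; rewrite sub0r normrN gtr0_norm ?invr_gt0// => nz.
by rewrite gtr0_sg; [rewrite mulr1 subrr|rewrite subr_gt0 -ltrBrDl].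
Qed.

End trigonometric_closure.

Section indicator_determinant.
Context {R : realType} {m : nat}.

(** Below the thresholds the matrix is unitriangular; if coordinate [k0] exceeds
    its threshold, a block of zeros is too large for any permutation to avoid. *)
Lemma indicator_det (x z : 'I_m -> R) :
  (forall a b : 'I_m, (a <= b)%N -> x a <= x b) ->
  (forall a b : 'I_m, (a <= b)%N -> z a <= z b) ->
  \det (\matrix_(k, a) ((x a <= z k)%R%:R - (a < k)%N%:R)) =
  [forall k, x k <= z k]%R%:R :> R.
Proof.
move=> xs zs; have [/forallP xz|/forallPn[k0]] := boolP [forall k, x k <= z k].
  rewrite -det_tr det_trig.
    by rewrite big1// => k _; rewrite !mxE xz ltnn subr0.
  apply/is_trig_mxP => a k ak; rewrite !mxE ak (_ : x a <= z k) ?subrr//.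
  by rewrite (le_trans (xs a k (ltnW ak))).
rewrite -ltNge => xz0; rewrite /determinant big1// => s _.
have [k kk0 sk] : exists2 k : 'I_m, (k <= k0)%N & (k0 <= s k)%N.
  apply/exists2P; apply: contrapT => /forallNP H.
  have sub : (s @: [set k : 'I_m | (k <= k0)%N] \subset [set a : 'I_m | (a < k0)%N])%SET.
    apply/fintype.subsetP => _ /imsetP[k + ->]; rewrite !inE => kk0.
    by rewrite ltnNge; apply/negP => sk; apply: (H k).
  have := subset_leq_card sub; rewrite card_imset; last exact: perm_inj.
  apply/negP; rewrite -ltnNge; apply: proper_card; apply/properP; split.
    by apply/fintype.subsetP => a; rewrite !inE => /ltnW.
  by exists k0; rewrite !inE ?leqnn ?ltnn.
rewrite (bigD1 k)//= mxE leNgt (_ : z k < x (s k)); last first.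
  by rewrite (le_lt_trans (zs k k0 kk0))// (lt_le_trans xz0)// xs.
by rewrite ltnNge (leq_trans kk0 sk) subr0 mul0r mulr0.
Qed.

End indicator_determinant.

(** * Uniqueness of the finite-dimensional laws *)

Section agreement.
Context {d : measure_display} {T : measurableType d} {R : realType}.
Variables P Q : probability T R.

(** Dynkin's pi-lambda theorem. *)
Lemma agree_pi (G : set (set T)) : setI_closed G ->
  (forall A, G A -> measurable A /\ P A = Q A) ->
  forall A, <<s G >> A -> P A = Q A.
Proof.
move=> GI GPQ A; rewrite -setI_closed_g_dynkin_g_sigma_algebra//.
suff : <<d G >> `<=` [set A | measurable A /\ P A = Q A] by move=> /[apply] -[].
apply: smallest_sub => //; split.
- by split; [exact: measurableT|rewrite !probability_setT].
- move=> B [mB PQB]; split; first exact: measurableC.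
  by rewrite !probability_setC// PQB.
move=> F tF FPQ; have mF n : measurable (F n) by have [] := FPQ n.
have mU : measurable (\bigcup_n F n) by exact: bigcup_measurable.
split=> //; have cP := measure_semi_sigma_additive F mF tF mU (s := P).
have cQ := measure_semi_sigma_additive F mF tF mU (s := Q).
have E : (fun n => (\sum_(0 <= i < n) P (F i))%E) = (fun n => (\sum_(0 <= i < n) Q (F i))%E).
  by apply/funext => n; apply: eq_bigr => i _; have [] := FPQ i.
rewrite E in cP; exact: (cvg_unique (@ereal_hausdorff R) cP cQ).
Qed.

Lemma agree_Ex (G : set (set T)) : <<s G >> `<=` measurable ->
  (forall A, <<s G >> A -> P A = Q A) -> forall Y, test G Y -> Ex P Y = Ex Q Y.
Proof.
move=> GT PQ Y tY; have mY := test_measurable GT tY.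
have push (Z : probability T R) :
    (\int[Z]_w (Y w)%:E = \int[pushforward Z Y]_y (y%:E))%E.
  rewrite (@integral_pushforward _ _ _ _ _ _ mY Z setT EFin)//.
  exact: (test_L1_self Z GT tY).
rewrite /Ex /Rintegral !push; congr fine; apply: eq_measure_integral => A mA _.
rewrite /pushforward /=; apply: PQ; have [+ _] := tY.
by move=> /(_ measurableT A mA); rewrite setTI.
Qed.

End agreement.

Section row_functions.
Context {R : realType} {m : nat}.

(** A row is a function of the index of the column and of the coordinate
    attached to that column; the elementary ones make [wave_rows]. *)
Definition elementary_row (r : 'I_m * R -> R) :=
  (exists la th, r = fun p => sin (la * p.2 + th)) \/ (exists c, r = fun p => c p.1).

Definition row_function := bounded_closure elementary_row.

Lemma row_bounded r : row_function r -> exists K, forall p, `|r p| <= K.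
Proof.
apply: closure_bounded => _ [[la [th ->]]|[c ->]].
  by exists 1 => p; rewrite ler_norml sin_geN1 sin_le1.
exists (\sum_a `|c a|) => p.
by rewrite (bigD1 p.1)//= lerDl sumr_ge0.
Qed.

Lemma row_measurable r a : row_function r -> measurable_fun setT (fun z => r (a, z)).
Proof.
elim=> {r} [_ [[la [th ->]]|[c ->]]|f g _ If _ Ig|c f _ If|u f K _ Iu uK uf] /=.
- apply: continuous_measurable_fun => z.
  apply: (continuous_comp (f := fun z : R => la * z + th)); last exact: continuous_sin.
  apply: cvgD; last exact: cvg_cst.
  by apply: cvgM; [exact: cvg_cst|exact: cvg_id].
- exact: measurable_cst.
- exact: measurable_funD.
- exact: measurable_funM.
- apply: (@measurable_fun_cvg _ _ R setT (fun n z => u n (a, z))) => // z _.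
Qed.

Lemma threshold_row z k : row_function (fun p => (p.2 <= z)%R%:R - (p.1 < k)%N%:R).
Proof.
apply: (@bc_add R _ _ (fun p : 'I_m * R => (p.2 <= z)%R%:R) (fun p => - (p.1 < k)%N%:R)).
  apply: (@closure_comp R _ _ _ _ snd _ _ (trig_le z)) => _ [la [th ->]].
  by apply: bc_base; left; exists la, th.
by apply: bc_base; right; exists (fun a : 'I_m => - (a < k)%N%:R).
Qed.

Variable s : 'S_m.

Definition row_det (r : 'I_m -> 'I_m * R -> R) (x : 'rV[R]_m) :=
  \det (\matrix_(k, a) r k (a, x ord0 (s a))).

Definition set_row r k0 g (k : 'I_m) : 'I_m * R -> R := if k == k0 then g else r k.

Lemma row_det_expand r k0 : exists C : 'rV[R]_m -> 'I_m -> R, forall h x,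
  row_det (set_row r k0 h) x = \sum_a h (a, x ord0 (s a)) * C x a.
Proof.
exists (fun x a => cofactor (\matrix_(k, a) r k (a, x ord0 (s a))) k0 a) => h x.
rewrite /row_det (expand_det_row _ k0); apply: eq_bigr => a _.
rewrite mxE /set_row eqxx; congr (_ * _).
rewrite /cofactor; congr (_ * \det _); apply/matrixP => i j; rewrite !mxE /set_row.
by rewrite [lift k0 i == k0]eq_sym (negbTE (neq_lift _ _)).
Qed.

Lemma set_row_id r k0 : set_row r k0 (r k0) = r.
Proof. by apply/funext => k; rewrite /set_row; case: eqVneq => [->|]. Qed.

End row_functions.

Section finite_dimensional.
Context {d : measure_display} {T : measurableType d} {R : realType}.
Variables P Q : probability T R.
Variables (m : nat) (X : time R -> T -> 'rV[R]_m).
Hypothesis mX : forall t i, measurable_fun setT (fun w => X t w ord0 i).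
Variables (rho : R) (b : 'rV[R]_m).
Hypothesis rho0 : 0 < rho.
Hypothesis coP : coalescing P X rho b.
Hypothesis coQ : coalescing Q X rho b.
Variable s : 'S_m.
Hypothesis bs : closed_chamber s b.

Let FT := past_measurable mX.
Local Notation state u w := (X (to_time u) w).

Lemma row_det_measurable (r : 'I_m -> 'I_m * R -> R) t :
  (forall k, row_function (r k)) -> measurable_fun setT (fun w => row_det s r (state t w)).
Proof.
move=> rr; rewrite /row_det /determinant; apply: measurable_sum => p.
apply: measurable_funM => //; apply: measurable_prod => i _.
under eq_fun do rewrite mxE.
apply: (measurableT_comp (f := fun z => r i (p i, z))); last exact: mX.
exact: row_measurable.
Qed.

Lemma row_det_bounded (r : 'I_m -> 'I_m * R -> R) :
  (forall k, row_function (r k)) -> exists K, forall x, `|row_det s r x| <= K.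
Proof.
move=> rr; have /choice[K rK] : forall k, exists K, forall p, `|r k p| <= K.
  by move=> k; exact: row_bounded.
exists (#|'S_m|%:R * (\sum_k `|K k|) ^+ m) => x; apply: det_bound => k a; rewrite mxE.
apply: (le_trans (rK k _)); apply: (le_trans (ler_norm _)).
by rewrite (bigD1 k)//= lerDl sumr_ge0.
Qed.

Section one_step.
Variables (u t : R) (A : set T).
Hypotheses (u0 : 0 <= u) (ut : u <= t) (FA : <<s past X u >> A).
Hypothesis agree_now : forall f : 'rV[R]_m -> R, continuous f ->
  (exists K, forall x, `|f x| <= K) ->
  Ex P (fun w => \1_A w * f (state u w)) = Ex Q (fun w => \1_A w * f (state u w)).

Let good r := Ex P (fun w => \1_A w * row_det s r (state t w)) =
  Ex Q (fun w => \1_A w * row_det s r (state t w)).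

Lemma row_det_L1 (Z : probability T R) r : (forall k, row_function (r k)) ->
  L1 Z (fun w => \1_A w * row_det s r (state t w)).
Proof.
move=> rr; have [K rK] := row_det_bounded rr.
apply: (test_L1 (@FT u) (test_indic FA)).
exact: (L1_bounded Z (row_det_measurable t rr) (fun w => rK _)).
Qed.

Lemma elementary_good r : (forall k, elementary_row (r k)) -> good r.
Proof.
move=> er; have /choice[p rp] : forall k, exists p : R * R * ('I_m -> R),
    (forall a, p.1.1 * p.2 a = 0) /\ r k = (fun q => sin (p.1.1 * q.2 + p.1.2) + p.2 q.1).
  move=> k; have [[la [th ->]]|[c ->]] := er k.
    by exists (la, th, fun=> 0); split=> [a|] /=; [rewrite mulr0|apply/funext => q; rewrite addr0].
  by exists (0, 0, c); split=> [a|] /=; [rewrite mul0r|apply/funext => q; rewrite mul0r addr0 sin0 add0r].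
pose la k := (p k).1.1; pose th k := (p k).1.2; pose c k a := (p k).2 a.
have lac k a : la k * c k a = 0 by have [+ _] := rp k; apply.
have E : row_det s r = wave_rows s la th c.
  apply/funext => x; congr (\det _); apply/matrixP => k a; rewrite !mxE.
  by have [_ ->] := rp k.
have A1 w : `|\1_A w| <= 1 :> R by rewrite indicE; case: (_ \in _); rewrite ?normr1 ?normr0.
have tA := test_indic FA (R := R).
rewrite /good E (wave_rows_decay th lac mX rho0 coP bs u0 ut tA A1).
rewrite (wave_rows_decay th lac mX rho0 coQ bs u0 ut tA A1); congr (_ * _).
have [M S] := wave_det_smooth s la th c.
have wE : wave_rows s la th c = wave_det s la th c (fun=> 0%N).
  by apply/funext => x; exact: wave_rowsE.
by rewrite wE; apply: agree_now; [exact: (sc_cont S)|exists M; exact: (sc_le S)].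
Qed.

(** Linearity and dominated convergence extend the identity one row at a time. *)
Lemma rows_good j r : (forall k : 'I_m, if (k < j)%N then row_function (r k) else elementary_row (r k)) ->
  good r.
Proof.
elim: j r => [|j IH] r rr; first by apply: elementary_good => k; have := rr k.
have [jm|mj] := ltnP j m; last first.
  apply: IH => k; have := rr k; have kj : (k < j)%N by exact: leq_trans (ltn_ord k) mj.
  by rewrite kj ltnS ltnW.
pose k0 := Ordinal jm.
have [C CE] := row_det_expand s r k0.
pose up h := set_row r k0 h.
have rf h k : row_function h -> row_function (up h k).
  move=> hr; rewrite /up /set_row; case: eqVneq => // kk0.
  have := rr k; case: ifP => // _; exact: bc_base.
have lin h : row_function h -> L1 P (fun w => \1_A w * row_det s (up h) (state t w)) /\
    L1 Q (fun w => \1_A w * row_det s (up h) (state t w)).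
  by move=> hr; split; apply: row_det_L1 => k; exact: rf.
suff gup h : row_function h -> good (up h).
  have := rr k0; rewrite ltnS leqnn => /gup.
  by rewrite /up set_row_id.
elim=> {h} [h eh|f g rf' gf rg gg|c f rf' gf|v f K rv gv vK vf].
- apply: IH => k; rewrite /up /set_row.
  have [->|kk0] := eqVneq k k0; first by rewrite ltnn.
  have := rr k; rewrite ltnS leq_eqVlt (_ : (k == j :> nat) = false)//.
  by apply/negbTE; apply: contra kk0 => /eqP kj; apply/eqP/val_inj.
- have E (Z : probability T R) : L1 Z (fun w => \1_A w * row_det s (up f) (state t w)) ->
      L1 Z (fun w => \1_A w * row_det s (up g) (state t w)) ->
      Ex Z (fun w => \1_A w * row_det s (up (fun x => f x + g x)) (state t w)) =
      Ex Z (fun w => \1_A w * row_det s (up f) (state t w)) +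
      Ex Z (fun w => \1_A w * row_det s (up g) (state t w)).
    move=> i1 i2; rewrite -ExD//; congr Ex; apply/funext => w.
    rewrite -mulrDr !CE -big_split /=; congr (_ * _); apply: eq_bigr => a _.
    by rewrite mulrDl.
  have [f1 f2] := lin f rf'; have [g1 g2] := lin g rg.
  by rewrite /good !E// gf gg.
- have E (Z : probability T R) : L1 Z (fun w => \1_A w * row_det s (up f) (state t w)) ->
      Ex Z (fun w => \1_A w * row_det s (up (fun x => c * f x)) (state t w)) =
      c * Ex Z (fun w => \1_A w * row_det s (up f) (state t w)).
    move=> i1; rewrite -ExZ//; congr Ex; apply/funext => w.
    rewrite !CE !mulr_sumr; apply: eq_bigr => a _; ring.
  have [f1 f2] := lin f rf'.
  by rewrite /good !E// gf.
- have rf' : row_function f by exact: bc_lim rv vK vf.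
  have /choice[L rL] : forall k, exists L, forall p, `|r k p| <= L.
    move=> k; apply: row_bounded; have := rr k; case: ifP => // _; exact: bc_base.
  pose W := \sum_k `|L k| + `|K|.
  have LW k p : `|r k p| <= W.
    apply: (le_trans (rL k p)); apply: (le_trans (ler_norm _)).
    by rewrite /W (bigD1 k)//= -addrA lerDl addr_ge0// sumr_ge0.
  have dW n x : `|row_det s (up (v n)) x| <= #|'S_m|%:R * W ^+ m.
    apply: det_bound => k a; rewrite mxE /up /set_row; case: eqVneq => // _.
      apply: (le_trans (vK n _)); apply: (le_trans (ler_norm _)).
      by rewrite /W lerDr sumr_ge0.
  have cv (Z : probability T R) : Ex Z (fun w => \1_A w * row_det s (up (v n)) (state t w))
      @[n --> \oo] --> Ex Z (fun w => \1_A w * row_det s (up f) (state t w)).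
    have mA := test_measurable (@FT u) (test_indic FA (R := R)).
    apply: (@Ex_bct _ _ _ Z _ _ (1 * (#|'S_m|%:R * W ^+ m))).
    + by move=> n; apply: measurable_funM => //; apply: row_det_measurable => k; exact: rf.
    + by apply: measurable_funM => //; apply: row_det_measurable => k; exact: rf.
    + apply: aeW => w; apply: cvgM; first exact: cvg_cst.
      under eq_fun do rewrite CE; rewrite CE.
      apply: cvg_big => [|a _]; first exact: add_continuous.
      by apply: cvgM; [exact: vf|exact: cvg_cst].
    + move=> n w; rewrite normrM ler_pM//.
      by rewrite indicE; case: (_ \in _); rewrite ?normr1 ?normr0.
  have E : (fun n => Ex P (fun w => \1_A w * row_det s (up (v n)) (state t w))) =
     (fun n => Ex Q (fun w => \1_A w * row_det s (up (v n)) (state t w))).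
    by apply/funext => n; exact: gv.
  have cP := cv P; rewrite E in cP.
  exact: (cvg_unique (@Rhausdorff R) cP (cv Q)).
Qed.

Definition orthant (z : 'I_m -> R) : set T := [set w | forall i, state t w ord0 i <= z i].

Lemma orthant_measurable z : measurable (orthant z).
Proof.
have -> : orthant z = \bigcap_(i in [set: 'I_m]) ((fun w => state t w ord0 i) @^-1` `]-oo, z i]).
  apply/seteqP; split => w H i; first by move=> _; rewrite /= in_itv/=; exact: H.
  by have := H i I; rewrite /= in_itv.
apply: fin_bigcap_measurable => // i _; rewrite -[X in measurable X]setTI.
exact: mX.
Qed.

(** Almost surely the state is sorted, and the determinant with threshold rows
    is the indicator of the orthant. *)
Lemma orthant_agree z : P (A `&` orthant z) = Q (A `&` orthant z).
Proof.
have mA : measurable A by exact: FT FA.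
have mAz : measurable (A `&` orthant z) by apply: measurableI => //; exact: orthant_measurable.
(* On sorted states the thresholds may be replaced by their running minima. *)
pose z' k := \big[Num.min/z (s k)]_(l < m | (k <= l)%N) z (s l).
have z'_sorted (a a' : 'I_m) : (a <= a')%N -> z' a <= z' a'.
  move=> aa'; apply/bigmin_geP; split=> [|l a'l]; first exact: (bigmin_le_cond _ (fun l => z (s l))).
  by apply: (bigmin_le_cond _ (fun l => z (s l))); exact: leq_trans a'l.
pose r k (p : 'I_m * R) := (p.2 <= z' k)%R%:R - (p.1 < k)%N%:R : R.
have rr k : row_function (r k) by exact: threshold_row.
have t0 := le_trans u0 ut.
have E (Z : probability T R) : coalescing Z X rho b ->
    Ex Z (fun w => \1_A w * row_det s r (state t w)) = Ex Z (\1_(A `&` orthant z)).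
  move=> coZ; apply: Ex_ae.
  - apply: measurable_funM; last exact: row_det_measurable.
    exact: (test_measurable (@FT u) (test_indic FA (R := R))).
  - exact: measurable_indic.
  apply: filterS (co_cone mX rho0 coZ t0) => w /= /(cone_chamber bs) cw.
  rewrite /row_det (indicator_det (x := fun a => state t w ord0 (s a)) cw z'_sorted).
  rewrite !indicE in_setI; suff -> : [forall k, state t w ord0 (s k) <= z' k] = (w \in orthant z).
    by case: (w \in A); rewrite /= ?mul1r ?mul0r.
  apply/forallP/idP => [H|/set_mem H k].
    apply/mem_set => i; rewrite -(permKV s i); apply: (le_trans (H _)).
    exact: (bigmin_le_cond _ (fun l => z (s l))).
  apply/bigmin_geP; split=> [|l kl]; first exact: H.
  exact: le_trans (cw k l kl) (H _).
have g : good r by apply: (@rows_good m) => k; rewrite ltn_ord.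
rewrite -[LHS]fineK ?fin_num_measure// -[RHS]fineK ?fin_num_measure//; congr EFin.
by move: g; rewrite /good !E// !Ex_indic.
Qed.

End one_step.

Definition observed (ts : seq R) : set (set T) :=
  [set A | exists u i U, [/\ u \in ts, measurable U &
     A = (fun w => state u w ord0 i) @^-1` U]].

Lemma observed_past ts u : (forall v, v \in ts -> v <= u) -> <<s observed ts >> `<=` <<s past X u >>.
Proof.
move=> tsu; apply: sub_sigma_algebra2 => A [v [i [U [vts mU ->]]]].
exists (to_time v), i, U; split=> //; apply: val_to_time_mono; exact: tsu.
Qed.

Lemma observed_sub ts ts' : {subset ts <= ts'} -> <<s observed ts >> `<=` <<s observed ts' >>.
Proof.
move=> tt; apply: sub_sigma_algebra2 => A [v [i [U [vts mU ->]]]].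
by exists v, i, U; split=> //; exact: tt.
Qed.

Lemma observed_measurable ts : <<s observed ts >> `<=` measurable.
Proof.
apply: smallest_sub; first exact: sigma_algebra_measurable.
by move=> _ [v [i [U [_ mU ->]]]]; rewrite -[X in measurable X]setTI; exact: mX.
Qed.

(** The orthants of the state at time [t], intersected with events observed
    before, form a pi-system. *)
Lemma observe_step ts u t : 0 <= u -> u <= t -> (forall v, v \in ts -> v <= u) ->
  (forall A (f : 'rV[R]_m -> R), <<s observed ts >> A -> continuous f -> (exists K, forall x, `|f x| <= K) ->
    Ex P (fun w => \1_A w * f (state u w)) = Ex Q (fun w => \1_A w * f (state u w))) ->
  forall A, <<s observed (t :: ts) >> A -> P A = Q A.
Proof.
move=> u0 ut tsu now.
pose G := [set B | exists A z, <<s observed ts >> A /\ B = A `&` orthant t z].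
have past_u := observed_past tsu.
have obsI A A' : <<s observed ts >> A -> <<s observed ts >> A' -> <<s observed ts >> (A `&` A').
  exact: (@measurableI _ (g_sigma_algebraType (observed ts))).
have GI : setI_closed G.
  move=> _ _ [A [z [FA ->]]] [A' [z' [FA' ->]]].
  exists (A `&` A'), (fun i => Num.min (z i) (z' i)); split; first exact: obsI.
  rewrite setIACA; congr (_ `&` _); apply/seteqP; split => w.
    by move=> [H H'] i; rewrite le_min H H'.
  by move=> H; split => i; have := H i; rewrite le_min => /andP[].
have GE B : G B -> measurable B /\ P B = Q B.
  move=> [A [z [FA ->]]]; split.
    by apply: measurableI; [exact: observed_measurable FA|exact: orthant_measurable].
  by apply: (orthant_agree u0 ut (past_u _ FA)) => f cf bf; exact: now.
have sub : <<s observed (t :: ts) >> `<=` <<s G >>.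
  apply: smallest_sub; first exact: smallest_sigma_algebra.
  (* orthants with large thresholds exhaust the sample space *)
  have large w : \forall n \near \oo, forall i, state t w ord0 i <= n%:R.
    apply: filter_forall => i; exists (Num.truncn (state t w ord0 i)).+1 => // n /= ni.
    have [x0|x0] := lerP 0 (state t w ord0 i); last by rewrite (le_trans (ltW x0)).
    by rewrite ltW// (lt_le_trans (truncnS_gt _))// ler_nat.
  have obsG A : <<s observed ts >> A -> <<s G >> A.
    move=> FA; have -> : A = \bigcup_n (A `&` orthant t (fun=> n%:R)).
      apply/seteqP; split => w; last by move=> [n _ []].
      by move=> Aw; have [n Hn] := filter_ex (large w); exists n.
    apply: (@bigcupT_measurable _ (g_sigma_algebraType G)) => n.
    by apply: sub_sigma_algebra; exists A, (fun=> n%:R).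
  move=> _ [v [i [U [+ mU ->]]]]; rewrite inE => /predU1P[->|vts]; last first.
    by apply: obsG; apply: sub_sigma_algebra; exists v, i, U.
  suff mi : measurable_fun setT ((fun w => state t w ord0 i) : g_sigma_algebraType G -> R).
    by rewrite -[X in <<s _ >> X]setTI; exact: mi.
  apply: (measurability _ (RGenInftyO.measurableE R)) => _ [_ [x ->] <-]; rewrite setTI.
  pose z n k : R := if k == i then x - n.+1%:R^-1 else n%:R.
  have -> : (fun w => state t w ord0 i) @^-1` `]-oo, x[ = \bigcup_n orthant t (z n).
    apply/seteqP; split => w; rewrite /= in_itv/=.
      move=> wx; have [n [Hn1 Hn2]] : exists n, (forall k, state t w ord0 k <= n%:R) /\
          state t w ord0 i <= x - n.+1%:R^-1.
        have wx0 : 0 < x - state t w ord0 i by rewrite subr_gt0.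
        have /cvgrPdist_lt/(_ _ wx0) near2 := @cvg_harmonic R.
        have [n [n1 n2]] := filter_ex (filterI (large w) near2).
        exists n; split=> //; move: n2; rewrite /= sub0r normrN gtr0_norm ?invr_gt0//.
        by move/ltW; rewrite !lerBrDr addrC.
      by exists n => // k; rewrite /z; case: eqVneq => [->|].
    move=> [n _ /(_ i)]; rewrite /z eqxx => /le_lt_trans; apply.
    by rewrite ltrBlDr ltrDl invr_gt0.
  apply: (@bigcupT_measurable _ (g_sigma_algebraType G)) => n.
  apply: sub_sigma_algebra; exists setT, (z n); split; last by rewrite setTI.
  exact: (@measurableT _ (g_sigma_algebraType (observed ts))).
by move=> A /sub; exact: (agree_pi GI GE).
Qed.

(** Induction on the times, the latest of which comes first. *)
Lemma sorted_agree ts : sorted >=%R ts -> (forall v, v \in ts -> 0 <= v) ->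
  forall A, <<s observed ts >> A -> P A = Q A.
Proof.
elim: ts => [|t ts IH] so ts0.
  have e : observed [::] = set0 by apply/seteqP; split => // A [u [i [U []]]].
  by apply: agree_pi; rewrite e.
have t0 : 0 <= t by apply: ts0; rewrite mem_head.
have {}IH : forall A, <<s observed ts >> A -> P A = Q A.
  by apply: IH => [|v vts]; [exact: path_sorted so|apply: ts0; rewrite inE vts orbT].
case: ts so ts0 IH => [|u ts] so ts0 IH.
  apply: (@observe_step _ 0) => // A f FA cf [K fK].
  have FA0 : <<s past X 0 >> A by apply: observed_past FA.
  have mA : measurable A by exact: observed_measurable FA.
  have E (Z : probability T R) : coalescing Z X rho b ->
      Ex Z (fun w => \1_A w * f (state 0 w)) = f b * fine (Z A).
    move=> coZ; rewrite -Ex_indic// -ExZ; last first.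
      exact: (test_L1_self Z (@FT 0) (test_indic FA0 (R := R))).
    have tA := test_indic FA0 (R := R).
    apply: Ex_ae.
    - exact: (test_measurable (@FT 0) (testM tA (path_test X cf fK 0))).
    - exact: (test_measurable (@FT 0) (testM (test_cst _ _) tA)).
    by apply: filterS (co_init coZ) => w /= ->; rewrite mulrC.
  by rewrite !E// IH.
have /andP[ut so'] := so.
have us : forall v, v \in u :: ts -> v <= u.
  move=> v; rewrite inE => /predU1P[->//|vts].
  have ge_tr : transitive (>=%R : rel R) by move=> y x z xy yz; exact: le_trans yz xy.
  by have /allP := order_path_min ge_tr so'; apply.
have u0 : 0 <= u by apply: ts0; rewrite !inE eqxx orbT.
apply: (@observe_step _ u) => // A f FA cf [K fK].
have tA := test_indic FA (R := R).
have tf : test (observed (u :: ts)) (fun w => f (state u w)).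
  split; last by exists K.
  apply: (@continuous_rV_measurable R m _ (g_sigma_algebraType (observed (u :: ts)))) => // i _ U mU.
  rewrite setTI; apply: sub_sigma_algebra; exists u, i, U; split=> //; exact: mem_head.
exact: (agree_Ex (@observed_measurable _) IH (testM tA tf)).
Qed.

Definition coordinates : set (set T) :=
  [set A | exists (t : time R) i U, measurable U /\ A = (fun w => X t w ord0 i) @^-1` U].

(** The events observed at finitely many times form a pi-system. *)
Lemma coordinates_agree A : <<s coordinates >> A -> P A = Q A.
Proof.
pose G := [set A | exists2 ts, (forall v, v \in ts -> 0 <= v) & <<s observed ts >> A].
have GI : setI_closed G.
  move=> B B' [ts ts0 FB] [ts' ts'0 FB']; exists (ts ++ ts').
    by move=> v; rewrite mem_cat => /orP[/ts0|/ts'0].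
  apply: (@measurableI _ (g_sigma_algebraType (observed (ts ++ ts')))).
    by apply: (observed_sub _ FB) => v; rewrite mem_cat => ->.
  by apply: (observed_sub _ FB') => v; rewrite mem_cat => ->; rewrite orbT.
have GE B : G B -> measurable B /\ P B = Q B.
  move=> [ts ts0 FB]; split; first exact: observed_measurable FB.
  apply: (@sorted_agree (sort >=%R ts)).
  - by apply: sort_sorted => x y; exact: le_total.
  - by move=> v; rewrite mem_sort; exact: ts0.
  - by apply: (observed_sub _ FB) => v; rewrite mem_sort.
have sub : <<s coordinates >> `<=` <<s G >>.
  apply: sub_sigma_algebra2 => _ [t [i [U [mU ->]]]]; exists [:: \val t].
    by move=> v; rewrite inE => /eqP ->; exact: time_ge0.
  apply: sub_sigma_algebra; exists (\val t), i, U; split; rewrite ?mem_head//.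
  by rewrite to_timeK.
by move=> /sub; exact: (agree_pi GI GE).
Qed.

End finite_dimensional.

(** * Borel sets of the path space *)

Section path_space.
Context {R : realType} {m : nat}.
Local Notation path := (borel_cpath R m).
Implicit Types (v w : path) (t : time R).

Lemma coord_continuous_path w : continuous (fun t => coord_process t w).
Proof. exact: cts_fun. Qed.

Lemma coord_measurable t i : measurable_fun setT (fun w : path => coord_process t w ord0 i).
Proof.
apply: (measurability _ (RGenOpens.measurableE R)) => _ [_ [a [b ->] <-]]; rewrite setTI.
apply: sub_sigma_algebra.
pose O : set 'rV[R]_m := (fun x => x ord0 i) @^-1` `]a, b[%classic.
have oO : open O by have /continuousP := @coordinate_continuous R m i; apply.
have oC := compact_open_open (@compact_set1 _ t) oO.
exists [set g | g @` [set t] `<=` O] => //.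
apply/seteqP; split => w /=; first by move=> H; apply: H; exists t.
by move=> H _ [_ -> <-].
Qed.

Lemma path_coordinate_continuous w i : continuous (fun r : R => coord_process (to_time r) w ord0 i).
Proof.
move=> r; apply: (continuous_comp (f := fun r => coord_process (to_time r) w)
  (g := fun x : 'rV[R]_m => x ord0 i)); last exact: coordinate_continuous.
apply: (continuous_comp (f := @to_time R) (g := fun t => coord_process t w)).
  exact: to_time_continuous.
exact: coord_continuous_path.
Qed.

(** Uniform neighbourhoods on [[0, N]] generate the compact-open topology. *)
Lemma open_contains_tube (U : set (cpath R m)) w : open U -> U w ->
  exists N : nat, forall v, (forall r i, r <= N%:R ->
    `|coord_process (to_time r) w ord0 i - coord_process (to_time r) v ord0 i| <= N.+1%:R^-1) -> U v.
Proof.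
case=> V oV VU Uw.
pose fw : time R -> 'rV[R]_m := fun t => coord_process t w.
pose near_w N (g : time R -> 'rV[R]_m) := forall r i, r <= N%:R ->
  `|fw (to_time r) ord0 i - g (to_time r) ord0 i| <= N.+1%:R^-1.
pose F : set_system (time R -> 'rV[R]_m) := [set A | exists N, forall g, near_w N g -> A g].
have near_mono N N' g : (N <= N')%N -> near_w N' g -> near_w N g.
  move=> NN' H r i rN; apply: (le_trans (H r i _)); first by rewrite (le_trans rN)// ler_nat.
  by rewrite lef_pV2 ?posrE// ler_nat.
have FF : Filter F.
  split; first by exists 0%N.
  - move=> A B [N HA] [N' HB]; exists (maxn N N') => g Hg; split.
      by apply: HA; apply: near_mono Hg; exact: leq_maxl.
    by apply: HB; apply: near_mono Hg; exact: leq_maxr.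
  - by move=> A B AB [N HA]; exists N => g /HA /AB.
have cvF : {compact-open, F --> fw}.
  apply/(compact_open_fam_compactP (coord_continuous_path (w := w))).
  apply/fam_cvgP => K cK A /uniform_nbhs[E [entE EA]].
  move: entE; rewrite -entourage_ballE => -[e /= e0 HE].
  have cval : continuous (fun t : time R => \val t) by exact: initial_continuous.
  have /compact_bounded[B [_ HB]] := continuous_compact (continuous_subspaceT cval) cK.
  have Kle t : K t -> \val t <= B + 1.
    move=> Kt; apply: (le_trans (ler_norm _)); apply: (HB (B + 1)); first by rewrite ltrDl.
    by exists t.
  pose N1 := (Num.truncn (B + 1)).+1; pose N2 := (Num.truncn e^-1).+1.
  exists (maxn N1 N2) => g Hg; apply: EA => t Kt; apply: HE => /=.
  apply/ball_rV => // i; rewrite -(to_timeK t).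
  apply: (@le_lt_trans _ _ ((maxn N1 N2).+1%:R^-1)).
    apply: Hg; apply: (le_trans (Kle t Kt)).
    rewrite (le_trans (ltW (truncnS_gt _)))// ler_nat; exact: leq_maxl.
  rewrite invf_plt ?posrE//; apply: (lt_le_trans (truncnS_gt _)).
  by rewrite ler_nat ltnW// ltnS leq_maxr.
have [N HN] : F V by apply: cvF; apply: open_nbhs_nbhs; split => //; move: Uw; rewrite -VU.
by exists N => v Hv; rewrite -VU; exact: HN.
Qed.

(** Rational step functions are dense for uniform convergence on [[0, N]]. *)
Definition step_value (n : nat) (q : seq 'rV[rat]_m) (r : R) : 'rV[rat]_m :=
  nth 0 q (Num.truncn (r * n.+1%:R)).

(** Rational times suffice by continuity, and a countable family of tubes
    results. *)
Definition tube (p : nat * nat * seq 'rV[rat]_m) : set path :=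
  [set v | forall (c : rat) i, ratr c <= p.1.1%:R :> R ->
     `|coord_process (to_time (ratr c)) v ord0 i - ratr (step_value p.1.2 p.2 (ratr c) ord0 i)|
       <= p.1.1.+1%:R^-1 / 2].

Lemma tube_generated p : <<s coordinates (@coord_process R m) >> (tube p).
Proof.
pose S (c : rat) := if ratr c <= p.1.1%:R :> R then
   \bigcap_(i in [set: 'I_m]) [set v : path | `|coord_process (to_time (ratr c)) v ord0 i -
     ratr (step_value p.1.2 p.2 (ratr c) ord0 i)| <= p.1.1.+1%:R^-1 / 2] else setT.
have -> : tube p = (~` (\bigcup_c (~` (S c)))).
  rewrite setC_bigcup; apply/seteqP; split => v H.
    by move=> c _; rewrite /S setCK; case: ifP => // cN i _; exact: H.
  by move=> c i cN; have := H c I; rewrite /S setCK cN => /(_ i I).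
apply: (@measurableC _ (g_sigma_algebraType (coordinates (@coord_process R m)))).
apply: (@countable_bigcupT_measurable _ (g_sigma_algebraType (coordinates (@coord_process R m)))) => //.
move=> c; apply: (@measurableC _ (g_sigma_algebraType (coordinates (@coord_process R m)))).
rewrite /S; case: ifP => _; last exact: (@measurableT _ (g_sigma_algebraType (coordinates (@coord_process R m)))).
apply: (@fin_bigcap_measurable _ (g_sigma_algebraType (coordinates (@coord_process R m)))) => // i _.
have mf : measurable_fun setT ((fun v => `|coord_process (to_time (ratr c)) v ord0 i -
     ratr (step_value p.1.2 p.2 (ratr c) ord0 i)|) :
     g_sigma_algebraType (coordinates (@coord_process R m)) -> R).
  apply: measurableT_comp => //; apply: measurable_funB => // _ U mU; rewrite setTI.
  by apply: sub_sigma_algebra; exists (to_time (ratr c)), i, U.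
rewrite (_ : [set _ | _] = setT `&` (fun v => `|coord_process (to_time (ratr c)) v ord0 i -
     ratr (step_value p.1.2 p.2 (ratr c) ord0 i)|) @^-1` `]-oo, p.1.1.+1%:R^-1 / 2]); first exact: mf.
by apply/seteqP; split => v /=; rewrite in_itv/= => // -[].
Qed.

Lemma tube_close p v w : tube p v -> tube p w -> forall r i, r <= p.1.1%:R ->
  `|coord_process (to_time r) w ord0 i - coord_process (to_time r) v ord0 i| <= p.1.1.+1%:R^-1.
Proof.
move=> pv pw r i rN; rewrite leNgt; apply/negP => far.
pose h (q : R) := coord_process (to_time q) w ord0 i - coord_process (to_time q) v ord0 i.
have ch : continuous h by move=> q; apply: cvgB; exact: path_coordinate_continuous.
have /nbhs_ballP[e /= e0 He] := near_gt_norm ch far.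
have [c /andP[c1 c2]] : exists c : rat, r - e < ratr c < r.
  have re : r - e < r by rewrite ltrBlDr ltrDl.
  by have [c] := rat_in_itvoo re; rewrite in_itv/= => ?; exists c.
have cN : ratr c <= p.1.1%:R :> R by rewrite (le_trans (ltW c2)).
have := He (ratr c); rewrite -ball_normE /= gtr0_norm ?subr_gt0// ltrBlDr -ltrBlDl => /(_ c1).
have := pv c i cN; have := pw c i cN; rewrite /h.
set x := coord_process _ w _ _; set y := coord_process _ v _ _; set z := ratr (_ ord0 i).
move=> xz yz; rewrite ltNge (_ : x - y = (x - z) - (y - z)); last by ring.
by rewrite (le_trans (ler_normB _ _))// [leRHS]splitr lerD.
Qed.

Lemma tube_exists w N : exists n q, tube (N, n, q) w.
Proof.
pose e : R := N.+1%:R^-1 / 2; have e0 : 0 < e by rewrite divr_gt0// invr_gt0.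
have e20 : 0 < e / 2 by rewrite divr_gt0.
pose f i (r : R) := coord_process (to_time r) w ord0 i.
have [|i h h' h'h Q|h h0 Hh] := @common_threshold R 'I_m (fun i h => forall x y : R,
   `[0, N%:R]%classic x -> `|x - y| < h -> `|f i x - f i y| < e / 2).
- move=> i; apply: compact_unif_continuous => //; first exact: path_coordinate_continuous.
  exact: segment_compact.
- by move=> x y Nx xy; apply: Q => //; exact: lt_le_trans h'h.
pose n := Num.truncn h^-1.
have nh : n.+1%:R^-1 < h by rewrite invf_plt ?posrE//; exact: truncnS_gt.
have n0 : 0 < n.+1%:R :> R by [].
have /choice[q Hq] : forall k : nat, exists q : 'rV[rat]_m, forall i,
    `|f i (k%:R / n.+1%:R) - ratr (q ord0 i)| < e / 2.
  move=> k; have /choice[q Hq] : forall i, exists q : rat, `|f i (k%:R / n.+1%:R) - ratr q| < e / 2.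
    by move=> i; exact: rat_approx.
  by exists (\row_i q i) => i; rewrite mxE.
exists n, (mkseq q (N * n.+1).+1) => c i /= cN.
pose k := Num.truncn (ratr c * n.+1%:R : R).
have k0 : (ratr c : R) < 0 -> k = 0%N.
  move=> c0; apply/truncn0Pn; rewrite -ltNge (@le_lt_trans _ _ 0)//.
  by rewrite mulr_le0_ge0// ltW.
have kN : (k <= N * n.+1)%N.
  rewrite -(@ler_nat R) natrM; have [c0|c0] := lerP 0 (ratr c : R).
    apply: (@le_trans _ _ (ratr c * n.+1%:R)); first by rewrite truncn_le// mulr_ge0.
    by rewrite ler_wpM2r.
  by rewrite k0// mulr_ge0.
rewrite /step_value -/k nth_mkseq ?ltnS//.
have near : `|f i (ratr c) - f i (k%:R / n.+1%:R)| < e / 2.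
  have [c0|c0] := lerP 0 (ratr c : R); last first.
    rewrite k0// mul0r (_ : f i (ratr c) = f i 0) ?subrr ?normr0// /f.
    by rewrite (_ : to_time (ratr c) = to_time 0)//; apply: val_inj; rewrite val_to_time_neg// val_to_time.
  apply: Hh; first by rewrite /= in_itv/= c0.
  have cn0 : 0 <= ratr c * n.+1%:R :> R by rewrite mulr_ge0.
  have /andP[k1 k2] := truncn_itv cn0.
  apply: le_lt_trans nh; rewrite ger0_norm.
    by rewrite lerBlDr -[X in _ <= X + _]mul1r -mulrDl ler_pdivlMr// nat1r ltW.
  by rewrite subr_ge0 ler_pdivrMr.
have := Hq k i; rewrite -/(f i (ratr c)) => Hk.
rewrite (_ : f i (ratr c) - _ = (f i (ratr c) - f i (k%:R / n.+1%:R)) +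
   (f i (k%:R / n.+1%:R) - ratr (q k ord0 i))); last by ring.
by rewrite (le_trans (ler_normD _ _))// [leRHS]splitr lerD// ltW.
Qed.

(** An open set is the union of the tubes that it contains. *)
Lemma borel_generated (A : set path) : measurable A -> <<s coordinates (@coord_process R m) >> A.
Proof.
apply: smallest_sub; first exact: smallest_sigma_algebra.
move=> U oU; pose J p := tube p `<=` U.
have -> : U = \bigcup_p (if `[< J p >] then tube p else set0).
  apply/seteqP; split => [w Uw|w [p _]]; last by case: asboolP => // JJ /JJ.
  have [N HN] := open_contains_tube oU Uw; have [n [q wq]] := tube_exists w N.
  exists (N, n, q) => //; rewrite ifT//; apply/asboolP => v vq.
  by apply: HN => r i rN; exact: (tube_close vq wq).
apply: (@countable_bigcupT_measurable _ (g_sigma_algebraType (coordinates (@coord_process R m)))).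
  exact: countableP.
move=> p; case: ifP => _; first exact: tube_generated.
exact: (@measurable0 _ (g_sigma_algebraType (coordinates (@coord_process R m)))).
Qed.

End path_space.

(** * The martingale characterization *)

Section from_definition.
Context {d : measure_display} {T : measurableType d} {R : realType}.
Variable P : probability T R.

Lemma prob1_ae A : measurable A -> P A = 1%E -> {ae P, forall w, A w}.
Proof.
move=> mA PA; exists (~` A); split; first exact: measurableC.
  by rewrite probability_setC// PA subee.
by move=> w.
Qed.

Variables (m : nat) (X : time R -> T -> 'rV[R]_m).
Hypothesis mX : forall t i, measurable_fun setT (fun w => X t w ord0 i).

Lemma state_eq_measurable t b : measurable [set w | X t w = b].
Proof.
have -> : [set w | X t w = b] = \bigcap_(i in [set: 'I_m]) ((fun w => X t w ord0 i) @^-1` [set b ord0 i]).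
  apply/seteqP; split => w /=; first by move=> E i _; rewrite /= E.
  by move=> H; apply/rowP => i; exact: H.
apply: fin_bigcap_measurable => // i _; rewrite -[X in measurable X]setTI.
exact: mX.
Qed.

Lemma initial_ae b : P [set w | X (time0 R) w = b] = 1%E ->
  {ae P, forall w, X (to_time 0) w = b}.
Proof. by rewrite time0E => Pb; apply: prob1_ae Pb; exact: state_eq_measurable. Qed.

Lemma SCBM_coalescing rho b : 0 < rho -> SCBM P rho X ->
  P [set w | X (time0 R) w = b] = 1%E -> coalescing P X rho b.
Proof.
move=> rho0 [bX sX] Xb; split.
- exact: initial_ae.
- by move=> i; exact: (brownian_gaussian_moments mX rho0 (bX i)).
move=> i j l s t Y ij s0 st tY.
(* the distance has speed [2 * rho] *)
have -> : rho * l ^+ 2 = 2 * rho * l ^+ 2 / 2 by field.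
apply: (stopped_sin_martingale mX (Z := fun t w => `|X t w ord0 i - X t w ord0 j|)) => //.
- by rewrite mulr_gt0.
- move=> u; apply: measurableT_comp => //.
  by apply: measurable_funB; exact: past_coord.
- exact: sX.
Qed.

End from_definition.

Section pushforward.
Context {d d' : measure_display} {T : measurableType d} {T' : measurableType d'} {R : realType}.
Variables (P : probability T R) (P' : probability T' R) (y : T -> T').
Hypothesis my : measurable_fun setT y.
Hypothesis P'E : forall A, measurable A -> P' A = P (y @^-1` A).
Variables (m : nat) (X : time R -> T' -> 'rV[R]_m).
Hypothesis mX : forall t i, measurable_fun setT (fun w => X t w ord0 i).

Let X' t w := X t (y w).

Lemma Ex_push f : measurable_fun setT f -> L1 P (f \o y) -> L1 P' f /\ Ex P' f = Ex P (f \o y).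
Proof.
move=> mf fi; have mEf : measurable_fun setT (EFin \o f) by exact/measurable_EFinP.
have fi' : P.-integrable (y @^-1` setT) ((EFin \o f) \o y) by exact: fi.
have eqP (g : T' -> \bar R) : (\int[P']_w g w = \int[pushforward P y]_w g w)%E.
  by apply: eq_measure_integral => A mA _; exact: P'E.
split.
  have /integrableP[m1 i1] := integrable_pushforward my mEf fi' measurableT.
  by apply/integrableP; split=> //; rewrite eqP.
by rewrite /Ex /Rintegral eqP (integral_pushforward my mEf fi').
Qed.

Lemma past_push u (Y : T' -> R) : test (past X u) Y -> test (past X' u) (Y \o y).
Proof.
move=> [mY [K YK]]; split; last by exists K => w; exact: YK.
have myu : measurable_fun setT
    (y : g_sigma_algebraType (past X' u) -> g_sigma_algebraType (past X u)).
  apply: (@measurability _ _ (g_sigma_algebraType (past X' u))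
    (g_sigma_algebraType (past X u)) setT y (past X u) erefl) => _ [B [s [i [U [su mU ->]]]] <-].
  by rewrite setTI; apply: sub_sigma_algebra; exists s, i, U.
exact: measurableT_comp mY myu.
Qed.

Lemma coalescing_push rho b : coalescing P X' rho b ->
  {ae P', forall w, X (to_time 0) w = b} -> coalescing P' X rho b.
Proof.
move=> coX X0; have mX' t i : measurable_fun setT (fun w => X' t w ord0 i).
  exact: (measurableT_comp (mX t i) my).
have FT := past_measurable mX; have FT' := past_measurable mX'.
split=> // [i|i j l s t Y ij s0 st tY].
- have gm := co_moments coX i; split.
  + by move=> u; exact: past_coord.
  + move=> u v Y u0 uv tY; have tY' := past_push tY.
    have mf : measurable_fun setT (fun w => Y w * (X (to_time v) w ord0 i - X (to_time u) w ord0 i)).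
      apply: measurable_funM; first exact: (test_measurable (@FT u) tY).
      by apply: measurable_funB; exact: mX.
    have [|_ ->] := @Ex_push _ mf; last exact: (gm_mean gm u0 uv tY').
    exact: (test_L1 (@FT' u) tY' (gm_incr_id_L1 FT' gm u0 uv)).
  + move=> u v Y u0 uv tY; have tY' := past_push tY.
    have mf : measurable_fun setT (fun w => Y w * (X (to_time v) w ord0 i - X (to_time u) w ord0 i) ^+ 2).
      apply: measurable_funM; first exact: (test_measurable (@FT u) tY).
      by apply: measurable_funX; apply: measurable_funB; exact: mX.
    have [|_ ->] := @Ex_push _ mf.
      exact: (test_L1 (@FT' u) tY' (gm_incr_sqr_L1 FT' gm u0 uv)).
    have [|_ ->] := @Ex_push _ (test_measurable (@FT u) tY).
      exact: (test_L1_self P (@FT' u) tY').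
    exact: (gm_var gm u0 uv tY').
  + have [C HC] := gm_fourth gm; exists C => u v u0 uv; have [i4 E4] := HC u v u0 uv.
    have mf : measurable_fun setT (fun w => (X (to_time v) w ord0 i - X (to_time u) w ord0 i) ^+ 4).
      by apply: measurable_funX; apply: measurable_funB; exact: mX.
    by have [|? ->] := @Ex_push _ mf.
- have tY' := past_push tY.
  have mf r : measurable_fun setT (fun w => Y w * sin (l * `|X (to_time r) w ord0 i - X (to_time r) w ord0 j|)).
    apply: measurable_funM; first exact: (test_measurable (@FT s) tY).
    have c := @sin_scale_continuous R l.
    apply: (measurableT_comp (f := fun z => sin (l * z))); first exact: continuous_measurable_fun.
    by apply: measurableT_comp => //; apply: measurable_funB; exact: mX.
  have ip r : L1 P (fun w => Y (y w) * sin (l * `|X (to_time r) (y w) ord0 i - X (to_time r) (y w) ord0 j|)).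
    have [K K0 YK] := test_bounded tY.
    apply: (@L1_bounded _ _ _ P _ (K * 1)); first exact: (measurableT_comp (mf r) my).
    by move=> w; rewrite normrM ler_pM// ler_norml sin_geN1 sin_le1.
  have [_ ->] := Ex_push (mf t) (ip t).
  have [_ ->] := Ex_push (mf s) (ip s).
  exact: (co_sin coX l ij s0 st tY').
Qed.

End pushforward.

Theorem theorem2p2 (R : realType) (rho : R) (rho_gt0 : 0 < rho) (m : nat)
    (b : 'rV[R]_m.+1)
    (d : measure_display) (Omega : measurableType d) (Pr : probability Omega R)
    (y : {RV Pr >-> borel_cpath R m.+1})
    (y_SCBM : SCBM Pr rho (fun t w => coord_process t (y w)))
    (y_init : Pr [set w | coord_process (time0 R) (y w) = b] = 1%E) :
  let P := distribution Pr y : probability (borel_cpath R m.+1) R in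
  (P [set w | coord_process (time0 R) w = b] = 1%E /\
   solves_martingale_problem rho P (@coord_process R m.+1)) /\
  (forall Q : probability (borel_cpath R m.+1) R,
     Q [set w | coord_process (time0 R) w = b] = 1%E ->
     solves_martingale_problem rho Q (@coord_process R m.+1) ->
     forall A : set (borel_cpath R m.+1), measurable A -> Q A = P A).
Proof.
move=> P.
have mX := @coord_measurable R m.+1.
have cX (w : borel_cpath R m.+1) : continuous (fun t => coord_process t w).
  exact: coord_continuous_path.
have my : measurable_fun setT y by [].
have mY t i : measurable_fun setT (fun w => coord_process t (y w) ord0 i).
  exact: (measurableT_comp (mX t i) my).
have P0 : P [set w | coord_process (time0 R) w = b] = 1%E by exact: y_init.
have coY := SCBM_coalescing mY rho_gt0 y_SCBM y_init.
have coP : coalescing P (@coord_process R m.+1) rho b.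
  by apply: (coalescing_push my _ mX coY) => //; exact: initial_ae.
split; first by split; [exact: P0|exact: (coalescing_solves mX cX rho_gt0 coP)].
move=> Q Q0 QMP A mA.
have coQ := problem_coalescing mX cX rho_gt0 QMP (initial_ae mX Q0).
have [s bs] := sorting_permutation b.
exact: (coordinates_agree mX rho_gt0 coQ coP bs (borel_generated mA)).
Qed.
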